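(* Let $G$ be a compact Lie group, let $(M,\omega)$ be a compact symplectic manifold, and let $\rho_0,\rho_1 : G\times M\to M$ be two symplectic actions of $G$ on $(M,\omega)$ which are $C^2$-close. Then $\rho_0$ and $\rho_1$ can be made equivalent by conjugation via a symplectomorphism. That is: for every smooth symplectic action $\rho_0$ of $G$ on $(M,\omega)$ there is a neighbourhood $\mathcal{V}$ of $\rho_0$ in the $C^2$-topology such that for every smooth symplectic action $\rho_1\in\mathcal{V}$ there exists a symplectomorphism $\phi$ of $(M,\omega)$ with $\rho_0(g)\circ\phi=\phi\circ\rho_1(g)$ for all $g\in G$.
   Context: A smooth action $\rho:G\times M\to M$ gives for each $g\in G$ the diffeomorphism $\rho(g)(x):=\rho(g,x)$. The action is symplectic if $\rho(g)^*\omega=\omega$ for all $g\in G$. Closeness of actions is measured by viewing an action as an element of $\mathrm{Map}(G\times M,M)$ endowed with the $C^2$-topology. Two actions $\rho_0,\rho_1$ are equivalent via a diffeomorphism $\phi$ if $\rho_0(g)\circ\phi=\phi\circ\rho_1(g)$ for all $g\in G$. *)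

(* Defs.v *)
From HB Require Import structures.
From mathcomp Require Import all_boot all_order all_algebra.
From mathcomp Require Import all_classical all_reals all_analysis.

Set Implicit Arguments.
Unset Strict Implicit.
Unset Printing Implicit Defensive.

Import Order.TTheory GRing.Theory Num.Theory.
Import numFieldNormedType.Exports.

Local Open Scope classical_set_scope.
Local Open Scope ring_scope.

Section IterDerive.
Context {R : realType} {V W : normedModType R}.

Definition iter_derive (vs : seq V) (f : V -> W) : V -> W :=
  foldr (fun v g => 'D_v g) f vs.

(* Used for open [U]. Differentiability of all the iterated directional
   derivatives entails their continuity, hence that [f] is C^oo on [U]. *)
Definition smooth_on (U : set V) (f : V -> W) : Prop :=
  forall vs x, U x -> differentiable (iter_derive vs f) x.

End IterDerive.

Record chart (R : realType) (n : nat) (T : topologicalType) := Chart {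
  chart_dom : set T ;
  chart_map :> T -> 'rV[R]_n ;
  (* meaningful on the image of [chart_dom] only *)
  chart_inv : 'rV[R]_n -> T ;
  chart_dom_open : open chart_dom ;
  chart_cod_open : open (chart_map @` chart_dom) ;
  chart_mapK : forall p, chart_dom p -> chart_inv (chart_map p) = p ;
  chart_map_continuous :
    forall p, chart_dom p -> {for p, continuous chart_map} ;
  chart_inv_continuous :
    forall x, (chart_map @` chart_dom) x -> {for x, continuous chart_inv} }.

Definition chart_cod (R : realType) (n : nat) (T : topologicalType)
  (c : chart R n T) : set 'rV[R]_n := c @` chart_dom c.

Definition local_rep (R : realType) (m n : nat) (T U : topologicalType)
  (f : T -> U) (c : chart R m T) (d : chart R n U) : 'rV[R]_m -> 'rV[R]_n :=
  fun x => d (f (chart_inv c x)).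

Definition local_dom (R : realType) (m n : nat) (T U : topologicalType)
  (f : T -> U) (c : chart R m T) (d : chart R n U) : set 'rV[R]_m :=
  c @` (chart_dom c `&` f @^-1` chart_dom d).

HB.mixin Record isManifold (R : realType) (n : nat) T & Topological T := {
  atlas : set (chart R n T) ;
  manifold_hausdorff : hausdorff_space T ;
  manifold_second_countable : @second_countable T ;
  atlas_cover : forall p : T, exists2 c, atlas c & chart_dom c p ;
  atlas_compatible : forall c d, atlas c -> atlas d ->
    smooth_on (local_dom id c d) (local_rep id c d) }.

#[short(type="manifoldType")]
HB.structure Definition Manifold (R : realType) (n : nat) :=
  {T of isManifold R n T & Topological T}.

Arguments atlas {R n} s.

Section RowMx.
Context {R : realType}.

Lemma continuous_row_mx (p q : nat) :
  continuous (fun z : 'rV[R]_p * 'rV[R]_q => row_mx z.1 z.2).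
Proof.
move=> [a b] A [P abP PA].
exists ([set a' : 'rV[R]_p | forall i j, P i (lshift q j) (a' i j)],
        [set b' : 'rV[R]_q | forall i j, P i (rshift p j) (b' i j)]).
  split=> /=.
    exists (fun i j => P i (lshift q j)) => // i j.
    by have := abP i (lshift q j); rewrite row_mxEl.
  exists (fun i j => P i (rshift p j)) => // i j.
  by have := abP i (rshift p j); rewrite row_mxEr.
move=> [a' b'] [/= a'P b'P]; apply: PA => i j.
case: (splitP j) => l jl; [have -> : j = lshift q l by exact/val_inj|have -> : j = rshift p l by exact/val_inj].
  by rewrite row_mxEl; exact: a'P.
by rewrite row_mxEr; exact: b'P.
Qed.

Lemma row_mx_is_linear (p q : nat) :
  linear (fun z : 'rV[R]_p * 'rV[R]_q => row_mx z.1 z.2).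
Proof. by move=> k [a b] [a' b'] /=; rewrite scale_row_mx add_row_mx. Qed.

Let row_mx_lin (p q : nat) :
    {linear ('rV[R]_p * 'rV[R]_q)%type -> 'rV[R]_(p + q)} :=
  HB.pack (fun z : 'rV[R]_p * 'rV[R]_q => row_mx z.1 z.2)
    (GRing.isLinear.Build _ _ _ _ _ (@row_mx_is_linear p q)).

Lemma near_eq_differentiable (V W : normedModType R) (f g : V -> W) (x : V) :
  (\near x, f x = g x) -> differentiable f x -> differentiable g x.
Proof.
move=> fg df; have fgx := nbhs_singleton fg.
have dfc : continuous ('d f x) by exact: diff_continuous.
have gE : g \o shift x = cst (g x) + 'd f x +o_ 0 id.
  apply/eqaddoP => e e0.
  have /diff_locallyP[_ /eqaddoP/(_ _ e0)] := df.
  have := fg; rewrite (near_shift 0) /= => fg0.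
  apply: filter_app; apply: filter_app fg0; apply: nearW => h /=.
  by rewrite !fctE /= subr0 => <-; rewrite fgx.
apply/diff_locallyP.
by rewrite (diff_unique dfc gE).
Qed.

Section smooth_on_row_mx.
Variables (m n p q : nat).
Variables (f : 'rV[R]_m -> 'rV[R]_p) (g : 'rV[R]_n -> 'rV[R]_q).
Variables (U : set 'rV[R]_m) (V : set 'rV[R]_n).
Hypotheses (oU : open U) (oV : open V).
Hypotheses (sf : smooth_on U f) (sg : smooth_on V g).

Let S := [set x : 'rV[R]_(m + n) | U (lsubmx x) /\ V (rsubmx x)].

Let h vs ws (x : 'rV[R]_(m + n)) : 'rV[R]_(p + q) :=
  row_mx (iter_derive vs f (lsubmx x)) (iter_derive ws g (rsubmx x)).

Let diff_h vs ws x : S x -> is_diff x (h vs ws)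
  (fun v => row_mx ('d (iter_derive vs f) (lsubmx x) (lsubmx v))
                   ('d (iter_derive ws g) (rsubmx x) (rsubmx v))).
Proof.
move=> [Ux Vx].
have df := sf vs Ux; have dg := sg ws Vx.
have dl : differentiable (iter_derive vs f \o lsubmx) x.
  by apply: differentiable_comp => //; exact: differentiable_lsubmx.
have dr : differentiable (iter_derive ws g \o rsubmx) x.
  by apply: differentiable_comp => //; exact: differentiable_rsubmx.
have dp := differentiable_pair dl dr.
have drow y : differentiable (row_mx_lin p q) y.
  by apply: linear_differentiable; exact: continuous_row_mx.
split; first exact: (differentiable_comp dp (drow _)).
have -> : h vs ws = row_mx_lin p q \o (fun y =>
  ((iter_derive vs f \o lsubmx) y, (iter_derive ws g \o rsubmx) y)) by [].
rewrite (diff_comp dp (drow _)).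
have rE y : 'd (row_mx_lin p q) y = row_mx_lin p q :> (_ -> _).
  by apply: diff_lin; exact: continuous_row_mx.
have lE : 'd (lsubmx : 'rV[R]_(m + n) -> 'rV[R]_m) x = lsubmx :> (_ -> _).
  by apply: diff_lin; exact: continuous_lsubmx.
have r'E : 'd (rsubmx : 'rV[R]_(m + n) -> 'rV[R]_n) x = rsubmx :> (_ -> _).
  by apply: diff_lin; exact: continuous_rsubmx.
rewrite rE (diff_pair dl dr).
rewrite (diff_comp (differentiable_lsubmx _) df).
by rewrite (diff_comp (differentiable_rsubmx _) dg) lE r'E.
Qed.

Lemma open_row_mx_dom : open S.
Proof.
rewrite -[S]/((lsubmx @^-1` U) `&` (rsubmx @^-1` V)).
apply: openI; apply: open_comp => //.
  by move=> x _; exact: continuous_lsubmx.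
by move=> x _; exact: continuous_rsubmx.
Qed.

Let iter_derive_h vs x : S x ->
  iter_derive vs (h [::] [::]) x = h (map lsubmx vs) (map rsubmx vs) x.
Proof.
elim: vs x => // v vs IH x Sx /=.
rewrite -[LHS]/('D_v (iter_derive vs (h [::] [::])) x).
rewrite (@near_eq_derive _ _ _ _ (h (map lsubmx vs) (map rsubmx vs))).
  have [dh dhE] := diff_h (map lsubmx vs) (map rsubmx vs) Sx.
  rewrite deriveE // dhE /h /= !deriveE //; last exact: sf Sx.1.
  exact: sg Sx.2.
by apply: filterS (open_nbhs_nbhs (conj open_row_mx_dom Sx)) => y /IH.
Qed.

Lemma smooth_on_row_mx :
  smooth_on S (fun x => row_mx (f (lsubmx x)) (g (rsubmx x))).
Proof.
move=> vs x Sx.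
apply: (@near_eq_differentiable _ _ (h (map lsubmx vs) (map rsubmx vs))).
  apply: filterS (open_nbhs_nbhs (conj open_row_mx_dom Sx)) => y Sy.
  by rewrite -iter_derive_h.
by have [] := diff_h (map lsubmx vs) (map rsubmx vs) Sx.
Qed.

End smooth_on_row_mx.
End RowMx.

Lemma smooth_on_sub (R : realType) (V W : normedModType R) (A B : set V)
    (f g : V -> W) :
  open A -> A `<=` B -> {in A, f =1 g} -> smooth_on B f -> smooth_on A g.
Proof.
move=> oA AB fg sf vs x Ax.
have nA y : A y -> \near y, A y by move=> Ay; exact: open_nbhs_nbhs.
have E y : A y -> iter_derive vs f y = iter_derive vs g y.
  elim: vs y => [|v vs IH] y Ay; first by apply: fg; rewrite inE.
  by apply: near_eq_derive; apply: filterS (nA _ Ay) => z; exact: IH.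
apply: near_eq_differentiable (sf vs x (AB _ Ax)).
by apply: filterS (nA _ Ax) => z; exact: E.
Qed.

Lemma open_setX (T U : topologicalType) (A : set T) (B : set U) :
  open A -> open B -> open (A `*` B).
Proof.
move=> oA oB; rewrite -[A `*` B]/((fst @^-1` A) `&` (snd @^-1` B)).
apply: openI; apply: open_comp => // x _; [exact: cvg_fst | exact: cvg_snd].
Qed.

Section ProductManifold.
Context {R : realType} {m n : nat} (M : manifoldType R m) (N : manifoldType R n).

Section ProductChart.
Variables (c : chart R m M) (d : chart R n N).

Let pdom : set (M * N) := [set p | chart_dom c p.1 /\ chart_dom d p.2].
Let pmap (p : M * N) : 'rV[R]_(m + n) := row_mx (c p.1) (d p.2).
Let pinv (x : 'rV[R]_(m + n)) : M * N :=
  (chart_inv c (lsubmx x), chart_inv d (rsubmx x)).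

Let pdom_open : open pdom.
Proof.
by apply: open_setX; exact: chart_dom_open.
Qed.

Let pcodE : pmap @` pdom =
  [set x | chart_cod c (lsubmx x) /\ chart_cod d (rsubmx x)].
Proof.
apply/seteqP; split=> x.
  by move=> [p [p1 p2] <-]; rewrite /= row_mxKl row_mxKr; split;
     [exists p.1 | exists p.2].
move=> [[p1 cp1 e1] [p2 dp2 e2]]; exists (p1, p2) => //.
by rewrite /pmap /= e1 e2 hsubmxK.
Qed.

Let pcod_open : open (pmap @` pdom).
Proof.
by rewrite pcodE; apply: open_row_mx_dom; exact: chart_cod_open.
Qed.

Let pmapK p : pdom p -> pinv (pmap p) = p.
Proof.
case: p => p1 p2 [/= h1 h2].
by rewrite /pinv row_mxKl row_mxKr !chart_mapK.
Qed.

Let pmap_continuous p : pdom p -> {for p, continuous pmap}.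
Proof.
move=> [h1 h2].
apply: (@continuous_comp _ _ _ (fun p : M * N => (c p.1, d p.2))
  (fun z : 'rV[R]_m * 'rV[R]_n => row_mx z.1 z.2)); last first.
  exact: continuous_row_mx.
have Hc : {for p, continuous (c \o fst)}.
  apply: continuous_comp; first exact: cvg_fst.
  exact: chart_map_continuous.
have Hd : {for p, continuous (d \o snd)}.
  apply: continuous_comp; first exact: cvg_snd.
  exact: chart_map_continuous.
exact: (cvg_pair Hc Hd).
Qed.

Let pinv_continuous x : (pmap @` pdom) x -> {for x, continuous pinv}.
Proof.
rewrite pcodE => -[h1 h2].
have Hc : {for x, continuous (chart_inv c \o lsubmx)}.
  apply: continuous_comp; first exact: continuous_lsubmx.
  exact: chart_inv_continuous.
have Hd : {for x, continuous (chart_inv d \o rsubmx)}.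
  apply: continuous_comp; first exact: continuous_rsubmx.
  exact: chart_inv_continuous.
exact: (cvg_pair Hc Hd).
Qed.

Definition prod_chart : chart R (m + n) (M * N)%type :=
  Chart pdom_open pcod_open pmapK pmap_continuous pinv_continuous.

End ProductChart.

Definition prod_atlas : set (chart R (m + n) (M * N)%type) :=
  [set e | exists c d, [/\ atlas M c, atlas N d & e = prod_chart c d]].

Let prod_hausdorff : hausdorff_space (M * N)%type.
Proof.
move=> [p1 p2] [q1 q2] pq; congr (_, _).
- have : cluster (nbhs p1) q1; last exact: manifold_hausdorff.
  move=> A B Ap Bq.
  have [|| [z1 z2] [/= [Az _] [Bz _]]] := pq (A `*` setT) (B `*` setT).
  + by exists (A, setT) => //; split=> //; exact: filterT.
  + by exists (B, setT) => //; split=> //; exact: filterT.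
  by exists z1.
- have : cluster (nbhs p2) q2; last exact: manifold_hausdorff.
  move=> A B Ap Bq.
  have [|| [z1 z2] [/= [_ Az] [_ Bz]]] := pq (setT `*` A) (setT `*` B).
  + by exists (setT, A) => //; split=> //; exact: filterT.
  + by exists (setT, B) => //; split=> //; exact: filterT.
  by exists z2.
Qed.

Let prod_second_countable : @second_countable (M * N)%type.
Proof.
have [B cB [oB bB]] := @manifold_second_countable R m M.
have [C cC [oC bC]] := @manifold_second_countable R n N.
exists ((fun BC => BC.1 `*` BC.2) @` (B `*` C)).
  exact: (sub_countable (card_image_le _ _) (countableX cB cC)).
split=> [_ [[X Y] [/= BX CY] <-]|[p1 p2] A [[X Y] [/= Xp Yp] XYA]].
  by apply: open_setX; [exact: oB | exact: oC].
have [X' [BX' X'p] X'X] := bB _ _ Xp; have [Y' [CY' Y'p] Y'Y] := bC _ _ Yp.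
exists (X' `*` Y'); first by split=> //; exists (X', Y').
by move=> [z1 z2] [/= /X'X ? /Y'Y ?]; exact: XYA.
Qed.

Let prod_cover (p : M * N) : exists2 e, prod_atlas e & chart_dom e p.
Proof.
have [c Mc cp] := @atlas_cover R m M p.1.
have [d Nd dp] := @atlas_cover R n N p.2.
by exists (prod_chart c d) => //; exists c, d.
Qed.

Let local_dom_open (T : topologicalType) k (c d : chart R k T) :
  open (local_dom id c d).
Proof.
have -> : local_dom id c d =
    chart_cod c `&` chart_inv c @^-1` chart_dom d.
  apply/seteqP; split=> x.
    by move=> [p [/= cp dp] <-]; split; [exists p | rewrite /= chart_mapK].
  by move=> [[p cp <-]]; rewrite /= chart_mapK // => dp; exists p.
rewrite openE => x [cx dx]; apply: filterI.
  by apply: open_nbhs_nbhs; split=> //; exact: chart_cod_open.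
apply: (chart_inv_continuous cx).
by apply: open_nbhs_nbhs; split=> //; exact: chart_dom_open.
Qed.

Let prod_compatible e e' : prod_atlas e -> prod_atlas e' ->
  smooth_on (local_dom id e e') (local_rep id e e').
Proof.
move=> [c [d [Mc Nd ->]]] [c' [d' [Mc' Nd' ->]]].
have := smooth_on_row_mx (@local_dom_open _ _ c c') (@local_dom_open _ _ d d')
  (atlas_compatible _ _ Mc Mc') (atlas_compatible _ _ Nd Nd').
apply: smooth_on_sub => //.
  exact: local_dom_open.
move=> _ [[p1 p2] [/= [cp dp] [cp' dp']] <-] /=.
by rewrite row_mxKl row_mxKr; split; [exists p1 | exists p2].
Qed.

HB.instance Definition _ := isManifold.Build R (m + n) (M * N)%type
  prod_hausdorff prod_second_countable prod_cover prod_compatible.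

End ProductManifold.

Definition smooth (R : realType) (m n : nat)
    (M : manifoldType R m) (N : manifoldType R n) (f : M -> N) : Prop :=
  continuous f /\
  forall c d, atlas M c -> atlas N d ->
    smooth_on (local_dom f c d) (local_rep f c d).

Definition diffeomorphism (R : realType) (m n : nat)
    (M : manifoldType R m) (N : manifoldType R n) (f : M -> N) : Prop :=
  smooth f /\ exists g : N -> M, [/\ smooth g, cancel f g & cancel g f].

Record smoothMap (R : realType) (m n : nat)
    (M : manifoldType R m) (N : manifoldType R n) := SmoothMap {
  smooth_fun :> M -> N ;
  smooth_funP : smooth smooth_fun }.

(* smooth maps, with the C^r topology *)
Definition CrMap (r : nat) (R : realType) (m n : nat)
  (M : manifoldType R m) (N : manifoldType R n) : Type := smoothMap M N.

Section CrTopology.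
Context (r : nat) {R : realType} {m n : nat}.
Context (M : manifoldType R m) (N : manifoldType R n).

(* The usual basic neighbourhoods of the compact-open C^r topology (equal to the
   strong one when [M] is compact). [vs] ranges over vectors of the unit ball, so that the bound is on the
   operator norms of the differentials of order at most [r]. *)
Definition Cr_ball (f : CrMap r M N) (c : chart R m M) (d : chart R n N)
    (K : set M) (e : R) : set (CrMap r M N) :=
  [set g : smoothMap M N | g @` K `<=` chart_dom d /\
    forall vs p, (size vs <= r)%N -> (forall v, v \in vs -> `|v| <= 1) -> K p ->
      `|iter_derive vs (local_rep (f : smoothMap M N) c d) (c p)
        - iter_derive vs (local_rep g c d) (c p)| < e].

Definition Cr_subbase : set (set (CrMap r M N)) :=
  [set A | exists (f : CrMap r M N) c d K e,
    [/\ atlas M c, atlas N d & compact K] /\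
    [/\ K `<=` chart_dom c, (f : smoothMap M N) @` K `<=` chart_dom d, 0 < e
      & A = Cr_ball f c d K e]].

HB.instance Definition _ := gen_eqMixin (CrMap r M N).
HB.instance Definition _ := gen_choiceMixin (CrMap r M N).
HB.instance Definition _ :=
  @isSubBaseTopological.Build (CrMap r M N) _ Cr_subbase id.

End CrTopology.

(* A field of bilinear forms on the tangent spaces is given by its local
   expressions: [a c x u v] is its value at the point of coordinates [x] in the
   chart [c] on the tangent vectors of coordinates [u] and [v]. Only the charts
   [c] of the atlas and the points [x] of [chart_cod c] matter. *)
Definition bilinear_field (R : realType) (n : nat) (M : manifoldType R n) :=
  chart R n M -> 'rV[R]_n -> 'rV[R]_n -> 'rV[R]_n -> R.

(* [is_pullback f b a] means [a = f^* b]. *)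
Definition is_pullback (R : realType) (m n : nat)
    (M : manifoldType R m) (N : manifoldType R n) (f : M -> N)
    (b : bilinear_field N) (a : bilinear_field M) : Prop :=
  forall c d, atlas M c -> atlas N d ->
  forall p, chart_dom c p -> chart_dom d (f p) ->
  forall u v, a c (c p) u v =
    b d (d (f p)) ('d (local_rep f c d) (c p) u) ('d (local_rep f c d) (c p) v).

Record twoForm (R : realType) (n : nat) (M : manifoldType R n) := TwoForm {
  form_coef :> chart R n M -> 'rV[R]_n -> 'rV[R]_n -> 'rV[R]_n -> R ;
  form_linearl : forall c, atlas M c -> forall x, chart_cod c x ->
    forall v, scalar (fun u => form_coef c x u v) ;
  form_linearr : forall c, atlas M c -> forall x, chart_cod c x ->
    forall u, scalar (form_coef c x u) ;
  form_alternating : forall c, atlas M c -> forall x, chart_cod c x ->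
    forall u, form_coef c x u u = 0 ;
  form_smooth : forall c, atlas M c -> forall u v,
    smooth_on (chart_cod c) (fun x => form_coef c x u v : R^o) ;
  (* pulling back along [id] compares two charts at the same point: this is
     the transformation rule of the local expressions *)
  form_compatible : is_pullback id form_coef form_coef }.

Section SymplecticForm.
Context {R : realType} {n : nat} {M : manifoldType R n}.
Implicit Type w : twoForm M.

(* [d w] evaluated on vector fields that are constant in the chart, for which
   the bracket terms of the invariant formula vanish *)
Definition closed_form w : Prop :=
  forall c, atlas M c -> forall x, chart_cod c x -> forall u v t,
    'D_u (fun y => w c y v t : R^o) x + 'D_v (fun y => w c y t u : R^o) x
      + 'D_t (fun y => w c y u v : R^o) x = 0.

Definition nondegenerate_form w : Prop :=
  forall c, atlas M c -> forall x, chart_cod c x ->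
    forall u, (forall v, w c x u v = 0) -> u = 0.

Definition symplectic_form w : Prop := closed_form w /\ nondegenerate_form w.

Definition symplectomorphism w (phi : M -> M) : Prop :=
  diffeomorphism phi /\ is_pullback phi (form_coef w) (form_coef w).

End SymplecticForm.

HB.mixin Record isLieGroup (R : realType) (n : nat) G
    & Group G & Manifold R n G := {
  mulg_smooth : smooth (fun p : G * G => (p.1 * p.2)%g) ;
  invg_smooth : smooth (fun x : G => (x^-1)%g) }.

#[short(type="lieGroupType")]
HB.structure Definition LieGroup (R : realType) (n : nat) :=
  {G of isLieGroup R n G & Group G & Manifold R n G}.

Section Actions.
Context {R : realType} {k n : nat} {G : lieGroupType R k} {M : manifoldType R n}.

Definition group_action (rho : G * M -> M) : Prop :=
  (forall x, rho (1%g, x) = x) /\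
  (forall g h x, rho (g, rho (h, x)) = rho ((g * h)%g, x)).

Definition symplectic_action (w : twoForm M) (rho : smoothMap (G * M)%type M) :=
  group_action rho /\
  forall g, is_pullback (fun x => rho (g, x)) (form_coef w) (form_coef w).

End Actions.

(* Main.v *)
(* Fix an immersion of M by finitely many functions f_i. For an action rho close to
   rho0, a time t and a point x, let phi_t(x) be the critical point near x of
     y |-> int_G sum_i (f_i (rho0 (g, y)) - (1 - t) f_i (rho0 (g, x)) - t f_i (rho (g, x)))^2 dg.
   The implicit function theorem and compactness give existence, uniqueness and
   regularity; phi_0 = id, and the invariance of the integral makes phi_1 a
   diffeomorphism conjugating rho to rho0 (Palais). Let Phi (t, x) = phi_t(x). The
   average over g of the pullbacks of w by (t, x) |-> Phi (t, rho (g, x)) is a closed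
   two-form on R * M, invariant under rho, which restricts to w at t = 0 and to
   phi_1^* w at t = 1. Close to rho0 its kernel is spanned by a field d/dt + X with X
   small (Moser); the flow of this field from time 0 to time 1 commutes with rho and
   carries phi_1^* w to w, and its composite with phi_1 is the required
   symplectomorphism. The Haar integral of a continuous function is obtained as the
   limit of its finite averages over translates (von Neumann). *)
Require Import Defs.
From HB Require Import structures.
From mathcomp Require Import all_boot all_order all_algebra.
From mathcomp Require Import all_classical all_reals all_analysis.
From mathcomp Require Import ring lra.

Set Implicit Arguments.
Unset Strict Implicit.
Unset Printing Implicit Defensive.

Import Order.TTheory GRing.Theory Num.Theory.
Import numFieldNormedType.Exports.

Local Open Scope classical_set_scope.
Local Open Scope ring_scope.

(** * Partial derivatives and parametrized C^k functions *)

(** The space of actions carries only a topology. Regularity is therefore that of functions on a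
    product [T * 'rV_m], differentiated in the vector variable and jointly continuous with the
    parameter in [T]. The parameter is either the action itself, where regularity of order 2 and
    compactness yield a neighbourhood of [rho0], or idle, for a fixed action, which is regular to
    every order. Averaging is forced by phi_t intertwining the actions only at t = 1: it makes the
    form, hence its kernel, invariant at all times. The ends are kept: the integrand is constant in
    g at t = 0 because rho preserves [w], and at t = 1 because phi_1 rho(g) = rho0(g) phi_1 and rho0
    preserves [w]. Working on R * M replaces the choice of a primitive, usual in Moser's method: the
    averaged form is closed as a mean of pullbacks of [w], and a closed form is preserved by the
    flow of a field in its kernel. The inverse of phi_1 solves the same critical equation with the
    point and its centre exchanged; the two Jacobians agree up to sign at rho0. The time bounds 7,
    6, 5, 4 are nested margins around [0, 1]: uniqueness of centres, their regularity, support of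
    the cut-off, region where it equals 1. *)

Notation "''e_' i" := (delta_mx 0 i) (at level 8, i at level 2, format "''e_' i").

Section Coordinates.
Context {R : realType}.

Lemma normr_coord (m : nat) (x : 'rV[R]_m) i : `|x 0 i| <= `|x|.
Proof.
rewrite [leRHS]/Num.Def.normr/= mx_normrE.
exact: (le_bigmax 0 (fun j : 'I_1 * 'I_m => `|x j.1 j.2|) (0, i)).
Qed.

Lemma normr_leP (m : nat) (x : 'rV[R]_m) (b : R) :
  0 <= b -> (forall i, `|x 0 i| <= b) -> `|x| <= b.
Proof.
move=> b0 xb; rewrite [leLHS]/Num.Def.normr/= mx_normrE bigmax_le//= => -[i j] _.
by rewrite ord1.
Qed.

Lemma normr_delta (m : nat) (i : 'I_m) : `|'e_i : 'rV[R]_m| <= 1.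
Proof.
by apply: normr_leP => // j; rewrite mxE; case: (_ && _); rewrite ?normr1 ?normr0.
Qed.

Lemma continuous_coord (T : topologicalType) (m : nat) (f : T -> 'rV[R]_m) z :
  {for z, continuous f} <-> forall i, {for z, continuous (fun x => f x 0 i)}.
Proof.
split=> [cf i|cf].
  apply: (@continuous_comp _ _ _ f (fun x : 'rV[R]_m => x 0 i)) => //.
  exact: coord_continuous.
apply/cvgrPdist_le => e e0; near=> x.
apply: normr_leP; first exact: ltW.
move=> i; rewrite !mxE; move: i; near: x; apply: filter_forall => i.
by have /cvgrPdist_le := cf i; apply.
Unshelve. all: by end_near. Qed.

Lemma row_sum_e (m : nat) (v : 'rV[R]_m) : v = \sum_i v 0 i *: 'e_i.
Proof. exact: row_sum_delta. Qed.

End Coordinates.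

Section Partials.
Context {R : realType} {m : nat}.
Implicit Types (f : 'rV[R]_m -> R) (x v : 'rV[R]_m).

Lemma is_derive_line (W : normedModType R) (g : 'rV[R]_m -> W) x v s :
  derivable g (x + s *: v) v ->
  is_derive (s : R) (1 : R) (fun t : R => g (x + t *: v)) ('D_v g (x + s *: v)).
Proof.
move=> dg.
have E : (fun h : R => h^-1 *: ((fun t : R => g (x + t *: v)) (h *: (1 : R) + s)
          - g (x + s *: v))) =
  (fun h : R => h^-1 *: (g (h *: v + (x + s *: v)) - g (x + s *: v))).
  apply/funext => h; congr (_ *: (g _ - _)).
  by rewrite scalerDl [h *: 1]mulr1 addrCA.
split; first by rewrite /derivable E.
by rewrite /derive E.
Qed.


(** Only derivability along [v] is assumed, so linearity of the differential cannot be used; along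
    the line through [x] the statement is about a function of one real variable, where derivability
    is differentiability. *)
Lemma is_derive_scale (W : normedModType R) (g : 'rV[R]_m -> W) x v (c : R) :
  derivable g x v -> is_derive x (c *: v) g (c *: 'D_v g x).
Proof.
move=> dg; pose h (t : R) := g (x + t *: v).
have dh : is_derive (0 : R) (1 : R) h ('D_v g x).
  by have := @is_derive_line _ g x v 0; rewrite scale0r addr0; apply.
have /derivable1_diffP dfh := @ex_derive _ _ _ _ _ _ _ dh.
have E : (fun t : R => t^-1 *: (h (t *: c + 0) - h 0)) =
         (fun t : R => t^-1 *: (g (t *: (c *: v) + x) - g x)).
  apply/funext => t; rewrite /h scale0r !addr0 scalerA; congr (_ *: (g _ - _)).
  by rewrite addrC.
have dhc := @diff_derivable _ _ _ h 0 c dfh.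
split; first by move: dhc; rewrite /derivable E.
have dc : 'D_c h 0 = c *: 'D_1 h 0.
  by rewrite !deriveE// -linearZ/= [c *: 1]mulr1.
by rewrite -(@derive_val _ _ _ _ _ _ _ dh) -dc /derive E.
Qed.

Lemma MVT_line f x v :
  (forall s, 0 <= s <= 1 -> derivable f (x + s *: v) v) ->
  exists2 s, 0 <= s <= 1 & f (x + v) - f x = 'D_v f (x + s *: v).
Proof.
move=> df.
have h s : s \in `[0, 1] -> is_derive (s : R) (1 : R) (fun t : R => f (x + t *: v))
    ('D_v f (x + s *: v)).
  by rewrite in_itv /= => sI; exact/is_derive_line/df.
have h1 : {within `[0, 1], continuous (fun t : R => f (x + t *: v))}.
  by apply: derivable_within_continuous => s /h [].
have h2 s : s \in `]0, 1[ -> is_derive (s : R) (1 : R) (fun t : R => f (x + t *: v))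
    ('D_v f (x + s *: v)).
  by move=> sI; apply: h; exact: subset_itv_oo_cc.
have [s sI] := MVT_segment ler01 h2 h1.
rewrite scale1r scale0r addr0 subr0 mulr1 => E.
by exists s => //; move: sI; rewrite in_itv.
Qed.

Lemma MVT_line_is_derive f (df : R -> R) x v :
  (forall s, 0 <= s <= 1 -> is_derive (x + s *: v) v f (df s)) ->
  exists2 s, 0 <= s <= 1 & f (x + v) - f x = df s.
Proof.
move=> h; have h' s : 0 <= s <= 1 -> derivable f (x + s *: v) v by move=> /h[].
have [s sI ->] := MVT_line h'; exists s => //; by have [_ ->] := h s sI.
Qed.

Lemma differentiable_estimate (V W : normedModType R) (g : V -> W) (x : V)
    (L : {linear V -> W}) : continuous L ->
  (forall e : R, 0 < e -> \forall v \near 0, `|g (v + x) - g x - L v| <= e * `|v|) ->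
  differentiable g x /\ 'd g x = L :> (V -> W).
Proof.
move=> cL gL.
have gE : g \o shift x = cst (g x) + L +o_ 0 id.
  apply/eqaddoP => e e0; apply: filterS (gL e e0) => v.
  by rewrite !fctE opprD addrA.
have dE := diff_unique cL gE; split=> //.
by apply/diff_locallyP; rewrite dE.
Qed.

Definition lin_of (a : 'I_m -> R) (v : 'rV[R]_m) : R := \sum_i v 0 i * a i.

Lemma lin_of_linear a : linear (lin_of a : _ -> R^o).
Proof.
move=> k u v; rewrite /lin_of scaler_sumr -big_split/=; apply: eq_bigr => i _.
by rewrite !mxE mulrDl -[k *: _]/(k * _) mulrA.
Qed.

HB.instance Definition _ a := GRing.isLinear.Build R 'rV[R]_m R^o _ (lin_of a)
  (lin_of_linear a).

Lemma lin_of_le a v (e : R) : (forall i, `|a i| <= e) ->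
  `|lin_of a v| <= m%:R * e * `|v|.
Proof.
move=> ae; apply: le_trans (ler_norm_sum _ _ _) _.
have -> : m%:R * e * `|v| = \sum_(i < m) e * `|v|.
  by rewrite sumr_const card_ord -[RHS]mulr_natl mulrA.
apply: ler_sum => i _; rewrite normrM mulrC ler_pM//.
exact: normr_coord.
Qed.

Lemma lin_of_continuous a : continuous (lin_of a : _ -> R^o).
Proof.
apply: bounded_linear_continuous; apply/linear_boundedP.
near=> r => v; apply: le_trans (lin_of_le v (e := \sum_i `|a i|) _) _.
  by move=> i; rewrite (bigD1 i)//= lerDl sumr_ge0.
by rewrite ler_wpM2r.
Unshelve. all: by end_near. Qed.

(** The increment is split along the path that changes one coordinate at a time, with vertices
    [p k], and the mean value theorem is applied on each edge. For the sup norm the whole path stays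
    within [|v|] of [x]. *)
Lemma partials_estimate f x v (e : R) : 0 <= e ->
  (forall y i, `|y - x| <= `|v| -> derivable f y 'e_i /\
    `|'D_('e_i) f y - 'D_('e_i) f x| <= e) ->
  `|f (v + x) - f x - lin_of (fun i => 'D_('e_i) f x) v| <= m%:R * e * `|v|.
Proof.
move=> e0 df.
pose p k := x + \sum_(i < m | (i < k)%N) v 0 i *: 'e_i.
have pk0 k j : (p k - x) 0 j = if (j < k)%N then v 0 j else 0.
  rewrite /p addrAC subrr add0r summxE.
  case: ifP => jk.
    rewrite (bigD1 j)//= !mxE !eqxx mulr1 big1 ?addr0// => i /andP[_ ij].
    by rewrite !mxE eqxx/= eq_sym (negbTE ij) mulr0.
  by rewrite big1// => i ik; rewrite !mxE eqxx/=; case: eqP => [ji|]; rewrite ?mulr0//;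
     rewrite ji ik in jk.
suff H k : (k <= m)%N -> `|f (p k) - f x -
    \sum_(i < m | (i < k)%N) v 0 i * 'D_('e_i) f x| <= k%:R * e * `|v|.
  have E : \sum_(i < m | (i < m)%N) v 0 i * 'D_('e_i) f x =
      lin_of (fun i => 'D_('e_i) f x) v.
    by apply: eq_bigl => i; rewrite ltn_ord.
  have <- : p m = v + x.
    by apply/eqP; rewrite -subr_eq; apply/eqP/rowP => j; rewrite pk0 ltn_ord.
  by rewrite -E; exact: H.
elim: k => [|k IH] km.
  by rewrite /p !big_pred0// addr0 !subr0 subrr normr0 mulr_ge0// mul0r.
pose i := Ordinal km.
have pS : p k.+1 = p k + v 0 i *: 'e_i.
  rewrite -[LHS](subrK x) (_ : p k.+1 - x = (p k - x) + v 0 i *: 'e_i).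
    by rewrite addrAC subrK.
  apply/rowP => j; rewrite [RHS]mxE !pk0 !mxE eqxx/= -val_eqE/= ltnS.
  case: ltngtP => jk; rewrite ?mulr0 ?addr0//.
  by rewrite add0r mulr1; congr (v 0 _); exact/val_inj.
have pball s : 0 <= s <= 1 -> `|p k + s *: (v 0 i *: 'e_i) - x| <= `|v|.
  move=> /andP[s0 s1]; apply: normr_leP => // j.
  rewrite addrAC mxE pk0 !mxE eqxx/= -val_eqE /=.
  case: ltngtP => jk; rewrite ?mulr0 ?addr0 ?normr0//; first exact: normr_coord.
  rewrite add0r mulr1 normrM ger0_norm//.
  by rewrite -[leRHS]mul1r ler_pM// normr_coord.
have dk s : 0 <= s <= 1 ->
    is_derive (p k + s *: (v 0 i *: 'e_i)) (v 0 i *: 'e_i) f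
      (v 0 i *: 'D_('e_i) f (p k + s *: (v 0 i *: 'e_i))).
  by move=> sI; apply: is_derive_scale; have [] := df _ i (pball s sI).
have [s sI fs] := MVT_line (fun s sI => @ex_derive _ _ _ _ _ _ _ (dk s sI)).
rewrite pS; set P := p k + _; rewrite (bigD1 i)//=.
rewrite (eq_bigl (fun j : 'I_m => (j < k)%N)); last first.
  by move=> j; rewrite ltnS andbC ltn_neqAle -val_eqE.
set S := \sum_(j < m | _) _ in IH *.
have -> : f P - f x - (v 0 i * 'D_('e_i) f x + S) =
   (f (p k) - f x - S) + ((f P - f (p k)) - v 0 i * 'D_('e_i) f x) by ring.
rewrite fs (@derive_val _ _ _ _ _ _ _ (dk s sI)) -[_ *: _]/(_ * _) -mulrBr.
apply: le_trans (ler_normD _ _) _.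
rewrite -natr1 mulrDl mulrDl mul1r lerD//; first exact/IH/ltnW.
rewrite normrM mulrC ler_pM// ?normr_coord//.
by have [] := df _ i (pball s sI).
Qed.

Lemma partials_is_diff f x :
  (forall i, \forall y \near x, derivable f y 'e_i) ->
  (forall i, {for x, continuous ('D_('e_i) f)}) ->
  differentiable f x /\ 'd f x = lin_of (fun i => 'D_('e_i) f x) :> (_ -> _).
Proof.
move=> df cf; apply: differentiable_estimate; first exact: lin_of_continuous.
(* The estimate has a factor [m]; dividing by [m.+1] absorbs it, even for [m = 0]. *)
move=> e e0; pose e' := e / m.+1%:R.
have e'0 : 0 < e' by rewrite divr_gt0.
have near_i i : \forall y \near x, derivable f y 'e_i /\
    `|'D_('e_i) f y - 'D_('e_i) f x| <= e'.
  near=> y; split; near: y; first exact: df.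
  by move/cvgrPdistC_le : (cf i) => /(_ _ e'0).
have near_all : \forall y \near x, forall i, derivable f y 'e_i /\
    `|'D_('e_i) f y - 'D_('e_i) f x| <= e'.
  exact: filter_forall near_i.
have [r /= r0 rdf] := (iffLR (nbhs_ballP _ _)) near_all; near=> v.
have vr : `|v| < r by near: v; exact: (@nbhs0_lt R 'rV[R]_m r r0).
apply: le_trans (partials_estimate (e := e') _ _) _; first exact: ltW.
  move=> y i yx; apply: rdf; rewrite -ball_normE/= distrC.
  exact: le_lt_trans yx vr.
rewrite ler_wpM2r// /e' mulrCA ger_pMr//.
by rewrite ler_pdivrMr// mul1r ler_nat.
Unshelve. all: by end_near. Qed.

Lemma deriveE_partials f x v : differentiable f x ->
  'D_v f x = \sum_i v 0 i * 'D_('e_i) f x.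
Proof.
move=> df; rewrite deriveE// {1}(row_sum_e v) linear_sum; apply: eq_bigr => i _.
by rewrite linearZ deriveE.
Qed.

End Partials.

Section NearBall.
Context {R : realType} {V : normedModType R}.

Lemma near_ballP (x : V) (P : V -> Prop) :
  (\forall y \near x, P y) <->
  exists2 r : R, 0 < r & forall y, `|y - x| < r -> P y.
Proof.
split.
  move=> /nbhs_ballP[r /= r0 rP]; exists r => // y yx; apply: rP.
  by rewrite -ball_normE /= distrC.
move=> [r r0 rP]; apply/nbhs_ballP; exists r => //= y.
by rewrite -ball_normE /= distrC; exact: rP.
Qed.

End NearBall.

Lemma near_eq_continuous (S U : topologicalType) (f g : S -> U) (z : S) :
  (\forall y \near z, f y = g y) -> {for z, continuous f} -> {for z, continuous g}.
Proof.
move=> fg cf B; rewrite /= -(nbhs_singleton fg) => /cf fB.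
have fB' : \forall y \near z, B (f y) by exact: fB.
suff : \forall y \near z, B (g y) by [].
by near=> y; rewrite -(near fg y)//; near: y.
Unshelve. all: by end_near. Qed.

Lemma continuous_pair (X Y Z : topologicalType) (f : X -> Y) (g : X -> Z) (x : X) :
  {for x, continuous f} -> {for x, continuous g} ->
  {for x, continuous (fun x => (f x, g x))}.
Proof. by move=> cf cg; exact: (cvg_pair cf cg). Qed.

Section ParametricCk.
Context {R : realType} {T : topologicalType} {m : nat}.
Implicit Types (f g : T * 'rV[R]_m -> R) (A B : set (T * 'rV[R]_m)).

Definition fibre f (t : T) : 'rV[R]_m -> R := fun x => f (t, x).

Definition pd i f : T * 'rV[R]_m -> R := fun z => 'D_('e_i) (fibre f z.1) z.2.

Lemma pdE i f z : pd i f z = 'D_('e_i) (fibre f z.1) z.2.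
Proof. by []. Qed.

(** Class C^k in the vector variable, with partial derivatives jointly continuous. The parameter
    space [T] is any topological space, such as the space of actions times [G], so no derivative in
    its direction makes sense. *)
Fixpoint Ck k f A : Prop :=
  (forall z, A z -> {for z, continuous f}) /\
  if k is k'.+1 then
    forall i, (forall z, A z -> derivable (fibre f z.1) z.2 'e_i) /\ Ck k' (pd i f) A
  else True.

Lemma near_fibre A z : open A -> A z -> \forall x \near z.2, A (z.1, x).
Proof.
move=> oA Az; have := open_nbhs_nbhs (conj oA Az).
case: z Az => t x Az [[P Q] [/= Pt Qx] PQA]; apply: filterS Qx => y Qy.
by apply: PQA; split=> //=; exact: nbhs_singleton Pt.
Qed.

Lemma Ck_cont k f A z : Ck k f A -> A z -> {for z, continuous f}.
Proof. by case: k => [|k] [cf _]; exact: cf. Qed.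

Lemma Ck_sub k f A B : B `<=` A -> Ck k f A -> Ck k f B.
Proof.
move=> BA; elim: k f => [|k IH] f [cf df]; split=> //.
- by move=> z /BA; exact: cf.
- by move=> z /BA; exact: cf.
- move=> i; have [dfi ci] := df i; split; last exact: IH.
  by move=> z /BA; exact: dfi.
Qed.

Lemma CkS k f A : Ck k.+1 f A -> Ck k f A.
Proof.
elim: k f => [|k IH] f [cf df]; split=> // i.
by have [dfi ci] := df i; split=> //; exact: IH.
Qed.

Lemma Ck_le j k f A : (j <= k)%N -> Ck k f A -> Ck j f A.
Proof.
move=> /subnK <-; elim: (k - j)%N => // l IH; rewrite addSn => /CkS; exact: IH.
Qed.

Lemma pd_ext i f g A z : open A -> {in A, f =1 g} -> A z -> pd i f z = pd i g z.
Proof.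
move=> oA fg Az; apply: near_eq_derive; apply: filterS (near_fibre oA Az) => x Ax.
by apply: fg; rewrite inE.
Qed.

Lemma Ck_ext k f g A : open A -> {in A, f =1 g} -> Ck k f A -> Ck k g A.
Proof.
move=> oA; elim: k f g => [|k IH] f g fg [cf df].
  by split=> // z Az; apply: near_eq_continuous (cf z Az);
    apply: filterS (open_nbhs_nbhs (conj oA Az)) => y Ay; apply: fg; rewrite inE.
split=> [z Az|i].
  by apply: near_eq_continuous (cf z Az);
    apply: filterS (open_nbhs_nbhs (conj oA Az)) => y Ay; apply: fg; rewrite inE.
have [dfi ci] := df i; split=> [z Az|].
  apply: near_eq_derivable (dfi z Az) => /=.
  by apply: filterS (near_fibre oA Az) => x Ax; apply: fg; rewrite inE.
by apply: IH ci => z; rewrite inE => Az; exact: pd_ext fg Az.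
Qed.

(** Each clause of [Ck] is a condition at a point on a function defined everywhere, so it can be
    checked on arbitrary sets [B]. *)
Lemma Ck_local k f A : (forall z, A z -> exists2 B, B z & Ck k f B) -> Ck k f A.
Proof.
elim: k f => [|k IH] f h.
  by split=> // z /h[B Bz [cf _]]; exact: cf.
split=> [z /h[B Bz [cf _]]|i]; first exact: cf.
split=> [z /h[B Bz [_ /(_ i)[df _]]]|]; first exact: df.
by apply: IH => z /h[B Bz [_ /(_ i)[_ ?]]]; exists B.
Qed.

Lemma Ck_base k (c : T -> R) A : (forall z, A z -> {for z, continuous (c \o fst)}) ->
  Ck k (fun z => c z.1) A.
Proof.
elim: k c => [|k IH] c cc; split=> // i; split=> [z Az|].
  by rewrite (_ : fibre _ _ = cst (c z.1))//; exact: derivable_cst.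
have -> : pd i (fun z : T * 'rV_m => c z.1) = (fun z => (fun=> 0) z.1).
  by apply/funext => z; rewrite /pd (_ : fibre _ _ = cst (c z.1))// derive_cst.
by apply: (IH (fun=> 0)) => z _; exact: cvg_cst.
Qed.

Lemma Ck_cst k (c : R) A : Ck k (fun=> c) A.
Proof. by apply: (@Ck_base k (fun=> c)) => z _; exact: cvg_cst. Qed.

Lemma Ck_coord k (i : 'I_m) A : Ck k (fun z => z.2 0 i) A.
Proof.
have cc z : {for z, continuous (fun z : T * 'rV[R]_m => z.2 0 i)}.
  apply: (@continuous_comp _ _ _ snd (fun x : 'rV[R]_m => x 0 i)).
    exact: cvg_snd.
  exact: coord_continuous.
have is_d (z : T * 'rV[R]_m) j : is_derive z.2 'e_j (fun x : 'rV[R]_m => x 0 i) (('e_j : 'rV[R]_m) 0 i).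
  have d := @derivable_id _ _ z.2 ('e_j : 'rV[R]_m).
  split; first by move/derivable_mxP : d.
  have E : 'D_('e_j) (@id 'rV[R]_m) z.2 0 i = 'D_('e_j) (fun x : 'rV[R]_m => x 0 i) z.2.
    by rewrite (derive_mx d) mxE.
  by rewrite -E derive_id.
case: k => [|k]; split=> // j; split=> [z _|]; first by have [] := is_d z j.
have -> : pd j (fun z : T * 'rV[R]_m => z.2 0 i) = fun=> ('e_j : 'rV[R]_m) 0 i.
  by apply/funext => z; have [] := is_d z j.
exact: Ck_cst.
Qed.

Lemma CkD k f g A : open A -> Ck k f A -> Ck k g A -> Ck k (fun z => f z + g z) A.
Proof.
move=> oA; elim: k f g => [|k IH] f g [cf df] [cg dg].
  by split=> // z Az; exact: (continuousD (cf z Az) (cg z Az)).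
split=> [z Az|i]; first exact: (continuousD (cf z Az) (cg z Az)).
have [dfi cfi] := df i; have [dgi cgi] := dg i; split=> [z Az|].
  exact: (derivableD (dfi z Az) (dgi z Az)).
apply: Ck_ext (IH _ _ cfi cgi) => // z; rewrite inE => Az.
by rewrite /pd -(deriveD (dfi z Az) (dgi z Az)).
Qed.

Lemma CkM k f g A : open A -> Ck k f A -> Ck k g A -> Ck k (fun z => f z * g z) A.
Proof.
move=> oA; elim: k f g => [|k IH] f g [cf df] [cg dg].
  by split=> // z Az; exact: (continuousM (cf z Az) (cg z Az)).
split=> [z Az|i]; first exact: (continuousM (cf z Az) (cg z Az)).
have [dfi cfi] := df i; have [dgi cgi] := dg i; split=> [z Az|].
  exact: (derivableM (dfi z Az) (dgi z Az)).
have Cf : Ck k f A by apply: CkS; split.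
have Cg : Ck k g A by apply: CkS; split.
apply: Ck_ext (CkD oA (IH _ _ Cf cgi) (IH _ _ Cg cfi)) => // z; rewrite inE => Az.
have := deriveM (dfi z Az) (dgi z Az).
by rewrite /pd /fibre -!surjective_pairing => <-.
Qed.

Lemma CkZ k (c : R) f A : open A -> Ck k f A -> Ck k (fun z => c * f z) A.
Proof. by move=> oA cf; apply: CkM => //; exact: Ck_cst. Qed.

Lemma CkN k f A : open A -> Ck k f A -> Ck k (fun z => - f z) A.
Proof.
move=> oA cf; apply: Ck_ext (CkZ (-1) oA cf) => // z _; exact: mulN1r.
Qed.

Lemma CkB k f g A : open A -> Ck k f A -> Ck k g A -> Ck k (fun z => f z - g z) A.
Proof. by move=> oA cf cg; apply: CkD => //; exact: CkN. Qed.

Lemma Ck_sum (I : Type) (r : seq I) (P : pred I) k (F : I -> T * 'rV[R]_m -> R) A :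
  open A -> (forall i, P i -> Ck k (F i) A) -> Ck k (fun z => \sum_(i <- r | P i) F i z) A.
Proof.
move=> oA cF; elim: r => [|i r IH].
  by under [X in Ck k X A]funext do rewrite big_nil; exact: Ck_cst.
have [Pi|/negbTE Pi] := boolP (P i); under [X in Ck k X A]funext do rewrite big_cons Pi.
  exact: CkD (cF i Pi) IH.
exact: IH.
Qed.

Lemma Ck_prod (I : Type) (r : seq I) (P : pred I) k (F : I -> T * 'rV[R]_m -> R) A :
  open A -> (forall i, P i -> Ck k (F i) A) -> Ck k (fun z => \prod_(i <- r | P i) F i z) A.
Proof.
move=> oA cF; elim: r => [|i r IH].
  by under [X in Ck k X A]funext do rewrite big_nil; exact: Ck_cst.
have [Pi|/negbTE Pi] := boolP (P i); under [X in Ck k X A]funext do rewrite big_cons Pi.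
  exact: CkM (cF i Pi) IH.
exact: IH.
Qed.

(** The derivative -f'/f^2 of the inverse is a product of functions of class C^k once the induction
    hypothesis gives 1/f of class C^k. *)
Lemma CkV k f A : open A -> (forall z, A z -> f z != 0) -> Ck k f A ->
  Ck k (fun z => (f z)^-1) A.
Proof.
move=> oA f0; elim: k => [|k IH] [cf df].
  by split=> // z Az; apply: (@continuousV _ _ f z _ (cf z Az)); exact: f0.
split=> [z Az|i]; first by apply: (@continuousV _ _ f z _ (cf z Az)); exact: f0.
have [dfi cfi] := df i.
have nz z : A z -> fibre f z.1 z.2 != 0.
  by move=> Az; rewrite /fibre -surjective_pairing f0.
split=> [z Az|]; first exact: (derivableV (nz z Az) (dfi z Az)).
have Cf : Ck k f A by apply: CkS; split.
have CV := IH Cf.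
apply: Ck_ext (CkM oA (CkN oA cfi) (CkM oA CV CV)) => // z; rewrite inE => Az.
have := deriveV (nz z Az) (dfi z Az).
rewrite /pd /fibre -!surjective_pairing => ->.
by rewrite -[_ *: _]/(_ * _) expr2 invfM mulNr mulrC mulNr.
Qed.

Lemma Ck1_diff f A z : open A -> Ck 1 f A -> A z ->
  differentiable (fibre f z.1) (z.2) /\
  'd (fibre f z.1) (z.2) = lin_of (fun i => pd i f z) :> (_ -> _).
Proof.
move=> oA [_ df] Az; apply: partials_is_diff => i.
  by apply: filterS (near_fibre oA Az) => x /((df i).1 (z.1, x)).
have [_ [ci _]] := df i; have := ci _ Az.
case: z Az => t x Az ci' B /ci'[[P Q] [/= Pt Qx] PQB].
by apply: filterS Qx => y Qy; apply: (PQB (t, y)); split=> //=; exact: nbhs_singleton Pt.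
Qed.

End ParametricCk.

(** [G] is only derivable along [v]. Restricted to the line through [x] it becomes differentiable in
    one real variable, and the chain rule for differentials applies to the restriction. *)
Lemma is_derive_chain (R : realType) (U V W : normedModType R) (G : U -> V)
    (H : V -> W) (x v : U) : derivable G x v -> differentiable H (G x) ->
  is_derive x v (H \o G) ('d H (G x) ('D_v G x)).
Proof.
move=> dG dH; pose g (t : R) := G (t *: v + x).
have lineE (Y : normedModType R) (f : U -> Y) :
    (fun h : R => h^-1 *: (f ((h *: (1 : R) + 0) *: v + x) - f (0 *: v + x))) =
    (fun h : R => h^-1 *: (f (h *: v + x) - f x)).
  apply/funext => h; congr (_ *: (f (_ *: _ + _) - f _)).
    by rewrite addr0 [_ *: _]mulr1.
  by rewrite scale0r add0r.
have dg : differentiable g 0 by apply/derivable1_diffP; exact: (iffLR (derivable1P G x v)).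
have Hg0 : differentiable H (g 0) by rewrite /g scale0r add0r.
have dHg := differentiable_comp dg Hg0.
split; first by apply: (iffRL (derivable1P _ _ _)); exact: (iffRL (derivable1_diffP (H \o g) 0)).
have -> : 'D_v (H \o G) x = 'D_1 (H \o g) 0 by rewrite /derive -lineE.
have -> : 'D_v G x = 'D_1 g 0 by rewrite /derive -lineE.
by rewrite !deriveE// diff_comp// /g scale0r add0r.
Qed.

Section CkComp.
Context {R : realType} {S T : topologicalType} {m q : nat}.

(** The parameter is moved by a merely continuous [a]. By the chain rule a partial derivative of the
    composite is a sum of products of partial derivatives of [F] with composites of partial
    derivatives of [h], to which the induction hypothesis applies. *)
Lemma Ck_comp k (h : T * 'rV[R]_m -> R) (B : set (T * 'rV[R]_m)) (a : S -> T)
    (F : S * 'rV[R]_q -> 'rV[R]_m) (A : set (S * 'rV[R]_q)) :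
  open A -> open B -> (forall z, A z -> B (a z.1, F z)) ->
  (forall z, A z -> {for z, continuous (a \o fst)}) ->
  (forall j, Ck k (fun z => F z 0 j) A) -> Ck k h B ->
  Ck k (fun z => h (a z.1, F z)) A.
Proof.
move=> oA oB AB ca; elim: k h => [|k IH] h cF ch.
  split=> // z Az; apply: (@continuous_comp _ _ _ (fun z => (a z.1, F z)) h).
    apply: continuous_pair; first exact: (ca z Az).
    by apply/continuous_coord => j; exact: Ck_cont (cF j) Az.
  by apply: Ck_cont ch _; exact: AB.
have dF i z : A z -> derivable (fun x => F (z.1, x)) z.2 'e_i.
  by move=> Az; apply/derivable_mxP => r j; rewrite ord1; have [_ /(_ i)[d _]] := cF j; exact: d.
have ch1 : Ck 1 h B by exact: Ck_le ch.
have dh z : A z -> differentiable (fibre h (a z.1)) (F (z.1, z.2)).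
  by move=> Az; rewrite -surjective_pairing; have [] := Ck1_diff oB ch1 (AB z Az).
split=> [z Az|i].
  apply: (@continuous_comp _ _ _ (fun z => (a z.1, F z)) h).
    apply: continuous_pair; first exact: (ca z Az).
    by apply/continuous_coord => j; exact: Ck_cont (cF j) Az.
  by apply: Ck_cont ch _; exact: AB.
split=> [z Az|].
  exact: (@ex_derive _ _ _ _ _ _ _ (is_derive_chain (dF i z Az) (dh z Az))).
have cF' j : Ck k (fun z => F z 0 j) A by exact: CkS (cF j).
have CC : Ck k (fun z => \sum_j pd i (fun z => F z 0 j) z * pd j h (a z.1, F z)) A.
  apply: Ck_sum => // j _; apply: CkM => //; first by have [_ /(_ i)[]] := cF j.
  by apply: IH => //; have [_ /(_ j)[]] := ch.
apply: Ck_ext CC => // z; rewrite inE => Az; apply/esym.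
rewrite /pd (@derive_val _ _ _ _ _ _ _ (is_derive_chain (dF i z Az) (dh z Az))).
rewrite -surjective_pairing (Ck1_diff oB ch1 (AB z Az)).2 /lin_of.
by apply: eq_bigr => j _; rewrite derive_mx ?mxE//; exact: dF.
Qed.

End CkComp.

Lemma is_derive_translate (R : realType) (V W : normedModType R) (g : V -> W) (x c v : V) d :
  is_derive (x + c) v g d -> is_derive x v (fun y => g (y + c)) d.
Proof.
move=> [dg <-].
have E : (fun h : R => h^-1 *: (g (h *: v + x + c) - g (x + c))) =
         (fun h : R => h^-1 *: (g (h *: v + (x + c)) - g (x + c))).
  by apply/funext => h; rewrite addrA.
by split; [rewrite /derivable E|rewrite /derive E].
Qed.

Section DirectionalCk.
Context {R : realType} {T : topologicalType} {m : nat}.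
Implicit Types (f : T * 'rV[R]_m -> R) (A : set (T * 'rV[R]_m)).

Lemma Ck_derive k f A v : open A -> Ck k.+1 f A ->
  Ck k (fun z => 'D_v (fibre f z.1) z.2) A.
Proof.
move=> oA cf; have cf1 : Ck 1 f A by exact: Ck_le cf.
have CC : Ck k (fun z => \sum_i v 0 i * pd i f z) A.
  by apply: Ck_sum => // i _; apply: CkZ => //; have [_ /(_ i)[]] := cf.
apply: Ck_ext CC => // z; rewrite inE => Az.
by rewrite deriveE_partials//; have [] := Ck1_diff oA cf1 Az.
Qed.

Lemma Ck1_derive f A v z : open A -> Ck 1 f A -> A z ->
  is_derive z.2 v (fibre f z.1) (lin_of (fun i => pd i f z) v).
Proof.
move=> oA cf Az; have [d dE] := Ck1_diff oA cf Az.
by split; [exact: diff_derivable|rewrite deriveE// dE].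
Qed.

Lemma is_derive_scaled_line f A z i (s c : R) : open A -> Ck 1 f A ->
  A (z.1, z.2 + s *: (c *: 'e_i)) ->
  is_derive (z.2 + s *: (c *: 'e_i)) (c *: 'e_i) (fibre f z.1)
    (c * pd i f (z.1, z.2 + s *: (c *: 'e_i))).
Proof.
move=> oA [_ /(_ i)[df _]] Az.
exact: (is_derive_scale c (df _ Az)).
Qed.

(** The mean value theorem is applied in direction [i] to the difference in direction [j], then in
    direction [j] to [pd i f]. The left-hand side is symmetric in [i] and [j], whence [pd_sym]. *)
Lemma second_difference f A t x i j (s r : R) : open A -> Ck 2 f A ->
  0 < s -> s + s < r -> (forall y, `|y - x| < r -> A (t, y)) ->
  exists2 y, `|y - x| < r &
    f (t, x + s *: 'e_i + s *: 'e_j) - f (t, x + s *: 'e_j)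
     - (f (t, x + s *: 'e_i) - f (t, x)) = s * (s * pd j (pd i f) (t, y)).
Proof.
move=> oA cf s0 sr rA.
have cf1 : Ck 1 f A by exact: Ck_le cf.
have cfi : Ck 1 (pd i f) A by have [_ /(_ i)[]] := cf.
have sm a b : 0 <= a <= 1 -> 0 <= b <= 1 ->
    `|x + a *: (s *: 'e_i) + b *: (s *: 'e_j) - x| < r.
  move=> /andP[a0 a1] /andP[b0 b1]; apply: le_lt_trans sr.
  rewrite [_ - x]addrC !addrA addNr add0r; apply: le_trans (ler_normD _ _) _.
  have nb c l : 0 <= c -> c <= 1 -> `|c *: (s *: 'e_l) : 'rV[R]_m| <= s.
    move=> c0 c1; rewrite normrZ normrZ (ger0_norm c0) (gtr0_norm s0) mulrCA.
    apply: ler_piMr; first exact: ltW.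
    by apply: mulr_ile1 => //; exact: normr_delta.
  by apply: lerD; exact: nb.
pose g y := f (t, y + s *: 'e_j) - f (t, y).
have I01 : 0 <= (1 : R) <= 1 by rewrite ler01 lexx.
have I00 : 0 <= (0 : R) <= 1 by rewrite ler01 lexx.
have shiftd a : 0 <= a <= 1 -> is_derive (x + a *: (s *: 'e_i)) (s *: 'e_i)
    (fun y => f (t, y + s *: 'e_j)) (s * pd i f (t, x + a *: (s *: 'e_i) + s *: 'e_j)).
  move=> aI.
  have Aa : A (t, x + a *: (s *: 'e_i) + s *: 'e_j).
    by apply: rA; have := sm a 1 aI I01; rewrite scale1r.
  apply: (@is_derive_translate _ _ _ (fibre f t)).
  by have [_ /(_ i)[df _]] := cf1; exact: (is_derive_scale s (df _ Aa)).
have dg a : 0 <= a <= 1 -> is_derive (x + a *: (s *: 'e_i)) (s *: 'e_i) g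
    (s * pd i f (t, x + a *: (s *: 'e_i) + s *: 'e_j) - s * pd i f (t, x + a *: (s *: 'e_i))).
  move=> aI; apply: is_deriveB; first exact: shiftd.
  apply: (@is_derive_scaled_line f A (t, x)) => //=.
  by apply: rA; have := sm a 0 aI I00; rewrite scale0r addr0.
have [a aI ga] := MVT_line (fun a aI => @ex_derive _ _ _ _ _ _ _ (dg a aI)).
have dh b : 0 <= b <= 1 -> is_derive (x + a *: (s *: 'e_i) + b *: (s *: 'e_j)) (s *: 'e_j)
    (fibre (pd i f) t) (s * pd j (pd i f) (t, x + a *: (s *: 'e_i) + b *: (s *: 'e_j))).
  move=> bI; apply: (@is_derive_scaled_line (pd i f) A (t, x + a *: (s *: 'e_i))) => //=.
  by apply: rA; exact: sm.
have [b bI hb] := MVT_line (fun b bI => @ex_derive _ _ _ _ _ _ _ (dh b bI)).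
exists (x + a *: (s *: 'e_i) + b *: (s *: 'e_j)); first exact: sm.
move: hb; rewrite (@derive_val _ _ _ _ _ _ _ (dh b bI)) => <-.
have := ga; rewrite (@derive_val _ _ _ _ _ _ _ (dg a aI)) /g /fibre -mulrBr => <-.
by ring.
Qed.

Lemma pd_sym f A z i j : open A -> Ck 2 f A -> A z ->
  pd i (pd j f) z = pd j (pd i f) z.
Proof.
case: z => t x oA cf Az.
have cij k l : {for (t, x), continuous (pd k (pd l f))}.
  have [_ /(_ l)[_ [_ /(_ k)[_ [c _]]]]] := cf; exact: c.
apply/eqP; rewrite -subr_eq0 -normr_le0; apply/ler_addgt0Pr => e e0; rewrite add0r.
have e20 : 0 < e / 2 by rewrite divr_gt0.
have nearc k l : \forall y \near x,
    `|pd k (pd l f) (t, x) - pd k (pd l f) (t, y)| <= e / 2.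
  have /cvgrPdist_le/(_ _ e20) := cij k l.
  move=> [[P Q] [/= Pt Qx] PQ]; apply: filterS Qx => y Qy.
  by apply: (PQ (t, y)); split=> //=; exact: nbhs_singleton Pt.
have : \forall y \near x, [/\ A (t, y),
    `|pd i (pd j f) (t, x) - pd i (pd j f) (t, y)| <= e / 2 &
    `|pd j (pd i f) (t, x) - pd j (pd i f) (t, y)| <= e / 2].
  have hA : \forall y \near x, A (t, y) by exact: (near_fibre oA Az).
  by apply: filterS3 hA (nearc i j) (nearc j i) => y; split.
move=> /near_ballP[r r0 rP].
(* With side [r / 3], two sides of the square together stay below [r]. *)
have s0 : 0 < r / 3 by rewrite divr_gt0.
have sr : r / 3 + r / 3 < r by lra.
have rA y : `|y - x| < r -> A (t, y) by move=> /rP[].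
have [y1 y1r E1] := second_difference i j oA cf s0 sr rA.
have [y2 y2r E2] := second_difference j i oA cf s0 sr rA.
have sn0 : r / 3 != 0 by rewrite gt_eqF.
have inj (a b : R) : r / 3 * (r / 3 * a) = r / 3 * (r / 3 * b) -> a = b.
  by move=> /(mulfI sn0)/(mulfI sn0).
have E : pd j (pd i f) (t, y1) = pd i (pd j f) (t, y2).
  apply: inj; apply: (etrans (esym E1)); apply: (etrans _ E2).
  rewrite [x + _ *: 'e_i + _]addrAC.
  move: (f _) (f _) (f _) (f _) => a b c d.
  by ring.
have [_ h1 _] := rP _ y2r; have [_ _ h2] := rP _ y1r.
rewrite E in h2.
have aux (a b c : R) : `|a - c| <= e / 2 -> `|b - c| <= e / 2 -> `|a - b| <= e.
  move=> h h'; rewrite (_ : a - b = (a - c) - (b - c)); last by ring.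
  by apply: le_trans (ler_normB _ _) _; rewrite [leRHS](splitr e) lerD.
exact: aux h1 h2.
Qed.

Lemma derive_sym f A z u v : open A -> Ck 2 f A -> A z ->
  'D_u (fun x => 'D_v (fibre f z.1) x) z.2 = 'D_v (fun x => 'D_u (fibre f z.1) x) z.2.
Proof.
move=> oA cf Az.
have E (a b : 'rV[R]_m) : 'D_a (fun x => 'D_b (fibre f z.1) x) z.2 =
    \sum_i \sum_j a 0 i * (b 0 j * pd i (pd j f) z).
  have Cb : Ck 1 (fun z => 'D_b (fibre f z.1) z.2) A by exact: Ck_derive.
  have [_ ->] := Ck1_derive a oA Cb Az.
  apply: eq_bigr => i _; rewrite -mulr_sumr; congr (_ * _).
  have cf1 : Ck 1 f A by exact: Ck_le cf.
  rewrite (@pd_ext _ _ _ _ _ (fun z => \sum_j b 0 j * pd j f z) A)//; last first.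
    by move=> y; rewrite inE => Ay; have [_ ->] := Ck1_derive b oA cf1 Ay.
  have dj j : is_derive z.2 'e_i (b 0 j *: fibre (pd j f) z.1) (b 0 j *: pd i (pd j f) z).
    apply: is_deriveZ; split=> //.
    by have [_ /(_ j)[_ [_ /(_ i)[d _]]]] := cf; exact: d.
  have [_ <-] := is_derive_sum dj.
  by rewrite /pd; congr ('D_ _ _ _); apply/funext => x; rewrite fct_sumE.
rewrite !E exchange_big/=; apply: eq_bigr => i _; apply: eq_bigr => j _.
by rewrite (pd_sym _ _ oA cf Az); ring.
Qed.

End DirectionalCk.

(** * Iterated directional derivatives and the classes [Ck] *)

Section SmoothOn.
Context {R : realType} {m : nat}.

Lemma iter_derive_coord (p : nat) (f : 'rV[R]_m -> 'rV[R]_p) (U : set 'rV[R]_m) vs x j :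
  open U -> (forall ws y, U y -> differentiable (iter_derive ws f) y) -> U x ->
  iter_derive vs f x 0 j = iter_derive vs (fun y => f y 0 j : R^o) x.
Proof.
move=> oU sf; elim: vs x => //= v vs IH x Ux.
rewrite derive_mx ?mxE; last exact/diff_derivable/sf.
apply: near_eq_derive; apply: filterS (open_nbhs_nbhs (conj oU Ux)) => y; exact: IH.
Qed.

Lemma differentiable_rowP (p : nat) (V : normedModType R) (f : V -> 'rV[R]_p) x :
  differentiable f x <-> forall j, differentiable (fun y => f y 0 j : R^o) x.
Proof.
split=> [df j|df].
  apply: (@differentiable_comp _ _ _ _ f (fun y : 'rV[R]_p => y 0 j)) => //.
  exact: differentiable_coord.
rewrite (_ : f = \sum_j (fun y => f y 0 j *: ('e_j : 'rV[R]_p))); last first.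
  by apply/funext => y; rewrite fct_sumE; exact: row_sum_e.
apply: differentiable_sum => j; exact: differentiableZl.
Qed.

(** An iterated derivative of [f] is computed coordinatewise only where the earlier ones are
    derivable, so for the converse the comparison and derivability are proved together, by induction
    on the list of directions. *)
Lemma smooth_on_coordP (p : nat) (f : 'rV[R]_m -> 'rV[R]_p) (U : set 'rV[R]_m) :
  open U -> smooth_on U f <-> forall j, smooth_on U (fun x => f x 0 j : R^o).
Proof.
move=> oU; split=> [sf j vs x Ux|sf vs x Ux].
  have dj : differentiable (fun y => iter_derive vs f y 0 j : R^o) x.
    by move: j; apply/differentiable_rowP; exact: sf.
  apply: near_eq_differentiable dj.
  apply: filterS (open_nbhs_nbhs (conj oU Ux)) => y Uy.
  by apply: iter_derive_coord Uy => // ws z Uz; exact: sf.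
have E ws y : U y -> forall j, iter_derive ws f y 0 j = iter_derive ws (fun y => f y 0 j : R^o) y.
  elim: ws y => //= v ws IH y Uy j; rewrite derive_mx ?mxE.
    by apply: near_eq_derive; apply: filterS (open_nbhs_nbhs (conj oU Uy)) => z /IH.
  apply/derivable_mxP => r l; rewrite ord1.
  apply: near_eq_derivable (diff_derivable (sf l ws y Uy)).
  by apply: filterS (open_nbhs_nbhs (conj oU Uy)) => z /IH.
apply/differentiable_rowP => j; apply: near_eq_differentiable (sf j vs x Ux).
by apply: filterS (open_nbhs_nbhs (conj oU Ux)) => z /E.
Qed.

Definition cyl {T : Type} (U : set 'rV[R]_m) : set (T * 'rV[R]_m) := [set z | U z.2].

Lemma open_cyl (T : topologicalType) U : open U -> open (cyl U : set (T * _)).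
Proof. by move=> oU; apply: open_comp => // z _; exact: cvg_snd. Qed.

Lemma smooth_on_Ck (T : topologicalType) k (g : 'rV[R]_m -> R) U : open U ->
  smooth_on U (g : _ -> R^o) -> Ck k (fun z : T * 'rV[R]_m => g z.2) (cyl U).
Proof.
move=> oU sg; rewrite -[g]/(iter_derive [::] (g : _ -> R^o)).
have cont ws z : cyl U z ->
    {for z, continuous (fun z : T * 'rV[R]_m => iter_derive ws (g : _ -> R^o) z.2)}.
  move=> Uz; apply: (@continuous_comp _ _ _ snd (iter_derive ws (g : _ -> R^o))).
    exact: cvg_snd.
  exact/differentiable_continuous/sg.
elim: k [::] => [|k IH] ws; first by split=> // z; exact: cont.
split=> [z|i]; first exact: cont.
split; first by move=> z Uz; apply: diff_derivable; exact: sg.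
exact: (IH ('e_i :: ws)).
Qed.

(** Each directional derivative costs one order ([Ck_derive]), hence the hypothesis for all [k]. The
    point [t] lifts a point of [U] to the cylinder. *)
Lemma Ck_smooth_on (T : topologicalType) (t : T) (g : 'rV[R]_m -> R) U : open U ->
  (forall k, Ck k (fun z : T * 'rV[R]_m => g z.2) (cyl U)) ->
  smooth_on U (g : _ -> R^o).
Proof.
move=> oU cg vs.
have oc : open (cyl U : set (T * _)) by exact: open_cyl.
have {}cg k : Ck k (fun z : T * 'rV[R]_m => iter_derive vs (g : _ -> R^o) z.2) (cyl U).
  elim: vs k => // v vs IH k; exact: (Ck_derive v oc (IH k.+1)).
move=> x Ux; by have [] := Ck1_diff oc (cg 1) (Ux : cyl U (t, x)).
Qed.

End SmoothOn.

Section CkMatrix.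
Context {R : realType} {T : topologicalType} {m n : nat}.
Variables (A : set (T * 'rV[R]_m)) (oA : open A) (k : nat).

Lemma Ck_det (q : nat) (M : T * 'rV[R]_m -> 'M[R]_q) :
  (forall i j, Ck k (fun z => M z i j) A) -> Ck k (fun z => \det (M z)) A.
Proof.
move=> cM; apply: Ck_sum => // s _; apply: CkZ => //.
by apply: Ck_prod => // i _; exact: cM.
Qed.

Lemma Ck_invmx (M : T * 'rV[R]_m -> 'M[R]_n) :
  (forall i j, Ck k (fun z => M z i j) A) ->
  (forall z, A z -> M z \in unitmx) ->
  forall i j, Ck k (fun z => invmx (M z) i j) A.
Proof.
move=> cM uM i j.
have CC : Ck k (fun z => (\det (M z))^-1 * cofactor (M z) j i) A.
  apply: CkM => //.
    apply: CkV => //; last exact: Ck_det.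
    by move=> z /uM; rewrite unitmxE unitfE.
  apply: CkZ => //; apply: Ck_det => a b.
  by under [X in Ck k X A]funext do rewrite !mxE; exact: cM.
apply: Ck_ext CC => // z; rewrite inE => /uM uz.
by rewrite /invmx uz !mxE.
Qed.

Lemma Ck_mulmx (p q r : nat) (M : T * 'rV[R]_m -> 'M[R]_(p, q))
    (N : T * 'rV[R]_m -> 'M[R]_(q, r)) :
  (forall i j, Ck k (fun z => M z i j) A) -> (forall i j, Ck k (fun z => N z i j) A) ->
  forall i j, Ck k (fun z => (M z *m N z) i j) A.
Proof.
move=> cM cN i j; under [X in Ck k X A]funext do rewrite mxE.
by apply: Ck_sum => // l _; exact: CkM.
Qed.

End CkMatrix.

Global Opaque pd.

(** * Smooth cut-off functions *)

Section FlatFunction.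
Context {R : realType}.

(* [flat j] is [t ^- j * exp (- 1 / t)] on [t > 0], extended by [0]; the family is
   stable under differentiation, which makes every [flat j] smooth. *)
Definition flat (j : nat) (t : R) : R := if 0 < t then t ^- j * expR (- t^-1) else 0.

(** The term of degree [j.+2] of the exponential series bounds [expR t^-1] from below. The resulting
    quadratic decay at [0] yields the derivative [0] there in [flat_derive]. *)
Lemma flat_le j t : `|flat j t| <= (j.+2)`!%:R * t ^+ 2.
Proof.
rewrite /flat; case: ifPn => [t0|_]; last by rewrite normr0 mulr_ge0// sqr_ge0.
have ti0 : 0 < t^-1 by rewrite invr_gt0.
have h := expR_ge1Dxn j.+1 (ltW ti0).
rewrite ger0_norm ?mulr_ge0 ?expR_ge0 ?invr_ge0 ?exprn_ge0 ?(ltW t0)//.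
rewrite expRN -exprVn ler_pdivrMr ?expR_gt0//.
have h2 : t^-1 ^+ j.+2 / (j.+2)`!%:R <= expR t^-1.
  by apply: le_trans h; rewrite lerDr ler01.
move: h2; rewrite ler_pdivrMr ?ltr0n ?fact_gt0// => h2.
have -> : t^-1 ^+ j = t ^+ 2 * t^-1 ^+ j.+2.
  have -> : t^-1 ^+ j.+2 = t^-1 ^+ j * t^-1 ^+ 2 by rewrite -exprD addn2.
  by rewrite mulrCA -exprMn mulfV ?gt_eqF// expr1n mulr1.
by rewrite [leRHS]mulrAC [leRHS]mulrC ler_wpM2l ?sqr_ge0// [leRHS]mulrC.
Qed.

Lemma flat_derive j t :
  is_derive t (1 : R) (flat j) (flat j.+2 t - j%:R * flat j.+1 t).
Proof.
have [t0|t0|->] := ltgtP t 0.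
- have E : \forall s \near t, (cst 0 : R -> R) s = flat j s.
    by near=> s; rewrite /flat ltNge (_ : s <= 0)//; apply: ltW; near: s; exact: lt_nbhsl.
  rewrite /flat ltNge (ltW t0)/= mulr0 subr0.
  by apply: near_eq_is_derive E _; exact: is_derive_cst.
- have E : \forall s \near t, s ^- j * expR (- s^-1) = flat j s.
    by near=> s; rewrite /flat (_ : 0 < s)//; near: s; exact: lt_nbhsr.
  apply: near_eq_is_derive E _; rewrite /flat t0.
  have tn0 : t != 0 by rewrite gt_eqF.
  have d1 : is_derive t (1 : R) (fun s : R => s^-1) (- t ^- 2).
    by apply: is_derive_eq (is_deriveV tn0 (is_derive_id t 1)) _; rewrite [_ *: _]mulr1.
  have d2 : is_derive t (1 : R) (fun s : R => expR (- s^-1)) (expR (- t^-1) * t ^- 2).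
    apply: (@is_derive1_comp _ expR (fun s => - s^-1)).
    by apply: is_derive_eq (is_deriveN d1) _; rewrite opprK.
  have d3 : is_derive t (1 : R) (fun s : R => s ^- j) (- j%:R * t ^- j.+1).
    rewrite (_ : (fun s : R => s ^- j) = (fun s : R => s^-1) ^+ j); last first.
      by apply/funext => s; rewrite fctE -exprVn; elim: j => // j IH; rewrite !exprS IH.
    apply: is_derive_eq (is_deriveX _ d1) _.
    case: j => [|j]; first by rewrite !mul0r scale0r oppr0 mul0r.
    rewrite -[_ *: _]/(_ * _) /= mulrN mulNr -mulrA; congr (- (_ * _)).
    by rewrite exprVn -invfM -exprD addn2.
  apply: is_derive_eq (is_deriveM d3 d2) _.
  rewrite -[_ *: _]/(_ * _) -[X in _ + X]/(_ * _).
  have -> : t ^- j.+2 = t ^- j * t ^- 2 by rewrite -invfM -exprD addn2.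
  move: (t ^- j) (t ^- j.+1) (t ^- 2) (expR _) => a b c d; ring.
have -> : flat j.+2 0 - j%:R * flat j.+1 0 = 0 :> R by rewrite /flat ltxx mulr0 subr0.
have c0 : (fun h : R => h^-1 *: (flat j (h *: (1 : R) + 0) - flat j 0)) @ 0^' --> (0 : R).
  apply/cvgrPdist_le => e e0; near=> h.
  rewrite sub0r normrN addr0 [h *: 1]mulr1 {2}/flat ltxx subr0.
  have h0 : h != 0 by near: h; exact: nbhs_dnbhs_neq.
  have C0 : (0 : R) < (j.+2)`!%:R by rewrite ltr0n fact_gt0.
  have he : `|h| < e / (j.+2)`!%:R by near: h; apply: dnbhs0_lt; rewrite divr_gt0.
  rewrite -[_ *: _]/(_ * _) normrM normfV ler_pdivrMl ?normr_gt0//.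
  apply: le_trans (flat_le _ _) _; rewrite -real_normK ?num_real// expr2 mulrCA.
  by rewrite ler_wpM2l// mulrC -ler_pdivlMr// ltW.
by split; [apply/cvg_ex; exists 0|exact: cvg_lim c0].
Unshelve. all: by end_near. Qed.

Lemma flat_ge0 j t : 0 <= flat j t.
Proof.
by rewrite /flat; case: ifPn => // t0; rewrite mulr_ge0 ?expR_ge0// invr_ge0 exprn_ge0// ltW.
Qed.

Lemma flat_gt0 j t : 0 < t -> 0 < flat j t.
Proof. by move=> t0; rewrite /flat t0 mulr_gt0 ?expR_gt0// invr_gt0 exprn_gt0. Qed.

Lemma flat_eq0 j t : t <= 0 -> flat j t = 0.
Proof. by move=> t0; rewrite /flat ltNge t0. Qed.

(** Smooth transition from [0] on [t <= 0] to [1] on [1 <= t]; the denominator is positive because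
    [t] or [1 - t] is. *)
Definition step t : R := flat 0 t / (flat 0 t + flat 0 (1 - t)).

Lemma step_den t : 0 < flat 0 t + flat 0 (1 - t).
Proof.
have [t0|t0] := ltP 0 t; first by rewrite ltr_wpDr ?flat_ge0 ?flat_gt0.
by rewrite ltr_wpDl ?flat_ge0// flat_gt0// subr_gt0 (le_lt_trans t0).
Qed.

Lemma step_eq0 t : t <= 0 -> step t = 0.
Proof. by move=> t0; rewrite /step flat_eq0// mul0r. Qed.

Lemma step_eq1 t : 1 <= t -> step t = 1.
Proof.
move=> t1; rewrite /step [flat 0 (1 - t)]flat_eq0 ?subr_le0// addr0 mulfV//.
by rewrite gt_eqF// flat_gt0// (lt_le_trans ltr01).
Qed.

Lemma step_ge0 t : 0 <= step t.
Proof. by rewrite divr_ge0 ?flat_ge0// ltW// step_den. Qed.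

Lemma step_le1 t : step t <= 1.
Proof. by rewrite ler_pdivrMr ?step_den// mul1r lerDl flat_ge0. Qed.

End FlatFunction.

Section Bump.
Context {R : realType} {T : topologicalType} {m : nat}.
Implicit Types (A : set (T * 'rV[R]_m)).

Lemma Ck_flat k j (u : T * 'rV[R]_m -> R) A : open A -> Ck k u A ->
  Ck k (fun z => flat j (u z)) A.
Proof.
move=> oA; have dflat i t : differentiable (flat i : R -> R) t.
  by apply/derivable1_diffP; have [] := flat_derive i t.
have cont i l z : Ck l u A -> A z -> {for z, continuous (fun z => flat i (u z))}.
  move=> cu Az; apply: (@continuous_comp _ _ _ u (flat i)); first exact: Ck_cont cu Az.
  exact: differentiable_continuous.
elim: k j => [|k IH] j cu; first by split=> // z; exact: cont cu.
split=> [z|i]; first exact: cont cu.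
have [_ /(_ i)[du ci]] := cu.
have d z : A z -> is_derive z.2 'e_i (fun x => flat j (u (z.1, x)))
    ((flat j.+2 (u z) - j%:R * flat j.+1 (u z)) * pd i u z).
  move=> Az; have dj : differentiable (flat j) (fibre u z.1 z.2) by [].
  have [dd dE] := is_derive_chain (du z Az) dj; split=> //.
  have chain (y h : R) : 'd (flat j) y h = (flat j.+2 y - j%:R * flat j.+1 y) * h.
    have dy : differentiable (flat j) y by [].
    rewrite -{1}[h]mulr1 -[h * 1]/(h *: 1) linearZ/= -(deriveE _ dy).
    by have [_ ->] := flat_derive j y; rewrite -[_ *: _]/(_ * _) mulrC.
  by rewrite [LHS]dE chain pdE /fibre -surjective_pairing.
split; first by move=> z /d[].
have cu' : Ck k u A by exact: CkS.
have CC := CkM oA (CkB oA (IH j.+2 cu') (CkZ j%:R oA (IH j.+1 cu'))) ci.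
by apply: Ck_ext CC => // z; rewrite inE => /d[_ <-]; rewrite pdE.
Qed.

Lemma Ck_step k (u : T * 'rV[R]_m -> R) A : open A -> Ck k u A ->
  Ck k (fun z => step (u z)) A.
Proof.
move=> oA cu; apply: CkM => //; first exact: Ck_flat.
apply: CkV => //; first by move=> z _; rewrite gt_eqF// step_den.
by apply: CkD => //; apply: Ck_flat => //; apply: CkB => //; exact: Ck_cst.
Qed.

(** Row vectors carry the sup norm, so a product of two-sided steps over the coordinates is [1] on
    the ball of radius [r1] and [0] outside the ball of radius [r2], without smoothing a norm. *)
Definition bump (c : 'rV[R]_m) (r1 r2 : R) (x : 'rV[R]_m) : R :=
  \prod_i (step ((r2 - (x 0 i - c 0 i)) / (r2 - r1)) *
           step ((r2 + (x 0 i - c 0 i)) / (r2 - r1))).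

Lemma Ck_bump k c r1 r2 A : open A -> Ck k (fun z => bump c r1 r2 z.2) A.
Proof.
move=> oA; apply: Ck_prod => // i _; apply: CkM => //; apply: Ck_step => //;
  (apply: CkM => //; last exact: Ck_cst); [apply: CkB => //|apply: CkD => //];
  try exact: Ck_cst; apply: CkB => //; try exact: Ck_cst; exact: Ck_coord.
Qed.

Lemma bump_ge0 c r1 r2 x : 0 <= bump c r1 r2 x.
Proof. by apply: prodr_ge0 => i _; rewrite mulr_ge0 ?step_ge0. Qed.

Lemma bump_le1 c r1 r2 x : bump c r1 r2 x <= 1.
Proof.
apply: prodr_ile1 => i _; rewrite mulr_ge0 ?step_ge0//=.
by rewrite mulr_ile1 ?step_ge0 ?step_le1.
Qed.

Lemma bump_eq1 c r1 r2 x : r1 < r2 -> `|x - c| <= r1 -> bump c r1 r2 x = 1.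
Proof.
move=> r12 xr; rewrite /bump big1// => i _.
have := le_trans (normr_coord (x - c) i) xr; rewrite !mxE ler_norml => /andP[h1 h2].
by rewrite !step_eq1 ?mulr1// ler_pdivlMr ?subr_gt0// mul1r; lra.
Qed.

Lemma bump_eq0 c r1 r2 x : 0 < r2 -> r1 < r2 -> r2 <= `|x - c| -> bump c r1 r2 x = 0.
Proof.
move=> r20 r12 xr.
have /mx_norm_neq0[[l i] /= E] : mx_norm (x - c) != 0.
  by rewrite -[mx_norm _]/(`|x - c|) gt_eqF// (lt_le_trans r20).
rewrite (ord1 l) -[mx_norm _]/(`|x - c|) in E.
rewrite /bump (bigD1 i)//=.
move: xr; rewrite E !mxE; set d := x 0 i - c 0 i => xr.
have rp : 0 < r2 - r1 by rewrite subr_gt0.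
have [d0|d0] := leP 0 d.
  rewrite [step _]step_eq0 ?mul0r// ler_pdivrMr// mul0r.
  by rewrite ger0_norm// in xr; rewrite subr_le0.
rewrite [step ((r2 + d) / _)]step_eq0 ?mulr0 ?mul0r// ler_pdivrMr// mul0r.
by rewrite ltr0_norm// in xr; rewrite -lerBrDr sub0r.
Qed.

End Bump.

(** * Averaging over a compact Lie group *)

Lemma continuous_sum_seq (R : realType) (X : topologicalType) (I : Type) (s : seq I)
    (F : I -> X -> R) (x : X) : (forall i, {for x, continuous (F i)}) ->
  {for x, continuous (fun y => \sum_(i <- s) F i y)}.
Proof.
move=> cF; elim: s => [|i s IH].
  by under [X in {for _, continuous X}]eq_fun do rewrite big_nil; exact: cvg_cst.
under [X in {for _, continuous X}]eq_fun do rewrite big_cons.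
exact: (continuousD (cF i) IH).
Qed.

Section Averages.
Context {R : realType} {k : nat} (G : lieGroupType R k).
Hypothesis compactG : compact [set: G].
Implicit Types (f g : G -> R) (s t : seq G).

Definition ravg s f (x : G) : R := (size s)%:R^-1 * \sum_(a <- s) f (x * a)%g.
Definition lavg s f (x : G) : R := (size s)%:R^-1 * \sum_(a <- s) f (a * x)%g.

Lemma avg_near s (u : G -> R) (c e : R) : s != [::] ->
  (forall a, a \in s -> `|u a - c| <= e) ->
  `|(size s)%:R^-1 * \sum_(a <- s) u a - c| <= e.
Proof.
move=> s0 ue; have sz : (0 : R) < (size s)%:R by rewrite ltr0n lt0n size_eq0.
rewrite (_ : _ - c = (size s)%:R^-1 * \sum_(a <- s) (u a - c)); last first.
  rewrite sumrB big_const_seq count_predT iter_addr addr0 mulrBr.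
  by rewrite -[c *+ _]mulr_natl mulKf// gt_eqF.
rewrite normrM gtr0_norm ?invr_gt0// ler_pdivrMl// mulr_natl.
apply: le_trans (ler_norm_sum _ _ _) _.
rewrite (_ : e *+ _ = \sum_(a <- s) e); last first.
  by rewrite big_const_seq count_predT iter_addr addr0.
by rewrite !big_seq; apply: ler_sum => a; exact: ue.
Qed.

Lemma ravg_comp s t f x : ravg s (ravg t f) x =
  ravg [seq (a * b)%g | a <- s, b <- t] f x.
Proof.
rewrite /ravg size_allpairs natrM invfM -mulrA; congr (_ * _).
rewrite -mulr_sumr; congr (_ * _); rewrite big_allpairs_dep /=.
by apply: eq_bigr => a _; apply: eq_bigr => b _; rewrite mulgA.
Qed.

Lemma lravg_comm s t f x : lavg s (ravg t f) x = ravg t (lavg s f) x.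
Proof.
rewrite /ravg /lavg -!mulr_sumr mulrCA exchange_big/=; congr (_ * (_ * _)).
by apply: eq_bigr => b _; apply: eq_bigr => a _; rewrite mulgA.
Qed.

Lemma cmulg : continuous (fun p : G * G => (p.1 * p.2)%g).
Proof. by have [] := @mulg_smooth R k G. Qed.

Lemma cinvg : continuous (fun x : G => (x^-1)%g).
Proof. by have [] := @invg_smooth R k G. Qed.

Lemma continuous_mulg (X : topologicalType) (u v : X -> G) (x : X) :
  {for x, continuous u} -> {for x, continuous v} ->
  {for x, continuous (fun y => (u y * v y)%g)}.
Proof.
move=> cu cv; apply: (@continuous_comp _ _ _ (fun y => (u y, v y)) (fun p : G * G => (p.1 * p.2)%g)).
  exact: continuous_pair.
exact: cmulg.
Qed.

Lemma ravg_cont s f : continuous f -> continuous (ravg s f).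
Proof.
move=> cf x; apply: (@continuousM _ _ (cst _) (fun x => \sum_(a <- s) f (x * a)%g)).
  exact: cst_continuous.
apply: continuous_sum_seq => a.
apply: (@continuous_comp _ _ _ (fun x => (x * a)%g) f); last exact: cf.
by apply: (@continuous_mulg _ id (cst a)); [exact: cvg_id|exact: cvg_cst].
Qed.

(** For a single pair, [a = x^-1 y] makes the difference vanish for every [b]. Compactness of [G] in
    [b], then of [G * G] in the pair, leaves finitely many such [a]. *)
Lemma uniform_translates f (e : R) : continuous f -> 0 < e ->
  exists s : seq G, forall x y, exists2 a, a \in s &
    forall b, `|f (x * a * b)%g - f (y * b)%g| <= e.
Proof.
move=> cf e0.
(* The filter of the lists that contain a given finite list: near-covering compactness along it
   collects the finitely many [a] into one list. *)
pose F : set_system (seq G) := [set P | exists s0 : seq G, forall s, {subset s0 <= s} -> P s].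
have FF : Filter F.
  split; first by exists [::].
    move=> P Q [s1 h1] [s2 h2]; exists (s1 ++ s2) => s sub; split.
      by apply: h1 => a as1; apply: sub; rewrite mem_cat as1.
    by apply: h2 => a as2; apply: sub; rewrite mem_cat as2 orbT.
  by move=> P Q PQ [s0 h]; exists s0 => s /h; exact: PQ.
have cGG : compact [set: G * G].
  by rewrite -setXTT; exact: compact_setX.
have cov : forall p : G * G, [set: G * G] p -> \forall p' \near p & s \near F,
   exists2 a, a \in s & forall b, `|f (p'.1 * a * b)%g - f (p'.2 * b)%g| <= e.
  move=> [x0 y0] _; pose a := (x0^-1 * y0)%g.
  have near_b : \forall p' \near (x0, y0), forall b, [set: G] b ->
      `|f (p'.1 * a * b)%g - f (p'.2 * b)%g| <= e.
    have := (iffLR (compact_near_coveringP _) compactG) (G * G)%type (nbhs (x0, y0))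
      (fun p' b => `|f (p'.1 * a * b)%g - f (p'.2 * b)%g| <= e) _ _.
    apply => b0 _.
    pose D (q : G * (G * G)) := f (q.2.1 * a * q.1)%g - f (q.2.2 * q.1)%g.
    have cD : {for (b0, (x0, y0)), continuous D}.
      have c1 : {for (b0, (x0, y0)), continuous (fun q : G * (G * G) => q.1)}.
        exact: cvg_fst.
      have c2 : {for (b0, (x0, y0)), continuous (fun q : G * (G * G) => q.2)}.
        exact: cvg_snd.
      have c3 : {for (b0, (x0, y0)), continuous (fun q : G * (G * G) => q.2.1)}.
        by apply: (continuous_comp c2); exact: cvg_fst.
      have c4 : {for (b0, (x0, y0)), continuous (fun q : G * (G * G) => q.2.2)}.
        by apply: (continuous_comp c2); exact: cvg_snd.
      apply: (@continuousB _ _ _ (fun q : G * (G * G) => f (q.2.1 * a * q.1)%g)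
        (fun q : G * (G * G) => f (q.2.2 * q.1)%g)).
        apply: (@continuous_comp _ _ _ (fun q : G * (G * G) => (q.2.1 * a * q.1)%g) f); last exact: cf.
        by do 2?apply: continuous_mulg => //; exact: cvg_cst.
      apply: (@continuous_comp _ _ _ (fun q : G * (G * G) => (q.2.2 * q.1)%g) f); last exact: cf.
      exact: continuous_mulg.
    have D0 : D (b0, (x0, y0)) = 0.
      by rewrite /D /= /a mulgA mulgV mul1g subrr.
    have /cvgrPdist_le/(_ _ e0) := cD; rewrite D0.
    by apply: filterS => q /=; rewrite sub0r normrN.
  exists ([set p' | forall b, `|f (p'.1 * a * b)%g - f (p'.2 * b)%g| <= e],
          [set s : seq G | a \in s]); last first.
    by move=> [p' s] [/= h as_]; exists a.
  split; first by apply: filterS near_b => p' h b; exact: h.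
  by exists [:: a] => s; apply; rewrite mem_head.
have [s0 h] := (iffLR (compact_near_coveringP _) cGG) _ _ _ FF cov.
by exists s0 => x y; have [a] := h s0 (fun _ => id) (x, y) I; exists a.
Qed.

Definition haar_limit f (c : R) := forall e : R, 0 < e ->
  exists2 s, s != [::] & forall x, `|ravg s f x - c| <= e.

Lemma haar_limit_ravg s f c : s != [::] -> haar_limit (ravg s f) c -> haar_limit f c.
Proof.
move=> s0 h e /h[t t0 tc]; exists [seq (a * b)%g | a <- t, b <- s].
  by rewrite -size_eq0 size_allpairs muln_eq0 !size_eq0 negb_or t0.
by move=> x; rewrite -ravg_comp.
Qed.

(** The constant is the infimum [M] of the upper bounds of averages. If [ravg s f] is below [M + d]
    everywhere, averaging it once more over the translates [t] still exceeds [M - d] somewhere, so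
    none of the translated values is far below [M]; [uniform_translates] compares one of them with
    the value at any [y]. *)
Lemma haar_limit_exists f : continuous f -> exists c, haar_limit f c.
Proof.
move=> cf.
have [p0 _ fmin] := compact_EVT_min (ex_intro _ (1%g : G) I) compactG (continuous_subspaceT cf).
have {}fmin x : f p0 <= f x by apply: fmin; rewrite inE.
have [p1 _ fmax] := compact_EVT_max (ex_intro _ (1%g : G) I) compactG (continuous_subspaceT cf).
have {}fmax x : f x <= f p1 by apply: fmax; rewrite inE.
pose S := [set b : R | exists2 s, s != [::] & forall x, ravg s f x <= b].
have Savg s x b : s != [::] -> (forall x, b <= f x) -> b <= ravg s f x.
  move=> s0 bf; rewrite /ravg ler_pdivlMl ?ltr0n ?lt0n ?size_eq0// mulr_natl.
  rewrite (_ : b *+ _ = \sum_(a <- s) b); first exact: ler_sum.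
  by rewrite big_const_seq count_predT iter_addr addr0.
have S0 : S !=set0.
  by exists (f p1), [:: 1%g] => // x; rewrite /ravg /= invr1 mul1r big_seq1 mulg1.
have Slb : has_inf S.
  split=> //; exists (f p0) => b [s s0 sb]; apply: le_trans (sb 1%g); exact: Savg.
exists (inf S) => e e0; have e20 : 0 < e / 2 by rewrite divr_gt0.
have [t ht] := uniform_translates cf e20.
have t0 : t != [::] by case: t ht => // /(_ 1%g 1%g)[].
pose N : R := (size t)%:R; have N0 : 0 < N by rewrite ltr0n lt0n size_eq0.
(* [2 * N * d = e / 2] will bound the deficit of one of the [N] translates; the other half of [e] is
   spent on comparing translates. *)
pose d := e / (4 * N); have d0 : 0 < d by rewrite divr_gt0// mulr_gt0.
have [b [s s0 sb] bd] := inf_adherent d0 Slb.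
exists s => // y; set M := inf S in bd *.
have sM x : ravg s f x < M + d by exact: le_lt_trans (sb x) bd.
have [x xM] : exists x, M - d < ravg t (ravg s f) x.
  apply: contrapT => /forallNP h.
  have : M <= M - d.
    apply: ge_inf; first by case: Slb.
    exists [seq (a * b)%g | a <- t, b <- s].
      by rewrite -size_eq0 size_allpairs muln_eq0 !size_eq0 negb_or t0.
    by move=> x; rewrite -ravg_comp leNgt; apply/negP/h.
  by rewrite lerBrDr gerDl leNgt d0.
have [a at_ ha] := ht x y.
have close : `|ravg s f (x * a)%g - ravg s f y| <= e / 2.
  rewrite /ravg -mulrBr -sumrB; have := @avg_near s (fun b => f (x * a * b)%g - f (y * b)%g) 0 (e / 2) s0.
  by rewrite subr0; apply => c _; rewrite subr0.
(* The [N] gaps below [M + d] are nonnegative and sum to less than [2 * N * d], so each is less than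
   that. *)
have low : M + d - 2 * N * d < ravg s f (x * a)%g.
  move: xM; rewrite {1}/ravg -/N ltr_pdivlMl// => xM.
  have : \sum_(c <- t) (M + d - ravg s f (x * c)%g) < 2 * N * d.
    rewrite sumrB big_const_seq count_predT iter_addr addr0 -mulr_natl -/N.
    by move: xM; set q := \sum_(_ <- _) _; lra.
  rewrite (big_rem a)//= => h.
  have : 0 <= \sum_(c <- rem a t) (M + d - ravg s f (x * c)%g).
    by apply: sumr_ge0 => c _; rewrite subr_ge0 ltW.
  by move: h; set q := \sum_(_ <- _) _; lra.
have dE : 2 * N * d = e / 2 by rewrite /d; field; rewrite gt_eqF.
have dl : d <= e / 4.
  rewrite /d; have : (1 : R) <= N by rewrite ler1n lt0n size_eq0.
  by move=> N1; rewrite ler_pdivrMr ?mulr_gt0//; nra.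
have := sM y; have := sM (x * a)%g; move: close low; rewrite dE !ler_norml.
by move=> /andP[h1 h2] h3 h4 h5; apply/andP; split; lra.
Qed.

Lemma haar_limit_left f : continuous f -> exists c, forall e : R, 0 < e ->
  exists2 s, s != [::] & forall x, `|lavg s f x - c| <= e.
Proof.
move=> cf; have cfi : continuous (fun x => f (x^-1)%g).
  by move=> x; apply: (@continuous_comp _ _ _ (fun x : G => (x^-1)%g) f); [exact: cinvg|exact: cf].
have [c hc] := haar_limit_exists cfi; exists c => e /hc[s s0 sc].
exists [seq (a^-1)%g | a <- s]; first by rewrite -size_eq0 size_map size_eq0.
move=> x; suff -> : lavg [seq (a^-1)%g | a <- s] f x = ravg s (fun x => f (x^-1)%g) (x^-1)%g.
  exact: sc.
rewrite /lavg /ravg size_map big_map; congr (_ * _); apply: eq_bigr => a _ /=.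
by rewrite invgM invgK.
Qed.

(** Right and left averages commute, so averaging on both sides brings any right limit within [e] of
    a left limit, which exists by inversion: all right limits are equal to it. *)
Lemma haar_limit_unique f c c' : continuous f ->
  haar_limit f c -> haar_limit f c' -> c = c'.
Proof.
move=> cf; have [d hd] := haar_limit_left cf.
suff {c c'}H c : haar_limit f c -> c = d by move=> /H -> /H ->.
move=> hc; apply/eqP; rewrite -subr_eq0 -normr_le0; apply/ler_addgt0Pr => e e0.
rewrite add0r; have e20 : 0 < e / 2 by rewrite divr_gt0.
have [s s0 sc] := hc _ e20; have [t t0 td] := hd _ e20.
have h1 : `|lavg t (ravg s f) 1%g - c| <= e / 2 by apply: avg_near => // a _; exact: sc.
have h2 : `|ravg s (lavg t f) 1%g - d| <= e / 2 by apply: avg_near => // a _; exact: td.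
rewrite lravg_comm in h1; rewrite -(subrKA (ravg s (lavg t f) 1%g)) [leRHS](splitr e).
by apply: le_trans (ler_normD _ _) _; rewrite lerD// distrC.
Qed.

(** The default [0] is taken only when no limit exists, which does not occur for continuous [f]. *)
Definition haar f : R := xget 0 (haar_limit f).

Lemma haarP f : continuous f -> haar_limit f (haar f).
Proof. by move=> /haar_limit_exists[c hc]; exact: (xgetI 0 hc). Qed.

Lemma haar_eq f c : continuous f -> haar_limit f c -> haar f = c.
Proof. by move=> cf; apply: haar_limit_unique => //; exact: haarP. Qed.

(** Average first for [f], then for the averaged [g]: the second average does not spoil the first,
    since averaging preserves nearness to a constant. *)
Lemma haarD f g : continuous f -> continuous g ->
  haar (fun x => f x + g x) = haar f + haar g.
Proof.
move=> cf cg; apply: haar_eq; first by move=> x; exact: (continuousD (cf x) (cg x)).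
move=> e e0; have e20 : 0 < e / 2 by rewrite divr_gt0.
have [s s0 sc] := haarP cf e20.
have ca := @ravg_cont s g cg.
have E : haar (ravg s g) = haar g.
  by apply/esym/haar_eq => //; apply: haar_limit_ravg s0 _; exact: haarP.
have [t t0 td] := haarP ca e20.
exists [seq (a * b)%g | a <- t, b <- s].
  by rewrite -size_eq0 size_allpairs muln_eq0 !size_eq0 negb_or t0.
move=> x; rewrite -ravg_comp.
have -> : ravg t (ravg s (fun x => f x + g x)) x = ravg t (ravg s f) x + ravg t (ravg s g) x.
  rewrite -[in RHS]mulrDr -big_split/=; congr (_ * _); apply: eq_bigr => a _.
  by rewrite -mulrDr -big_split.
rewrite opprD addrACA [leRHS](splitr e); apply: le_trans (ler_normD _ _) _.
by rewrite lerD// -?E//; apply: avg_near => // a _; exact: sc.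
Qed.

Lemma haarZ (c : R) f : continuous f -> haar (fun x => c * f x) = c * haar f.
Proof.
move=> cf; apply: haar_eq; first by move=> x; exact: (continuousM (cvg_cst c) (cf x)).
move=> e e0; have [->|c0] := eqVneq c 0.
  exists [:: 1%g] => // x; rewrite /ravg big_seq1 !mul0r mulr0 subr0 normr0; exact: ltW.
have ec : 0 < e / `|c| by rewrite divr_gt0 ?normr_gt0.
have [s s0 sc] := haarP cf ec; exists s => // x.
rewrite /ravg -mulr_sumr mulrCA -mulrBr normrM -ler_pdivlMl ?normr_gt0// [leRHS]mulrC.
exact: sc.
Qed.

Lemma continuous_scale (c : R) f : continuous f -> continuous (fun x => c * f x).
Proof. by move=> cf x; exact: (continuousM (cvg_cst c) (cf x)). Qed.

Lemma haar_ge f (b : R) : continuous f -> (forall x, b <= f x) -> b <= haar f.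
Proof.
move=> cf bf; apply/ler_addgt0Pr => e e0.
have [s s0 /(_ 1%g)] := haarP cf e0; rewrite ler_norml => /andP[_ h].
have : b <= ravg s f 1%g.
  rewrite /ravg ler_pdivlMl ?ltr0n ?lt0n ?size_eq0// mulr_natl.
  rewrite (_ : b *+ _ = \sum_(a <- s) b); first exact: ler_sum.
  by rewrite big_const_seq count_predT iter_addr addr0.
by move=> h'; lra.
Qed.

Lemma haar_le f (b : R) : continuous f -> (forall x, f x <= b) -> haar f <= b.
Proof.
move=> cf bf; have cNf := @continuous_scale (-1) f cf.
have := @haar_ge _ (- b) cNf; rewrite haarZ// mulN1r lerN2; apply => x.
by rewrite mulN1r lerN2.
Qed.

Lemma haar_shift f (h : G) : continuous f -> haar (fun x => f (x * h)%g) = haar f.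
Proof.
move=> cf; have cfh : continuous (fun x => f (x * h)%g).
  move=> x; apply: (@continuous_comp _ _ _ (fun x => (x * h)%g) f); last exact: cf.
  by apply: (@continuous_mulg _ id (cst h)); [exact: cvg_id|exact: cvg_cst].
apply/esym/haar_eq => // e /(haarP cfh)[s s0 sc].
exists [seq (a * h)%g | a <- s]; first by rewrite -size_eq0 size_map size_eq0.
move=> x; suff -> : ravg [seq (a * h)%g | a <- s] f x = ravg s (fun x => f (x * h)%g) x.
  exact: sc.
by rewrite /ravg size_map big_map; congr (_ * _); apply: eq_bigr => a _; rewrite mulgA.
Qed.

Lemma haar_cst (c : R) : haar (fun=> c) = c.
Proof.
have cc : continuous (fun _ : G => c) by exact: cst_continuous.
by apply/eqP; rewrite eq_le haar_le//= haar_ge.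
Qed.

Lemma haar_dist f g (e : R) : continuous f -> continuous g ->
  (forall x, `|f x - g x| <= e) -> `|haar f - haar g| <= e.
Proof.
move=> cf cg fg.
have cNg := @continuous_scale (-1) g cg.
have cD : continuous (fun x => f x + -1 * g x) by move=> x; exact: (continuousD (cf x) (cNg x)).
have h x : - e <= f x + -1 * g x <= e by rewrite mulN1r -ler_norml.
rewrite -[- haar g]mulN1r -haarZ// -haarD// ler_norml; apply/andP; split.
  by apply: haar_ge => // x; have /andP[] := h x.
by apply: haar_le => // x; have /andP[] := h x.
Qed.

Lemma haar_sum (I : Type) (s : seq I) (F : I -> G -> R) :
  (forall i, continuous (F i)) ->
  haar (fun x => \sum_(i <- s) F i x) = \sum_(i <- s) haar (F i).
Proof.
move=> cF; elim: s => [|i s IH].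
  by rewrite big_nil; under eq_fun do rewrite big_nil; exact: haar_cst.
rewrite big_cons -IH -haarD//; last by move=> x; apply: continuous_sum_seq => j; exact: cF.
by congr (haar _); apply/funext => x; rewrite big_cons.
Qed.

End Averages.

(** * Implicit functions *)

HB.instance Definition _ (R : realType) (m n : nat) :=
  Uniform_isComplete.Build 'M[R]_(m, n) cauchy_cvg.

Section LipschitzBound.
Context {R : realType} {T : topologicalType} {m : nat}.
Implicit Types (f : T * 'rV[R]_m -> R) (A : set (T * 'rV[R]_m)).

Lemma Ck1_lipschitz f A t (x v : 'rV[R]_m) (c : R) : open A -> Ck 1 f A ->
  (forall s, 0 <= s <= 1 -> A (t, x + s *: v)) ->
  (forall s i, 0 <= s <= 1 -> `|pd i f (t, x + s *: v)| <= c) ->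
  `|f (t, x + v) - f (t, x)| <= m%:R * c * `|v|.
Proof.
move=> oA cf sA sc.
have d s : 0 <= s <= 1 -> is_derive (x + s *: v) v (fibre f t)
    (lin_of (fun i => pd i f (t, x + s *: v)) v).
  by move=> sI; exact: (Ck1_derive v oA cf (sA s sI)).
have [s sI] := MVT_line_is_derive d; rewrite /fibre => ->.
by apply: lin_of_le => i; exact: sc.
Qed.

Lemma segment_ball (V : normedModType R) (c x y : V) (r s : R) :
  `|x - c| < r -> `|y - c| < r -> 0 <= s <= 1 -> `|x + s *: (y - x) - c| < r.
Proof.
move=> xr yr /andP[s0 s1].
have -> : x + s *: (y - x) - c = (1 - s) *: (x - c) + s *: (y - c).
  rewrite [LHS]addrAC scalerBl scale1r -[RHS]addrA [in RHS](addrC (- _)) -scalerBr opprB.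
  by rewrite [in RHS]addrA subrK.
apply: le_lt_trans (ler_normD _ _) _; rewrite !normrZ.
rewrite (ger0_norm s0) ger0_norm ?subr_ge0//.
have [->|sn0] := eqVneq s 0; first by rewrite mul0r addr0 subr0 mul1r.
have sp : 0 < s by rewrite lt_def sn0.
have -> : r = (1 - s) * r + s * r by ring.
by apply: ler_ltD; [rewrite ler_wpM2l ?subr_ge0// ltW|rewrite ltr_pM2l].
Qed.

End LipschitzBound.

Section ImplicitFunction.
Context {R : realType} {Q : topologicalType} {n : nat}.
Variables (H : Q * 'rV[R]_n -> 'rV[R]_n) (B : set (Q * 'rV[R]_n)).
Hypotheses (oB : open B) (cH : forall j, Ck 1 (fun z => H z 0 j) B).

Definition vjacobian (z : Q * 'rV[R]_n) : 'M[R]_n :=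
  \matrix_(i, j) pd i (fun z => H z 0 j) z.

(** Banach's theorem for [g], a Newton map with the Jacobian frozen at the base point, whose fixed
    points are the zeros of [H]. As [Q] is only a topological space, smallness in [q] comes from
    continuity, and the solution is obtained continuous at every point of [O]. *)
Lemma implicit_function q0 y0 : B (q0, y0) -> H (q0, y0) = 0 ->
  vjacobian (q0, y0) \in unitmx ->
  exists r : R, exists O : set Q, exists ysol : Q -> 'rV[R]_n,
  [/\ 0 < r, open O, O q0 & forall q, O q ->
    [/\ `|ysol q - y0| < r, H (q, ysol q) = 0,
      (forall y, `|y - y0| < r -> B (q, y)),
      (forall y, `|y - y0| < r -> H (q, y) = 0 -> y = ysol q) &
      {for q, continuous ysol}]].
Proof.
move=> B0 H0 uJ; set J := vjacobian (q0, y0) in uJ.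
pose K := invmx J; pose g z := z.2 - H z *m K.
have cg j : Ck 1 (fun z => g z 0 j) B.
  have CC : Ck 1 (fun z : Q * 'rV[R]_n => z.2 0 j - \sum_l H z 0 l * K l j) B.
    apply: CkB => //; first exact: Ck_coord.
    by apply: Ck_sum => // l _; apply: CkM => //; exact: Ck_cst.
  by apply: Ck_ext CC => // z _; rewrite !mxE.
have g0 i j : pd i (fun z => g z 0 j) (q0, y0) = 0.
  have dH l : is_derive y0 'e_i (K l j *: (fibre (fun z => H z 0 l) q0)) (K l j *: J i l).
    apply: is_deriveZ; rewrite mxE pdE; split=> //.
    by have [_ /(_ i)[d _]] := cH l; exact: (d (q0, y0)).
  have dc : is_derive y0 'e_i (fun y : 'rV[R]_n => y 0 j) (('e_i : 'rV[R]_n) 0 j).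
    have d := @derivable_id _ _ y0 ('e_i : 'rV[R]_n).
    split; first by move/derivable_mxP : d.
    have E : 'D_('e_i) (@id 'rV[R]_n) y0 0 j = 'D_('e_i) (fun x : 'rV[R]_n => x 0 j) y0.
      by rewrite (derive_mx d) mxE.
    by rewrite -E derive_id.
  have [_ E] := is_deriveB dc (is_derive_sum dH).
  rewrite pdE (_ : fibre _ _ = (fun y : 'rV[R]_n => y 0 j) - \sum_(l < n) K l j *: fibre (fun z => H z 0 l) q0).
    rewrite [LHS]E (_ : \sum_l K l j *: J i l = (J *m K) i j).
      by rewrite mulmxV// !mxE eqxx/= eq_sym subrr.
    by rewrite mxE; apply: eq_bigr => l _; rewrite -[_ *: _]/(_ * _) mulrC.
  apply/funext => y; rewrite /fibre /g /= !mxE fctE fct_sumE /=; congr (_ - _).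
  by apply: eq_bigr => l _; rewrite -[RHS]/(_ * _) mulrC.
(* A bound [c] on all partial derivatives gives the Lipschitz constant [n * c], which is at most
   1/2. *)
pose c : R := (2 * n.+1%:R)^-1.
have c0 : 0 < c by rewrite invr_gt0 mulr_gt0.
have nearall : \forall z \near (q0, y0), B z /\
    forall ij : 'I_n * 'I_n, `|pd ij.1 (fun z => g z 0 ij.2) z| <= c.
  apply: filterI; first exact: (open_nbhs_nbhs (conj oB B0)).
  have h (ij : 'I_n * 'I_n) : \forall z \near (q0, y0),
      `|pd ij.1 (fun z => g z 0 ij.2) z| <= c.
    case: ij => i j /=; have [_ /(_ i)[_ [ci _]]] := cg j.
    have /cvgrPdist_le/(_ _ c0) := ci _ B0; rewrite g0.
    by apply: filterS => z; rewrite sub0r normrN.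
  exact: filter_forall h.
case: nearall => -[P1 P2] [/= /nbhs_interior P1q /near_ballP[r1 r10 r1P]] PP.
pose r := r1 / 2; have r0 : 0 < r by rewrite divr_gt0.
have rr1 : r < r1 by rewrite /r; lra.
pose O1 := P1^°.
have inB q y : O1 q -> `|y - y0| < r1 -> B (q, y) /\
    forall ij : 'I_n * 'I_n, `|pd ij.1 (fun z => g z 0 ij.2) (q, y)| <= c.
  by move=> /interior_subset hq yr; apply: PP; split=> //=; exact: r1P.
have contr q y y' : O1 q -> `|y - y0| < r1 -> `|y' - y0| < r1 ->
    `|g (q, y') - g (q, y)| <= `|y' - y| / 2.
  move=> hq yr yr'; apply: normr_leP; first by rewrite divr_ge0.
  move=> j; rewrite !mxE.
  have := @Ck1_lipschitz _ _ _ (fun z => g z 0 j) B q y (y' - y) c oB (cg j) _ _.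
  rewrite [y + _]addrC subrK => h; rewrite [X in `|X|](_ : _ = g (q, y') 0 j - g (q, y) 0 j); last by rewrite !mxE.
  apply: le_trans (h _ _) _.
  - by move=> s sI; have [] := inB q _ hq (segment_ball yr yr' sI).
  - by move=> s i sI; have [_ /(_ (i, j))] := inB q _ hq (segment_ball yr yr' sI).
  rewrite mulrC ler_wpM2l// /c invfM mulrCA ler_piMr ?invr_ge0//.
  by rewrite ler_pdivrMr// mul1r ler_nat.
have fixE q y : (g (q, y) = y) <-> H (q, y) = 0.
  rewrite /g /=; split=> [gy|->]; last by rewrite mul0mx subr0.
  have E : H (q, y) *m K = 0 by rewrite -[LHS](subKr y) gy subrr.
  by rewrite -[LHS]mulmx1 -(mulVmx uJ) mulmxA -/K E mul0mx.
have gcont y : B (q0, y) -> {for q0, continuous (fun q => g (q, y))}.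
  move=> By; apply: (@continuous_comp _ _ _ (fun q => (q, y)) g).
    by apply: continuous_pair; [exact: cvg_id|exact: cvg_cst].
  by apply/continuous_coord => j; exact: Ck_cont (cg j) By.
have near0 : \forall q \near q0, O1 q /\ `|g (q, y0) - y0| < r / 2.
  apply: filterI; first exact: P1q.
  have /cvgrPdistC_lt/(_ (r / 2)) := gcont y0 B0.
  by rewrite (iffRL (fixE _ _) H0); apply; rewrite divr_gt0.
(* The centre moves by less than [r / 2] and distances are halved, so the closed ball of radius [r]
   is mapped into itself. *)
pose O := [set q | O1 q /\ `|g (q, y0) - y0| < r / 2]^°.
have OP q : O q -> O1 q /\ `|g (q, y0) - y0| < r / 2 by move=> /interior_subset.
have sol q : O q -> exists2 y, `|y - y0| < r & H (q, y) = 0.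
  move=> /OP[hq gq].
  pose U : set 'rV[R]_n := closed_ball y0 r.
  have UE y : U y <-> `|y - y0| <= r.
    by rewrite /U closed_ballE// /closed_ball_ /= distrC.
  have Ur1 y : U y -> `|y - y0| < r1 by move=> /UE /le_lt_trans; apply.
  have y0U : U y0 by apply/UE; rewrite subrr normr0 ltW.
  have gU y : U y -> U (g (q, y)).
    move=> Uy; apply/UE; rewrite -(subrKA (g (q, y0))).
    apply: le_trans (ler_normD _ _) _.
    have h := contr q y0 y hq (Ur1 _ y0U) (Ur1 _ Uy).
    by move/UE : Uy => Uy; apply: le_trans (lerD h (ltW gq)) _; lra.
  pose gq' := fun y => g (q, y).
  have gfun : set_fun U U gq' by move=> y; exact: gU.
  pose G : {fun U >-> U} := mkfun gfun.
  have Gc : is_contraction G.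
    have h20 : (0 : R) <= 2^-1 by rewrite invr_ge0.
    exists (NngNum h20); split => /=; first by rewrite invf_lt1 ?ltr1n.
    move=> -[y y'] [/= Uy Uy']; rewrite mulrC.
    exact: contr (Ur1 _ Uy') (Ur1 _ Uy).
  have cU : closed U by exact: closed_ball_closed.
  have [y Uy yE] := banach_fixed_point Gc cU (ex_intro _ y0 y0U).
  have {}yE : g (q, y) = y by rewrite [in RHS]yE.
  exists y; last exact/fixE.
  have h := contr q y0 y hq (Ur1 _ y0U) (Ur1 _ Uy).
  rewrite yE in h; move/UE : Uy => Uy.
  rewrite -(subrKA (g (q, y0))); apply: le_lt_trans (ler_normD _ _) _.
  by move: h gq Uy; lra.
pose ysol q := xget y0 [set y | `|y - y0| < r /\ H (q, y) = 0].
have ysolP q : O q -> `|ysol q - y0| < r /\ H (q, ysol q) = 0.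
  move=> /sol[y yr Hy]; have h : [set y | `|y - y0| < r /\ H (q, y) = 0] y by [].
  exact: (xgetPex y0 (ex_intro _ y h)).
have uniq q y y' : O q -> `|y - y0| < r -> `|y' - y0| < r -> H (q, y) = 0 ->
    H (q, y') = 0 -> y = y'.
  move=> /OP[hq _] yr yr' /fixE Hy /fixE Hy'; apply/eqP; rewrite -subr_eq0 -normr_le0.
  have := contr q y' y hq (lt_trans yr' rr1) (lt_trans yr rr1).
  by rewrite Hy Hy'; have := normr_ge0 (y - y'); lra.
exists r, O, ysol; split=> //.
  exact: open_interior.
move=> q hq; have [yr Hy] := ysolP q hq; have [hq1 _] := OP q hq; split=> //.
- by move=> y yr'; have [] := inB q y hq1 (lt_trans yr' rr1).
- by move=> y yr' Hy'; apply: (uniq q).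
apply/cvgrPdist_le => e e0.
have gcq : {for q, continuous (fun q' => g (q', ysol q))}.
  apply: (@continuous_comp _ _ _ (fun q' => (q', ysol q)) g).
    by apply: continuous_pair; [exact: cvg_id|exact: cvg_cst].
  apply/continuous_coord => j; apply: Ck_cont (cg j) _.
  by have [] := inB q (ysol q) hq1 (lt_trans yr rr1).
have e20 : 0 < e / 2 by rewrite divr_gt0.
have n1 : \forall q' \near q, `|g (q, ysol q) - g (q', ysol q)| <= e / 2.
  by have /cvgrPdist_le/(_ _ e20) := gcq.
have n2 : \forall q' \near q, O q'.
  exact: (open_nbhs_nbhs (conj (open_interior _) hq)).
apply: filterS2 n1 n2 => q' h hq'; have [yr' Hy'] := ysolP q' hq'; have [hq1' _] := OP q' hq'.
have := contr q' (ysol q') (ysol q) hq1' (lt_trans yr' rr1) (lt_trans yr rr1).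
move: h; rewrite (iffRL (fixE _ _) Hy) (iffRL (fixE _ _) Hy') => h h'.
have := ler_normD (ysol q - g (q', ysol q)) (g (q', ysol q) - ysol q').
rewrite subrKA => h3; move: h h' h3.
set a := `|_|; set b := `|_|; set d := `|_|; lra.
Qed.

End ImplicitFunction.

Section ImplicitRegularity.
Context {R : realType} {T : topologicalType} {m n : nat}.

Lemma diff_estimate (V W : normedModType R) (g : V -> W) (x : V) (e : R) :
  differentiable g x -> 0 < e ->
  \forall v \near 0, `|g (v + x) - g x - 'd g x v| <= e * `|v|.
Proof.
move=> dg e0; have /diff_locallyP[_ /eqaddoP/(_ _ e0)] := dg.
by apply: filterS => v; rewrite !fctE opprD addrA.
Qed.

Variables (H : T * 'rV[R]_(m + n) -> 'rV[R]_n) (y : T * 'rV[R]_m -> 'rV[R]_n).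
Variables (A : set (T * 'rV[R]_m)) (B : set (T * 'rV[R]_(m + n))).
Hypotheses (oA : open A) (oB : open B).
Let w (z : T * 'rV[R]_m) := (z.1, row_mx z.2 (y z)).
Let J (z : T * 'rV[R]_(m + n)) : 'M[R]_n :=
  \matrix_(i, j) pd (rshift m i) (fun z => H z 0 j) z.
Hypotheses (AB : forall z, A z -> B (w z)) (H0 : forall z, A z -> H (w z) = 0)
  (uJ : forall z, A z -> J (w z) \in unitmx)
  (cy : forall z, A z -> {for z, continuous y}).

(** [y] is only known to be continuous. Linearizing [H (w z) = 0] shows that [D s + s *: (p *m K)]
    is small with respect to [|s| + |D s|]; a first use of this ([key] with 1/2) bounds [D s] by a
    multiple of [|s|], a second one identifies the derivative. *)
Lemma implicit_derive z i : (forall j, Ck 1 (fun z => H z 0 j) B) -> A z ->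
  is_derive z.2 'e_i (fun x => y (z.1, x))
    (- (\row_j pd (lshift n i) (fun z => H z 0 j) (w z)) *m invmx (J (w z))).
Proof.
move=> cH Az; set p := \row_j _; set K := invmx _.
have sz : (z.1, z.2) = z by rewrite -surjective_pairing.
pose h x := H (z.1, x).
have dh : differentiable h ((w z).2).
  by apply/differentiable_rowP => j; have [] := Ck1_diff oB (cH j) (AB Az).
have dhE (s : R) (D : 'rV[R]_n) :
    'd h ((w z).2) (row_mx (s *: 'e_i) D) = s *: p + D *m J (w z).
  apply/rowP => j.
  have -> : 'd h ((w z).2) (row_mx (s *: 'e_i) D) 0 j =
      lin_of (fun l => pd l (fun z => H z 0 j) (w z)) (row_mx (s *: 'e_i) D).
    have [dj <-] := Ck1_diff oB (cH j) (AB Az).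
    by rewrite -!deriveE// derive_mx ?mxE//; exact: diff_derivable.
  rewrite /lin_of big_split_ord /= !mxE; congr (_ + _).
    rewrite (bigD1 i)//= row_mxEl !mxE !eqxx mulr1 big1 ?addr0// => l li.
    by rewrite row_mxEl !mxE (negbTE li) andbF mulr0 mul0r.
  by apply: eq_bigr => l _; rewrite row_mxEr !mxE.
have [c [c0 cK]] : exists c : R, 0 < c /\ forall u : 'rV[R]_n, `|u *m K| <= c * `|u|.
  pose q : R := \sum_l \sum_j `|K l j|.
  have q0 : 0 <= q by apply: sumr_ge0 => l _; exact: sumr_ge0.
  exists (n%:R * q + 1); split; first by rewrite ltr_wpDl// mulr_ge0.
  move=> u; apply: normr_leP; first by rewrite mulr_ge0// addr_ge0// mulr_ge0.
  move=> j; rewrite mxE -[\sum_l _]/(lin_of (fun l => K l j) u).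
  apply: le_trans (lin_of_le u (e := q) _) _; last by rewrite ler_wpM2r// lerDl.
  move=> l; rewrite /q (bigD1 l)//= (bigD1 j)//= -addrA lerDl addr_ge0//.
    exact: sumr_ge0.
  by apply: sumr_ge0 => ? _; exact: sumr_ge0.
pose P : R := `|p *m K|; have P0 : 0 <= P by rewrite normr_ge0.
pose D s := y (z.1, s *: 'e_i + z.2) - y z.
have c2 : {for (0 : R), continuous (fun s : R => s *: 'e_i + z.2)}.
  apply: continuousD; last exact: cvg_cst.
  exact: scalel_continuous.
have c3 : {for (0 : R), continuous (fun s : R => (z.1, s *: 'e_i + z.2))}.
  by apply: continuous_pair => //; exact: cvg_cst.
have E0 : (z.1, (0 : R) *: 'e_i + z.2) = z by rewrite scale0r add0r.
have D0 : {for (0 : R), continuous D}.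
  apply: continuousB; last exact: cvg_cst.
  apply: (@continuous_comp _ _ _ (fun s : R => (z.1, s *: 'e_i + z.2)) y) => //.
  by rewrite E0; exact: cy.
have key e : 0 < e -> \forall s \near (0 : R), `|D s + s *: (p *m K)| <= e * (`|s| + `|D s|).
  move=> e0; have ec : 0 < e / c by rewrite divr_gt0.
  have := diff_estimate dh ec.
  move=> /near_ballP[r r0 hr].
  have nA : \forall s \near (0 : R), A (z.1, s *: 'e_i + z.2).
    by apply: c3; rewrite E0; exact: (open_nbhs_nbhs (conj oA Az)).
  have nD : \forall s \near (0 : R), `|D s| < r.
    have /cvgrPdistC_lt/(_ _ r0) := D0; apply: filterS => s.
    by rewrite /D E0 subrr subr0.
  have ns : \forall s \near (0 : R), `|s| < r.
    by apply/near_ballP; exists r => // s; rewrite subr0.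
  near=> s.
  have As : A (z.1, s *: 'e_i + z.2) by near: s.
  have Ds : `|D s| < r by near: s.
  have sr : `|s| < r by near: s.
  pose v := row_mx (s *: 'e_i) (D s) : 'rV[R]_(m + n).
  have vle : `|v| <= `|s| + `|D s|.
    apply: normr_leP; first by rewrite addr_ge0.
    move=> l; rewrite /v; case: (splitP l) => l' ll'.
      have -> : l = lshift n l' by exact/val_inj.
      rewrite row_mxEl !mxE eqxx/= ler_wpDr//.
      by case: eqP => _; rewrite ?mulr1 ?mulr0 ?normr0.
    have -> : l = rshift m l' by exact/val_inj.
    by rewrite row_mxEr ler_wpDl// normr_coord.
  have vr : `|v - 0| < r.
    rewrite subr0; apply: le_lt_trans (_ : `|v| <= Num.max `|s| `|D s|) _; last by rewrite gt_max sr.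
    apply: normr_leP; first by rewrite le_max normr_ge0.
    move=> l; rewrite /v le_max; case: (splitP l) => l' ll'.
      have -> : l = lshift n l' by exact/val_inj.
      rewrite row_mxEl !mxE eqxx/=; apply/orP; left.
      by case: eqP => _; rewrite ?mulr1 ?mulr0 ?normr0.
    have -> : l = rshift m l' by exact/val_inj.
    by rewrite row_mxEr normr_coord orbT.
  have := hr _ vr; rewrite /h.
  have -> : v + (w z).2 = (w (z.1, s *: 'e_i + z.2)).2.
    by rewrite /w /v /= add_row_mx /D subrK.
  rewrite -[z.1]/((z.1, s *: 'e_i + z.2).1) -surjective_pairing (H0 As).
  rewrite -[H (_, (w z).2)]/(H (w z)) (H0 Az) subrr sub0r normrN.
  have -> : 'd h ((w z).2) v = s *: p + D s *m J (w z) by exact: dhE.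
  move=> est; have -> : D s + s *: (p *m K) = (s *: p + D s *m J (w z)) *m K.
    by rewrite mulmxDl -scalemxAl -mulmxA mulmxV ?uJ// mulmx1 addrC.
  apply: le_trans (cK _) _; rewrite -ler_pdivlMl// mulrA [c^-1 * e]mulrC.
  apply: le_trans est _; rewrite ler_wpM2l// ltW//.
have bound : \forall s \near (0 : R), `|D s| <= (2 * P + 1) * `|s|.
  have := key 2^-1 _; rewrite invr_gt0 ltr0n => /(_ isT).
  apply: filterS => s hs.
  have := ler_normD (D s + s *: (p *m K)) (- (s *: (p *m K))).
  rewrite addrK normrN [`|s *: _|]normrZ -/P.
  have := normr_ge0 s; have := normr_ge0 (D s).
  move: hs; set a := `|D s + _|; set b := `|D s|; set d := `|s|.
  by move=> h1 h2 h3 h4; nra.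
have lim : (fun s : R => s^-1 *: ((fun x => y (z.1, x)) (s *: 'e_i + z.2)
    - (fun x => y (z.1, x)) z.2)) @ 0^' --> - p *m K.
  apply/cvgrPdist_le => e e0.
  (* By [bound], [|s| + |D s|] is at most [(2 * P + 2) * |s|]. *)
  pose e1 := e / (2 * P + 2).
  have P2 : 0 < 2 * P + 2 by lra.
  have e10 : 0 < e1 by rewrite divr_gt0.
  near=> s.
  have s0 : s != 0 by near: s; exact: nbhs_dnbhs_neq.
  have h1 : `|D s + s *: (p *m K)| <= e1 * (`|s| + `|D s|).
    by near: s; apply: nbhs_dnbhs; exact: key.
  have h2 : `|D s| <= (2 * P + 1) * `|s| by near: s; exact: nbhs_dnbhs.
  rewrite /= sz -/(D s).
  have -> : - p *m K - s^-1 *: D s = - (s^-1 *: (D s + s *: (p *m K))).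
    by rewrite [in RHS]scalerDr scalerA mulVf// scale1r mulNmx opprD addrC.
  rewrite normrN normrZ normfV ler_pdivrMl ?normr_gt0// [leRHS]mulrC.
  apply: le_trans h1 _.
  have -> : e = e1 * (2 * P + 2) by rewrite /e1 divfK// gt_eqF.
  rewrite -[leRHS]mulrA ler_wpM2l ?(ltW e10)//.
  apply: le_trans (_ : `|s| + (2 * P + 1) * `|s| <= _); first by rewrite lerD2l.
  by have := normr_ge0 s; set d := `|s| => d0; lra.
by split; [apply/cvg_ex; exists (- p *m K)|exact: cvg_lim lim].
Unshelve. all: by end_near. Qed.

(** Bootstrapping: the formula of [implicit_derive] involves [y] itself and first derivatives of
    [H], so when [H] has class [k.+1], class [k] of [y] passes to its partial derivatives. *)
Lemma implicit_Ck k : (forall j, Ck k (fun z => H z 0 j) B) ->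
  forall j, Ck k (fun z => y z 0 j) A.
Proof.
elim: k => [|k IH] cH j.
  by split=> // z Az; move/continuous_coord : (cy Az); exact.
have cy1 l : Ck k (fun z => y z 0 l) A by apply: IH => l'; exact: CkS.
have cH1 l : Ck 1 (fun z => H z 0 l) B by exact: Ck_le (cH l).
have d i z (Az : A z) := implicit_derive i cH1 Az.
split=> [z Az|i]; first by move/continuous_coord : (cy Az); exact.
split=> [z Az|].
  by have [d1 _] := d i z Az; move/derivable_mxP : d1; exact.
have cw l : Ck k (fun z => row_mx z.2 (y z) 0 l) A.
  case: (splitP l) => l' ll'.
    have -> : l = lshift n l' by exact/val_inj.
    by under [X in Ck k X A]funext do rewrite row_mxEl; exact: Ck_coord.
  have -> : l = rshift m l' by exact/val_inj.
  by under [X in Ck k X A]funext do rewrite row_mxEr.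
have cHw l l' : Ck k (fun z => pd l (fun z => H z 0 l') (w z)) A.
  apply: (@Ck_comp R T T (m + n) m k (pd l (fun z => H z 0 l')) B id (fun z => row_mx z.2 (y z)) A) => //.
    by move=> z _; exact: cvg_fst.
  by have [_ /(_ l)[]] := cH l'.
have CC : Ck k (fun z => (- (\row_j pd (lshift n i) (fun z => H z 0 j) (w z)) *m invmx (J (w z))) 0 j) A.
  apply: Ck_mulmx => // [a b|a b].
    have CN := CkN oA (cHw (lshift n i) b).
    by apply: Ck_ext CN => // z _; rewrite !mxE.
  apply: Ck_invmx => //= a' b'.
  by under [X in Ck k X A]funext do rewrite mxE; exact: cHw.
apply: Ck_ext CC => // z; rewrite inE => Az; have [d1 d2] := d i z Az.
by rewrite -d2 pdE derive_mx// mxE.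
Qed.

End ImplicitRegularity.

(** * Differentiation under the Haar mean *)

Section HaarCk.
Context {R : realType} {k : nat} (G : lieGroupType R k).
Hypothesis compactG : compact [set: G].

(** Tube argument: in a neighbourhood from the covering of [G], both values are compared with the
    one at its centre, which makes continuity at the points [(z, g)] uniform in [g]. *)
Lemma compact_uniform (Z : topologicalType) (F : Z * G -> R) (z : Z) (e : R) :
  (forall g, {for (z, g), continuous F}) -> 0 < e ->
  \forall z' \near z, forall g, `|F (z', g) - F (z, g)| <= e.
Proof.
move=> cF e0; have e20 : 0 < e / 2 by rewrite divr_gt0.
suff : \forall z' \near z, [set: G] `<=` (fun g => `|F (z', g) - F (z, g)| <= e).
  by apply: filterS => z' h g; exact: h.
apply: (iffLR (compact_near_coveringP _) compactG) => g _.
have /cvgrPdist_le/(_ _ e20) [[P Q] [/= Pz Qg] PQ] := cF g.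
exists (Q, P) => // -[g' z'] [/= Qg' Pz'].
have h1 := PQ (z', g') (conj Pz' Qg').
have h2 := PQ (z, g') (conj (nbhs_singleton Pz) Qg').
rewrite /= in h1 h2; rewrite -(subrKA (F (z, g))) [leRHS](splitr e).
by apply: le_trans (ler_normD _ _) _; rewrite lerD// distrC.
Qed.

Lemma is_derive_estimate (V W : normedModType R) (f : V -> W) (x v : V) (D : W) :
  (forall e : R, 0 < e -> \forall h \near (0 : R),
    `|f (h *: v + x) - f x - h *: D| <= e * `|h|) ->
  is_derive x v f D.
Proof.
move=> fD.
have lim : (fun h : R => h^-1 *: (f (h *: v + x) - f x)) @ 0^' --> D.
  apply/cvgrPdist_le => e e0; near=> h.
  have h0 : h != 0 by near: h; exact: nbhs_dnbhs_neq.
  have hD : `|f (h *: v + x) - f x - h *: D| <= e * `|h|.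
    by near: h; apply: nbhs_dnbhs; exact: fD.
  rewrite -[D in X in `|X|]scale1r -(mulVf h0) -scalerA -scalerBr normrZ normfV.
  by rewrite ler_pdivrMl ?normr_gt0// [leRHS]mulrC distrC.
by split; [apply/cvg_ex; exists D|exact: cvg_lim lim].
Unshelve. all: by end_near. Qed.

Context {T : topologicalType} {m : nat}.
Implicit Types (f : (T * G) * 'rV[R]_m -> R) (A : set (T * 'rV[R]_m)).

Definition haar_mean f (z : T * 'rV[R]_m) : R := haar (fun g => f ((z.1, g), z.2)).

Definition with_group A : set ((T * G) * 'rV[R]_m) := [set z | A (z.1.1, z.2)].

Lemma open_with_group A : open A -> open (with_group A).
Proof.
move=> oA; apply: (@open_comp _ _ (fun z : (T * G) * 'rV[R]_m => (z.1.1, z.2)) A) => // z _.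
apply: (@continuous_pair _ _ _ (fun z : (T * G) * 'rV[R]_m => z.1.1) snd); last exact: cvg_snd.
by apply: (@continuous_comp _ _ _ fst fst); exact: cvg_fst.
Qed.

Lemma continuous_in_group j f A z : Ck j f (with_group A) -> A z ->
  continuous (fun g => f ((z.1, g), z.2)).
Proof.
move=> cf Az g; apply: (@continuous_comp _ _ _ (fun g => ((z.1, g), z.2)) f).
  apply: continuous_pair; last exact: cvg_cst.
  by apply: continuous_pair; [exact: cvg_cst|exact: cvg_id].
by apply: Ck_cont cf _; rewrite /with_group /= -surjective_pairing.
Qed.

Lemma haar_uniform j f A z (e : R) : Ck j f (with_group A) -> A z -> 0 < e ->
  \forall z' \near z, forall g, `|f ((z'.1, g), z'.2) - f ((z.1, g), z.2)| <= e.
Proof.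
move=> cf Az e0.
apply: (@compact_uniform _ (fun p => f ((p.1.1, p.2), p.1.2))) => // g.
apply: (@continuous_comp _ _ _ (fun p : (T * 'rV[R]_m) * G => ((p.1.1, p.2), p.1.2)) f).
  apply: (@continuous_pair _ _ _ (fun p : (T * 'rV[R]_m) * G => (p.1.1, p.2)) (fun p => p.1.2)).
    apply: (@continuous_pair _ _ _ (fun p : (T * 'rV[R]_m) * G => p.1.1) snd).
      by apply: (@continuous_comp _ _ _ fst fst); exact: cvg_fst.
    exact: cvg_snd.
  by apply: (@continuous_comp _ _ _ fst snd); [exact: cvg_fst|exact: cvg_snd].
by apply: Ck_cont cf _; rewrite /with_group /= -surjective_pairing.
Qed.

Lemma haar_mean_cont j f A z : open A -> Ck j f (with_group A) -> A z ->
  {for z, continuous (haar_mean f)}.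
Proof.
move=> oA cf Az; apply/cvgrPdist_le => e e0.
have n1 := haar_uniform cf Az e0.
have n2 : \forall z' \near z, A z' by exact: (open_nbhs_nbhs (conj oA Az)).
apply: filterS2 n1 n2 => z' h Az'; rewrite distrC; apply: haar_dist => //.
- exact: continuous_in_group cf Az'.
- exact: continuous_in_group cf Az.
Qed.

(** For each [g] the mean value theorem replaces the increment of [f] by a derivative on the
    segment, which differs from the one at [z] by at most [e], uniformly in [g]. *)
Lemma haar_mean_derive f A z i : open A -> Ck 1 f (with_group A) -> A z ->
  is_derive z.2 'e_i (fibre (haar_mean f) z.1) (haar_mean (pd i f) z).
Proof.
move=> oA cf Az; have oA' := open_with_group oA.
have cfi : Ck 0 (pd i f) (with_group A) by have [_ /(_ i)[]] := cf.
apply: is_derive_estimate => e e0.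
have n1 := haar_uniform cfi Az e0.
have n2 : \forall z' \near z, A z' by exact: (open_nbhs_nbhs (conj oA Az)).
have [[P Q] [/= Pz /near_ballP[r r0 rQ]] PQ] : \forall z' \near z, A z' /\
   forall g, `|pd i f ((z'.1, g), z'.2) - pd i f ((z.1, g), z.2)| <= e.
  by apply: filterS2 n1 n2 => z' h Az'; split.
apply/near_ballP; exists r => // h; rewrite subr0 => hr.
have line s : 0 <= s <= 1 -> Q (z.2 + s *: (h *: 'e_i)).
  move=> /andP[s0 s1]; apply: rQ; rewrite [_ - z.2]addrC addrA addNr add0r.
  apply: le_lt_trans hr; rewrite normrZ normrZ (ger0_norm s0).
  have := normr_delta (R := R) i; have := normr_ge0 ('e_i : 'rV[R]_m); have := normr_ge0 h.
  move=> h1 h2 h3; apply: le_trans (_ : 1 * (`|h| * 1) <= _); last by rewrite mul1r mulr1.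
  by apply: ler_pM => //; rewrite ?mulr_ge0 ?ler_wpM2l.
have lineA s : 0 <= s <= 1 -> A (z.1, z.2 + s *: (h *: 'e_i)).
  by move=> sI; have [] := PQ (z.1, z.2 + s *: (h *: 'e_i)) (conj (nbhs_singleton Pz) (line s sI)).
have Ah : A (z.1, h *: 'e_i + z.2).
  by have := lineA 1; rewrite ler01 lexx scale1r addrC; apply.
have c1 := continuous_in_group cf Ah.
have c2 := continuous_in_group cf Az.
have c3 := continuous_in_group cfi Az.
have c4 : continuous (fun g => h * pd i f ((z.1, g), z.2)) by exact: continuous_scale.
have c5 : continuous (fun g => f ((z.1, g), z.2) + h * pd i f ((z.1, g), z.2)).
  by move=> g; exact: (continuousD (c2 g) (c4 g)).
rewrite /fibre /haar_mean /= -addrA -opprD -[h *: haar _]/(h * _) -haarZ// -haarD//.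
apply: (haar_dist compactG c1 c5).
move=> g; have d s : 0 <= s <= 1 -> is_derive (z.2 + s *: (h *: 'e_i)) (h *: 'e_i)
    (fibre f (z.1, g)) (h * pd i f ((z.1, g), z.2 + s *: (h *: 'e_i))).
  move=> sI; apply: (@is_derive_scaled_line _ _ _ f (with_group A) ((z.1, g), z.2)) => //=.
  exact: lineA.
have [s sI E] := MVT_line_is_derive d.
rewrite [h *: 'e_i + z.2]addrC opprD addrA; move: E; rewrite /fibre => ->.
rewrite -mulrBr normrM mulrC ler_wpM2r//.
by have [_] := PQ (z.1, z.2 + s *: (h *: 'e_i)) (conj (nbhs_singleton Pz) (line s sI)); apply.
Qed.

Lemma Ck_haar_mean j f A : open A -> Ck j f (with_group A) -> Ck j (haar_mean f) A.
Proof.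
move=> oA; elim: j f => [|j IH] f cf.
  by split=> // z Az; exact: haar_mean_cont cf Az.
have cf1 : Ck 1 f (with_group A) by exact: Ck_le cf.
split=> [z Az|i]; first exact: haar_mean_cont cf Az.
split=> [z Az|]; first by have [] := haar_mean_derive i oA cf1 Az.
apply: Ck_ext (IH (pd i f) _) => //; last by have [_ /(_ i)[]] := cf.
by move=> z; rewrite inE => Az; have [_ <-] := haar_mean_derive i oA cf1 Az; rewrite pdE.
Qed.

End HaarCk.

(** * Flows of compactly supported fields *)

Section Primitive.
Context {R : realType}.
Implicit Types (f F : R -> R).

Lemma increment_eq0 (F : R -> R) (a b : R) : a <= b ->
  (forall x, a <= x <= b -> is_derive x (1 : R) F 0) -> F b = F a.
Proof.
move=> ab dF.
have h1 x : x \in `]a, b[ -> is_derive x (1 : R) F 0.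
  by rewrite in_itv/= => /andP[h1 h2]; apply: dF; rewrite !ltW.
have h2 : {within `[a, b], continuous F}.
  by apply: derivable_within_continuous => x; rewrite in_itv/= => h; have [] := dF x h.
have [c _ E] := MVT_segment ab h1 h2.
by apply/eqP; rewrite -subr_eq0 E mul0r.
Qed.

(** Integrating from [- S] makes every [x] with [|x| < S] an interior point, where the fundamental
    theorem of calculus applies; the value at [0] is subtracted afterwards. *)
Lemma local_primitive f (S : R) : continuous f -> 0 < S ->
  exists2 F : R -> R, F 0 = 0 & forall x, `|x| < S -> is_derive x (1 : R) F (f x).
Proof.
move=> cf S0.
pose F0 (x : R) : R := (\int[lebesgue_measure]_(t in [set` Interval (BLeft (- S)) (BRight x)]) f t)%R.
exists (fun x => F0 x - F0 0); first exact: subrr.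
move=> x; rewrite ltr_norml => /andP[x1 x2].
have xu : x < S by [].
have int : lebesgue_measure.-integrable [set` Interval (BLeft (- S)) (BRight S)] (EFin \o f).
  apply: continuous_compact_integrable; first exact: segment_compact.
  by apply: continuous_subspaceT; exact: cf.
have ax : (BLeft (- S)%R < BRight x)%E by rewrite /= lte_fin.
have [d dE] := continuous_FTC1 xu int ax (cf x).
have : is_derive x (1 : R) F0 (f x).
  have E : 'D_1 F0 x = f x by rewrite -derive1E; exact: dE.
  exact: (DeriveDef d E).
move=> h; have h2 := is_deriveB h (is_derive_cst (F0 0) x (1 : R)).
by rewrite subr0 in h2.
Qed.

(** The primitives on the intervals [|x| < n.+1] all vanish at [0], so they agree on overlaps and
    glue. *)
Lemma primitive_exists f : continuous f ->
  exists F : R -> R, F 0 = 0 /\ forall x, is_derive x (1 : R) F (f x).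
Proof.
move=> cf.
have ex (n : nat) : exists F, F 0 = 0 /\ forall x, `|x| < n.+1%:R -> is_derive x (1 : R) F (f x).
  by have [F F0 dF] := local_primitive cf (ltr0Sn R n); exists F.
pose P n := sval (cid (ex n)).
have P0 n : P n 0 = 0 by have [] := svalP (cid (ex n)).
have dP n x : `|x| < n.+1%:R -> is_derive x (1 : R) (P n) (f x).
  by have [_] := svalP (cid (ex n)); apply.
have agree n1 n2 x : `|x| < n1.+1%:R -> `|x| < n2.+1%:R -> P n1 x = P n2 x.
  move=> x1 x2; pose D y := P n1 y - P n2 y.
  have dD y : `|y| <= `|x| -> is_derive y (1 : R) D 0.
    move=> yx; rewrite -(subrr (f y)); apply: is_deriveB; apply: dP.
      exact: le_lt_trans yx x1.
    exact: le_lt_trans yx x2.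
  have D0 : D 0 = 0 by rewrite /D !P0 subrr.
  suff : D x = 0 by move/eqP; rewrite subr_eq0 => /eqP.
  have [xp|xn] := leP 0 x.
    rewrite -D0; apply: increment_eq0 => // y /andP[y0 yx]; apply: dD.
    by rewrite !ger0_norm.
  rewrite -D0; apply/esym; apply: increment_eq0; first exact: ltW.
  move=> y /andP[yx y0]; apply: dD; rewrite (ltr0_norm xn).
  by rewrite ler_norml opprK yx/= (le_trans y0)// oppr_ge0 ltW.
pose idx (x : R) := Num.trunc `|x|.
have idxP (x : R) : `|x| < (idx x).+1%:R by rewrite /idx; have /andP[] := trunc_itv (normr_ge0 x).
exists (fun x => P (idx x) x); split; first exact: P0.
move=> x; have xn : \forall y \near x, P (idx x) y = P (idx y) y.
  have : \forall y \near x, `|y| < (idx x).+1%:R.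
    have cn : {for x, continuous (fun y : R => `|y|)} by exact: norm_continuous.
    by have := cn [set t | t < (idx x).+1%:R]; apply; apply: lt_nbhsl.
  by apply: filterS => y yx; exact: agree.
by apply: near_eq_is_derive xn _; exact: dP.
Qed.

Definition primitive f : R -> R :=
  xget (fun=> 0) [set F : R -> R | F 0 = 0 /\ forall x, is_derive x (1 : R) F (f x)].

Lemma primitiveP f : continuous f ->
  primitive f 0 = 0 /\ forall x, is_derive x (1 : R) (primitive f) (f x).
Proof. by move=> /primitive_exists ex; exact: (xgetPex (fun=> 0) ex). Qed.

(** [L * m * expR (2 * L * u)] integrates to [m / 2 * (expR (2 * L * s) - 1)]: in the norm weighted
    by this exponential, an [L]-Lipschitz map followed by an integration gains a factor 1/2 over any
    length of time. Gronwall's bound and the convergence of Picard's iteration both rest on this. *)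
Lemma growth_nonneg (g dg : R -> R) (L m e s : R) : 0 < L -> 0 <= s ->
  (forall u, 0 <= u <= s -> is_derive u (1 : R) g (dg u)) ->
  (forall u, 0 <= u <= s -> `|dg u| <= L * m * expR (2 * L * u) + e) ->
  `|g s - g 0| <= m / 2 * (expR (2 * L * s) - 1) + e * s.
Proof.
move=> L0 s0 dgP dgle.
pose z u := m / 2 * expR (2 * L * u) + e * u.
have dz u : is_derive u (1 : R) z (L * m * expR (2 * L * u) + e).
  have dl : is_derive u (1 : R) (fun u : R => 2 * L * u) (2 * L).
    have := is_deriveZ (2 * L) (is_derive_id u (1 : R)).
    by rewrite -[_ *: 1]/(_ * 1) mulr1.
  have de : is_derive u (1 : R) (fun u : R => expR (2 * L * u)) (expR (2 * L * u) * (2 * L)).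
    exact: (@is_derive1_comp _ expR (fun u => 2 * L * u)).
  have d1 := is_deriveZ (m / 2) de.
  have d2 := is_deriveZ e (is_derive_id u (1 : R)).
  apply: is_derive_eq (is_deriveD d1 d2) _.
  by rewrite -[_ *: 1]/(_ * 1) mulr1 -[_ *: _]/(_ * _); congr (_ + _); field.
(* Taking [b = 1] and [b = -1] turns the one-sided comparison with [z] into a bound of the absolute
   value. *)
have aux (b : R) : `|b| = 1 -> b * (g s - g 0) <= z s - z 0.
  move=> b1; pose q u := z u - b * g u.
  have dq u : 0 <= u <= s -> is_derive u (1 : R) q (L * m * expR (2 * L * u) + e - b * dg u).
    by move=> us; exact: (is_deriveB (dz u) (is_deriveZ b (dgP u us))).
  have h1 u : u \in `]0, s[ -> is_derive u (1 : R) q (L * m * expR (2 * L * u) + e - b * dg u).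
    by rewrite in_itv/= => /andP[h1 h2]; apply: dq; rewrite !ltW.
  have h2 : {within `[0, s], continuous q}.
    by apply: derivable_within_continuous => u; rewrite in_itv/= => us; have [] := dq u us.
  have [c cs E] := MVT_segment s0 h1 h2.
  have : 0 <= q s - q 0.
    rewrite E subr0 mulr_ge0// subr_ge0; move: cs; rewrite in_itv/= => cs.
    by apply: le_trans (dgle c cs); apply: le_trans (ler_norm _) _; rewrite normrM b1 mul1r.
  rewrite /q mulrBr; move: (b * g s) (b * g 0) (z s) (z 0) => c1 c2 c3 c4; lra.
have zE : z s - z 0 = m / 2 * (expR (2 * L * s) - 1) + e * s.
  by rewrite /z !mulr0 expR0; ring.
rewrite -zE ler_norml; apply/andP; split.
  by have := aux (-1); rewrite normrN1 mulN1r => /(_ erefl); lra.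
by have := aux 1; rewrite normr1 mul1r; apply.
Qed.

Lemma growth (g dg : R -> R) (L m e s : R) : 0 < L ->
  (forall u, `|u| <= `|s| -> is_derive u (1 : R) g (dg u)) ->
  (forall u, `|u| <= `|s| -> `|dg u| <= L * m * expR (2 * L * `|u|) + e) ->
  `|g s - g 0| <= m / 2 * (expR (2 * L * `|s|) - 1) + e * `|s|.
Proof.
move=> L0 dgP dgle; have [s0|s0] := leP 0 s.
  rewrite (ger0_norm s0); apply: (@growth_nonneg g dg) => // u /andP[u0 us].
    by apply: dgP; rewrite !ger0_norm.
  by have := dgle u; rewrite (ger0_norm u0) (ger0_norm s0); apply.
rewrite (ltr0_norm s0).
have := @growth_nonneg (fun u => g (- u)) (fun u => - dg (- u)) L m e (- s) L0 _ _ _.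
rewrite opprK oppr0; apply.
- by rewrite oppr_ge0 ltW.
- move=> u /andP[u0 us].
  have d1 : is_derive u (1 : R) (fun u : R => - u) (-1).
    exact: (is_deriveN (is_derive_id u (1 : R))).
  have d2 : is_derive (- u) (1 : R) g (dg (- u)).
    by apply: dgP; rewrite normrN ger0_norm// ltr0_norm.
  apply: is_derive_eq (@is_derive1_comp _ g (fun u => - u) u _ _ d2 d1) _.
  by rewrite mulrN1.
- move=> u /andP[u0 us]; rewrite normrN.
  by have := dgle (- u); rewrite normrN (ger0_norm u0) (ltr0_norm s0); apply.
Qed.

Lemma growth_row (n : nat) (g dg : R -> 'rV[R]_n) (L m e s : R) : 0 < L -> 0 <= m -> 0 <= e ->
  (forall u, `|u| <= `|s| -> is_derive u (1 : R) g (dg u)) ->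
  (forall u, `|u| <= `|s| -> `|dg u| <= L * m * expR (2 * L * `|u|) + e) ->
  `|g s - g 0| <= m / 2 * (expR (2 * L * `|s|) - 1) + e * `|s|.
Proof.
move=> L0 m0 e0 dgP dgle; apply: normr_leP.
  rewrite addr_ge0 ?mulr_ge0 ?invr_ge0// subr_ge0 -expR0 ler_expR.
  by rewrite !mulr_ge0// ltW.
move=> j; rewrite !mxE; apply: (@growth (fun u => g u 0 j) (fun u => dg u 0 j) L m e s) => // u us.
  have [d <-] := dgP u us; split; first by move/derivable_mxP : d.
  by rewrite derive_mx// mxE.
by apply: le_trans (dgle u us); exact: normr_coord.
Qed.

(** [m] is the maximum of the weighted norm on [[- S, S]]. At a point where it is attained,
    [growth_row] bounds it by half of itself plus the data, and [m] is absorbed. *)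
Lemma gronwall (n : nat) (g dg : R -> 'rV[R]_n) (L e S : R) : 0 < L -> 0 <= e -> 0 <= S ->
  (forall u, `|u| <= S -> is_derive u (1 : R) g (dg u)) ->
  (forall u, `|u| <= S -> `|dg u| <= L * `|g u| + e) ->
  forall s, `|s| <= S -> `|g s| <= 2 * expR (2 * L * S) * (`|g 0| + e * S).
Proof.
move=> L0 e0 S0 dgP dgle.
pose q u := expR (- (2 * L * `|u|)) * `|g u|.
have qc : {within `[- S, S], continuous q}.
  apply: continuous_in_subspaceT => u; rewrite inE/= in_itv/= -ler_norml => uS.
  apply: (@continuousM _ _ (fun u : R => expR (- (2 * L * `|u|))) (fun u => `|g u|)).
    apply: (@continuous_comp _ _ _ (fun u : R => - (2 * L * `|u|)) expR); last exact: continuous_expR.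
    apply: (@continuousN _ _ _ (fun u : R => 2 * L * `|u|)).
    by apply: (@continuousM _ _ (cst (2 * L)) (fun u : R => `|u|)); [exact: cvg_cst|exact: norm_continuous].
  apply: (@continuous_comp _ _ _ g (fun x : 'rV[R]_n => `|x|)); last exact: norm_continuous.
  by apply: differentiable_continuous; apply/derivable1_diffP; have [] := dgP u uS.
have SS : - S <= S by lra.
have [c cS cmax] := EVT_max SS qc.
pose m := q c.
have qE u : `|g u| = q u * expR (2 * L * `|u|).
  by rewrite /q mulrAC -expRD addNr expR0 mul1r.
have m0 : 0 <= m by rewrite /m /q mulr_ge0// expR_ge0.
have gm u : `|u| <= S -> `|g u| <= m * expR (2 * L * `|u|).
  by move=> uS; rewrite qE ler_wpM2r ?expR_ge0//; apply: cmax; rewrite in_itv/= -ler_norml.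
have cS' : `|c| <= S by move: cS; rewrite in_itv/= -ler_norml.
have est s : `|s| <= S -> `|g s| <= `|g 0| + (m / 2 * (expR (2 * L * `|s|) - 1) + e * `|s|).
  move=> sS; rewrite -{1}(subrK (g 0) (g s)) addrC.
  apply: le_trans (ler_normD _ _) _; rewrite lerD2l.
  apply: (@growth_row _ g dg) => // u us; first by apply: dgP; exact: le_trans us sS.
  apply: le_trans (dgle u (le_trans us sS)) _; rewrite lerD2r -mulrA ler_wpM2l ?(ltW L0)//.
  by apply: gm; exact: le_trans us sS.
have mle : m <= 2 * (`|g 0| + e * S).
  have h := est c cS'; have E1 : expR (2 * L * `|c|) >= 1.
    by rewrite -expR0 ler_expR !mulr_ge0// ltW.
  have h2 : m * expR (2 * L * `|c|) <= `|g 0| + (m / 2 * (expR (2 * L * `|c|) - 1) + e * `|c|).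
    by rewrite -qE.
  have h3 : e * `|c| <= e * S by rewrite ler_wpM2l.
  have := normr_ge0 (g 0); move: h2 h3 E1.
  set E := expR _; set a := `|g 0|; set b := e * S; set d := e * `|c| => h2 h3 h4 a0.
  nra.
move=> s sS; apply: le_trans (gm s sS) _.
rewrite [leRHS]mulrAC; apply: ler_pM; rewrite ?expR_ge0//.
by rewrite ler_expR ler_wpM2l// mulr_ge0// ltW.
Qed.

End Primitive.

Lemma lipschitz_continuous (R : realType) (V W : normedModType R) (f : V -> W) (L : R) :
  0 < L -> (forall x y, `|f x - f y| <= L * `|x - y|) -> continuous f.
Proof.
move=> L0 fL x; apply/cvgrPdist_le => e e0.
have eL : 0 < e / L by rewrite divr_gt0.
apply/near_ballP; exists (e / L) => // y yx.
apply: le_trans (fL _ _) _; rewrite -ler_pdivlMl// mulrC distrC; exact: ltW.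
Qed.

Lemma continuous_section (X Y : topologicalType) (a : X) (y : Y) :
  {for y, continuous (fun y : Y => (a, y))}.
Proof. by apply: continuous_pair; [exact: cvg_cst|exact: cvg_id]. Qed.

Section RowDerive.
Context {R : realType}.

Lemma is_derive_rowP (V : normedModType R) (n : nat) (g : V -> 'rV[R]_n) (x v : V) (d : 'rV[R]_n) :
  is_derive x v g d <-> forall j, is_derive x v (fun y => g y 0 j) (d 0 j).
Proof.
split=> [[dg <-] j|dg].
  by split; [move/derivable_mxP : dg|rewrite derive_mx// mxE].
have dg' : derivable g x v by apply/derivable_mxP => r j; rewrite ord1; have [] := dg j.
split=> //; rewrite derive_mx//; apply/rowP => j; rewrite mxE.
by have [_ ->] := dg j.
Qed.

Lemma is_derive1_continuous (V : normedModType R) (g : R -> V) (s : R) d :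
  is_derive s (1 : R) g d -> {for s, continuous g}.
Proof. by move=> [dg _]; apply/differentiable_continuous/derivable1_diffP. Qed.

Lemma pow2_small (E e : R) : 0 < e -> exists k : nat, E / 2 ^+ k <= e.
Proof.
move=> e0; have [k kE] : exists k : nat, `|E| / e < k%:R.
  exists (Num.trunc (`|E| / e)).+1.
  by have /andP[] := trunc_itv (divr_ge0 (normr_ge0 E) (ltW e0)).
exists k; rewrite ler_pdivrMr ?exprn_gt0//; apply: le_trans (ler_norm E) _.
move: kE; rewrite ltr_pdivrMr// => /ltW/le_trans; apply; rewrite mulrC ler_wpM2l ?(ltW e0)//.
by rewrite -natrX ler_nat ltnW// ltn_expl.
Qed.

Definition vprim (n : nat) (f : R -> 'rV[R]_n) (s : R) : 'rV[R]_n :=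
  \row_j primitive (fun u => f u 0 j) s.

Lemma vprimP (n : nat) (f : R -> 'rV[R]_n) : continuous f ->
  vprim f 0 = 0 /\ forall s, is_derive s (1 : R) (vprim f) (f s).
Proof.
move=> cf; have cj j : continuous (fun u => f u 0 j).
  by move=> u; move/continuous_coord : (cf u); exact.
split; first by apply/rowP => j; rewrite !mxE; have [] := primitiveP (cj j).
move=> s; apply/is_derive_rowP => j.
rewrite (_ : (fun y => vprim f y 0 j) = primitive (fun u => f u 0 j)).
  by have [_] := primitiveP (cj j); exact.
by apply/funext => u; rewrite mxE.
Qed.

End RowDerive.

(** * Picard iteration for bounded Lipschitz fields *)

Section Picard.
Context {R : realType} {n : nat}.
Variables (Y : 'rV[R]_n -> 'rV[R]_n) (L M : R).
Hypotheses (L0 : 0 < L) (YL : forall x y, `|Y x - Y y| <= L * `|x - y|)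
  (YM : forall x, `|Y x| <= M).

Let M0 : 0 <= M. Proof. exact: le_trans (normr_ge0 _) (YM 0). Qed.

Let cY : continuous Y. Proof. exact: lipschitz_continuous L0 YL. Qed.

Let E (s : R) := expR (2 * L * `|s|).
Let E1 s : 1 <= E s. Proof. by rewrite /E -expR0 ler_expR !mulr_ge0// ltW. Qed.
Let E0 s : 0 <= E s. Proof. exact: expR_ge0. Qed.
(** The first Picard step is at most [M * |s|], and [L * |s| <= E s], so [C * E s] bounds it. *)
Let C := M / L.
Let C0 : 0 <= C. Proof. by rewrite divr_ge0// ltW. Qed.

Fixpoint picard (x : 'rV[R]_n) (k : nat) : R -> 'rV[R]_n :=
  if k is k'.+1 then fun s => x + vprim (Y \o picard x k') s else fun=> x.

Let step_derive x (g : R -> 'rV[R]_n) : continuous g ->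
  (x + vprim (Y \o g) 0 = x) /\
  forall s, is_derive s (1 : R) (fun s => x + vprim (Y \o g) s) (Y (g s)).
Proof.
move=> cg; have cYg : continuous (Y \o g).
  by move=> s; apply: continuous_comp; [exact: cg|exact: cY].
have [v0 dv] := vprimP cYg; rewrite v0 addr0; split=> // s.
by have := is_deriveD (is_derive_cst x s (1 : R)) (dv s); rewrite add0r.
Qed.

Let picard_cont x k : continuous (picard x k).
Proof.
elim: k => [|k IH] s; first exact: cvg_cst.
by have [_ /(_ s)] := step_derive x IH; exact: is_derive1_continuous.
Qed.

Let picard0 x k : picard x k 0 = x.
Proof. by case: k => // k; have [] := step_derive x (@picard_cont x k). Qed.

Let picard_derive x k s : is_derive s (1 : R) (picard x k.+1) (Y (picard x k s)).
Proof. by have [_] := step_derive x (@picard_cont x k); exact. Qed.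

Let picard_step x k s : `|picard x k.+1 s - picard x k s| <= C / 2 ^+ k * E s.
Proof.
elim: k s => [|k IH] s.
  have h := @growth_row R n (picard x 1) (fun=> Y x) L 0 M s L0 (lexx 0) M0.
  rewrite !mul0r add0r picard0 in h; apply: le_trans (h _ _) _.
  - by move=> u _; exact: (picard_derive x 0).
  - by move=> u _; rewrite mulr0 mul0r add0r.
  rewrite expr0 divr1 /C -mulrA ler_wpM2l// ler_pdivlMl//.
  have := expR_ge1Dx (2 * L * `|s|); rewrite -/(E s).
  have : 0 <= L * `|s| by rewrite mulr_ge0// ltW.
  by rewrite -mulrA; move: (L * `|s|) (E s) => a b h1 h2; lra.
have Ck0 : 0 <= C / 2 ^+ k by rewrite divr_ge0// exprn_ge0.
have h := @growth_row R n (fun u => picard x k.+2 u - picard x k.+1 u)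
  (fun u => Y (picard x k.+1 u) - Y (picard x k u)) L (C / 2 ^+ k) 0 s L0 Ck0 (lexx 0).
rewrite !picard0 subrr subr0 in h; apply: le_trans (h _ _) _.
- by move=> u _; exact: (is_deriveB (picard_derive x k.+1 u) (picard_derive x k u)).
- by move=> u _; rewrite addr0 -mulrA; apply: le_trans (YL _ _) _; rewrite ler_wpM2l ?(ltW L0)//; exact: IH.
rewrite mul0r addr0 exprSr invfM [C * (_ * _)]mulrA ler_wpM2l//; last by rewrite gerBl.
by rewrite mulr_ge0.
Qed.

(** Tail of the geometric series of the bounds in [picard_step]. *)
Let D k s := 2 * C / 2 ^+ k * E s.

Let D_step k s : D k s - D k.+1 s = C / 2 ^+ k * E s.
Proof. by rewrite /D exprSr; field; rewrite expf_neq0. Qed.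

Let D0 k s : 0 <= D k s.
Proof. by rewrite /D mulr_ge0// divr_ge0 ?exprn_ge0// mulr_ge0. Qed.

Let picard_dist x k p s : `|picard x (k + p) s - picard x k s| <= D k s - D (k + p) s.
Proof.
elim: p => [|p IH]; first by rewrite addn0 !subrr normr0.
rewrite addnS -(subrKA (picard x (k + p) s)); apply: le_trans (ler_normD _ _) _.
have := picard_step x (k + p) s; rewrite -D_step; move: IH.
by move=> h1 h2; apply: le_trans (lerD h2 h1) _; lra.
Qed.

Let D_small s (e : R) : 0 < e -> exists k, D k s <= e.
Proof.
by move=> e0; have [k h] := pow2_small (2 * C * E s) e0; exists k; rewrite /D mulrAC.
Qed.

Definition picard_limit x s : 'rV[R]_n := lim (picard x k s @[k --> \oo]).

Let picard_close x k s : `|picard x k s - picard_limit x s| <= D k s.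
Proof.
have near_dist k' : \forall q \near \oo, `|picard x k' s - picard x q s| <= D k' s.
  exists k' => // q /= kq; rewrite distrC -(subnKC kq).
  by apply: le_trans (picard_dist x k' (q - k') s) _; rewrite gerBl.
have cv : cvg (picard x k s @[k --> \oo]).
  apply: cauchy_cvg; apply: cauchy_exP => e e0.
  have e20 : 0 < e / 2 by rewrite divr_gt0.
  have [k' hk] := D_small s e20; exists (picard x k' s).
  apply: filterS (near_dist k') => q h; rewrite -ball_normE /=.
  by apply: le_lt_trans (le_trans h hk) _; rewrite ltr_pdivrMr// mulr2n mulrDr mulr1 ltrDl.
apply/ler_addgt0Pr => e e0.
have /cvgrPdist_le/(_ _ e0) h := cv.
have [q [h1 h2]] : exists q, `|picard_limit x s - picard x q s| <= e /\
    `|picard x k s - picard x q s| <= D k s.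
  by have [q] := filter_ex (filterI h (near_dist k)); exists q.
rewrite -(subrKA (picard x q s)); apply: le_trans (ler_normD _ _) _.
by rewrite lerD// distrC.
Qed.

Let limit_cont x : continuous (picard_limit x).
Proof.
move=> s; apply/cvgrPdist_le => e e0; have e30 : 0 < e / 3 by rewrite divr_gt0.
have [k hk] := D_small (`|s| + 1) e30.
have mono u : `|u| <= `|s| + 1 -> D k u <= e / 3.
  move=> us; apply: le_trans hk; rewrite /D ler_wpM2l//.
    by rewrite divr_ge0 ?exprn_ge0// mulr_ge0.
  rewrite /E ler_expR ler_wpM2l ?mulr_ge0 ?(ltW L0)//.
  by rewrite [leRHS]ger0_norm// addr_ge0.
have n1 : \forall u \near s, `|picard x k s - picard x k u| <= e / 3.
  by have /cvgrPdist_le/(_ _ e30) := @picard_cont x k s.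
have n2 : \forall u \near s, `|u| <= `|s| + 1.
  apply/near_ballP; exists 1 => // u us; rewrite -{1}(subrK s u).
  by apply: le_trans (ler_normD _ _) _; rewrite addrC lerD2l ltW.
apply: filterS2 n1 n2 => u h1 h2.
have h3 := le_trans (picard_close x k u) (mono u h2).
have h4 : `|picard x k s - picard_limit x s| <= e / 3.
  by apply: le_trans (picard_close x k s) (mono s _); rewrite lerDl.
rewrite -(subrKA (picard x k s)); apply: le_trans (ler_normD _ _) _.
rewrite -(subrKA (picard x k u) (picard x k s)).
have h5 := ler_normD (picard x k s - picard x k u) (picard x k u - picard_limit x u).
by rewrite distrC; move: h1 h3 h4 h5; lra.
Qed.

Lemma picard_limitP x : picard_limit x 0 = x /\
  forall s, is_derive s (1 : R) (picard_limit x) (Y (picard_limit x s)).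
Proof.
have [h0 hd] := step_derive x (@limit_cont x).
suff E2 : (fun s => x + vprim (Y \o picard_limit x) s) = picard_limit x.
  by move: h0 hd; rewrite E2 => h0 hd; split=> //; rewrite -[LHS]/((picard_limit x) 0) -E2.
apply/funext => s; apply/eqP; rewrite -subr_eq0 -normr_le0.
apply/ler_addgt0Pr => e e0; rewrite add0r; have [k hk] := D_small s e0.
apply: le_trans hk.
have h := @growth_row R n (fun u => picard x k.+1 u - (x + vprim (Y \o picard_limit x) u))
  (fun u => Y (picard x k u) - Y (picard_limit x u)) L (2 * C / 2 ^+ k) 0 s L0 _ (lexx 0).
rewrite picard0 h0 subrr subr0 in h.
have h1 : `|picard x k.+1 s - (x + vprim (Y \o picard_limit x) s)| <= D k.+1 s.
  apply: le_trans (h _ _ _) _.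
  - by rewrite divr_ge0 ?exprn_ge0// mulr_ge0.
  - by move=> u _; exact: (is_deriveB (picard_derive x k u) (hd u)).
  - move=> u _; rewrite addr0 -mulrA; apply: le_trans (YL _ _) _.
    by rewrite ler_wpM2l ?(ltW L0)//; exact: picard_close.
  rewrite mul0r addr0 /D exprSr invfM [2 * C * (_ * _)]mulrA ler_wpM2l//.
    by rewrite mulr_ge0// divr_ge0 ?exprn_ge0// mulr_ge0.
  by rewrite gerBl.
have h2 := picard_close x k.+1 s.
have h3 := ler_normD (picard x k.+1 s - picard_limit x s) (- (picard x k.+1 s - (x + vprim (Y \o picard_limit x) s))).
rewrite normrN opprB in h3.
rewrite (_ : _ + (x + _ - _) = x + vprim (Y \o picard_limit x) s - picard_limit x s) in h3; last first.
  by rewrite addrC addrA subrK.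
apply: le_trans h3 _; have := D_step k s.
have : D k.+1 s = C / 2 ^+ k * E s by rewrite /D exprSr; field; rewrite expf_neq0.
by move: h1 h2; lra.
Qed.

Lemma integral_curve_dist (g1 g2 : R -> 'rV[R]_n) (S : R) : 0 <= S ->
  (forall u, `|u| <= S -> is_derive u (1 : R) g1 (Y (g1 u))) ->
  (forall u, `|u| <= S -> is_derive u (1 : R) g2 (Y (g2 u))) ->
  forall s, `|s| <= S -> `|g1 s - g2 s| <= 2 * expR (2 * L * S) * `|g1 0 - g2 0|.
Proof.
move=> S0 d1 d2 s sS.
have := @gronwall R n (fun u => g1 u - g2 u) (fun u => Y (g1 u) - Y (g2 u)) L 0 S L0 (lexx 0) S0.
rewrite mul0r addr0; apply => // u uS; first exact: (is_deriveB (d1 u uS) (d2 u uS)).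
by rewrite addr0.
Qed.

Lemma integral_curve_unique (g1 g2 : R -> 'rV[R]_n) (S : R) : 0 <= S ->
  (forall u, `|u| <= S -> is_derive u (1 : R) g1 (Y (g1 u))) ->
  (forall u, `|u| <= S -> is_derive u (1 : R) g2 (Y (g2 u))) ->
  g1 0 = g2 0 -> forall s, `|s| <= S -> g1 s = g2 s.
Proof.
move=> S0 d1 d2 g0 s sS; apply/eqP; rewrite -subr_eq0 -normr_le0.
apply: le_trans (integral_curve_dist S0 d1 d2 sS) _.
by rewrite g0 subrr normr0 mulr0.
Qed.

End Picard.

Section TameFields.
Context {R : realType}.

(** Smooth with bounded support: the derivatives are bounded, so the flow is complete, and the class
    is stable under [tangent_field]. *)
Definition tame (n : nat) (Y : 'rV[R]_n -> 'rV[R]_n) : Prop :=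
  (forall k j, Ck k (fun z : R * 'rV[R]_n => Y z.2 0 j) setT) /\
  exists B, forall x, B < `|x| -> Y x = 0.

Lemma support_bounded (n : nat) (f : 'rV[R]_n -> R) : continuous f ->
  (exists B, forall x, B < `|x| -> f x = 0) -> exists2 M : R, 0 <= M & forall x, `|f x| <= M.
Proof.
move=> cf [B fB]; pose B' := Num.max B 0.
pose K := [set x : 'rV[R]_n | `|x| <= B'].
have K0 : K 0 by rewrite /K /= normr0 le_max lexx orbT.
have cn : continuous (fun x : 'rV[R]_n => `|x|) by move=> x; exact: norm_continuous.
have cK : compact K.
  apply: bounded_closed_compact.
    exists B'; split; first exact: num_real.
    by move=> b bB x xB; exact: le_trans xB (ltW bB).
  rewrite (_ : K = (fun x : 'rV[R]_n => `|x|) @^-1` [set t | t <= B'])//.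
  by apply: preimage_closed; [move=> x _; exact: cn|exact: closed_le].
have cnf : continuous (fun x => `|f x|).
  by move=> x; apply: (@continuous_comp _ _ _ f (fun t : R => `|t|)); [exact: cf|exact: norm_continuous].
have [c _ cmax] := EVT_max_rV (ex_intro _ 0 K0) cK (continuous_subspaceT cnf).
exists `|f c| => // x; have [xK|xK] := leP `|x| B'.
  by apply: cmax; rewrite inE.
by rewrite fB ?normr0//; apply: le_lt_trans xK; rewrite le_max lexx.
Qed.

Lemma Ck_continuous_snd (n k : nat) (f : 'rV[R]_n -> R) :
  Ck k (fun z : R * 'rV[R]_n => f z.2) setT -> continuous f.
Proof.
move=> cf x; apply: (@continuous_comp _ _ _ (fun x => (0 : R, x)) (fun z : R * 'rV[R]_n => f z.2)).
  exact: continuous_section.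
exact: Ck_cont cf I.
Qed.

Lemma pd_support (n : nat) (f : 'rV[R]_n -> R) i (B : R) x : (forall x, B < `|x| -> f x = 0) ->
  B < `|x| -> 'D_('e_i) f x = 0.
Proof.
move=> fB xB; have E : \forall y \near x, f y = (cst 0 : _ -> R) y.
  have cn : {for x, continuous (fun x : 'rV[R]_n => `|x|)} by exact: norm_continuous.
  have : \forall y \near x, B < `|y|.
    by have := cn [set t | B < t]; apply; exact: lt_nbhsr.
  by apply: filterS => y /fB.
by rewrite (near_eq_derive _ E) derive_cst.
Qed.

Variable (n : nat).
Implicit Types (Y : 'rV[R]_n -> 'rV[R]_n) (x v : 'rV[R]_n).

Definition coordf Y j := fun z : R * 'rV[R]_n => Y z.2 0 j.

Lemma tame_bounds Y : tame Y -> exists M : R, [/\ 0 < M,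
  (forall x, `|Y x| <= M), (forall i j z, `|pd i (coordf Y j) z| <= M) &
  (forall l i j z, `|pd l (pd i (coordf Y j)) z| <= M)].
Proof.
move=> [cY [B YB]].
have cj j : Ck 2 (coordf Y j) setT by exact: cY.
have bnd (f : R * 'rV[R]_n -> R) : Ck 0 f setT -> (forall s t x, f (s, x) = f (t, x)) ->
   (forall x, B < `|x| -> f (0, x) = 0) -> exists M, 0 <= M /\ forall z, `|f z| <= M.
  move=> cf fE fB.
  have cf' : continuous (fun x => f (0, x)).
    move=> x; apply: (@continuous_comp _ _ _ (fun x => (0 : R, x)) f).
      exact: continuous_section.
    exact: Ck_cont cf I.
  have [M M0 hM] := support_bounded cf' (ex_intro _ B fB).
  by exists M; split=> // -[t x]; rewrite (fE t 0).
have s1 i j x : B < `|x| -> pd i (coordf Y j) (0, x) = 0.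
  move=> xB; rewrite pdE /=; apply: (@pd_support _ _ _ B) => // y yB.
  by rewrite /fibre /coordf /= YB// mxE.
have c1 i j : Ck 1 (pd i (coordf Y j)) setT by have [_ /(_ i)[]] := cj j.
have e1 i j s t x : pd i (coordf Y j) (s, x) = pd i (coordf Y j) (t, x) by rewrite !pdE.
have h0 j : exists M, 0 <= M /\ forall z, `|coordf Y j z| <= M.
  apply: bnd => //; first exact: Ck_le (cj j).
  by move=> x xB; rewrite /coordf /= YB// mxE.
have h1 (ij : 'I_n * 'I_n) : exists M, 0 <= M /\ forall z, `|pd ij.1 (coordf Y ij.2) z| <= M.
  apply: bnd; first exact: Ck_le (c1 _ _).
    by move=> s t x; exact: e1.
  by move=> x; exact: s1.
have h2 (lij : 'I_n * ('I_n * 'I_n)) : exists M, 0 <= M /\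
    forall z, `|pd lij.1 (pd lij.2.1 (coordf Y lij.2.2)) z| <= M.
  apply: bnd; first by have [_ /(_ lij.1)[]] := c1 lij.2.1 lij.2.2.
    by move=> s t x; rewrite !pdE /fibre /=; congr ('D_ _ _ _); apply/funext => y; exact: e1.
  by move=> x xB; rewrite pdE /=; apply: (@pd_support _ _ _ B) => // y yB; exact: s1.
have [M0 hM0] := choice h0; have [M1 hM1] := choice h1; have [M2 hM2] := choice h2.
exists (1 + \sum_j M0 j + \sum_ij M1 ij + \sum_lij M2 lij).
have S0 : 0 <= \sum_j M0 j by apply: sumr_ge0 => j _; have [] := hM0 j.
have S1 : 0 <= \sum_ij M1 ij by apply: sumr_ge0 => j _; have [] := hM1 j.
have S2 : 0 <= \sum_lij M2 lij by apply: sumr_ge0 => j _; have [] := hM2 j.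
split; first by lra.
- move=> x; apply: normr_leP; first by lra.
  move=> j; apply: le_trans ((hM0 j).2 (0, x)) _.
  have : M0 j <= \sum_j M0 j.
    by rewrite (bigD1 j)//= lerDl; apply: sumr_ge0 => i _; have [] := hM0 i.
  by lra.
- move=> i j z; apply: le_trans ((hM1 (i, j)).2 z) _.
  have : M1 (i, j) <= \sum_ij M1 ij.
    by rewrite (bigD1 (i, j))//= lerDl; apply: sumr_ge0 => l _; have [] := hM1 l.
  by lra.
- move=> l i j z; apply: le_trans ((hM2 (l, (i, j))).2 z) _.
  have : M2 (l, (i, j)) <= \sum_lij M2 lij.
    by rewrite (bigD1 (l, (i, j)))//= lerDl; apply: sumr_ge0 => q _; have [] := hM2 q.
  by lra.
Qed.

Definition dfield Y x v : 'rV[R]_n := \row_j lin_of (fun i => pd i (coordf Y j) (0, x)) v.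

Lemma tame_estimates Y : tame Y -> exists L : R, [/\ 0 < L,
  (forall x, `|Y x| <= L), (forall x y, `|Y x - Y y| <= L * `|x - y|),
  (forall x v, `|dfield Y x v| <= L * `|v|) &
  (forall x v, `|Y (v + x) - Y x - dfield Y x v| <= L * (`|v| * `|v|))].
Proof.
move=> tY; have [M [M0 h0 h1 h2]] := tame_bounds tY; have [cY _] := tY.
have n0 : (0 : R) <= n%:R by [].
(* The summands bound the field, its differential and Lipschitz constant, and the second-order
   remainder; a factor [n] arises each time a linear form is estimated by its coefficients. *)
exists (M + n%:R * M + n%:R * (n%:R * M)).
have nM : 0 <= n%:R * M by rewrite mulr_ge0// ltW.
have nnM : 0 <= n%:R * (n%:R * M) by rewrite mulr_ge0.
split; first by lra.
- by move=> x; apply: le_trans (h0 x) _; lra.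
- move=> x y; apply: normr_leP; first by rewrite mulr_ge0//; lra.
  move=> j; rewrite !mxE.
  have := @Ck1_lipschitz _ _ _ (coordf Y j) setT 0 y (x - y) M openT (cY 1 j) (fun _ _ => I).
  rewrite /coordf /= [y + _]addrC subrK => h; apply: le_trans (h _) _; first by move=> *; exact: h1.
  by rewrite ler_wpM2r//; lra.
- move=> x v; apply: normr_leP; first by rewrite mulr_ge0//; lra.
  move=> j; rewrite mxE; apply: le_trans (lin_of_le v (e := M) _) _; first by move=> i; exact: h1.
  by rewrite ler_wpM2r//; lra.
move=> x v; apply: normr_leP; first by rewrite !mulr_ge0//; lra.
move=> j; rewrite !mxE.
have e0 : 0 <= n%:R * M * `|v| by rewrite mulr_ge0.
have := @partials_estimate R n (fun x => Y x 0 j) x v (n%:R * M * `|v|) e0.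
have E i : pd i (coordf Y j) (0, x) = 'D_('e_i) (fun x => Y x 0 j) x by rewrite pdE.
rewrite (_ : lin_of (fun i => 'D_('e_i) (fun x => Y x 0 j) x) v = lin_of (fun i => pd i (coordf Y j) (0, x)) v); last first.
  by apply: eq_bigr => i _; rewrite E.
move=> h; apply: le_trans (h _) _.
  move=> y i yv; split.
    by have [_ /(_ i)[d _]] := cY 1 j; exact: (d (0, y) I).
  have c1 : Ck 1 (pd i (coordf Y j)) setT by have [_ /(_ i)[]] := cY 2 j.
  have := @Ck1_lipschitz _ _ _ (pd i (coordf Y j)) setT 0 x (y - x) M openT c1 (fun _ _ => I).
  rewrite [x + _]addrC subrK !pdE => h'; apply: le_trans (h' _) _; first by move=> *; exact: h2.
  by rewrite ler_wpM2l.
rewrite !mulrA -[leLHS]mulrA -[leRHS]mulrA ler_wpM2r ?mulr_ge0//.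
by rewrite mulrA in nnM *; lra.
Qed.

Definition flow Y (s : R) x : 'rV[R]_n :=
  xget (fun=> x) [set g : R -> 'rV[R]_n | g 0 = x /\
    forall s, is_derive s (1 : R) g (Y (g s))] s.

Lemma flowP Y x : tame Y -> flow Y 0 x = x /\
  forall s, is_derive s (1 : R) (fun s => flow Y s x) (Y (flow Y s x)).
Proof.
move=> tY; have [L [L0 YM YL _ _]] := tame_estimates tY.
have h := @picard_limitP R n Y L L L0 YL YM x.
have ex : exists g, [set g : R -> 'rV[R]_n | g 0 = x /\
    forall s, is_derive s (1 : R) g (Y (g s))] g by exists (picard_limit Y x).
exact: (xgetPex (fun=> x) ex).
Qed.

Lemma flow_unique Y x (g : R -> 'rV[R]_n) (S : R) : tame Y -> 0 <= S -> g 0 = x ->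
  (forall u, `|u| <= S -> is_derive u (1 : R) g (Y (g u))) ->
  forall s, `|s| <= S -> g s = flow Y s x.
Proof.
move=> tY S0 g0 dg s sS; have [L [L0 YM YL _ _]] := tame_estimates tY.
have [f0 df] := flowP x tY.
by apply: (@integral_curve_unique R n Y L L0 YL g (fun s => flow Y s x) S) => //; rewrite f0.
Qed.

End TameFields.

Lemma Ck_comp0 (R : realType) (T : topologicalType) (m p k : nat) (g : 'rV[R]_p -> R)
    (F : T * 'rV[R]_m -> 'rV[R]_p) (A : set (T * 'rV[R]_m)) (B : set 'rV[R]_p) :
  open A -> open B -> (forall z, A z -> B (F z)) ->
  Ck k (fun z : R * 'rV[R]_p => g z.2) (cyl B) ->
  (forall j, Ck k (fun z => F z 0 j) A) -> Ck k (fun z => g (F z)) A.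
Proof.
move=> oA oB AB cg cF.
apply: (@Ck_comp R T R p m k (fun z : R * 'rV[R]_p => g z.2) (cyl B) (fun=> 0) F A) => //.
  exact: open_cyl.
by move=> z _; exact: cvg_cst.
Qed.

(** * Differentiability of flows in the initial point *)

Section TangentField.
Context {R : realType} {n : nat}.
Variables (Y : 'rV[R]_n -> 'rV[R]_n).
Hypothesis tY : tame Y.

(* The cut-off in the fibre direction keeps the tangent field compactly
   supported, so that the construction can be iterated. *)
Definition tangent_field (r : R) (z : 'rV[R]_(n + n)) : 'rV[R]_(n + n) :=
  bump 0 r (2 * r) (rsubmx z) *: row_mx (Y (lsubmx z)) (dfield Y (lsubmx z) (rsubmx z)).

Lemma tame_tangent_field r : 0 < r -> tame (tangent_field r).
Proof.
move=> r0; have [cY [B YB]] := tY.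
have oT : open (setT : set (R * 'rV[R]_(n + n))) by exact: openT.
have oTn : open (setT : set 'rV[R]_n) by exact: openT.
have cl k i : Ck k (fun z : R * 'rV[R]_(n + n) => lsubmx z.2 0 i) setT.
  by under [X in Ck k X _]eq_fun do rewrite mxE; exact: Ck_coord.
have cr k i : Ck k (fun z : R * 'rV[R]_(n + n) => rsubmx z.2 0 i) setT.
  by under [X in Ck k X _]eq_fun do rewrite mxE; exact: Ck_coord.
have cb k : Ck k (fun z : R * 'rV[R]_(n + n) => bump 0 r (2 * r) (rsubmx z.2)) setT.
  apply: (@Ck_comp0 _ _ _ _ _ (bump 0 r (2 * r)) _ _ setT) => //.
  by apply: Ck_bump; exact: open_cyl.
split.
  move=> k j; rewrite -(splitK j); case: (fintype.split j) => j' /=.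
    apply: Ck_ext (CkM oT (cb k) (_ : Ck k (fun z => Y (lsubmx z.2) 0 j') setT)) => //.
      by move=> z _; rewrite /tangent_field mxE row_mxEl.
    apply: (@Ck_comp0 _ _ _ _ _ (fun x => Y x 0 j') (fun z => lsubmx z.2) _ setT) => //.
  apply: Ck_ext (CkM oT (cb k) (_ : Ck k (fun z => \sum_i rsubmx z.2 0 i * pd i (coordf Y j') (0, lsubmx z.2)) setT)) => //.
    by move=> z _; rewrite /tangent_field mxE row_mxEr mxE.
  apply: Ck_sum => // i _; apply: CkM => //.
  apply: (@Ck_comp0 _ _ _ _ _ (fun x => pd i (coordf Y j') (0, x)) (fun z => lsubmx z.2) _ setT) => //.
  have [_ /(_ i)[_ ci]] := cY k.+1 j'.
  apply: (@Ck_ext _ _ _ k (pd i (coordf Y j'))) (@Ck_sub _ _ _ k _ setT (cyl setT) (fun _ _ => I) ci) => //; exact: open_cyl.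
exists (Num.max (Num.max B 0) (2 * r)) => z zB.
have [lB|lB] := ltP (Num.max B 0) `|lsubmx z|.
  have lB' : B < `|lsubmx z| by apply: le_lt_trans lB; rewrite le_max lexx.
  rewrite /tangent_field YB// (_ : dfield Y _ _ = 0) ?row_mx0 ?scaler0//.
  apply/rowP => j; rewrite !mxE /lin_of big1// => i _; rewrite pdE.
  rewrite (@pd_support _ _ _ i B) ?mulr0// => x xB.
  by rewrite /fibre /coordf /= YB// mxE.
have [rB|rB] := ltP (2 * r) `|rsubmx z|.
  by rewrite /tangent_field bump_eq0 ?scale0r ?subr0 ?(ltW rB)//; lra.
suff : `|z| <= Num.max (Num.max B 0) (2 * r) by rewrite leNgt zB.
apply: normr_leP; first by rewrite !le_max lexx orbT.
move=> j; rewrite -(splitK j); case: (fintype.split j) => j' /=; rewrite le_max.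
  have := le_trans (normr_coord (lsubmx z) j') lB; by rewrite mxE => ->.
by have := le_trans (normr_coord (rsubmx z) j') rB; rewrite mxE => ->; rewrite orbT.
Qed.

(** The second block solves the linearized equation along the first. By Gronwall's inequality the
    increment of the flow minus [h] times this block is of order [h ^+ 2], so the block is the
    derivative along [v]; derivability of the flow is a result here, not an assumption. *)
Lemma tangent_flow (S : R) (v : 'rV[R]_n) : 0 <= S ->
  exists2 r : R, 0 < r & forall x s, `|s| <= S ->
    [/\ lsubmx (flow (tangent_field r) s (row_mx x v)) = flow Y s x,
        is_derive s (1 : R) (fun s => rsubmx (flow (tangent_field r) s (row_mx x v)))
          (dfield Y (flow Y s x) (rsubmx (flow (tangent_field r) s (row_mx x v)))) &
        is_derive x v (flow Y s) (rsubmx (flow (tangent_field r) s (row_mx x v)))].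
Proof.
move=> S0; have [L [L0 YM YL dYL Y2]] := tame_estimates tY.
have n2 : (0 : R) < 2 by [].
pose E := 2 * expR (2 * L * S); have E0 : 0 < E by rewrite mulr_gt0// expR_gt0.
have sub_derive (r : R) (g : R -> 'rV[R]_(n + n)) u d : is_derive u (1 : R) g d ->
    is_derive u (1 : R) (fun s => lsubmx (g s)) (lsubmx d) /\
    is_derive u (1 : R) (fun s => rsubmx (g s)) (rsubmx d).
  move=> /is_derive_rowP h; split; apply/is_derive_rowP => j; rewrite mxE.
    by under eq_fun do rewrite mxE; exact: h.
  by under eq_fun do rewrite mxE; exact: h.
have bound r x u : 0 < r -> `|u| <= S -> `|rsubmx (flow (tangent_field r) u (row_mx x v))| <= E * `|v|.
  move=> r0 uS; have tT := tame_tangent_field r0.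
  have [f0 df] := flowP (row_mx x v) tT.
  have := @gronwall R n (fun u => rsubmx (flow (tangent_field r) u (row_mx x v)))
    (fun u => rsubmx (tangent_field r (flow (tangent_field r) u (row_mx x v)))) L 0 S L0 (lexx 0) S0.
  rewrite f0 row_mxKr mul0r addr0; apply=> // t tS; first by have [] := sub_derive r _ _ _ (df t).
  rewrite addr0 /tangent_field linearZ/= row_mxKr normrZ ger0_norm ?bump_ge0//.
  set Z := flow _ t _; apply: (le_trans _ (dYL (lsubmx Z) (rsubmx Z))).
  by rewrite ler_piMl// bump_le1.
(* The bound [E * |v|] on the second block holds whatever the cut-off radius, so that radius can be
   chosen beyond it: the cut-off is not felt up to time [S]. *)
pose r := E * `|v| + 1; have r0 : 0 < r by rewrite ltr_wpDl// mulr_ge0// ltW.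
exists r => // x; have tT := tame_tangent_field r0.
have [f0 df] := flowP (row_mx x v) tT.
pose z u := flow (tangent_field r) u (row_mx x v).
have zE u : `|u| <= S -> tangent_field r (z u) =
    row_mx (Y (lsubmx (z u))) (dfield Y (lsubmx (z u)) (rsubmx (z u))).
  move=> uS; rewrite /tangent_field bump_eq1 ?scale1r//; first by lra.
  by rewrite subr0; apply: le_trans (bound r x u r0 uS) _; rewrite /r lerDl.
have dl u : `|u| <= S -> is_derive u (1 : R) (fun s => lsubmx (z s)) (Y (lsubmx (z u))).
  by move=> uS; have [+ _] := sub_derive r _ _ _ (df u); rewrite -/(z u) zE// row_mxKl.
have zl s : `|s| <= S -> lsubmx (z s) = flow Y s x.
  by apply: flow_unique => //; rewrite /z f0 row_mxKl.
have dr u : `|u| <= S -> is_derive u (1 : R) (fun s => rsubmx (z s)) (dfield Y (flow Y u x) (rsubmx (z u))).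
  by move=> uS; have [_ +] := sub_derive r _ _ _ (df u); rewrite -/(z u) zE// row_mxKr zl.
move=> s sS; split; [exact: zl|exact: dr|].
pose C := E * (S * (L * ((E * `|v|) * (E * `|v|)))).
have C0 : 0 <= C by rewrite !mulr_ge0// ltW.
apply: is_derive_estimate => e e0.
apply/near_ballP; exists (e / (C + 1)); first by rewrite divr_gt0// ltr_wpDl.
move=> h; rewrite subr0 => hlt.
have [fx0 dfx] := flowP x tY; have [fh0 dfh] := flowP (h *: v + x) tY.
pose g u := flow Y u (h *: v + x) - flow Y u x - h *: rsubmx (z u).
pose dg u := Y (flow Y u (h *: v + x)) - Y (flow Y u x) - h *: dfield Y (flow Y u x) (rsubmx (z u)).
have dist u : `|u| <= S -> `|flow Y u (h *: v + x) - flow Y u x| <= E * (`|h| * `|v|).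
  move=> uS; have := @integral_curve_dist R n Y L L0 YL (fun u => flow Y u (h *: v + x)) (fun u => flow Y u x) S S0
    (fun u _ => dfh u) (fun u _ => dfx u) u uS.
  by rewrite fh0 fx0 addrK normrZ.
(* Quadratic Taylor remainder of [Y] between two orbits that start [h *: v] apart. *)
pose eps := L * ((E * (`|h| * `|v|)) * (E * (`|h| * `|v|))).
have eps0 : 0 <= eps by rewrite !mulr_ge0// ltW.
have := @gronwall R n g dg L eps S L0 eps0 S0 _ _ s sS.
have g0 : g 0 = 0 by rewrite /g fh0 fx0 /z f0 row_mxKr addrK subrr.
rewrite g0 normr0 add0r -/E => H; apply: le_trans (H _ _) _.
- move=> u uS.
  exact: (is_deriveB (is_deriveB (dfh u) (dfx u)) (is_deriveZ h (dr u uS))).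
- move=> u uS; pose d := flow Y u (h *: v + x) - flow Y u x.
  have -> : dg u = (Y (d + flow Y u x) - Y (flow Y u x) - dfield Y (flow Y u x) d)
      + dfield Y (flow Y u x) (g u).
    have lin (y p q : 'rV[R]_n) (c : R) : dfield Y y (p - c *: q) = dfield Y y p - c *: dfield Y y q.
      by apply/rowP => j; rewrite !mxE linearB linearZ.
    by rewrite /dg /g -/d lin addrA subrK /d subrK.
  apply: le_trans (ler_normD _ _) _; rewrite addrC lerD//.
  apply: le_trans (Y2 _ _) _; rewrite /eps ler_wpM2l ?(ltW L0)//.
  by apply: ler_pM => //; exact: dist.
have -> : E * (eps * S) = C * `|h| * `|h| by rewrite /C /eps; ring.
rewrite ler_wpM2r//; have [->|Cn0] := eqVneq C 0; first by rewrite mul0r ltW.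
apply: le_trans (_ : (C + 1) * `|h| <= e); first by rewrite ler_wpM2r// lerDl.
by rewrite mulrC -ler_pdivlMr ?ltr_wpDl// ltW.
Qed.

Lemma flow_variational x v s :
  is_derive s (1 : R) (fun s => 'D_v (flow Y s) x) (dfield Y (flow Y s x) ('D_v (flow Y s) x)).
Proof.
(* One cut-off radius must serve on a whole neighbourhood of [s], hence the margin 1. *)
have S0 : 0 <= `|s| + 1 by rewrite addr_ge0.
have [r r0 h] := tangent_flow v S0.
have sS : `|s| <= `|s| + 1 by rewrite lerDl.
have [_ d1 [_ d2]] := h x s sS; rewrite d2.
apply: near_eq_is_derive d1; apply/near_ballP; exists 1 => // u us.
have uS : `|u| <= `|s| + 1.
  by rewrite -{1}(subrK s u); apply: le_trans (ler_normD _ _) _; rewrite addrC lerD2l ltW.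
by have [_ _ [_ ->]] := h x u uS.
Qed.

Lemma derive_flow0 x v : 'D_v (flow Y 0) x = v.
Proof.
have -> : flow Y 0 = id by apply/funext => y; have [] := flowP y tY.
exact: derive_id.
Qed.

End TangentField.

Lemma flow_continuous (R : realType) (n : nat) (Y : 'rV[R]_n -> 'rV[R]_n) s : tame Y ->
  continuous (flow Y s).
Proof.
move=> tY; have [L [L0 YM YL _ _]] := tame_estimates tY.
apply: (@lipschitz_continuous _ _ _ _ (2 * expR (2 * L * `|s|))).
  by rewrite mulr_gt0// expR_gt0.
move=> x y; have [fx dx] := flowP x tY; have [fy dy] := flowP y tY.
have := @integral_curve_dist R n Y L L0 YL _ _ `|s| (normr_ge0 s) (fun u _ => dx u) (fun u _ => dy u) s (lexx _).
by rewrite fx fy.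
Qed.

(* A partial derivative of a flow is a component of the flow of the tangent
   field, hence smoothness by induction. *)
Lemma flow_Ck (R : realType) k (n : nat) (Y : 'rV[R]_n -> 'rV[R]_n) s j : tame Y ->
  Ck k (fun z : R * 'rV[R]_n => flow Y s z.2 0 j) setT.
Proof.
elim: k n Y j => [|k IH] n Y j tY.
  split=> // z _; apply: (@continuous_comp _ _ _ (fun z : R * 'rV[R]_n => flow Y s z.2) (fun x : 'rV[R]_n => x 0 j)).
    by apply: (@continuous_comp _ _ _ snd (flow Y s)); [exact: cvg_snd|exact: flow_continuous].
  exact: coord_continuous.
split=> [z _|i].
  apply: (@continuous_comp _ _ _ (fun z : R * 'rV[R]_n => flow Y s z.2) (fun x : 'rV[R]_n => x 0 j)).
    by apply: (@continuous_comp _ _ _ snd (flow Y s)); [exact: cvg_snd|exact: flow_continuous].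
  exact: coord_continuous.
have [r r0 h] := tangent_flow tY ('e_i) (normr_ge0 s).
have d z : is_derive z.2 'e_i (fibre (fun z : R * 'rV[R]_n => flow Y s z.2 0 j) z.1)
    (rsubmx (flow (tangent_field Y r) s (row_mx z.2 'e_i)) 0 j).
  by have [_ _ /is_derive_rowP/(_ j)] := h z.2 s (lexx _).
split; first by move=> z _; have [] := d z.
have CC : Ck k (fun z : R * 'rV[R]_n => flow (tangent_field Y r) s (row_mx z.2 'e_i) 0 (rshift n j)) setT.
  apply: (@Ck_comp0 _ _ _ _ _ (fun y => flow (tangent_field Y r) s y 0 (rshift n j)) (fun z => row_mx z.2 'e_i) _ setT) => //.
  - exact: openT.
  - exact: openT.
  - exact: (@Ck_sub _ _ _ k _ setT (cyl setT) (fun _ _ => I) (IH _ _ (rshift n j) (tame_tangent_field tY r0))).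
  move=> l; rewrite -(splitK l); case: (fintype.split l) => l' /=.
    by under [X in Ck k X _]eq_fun do rewrite row_mxEl; exact: Ck_coord.
  by under [X in Ck k X _]eq_fun do rewrite row_mxEr; exact: Ck_cst.
apply: Ck_ext CC => //; first exact: openT.
by move=> z _; rewrite pdE; have [_ ->] := d z; rewrite mxE.
Qed.

(** * Closed two-forms in coordinates *)

Section LocalForms.
Context {R : realType} {n : nat}.

Record local_form (D : set 'rV[R]_n) (a : 'rV[R]_n -> 'rV[R]_n -> 'rV[R]_n -> R) : Prop :=
  LocalForm {
    lf_linearl : forall x, D x -> forall v, scalar (fun u => a x u v) ;
    lf_linearr : forall x, D x -> forall u, scalar (a x u) ;
    lf_alternating : forall x, D x -> forall u, a x u u = 0 ;
    lf_smooth : forall u v, Ck 1 (fun z : R * 'rV[R]_n => a z.2 u v) (cyl D) }.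

Definition local_closed (D : set 'rV[R]_n) (a : 'rV[R]_n -> 'rV[R]_n -> 'rV[R]_n -> R) :=
  forall x, D x -> forall u v t,
    'D_u (fun y => a y v t) x + 'D_v (fun y => a y t u) x + 'D_t (fun y => a y u v) x = 0.

Variables (D : set 'rV[R]_n) (a : 'rV[R]_n -> 'rV[R]_n -> 'rV[R]_n -> R).
Hypotheses (oD : open D) (la : local_form D a).

Lemma scalar0 (f : 'rV[R]_n -> R) : scalar f -> f 0 = 0.
Proof. by move=> lf; have := lf (-1) 0 0; rewrite scaler0 addr0 mulN1r addNr. Qed.

Lemma scalar_sum (f : 'rV[R]_n -> R) (c : 'I_n -> R) (F : 'I_n -> 'rV[R]_n) : scalar f ->
  f (\sum_i c i *: F i) = \sum_i c i * f (F i).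
Proof.
move=> lf; elim/big_rec2 : _ => [|i y1 y2 _ <-]; first exact: scalar0.
exact: lf.
Qed.

Lemma lf_expand x u v : D x ->
  a x u v = \sum_i \sum_j u 0 i * v 0 j * a x 'e_i 'e_j.
Proof.
move=> Dx; rewrite {1}(row_sum_e u) (scalar_sum _ _ (lf_linearl la Dx v)).
apply: eq_bigr => i _; rewrite {1}(row_sum_e v) (scalar_sum _ _ (lf_linearr la Dx _)).
by rewrite mulr_sumr; apply: eq_bigr => j _; rewrite mulrA.
Qed.

Lemma lf_sym x u v : D x -> a x u v = - a x v u.
Proof.
move=> Dx; apply/eqP; rewrite -addr_eq0; apply/eqP.
have addl y z t : a x (y + z) t = a x y t + a x z t.
  by have := lf_linearl la Dx t 1 y z; rewrite scale1r mul1r.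
have addr y z t : a x t (y + z) = a x t y + a x t z.
  by have := lf_linearr la Dx t 1 y z; rewrite scale1r mul1r.
have := lf_alternating la Dx (u + v).
by rewrite addl !addr !(lf_alternating la Dx) add0r addr0.
Qed.

Lemma lf_diff x u v : D x -> differentiable (fun y => a y u v : R^o) x.
Proof.
move=> Dx; have oc : open (cyl D : set (R * _)) by exact: open_cyl.
by have [] := Ck1_diff oc (lf_smooth la u v) (Dx : cyl D (0, x)).
Qed.

(** Leibniz rule in the base point and in both arguments. Expanding in the basis ([lf_expand]) makes
    the expression a sum of products of scalar functions. *)
Lemma lf_derive (V : normedModType R) (g b c : V -> 'rV[R]_n) (s v : V) dg db dc : (\forall t \near s, D (g t)) ->
  is_derive s v g dg -> is_derive s v b db -> is_derive s v c dc ->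
  is_derive s v (fun s => a (g s) (b s) (c s))
    ('D_dg (fun y => a y (b s) (c s)) (g s) + a (g s) db (c s) + a (g s) (b s) dc).
Proof.
move=> nD hg hb hc.
have Dg := nbhs_singleton nD; have [dg' _] := hg.
pose m i j y := a y 'e_i 'e_j.
have hm i j : is_derive s v (fun t => m i j (g t)) ('D_dg (m i j) (g s)).
  have := is_derive_chain dg' (lf_diff 'e_i 'e_j Dg).
  by rewrite -deriveE ?(@derive_val _ _ _ _ _ _ _ hg)//; exact: lf_diff.
move/is_derive_rowP : hb => hb; move/is_derive_rowP : hc => hc.
pose q i j := fun t => (b t 0 i * c t 0 j) * m i j (g t).
have hq i j : is_derive s v (q i j) ((db 0 i * c s 0 j + b s 0 i * dc 0 j) * m i j (g s)
    + b s 0 i * c s 0 j * 'D_dg (m i j) (g s)).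
  have h1 := is_deriveM (hb i) (hc j).
  have h2 := is_deriveM h1 (hm i j).
  by apply: is_derive_eq h2 _; rewrite /GRing.scale /= !fctE; ring.
have hS : is_derive s v (\sum_i \sum_j q i j) (\sum_i \sum_j
   ((db 0 i * c s 0 j + b s 0 i * dc 0 j) * m i j (g s) + b s 0 i * c s 0 j * 'D_dg (m i j) (g s))).
  by apply: is_derive_sum => i; apply: is_derive_sum => j; exact: hq.
have hE : \forall t \near s, (\sum_i \sum_j q i j) t = a (g t) (b t) (c t).
  apply: filterS nD => t Dt; rewrite lf_expand// fct_sumE; apply: eq_bigr => i _.
  by rewrite fct_sumE.
have -> : 'D_dg (fun y => a y (b s) (c s)) (g s) + a (g s) db (c s) + a (g s) (b s) dc =
   \sum_i \sum_j ((db 0 i * c s 0 j + b s 0 i * dc 0 j) * m i j (g s) + b s 0 i * c s 0 j * 'D_dg (m i j) (g s)).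
  have -> : 'D_dg (fun y => a y (b s) (c s)) (g s) = \sum_i \sum_j b s 0 i * c s 0 j * 'D_dg (m i j) (g s).
    have hh i j : is_derive (g s) dg ((b s 0 i * c s 0 j) *: m i j) ((b s 0 i * c s 0 j) *: 'D_dg (m i j) (g s)).
      by apply: is_deriveZ; split=> //; apply: diff_derivable; exact: lf_diff.
    have [_ <-] : is_derive (g s) dg (\sum_i \sum_j ((b s 0 i * c s 0 j) *: m i j)) (\sum_i \sum_j b s 0 i * c s 0 j * 'D_dg (m i j) (g s)).
      by apply: is_derive_sum => i; apply: is_derive_sum => j; exact: hh.
    apply: near_eq_derive; apply: filterS (open_nbhs_nbhs (conj oD Dg)) => y Dy.
    rewrite lf_expand// fct_sumE; apply: eq_bigr => i _; rewrite fct_sumE.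
    by apply: eq_bigr => j _.
  rewrite (lf_expand db _ Dg) (lf_expand _ dc Dg) -!big_split/=; apply: eq_bigr => i _.
  by rewrite -!big_split/=; apply: eq_bigr => j _; rewrite /m; ring.
exact: near_eq_is_derive hE hS.
Qed.

End LocalForms.

Section Pullback.
Context {R : realType} {N n : nat}.
Variables (D : set 'rV[R]_n) (a : 'rV[R]_n -> 'rV[R]_n -> 'rV[R]_n -> R).
Hypotheses (oD : open D) (la : local_form D a) (ca : local_closed D a).
Variables (q : 'rV[R]_N -> 'rV[R]_n) (U : set 'rV[R]_N).
Hypotheses (oU : open U) (UD : forall x, U x -> D (q x))
  (cq : forall j, Ck 2 (fun z : R * 'rV[R]_N => q z.2 0 j) (cyl U)).

Let oc : open (cyl U : set (R * 'rV[R]_N)). Proof. exact: open_cyl. Qed.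

Lemma pullback_derivable x u : U x -> derivable q x u.
Proof.
move=> Ux; apply/derivable_mxP => i j; rewrite ord1; apply: diff_derivable.
by have [] := Ck1_diff oc (Ck_le (isT : (1 <= 2)%N) (cq j)) (Ux : cyl U (0, x)).
Qed.

Let Dq u x := 'D_u q x.

Let DqE u x j : U x -> Dq u x 0 j = 'D_u (fun y => q y 0 j) x.
Proof. by move=> Ux; rewrite /Dq derive_mx ?mxE//; exact: pullback_derivable. Qed.

Let H t u x : 'rV[R]_n := \row_j 'D_t (fun y => 'D_u (fun y => q y 0 j) y) x.

Let Dq_derive u t x : U x -> is_derive x t (Dq u) (H t u x).
Proof.
move=> Ux; apply/is_derive_rowP => j; rewrite mxE.
have c1 : Ck 1 (fun z : R * 'rV[R]_N => 'D_u (fibre (fun z => q z.2 0 j) z.1) z.2) (cyl U).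
  exact: Ck_derive.
have h := Ck1_derive t oc c1 (Ux : cyl U (0, x)).
have E : \forall y \near x, 'D_u (fun y => q y 0 j) y = Dq u y 0 j.
  by apply: filterS (open_nbhs_nbhs (conj oU Ux)) => y Uy; rewrite DqE.
apply: near_eq_is_derive E _; apply: DeriveDef => //; by have [] := h.
Qed.

Let H_sym u t x : U x -> H t u x = H u t x.
Proof.
move=> Ux; apply/rowP => j; rewrite [LHS]mxE [RHS]mxE.
exact: (derive_sym t u oc (cq j) (Ux : cyl U (0, x))).
Qed.

Definition pullback_form x u v := a (q x) ('D_u q x) ('D_v q x).

(** Exterior differentiation commutes with pullback: besides the cyclic sum of [a] at the image
    vectors, six terms with second derivatives [H] appear, and they cancel in pairs because [H] is
    symmetric and [a] alternating. *)
Lemma pullback_closed : local_closed U pullback_form.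
Proof.
move=> x Ux u v t; have Dqx := UD Ux.
have hq w : is_derive x w q (Dq w x) by split=> //; exact: pullback_derivable.
have nD : \forall y \near x, D (q y).
  by apply: filterS (open_nbhs_nbhs (conj oU Ux)) => y; exact: UD.
have d w1 w2 w3 := lf_derive oD la nD (hq w1) (Dq_derive w2 w1 Ux) (Dq_derive w3 w1 Ux).
have [_ E1] := d u v t; have [_ E2] := d v t u; have [_ E3] := d t u v.
have alg (A1 A2 A3 b1 b2 b3 c1 c2 c3 : R) : A1 + A2 + A3 = 0 ->
    c2 = - b1 -> c1 = - b3 -> c3 = - b2 ->
    (A1 + b1 + c1) + (A2 + b2 + c2) + (A3 + b3 + c3) = 0.
  by move=> E -> -> ->; rewrite -[RHS]E; ring.
rewrite /pullback_form.
apply: (etrans (f_equal2 (fun b c : R => b + c) (f_equal2 (fun b c : R => b + c) E1 E2) E3)).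
apply: alg (ca Dqx (Dq u x) (Dq v x) (Dq t x)) _ _ _.
- by rewrite (H_sym v u Ux); exact: (lf_sym la _ _ Dqx).
- by rewrite (H_sym u t Ux); exact: (lf_sym la _ _ Dqx).
- by rewrite (H_sym t v Ux); exact: (lf_sym la _ _ Dqx).
Qed.

End Pullback.

Section InvariantForm.
Context {R : realType} {n : nat}.
Variables (D : set 'rV[R]_n) (a : 'rV[R]_n -> 'rV[R]_n -> 'rV[R]_n -> R).
Hypotheses (oD : open D) (la : local_form D a) (ca : local_closed D a).
Variable (Y : 'rV[R]_n -> 'rV[R]_n).
Hypotheses (tY : tame Y) (kerY : forall y, D y -> forall b, a y (Y y) b = 0).

Lemma dfieldE y b : is_derive y b Y (dfield Y y b).
Proof.
have [cY _] := tY; apply/is_derive_rowP => j; rewrite mxE.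
exact: (Ck1_derive b openT (cY 1%N j) (I : setT (0 : R, y))).
Qed.

(** Derivative along [u] of the identity [a x (Y x) v = 0]. *)
Lemma kernel_derive y u v : D y ->
  'D_u (fun x => a x (Y y) v) y + a y (dfield Y y u) v = 0.
Proof.
move=> Dy; have nD : \forall x \near y, D x by exact: (open_nbhs_nbhs (conj oD Dy)).
have [_ E] := lf_derive oD la nD (is_derive_id y u) (dfieldE y u) (is_derive_cst v y u).
have E0 : \forall x \near y, a x (Y x) v = (cst 0 : _ -> R) x.
  by apply: filterS nD => x Dx; exact: kerY.
move: E; rewrite /= (near_eq_derive _ E0) derive_cst => ->.
by rewrite (scalar0 (lf_linearr la Dy _)) addr0.
Qed.

Let preserve_alg (A B C d e : R) : A + - B + C = 0 -> B + d = 0 -> C + e = 0 ->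
  A + d + - e = 0.
Proof. by move=> h1 h2 h3; lra. Qed.

(** Cartan's formula: the Lie derivative of [a] along [Y] vanishes because [a] is closed and [Y]
    lies in its kernel. In coordinates, the variational equation is combined with [kernel_derive]
    for both vectors and with closedness at [Y], [p], [q]. *)
Lemma flow_preserves_form x u v :
  (forall s, 0 <= s <= 1 -> D (flow Y s x)) ->
  a (flow Y 1 x) ('D_u (flow Y 1) x) ('D_v (flow Y 1) x) = a x u v.
Proof.
move=> Dflow; have [f0 df] := flowP x tY.
pose F s := a (flow Y s x) ('D_u (flow Y s) x) ('D_v (flow Y s) x).
have F0 : F 0 = a x u v by rewrite /F !derive_flow0// f0.
rewrite -F0 -[LHS]/(F 1); apply: increment_eq0; first exact: ler01.
move=> s sI; have Ds := Dflow s sI.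
have nD : \forall t \near s, D (flow Y t x).
  have /(is_derive1_continuous) ct := df s.
  by apply: ct; exact: (open_nbhs_nbhs (conj oD Ds)).
have [h hE] := lf_derive oD la nD (df s) (flow_variational tY x u s) (flow_variational tY x v s).
split=> //; rewrite [LHS]hE.
set y := flow Y s x; set p := 'D_u (flow Y s) x; set q := 'D_v (flow Y s) x.
have k1 := kernel_derive p q Ds; have k2 := kernel_derive q p Ds.
rewrite (lf_sym la p _ Ds).
have E2 : 'D_p (fun x => a x q (Y y)) y = - 'D_p (fun x => a x (Y y) q) y.
  have E : \forall x \near y, a x q (Y y) = (- (fun x => a x (Y y) q)) x.
    by apply: filterS (open_nbhs_nbhs (conj oD Ds)) => z Dz; exact: (lf_sym la _ _ Dz).
  have d : derivable (fun x => a x (Y y) q) y p.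
    exact: (diff_derivable (lf_diff oD la (Y y) q Ds)).
  by rewrite (near_eq_derive _ E) (deriveN d).
have c' (A C : R) : A + 'D_p (fun x => a x q (Y y)) y + C = 0 ->
    A + - 'D_p (fun x => a x (Y y) q) y + C = 0.
  by move=> h0; exact: (eq_ind _ (fun t => A + t + C = 0) h0 _ E2).
exact: (preserve_alg (c' _ _ (ca Ds (Y y) p q)) k1 k2).
Qed.

End InvariantForm.

(** * Parametrized maps into a manifold *)

Section Charts.
Context {R : realType} {n : nat} {M : manifoldType R n}.
Implicit Types (c d : chart R n M).

Lemma chart_cod_in c x : chart_dom c x -> chart_cod c (c x).
Proof. by move=> cx; exists x. Qed.

Lemma chart_inv_dom c y : chart_cod c y -> chart_dom c (chart_inv c y).
Proof. by move=> [x cx <-]; rewrite chart_mapK. Qed.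

Lemma chart_invK c y : chart_cod c y -> c (chart_inv c y) = y.
Proof. by move=> [x cx <-]; rewrite chart_mapK. Qed.

Lemma open_preimage_on (X Y : topologicalType) (A : set X) (p : X -> Y) (B : set Y) :
  open A -> open B -> (forall z, A z -> {for z, continuous p}) -> open (A `&` p @^-1` B).
Proof.
move=> oA oB cp; rewrite openE => z [Az Bz]; apply: filterI.
  exact: (open_nbhs_nbhs (conj oA Az)).
by apply: (cp z Az); exact: (open_nbhs_nbhs (conj oB Bz)).
Qed.

Definition transition_dom c d : set 'rV[R]_n :=
  chart_cod c `&` chart_inv c @^-1` chart_dom d.

Lemma transition_domE c d : transition_dom c d = local_dom id c d.
Proof.
apply/seteqP; split=> x.
  by move=> [[p cp <-]]; rewrite /= chart_mapK // => dp; exists p.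
by move=> [p [/= cp dp] <-]; split; [exists p | rewrite /= chart_mapK].
Qed.

Lemma open_transition_dom c d : open (transition_dom c d).
Proof.
apply: open_preimage_on; [exact: chart_cod_open|exact: chart_dom_open|].
exact: chart_inv_continuous.
Qed.

Lemma transition_Ck (T : topologicalType) c d k j : atlas M c -> atlas M d ->
  Ck k (fun z : T * 'rV[R]_n => d (chart_inv c z.2) 0 j) (cyl (transition_dom c d)).
Proof.
move=> Mc Md; have := atlas_compatible _ _ Mc Md; rewrite -transition_domE.
have oD := @open_transition_dom c d.
move=> /(iffLR (smooth_on_coordP _ oD)) /(_ j) sj.
exact: (smooth_on_Ck T k oD sj).
Qed.

End Charts.

Section Plots.
Context {R : realType} {n : nat} {M : manifoldType R n}.

Definition plot (T : topologicalType) (m k : nat) (p : T * 'rV[R]_m -> M)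
    (A : set (T * 'rV[R]_m)) : Prop :=
  (forall z, A z -> {for z, continuous p}) /\
  forall d, atlas M d -> forall j, Ck k (fun z => d (p z) 0 j) (A `&` p @^-1` chart_dom d).

Lemma plot_open (T : topologicalType) (m k : nat) (p : T * 'rV[R]_m -> M) A (B : set M) :
  open A -> open B -> plot k p A -> open (A `&` p @^-1` B).
Proof. by move=> oA oB [cp _]; exact: open_preimage_on. Qed.

Lemma plot_le (T : topologicalType) (m j k : nat) (p : T * 'rV[R]_m -> M) A :
  (j <= k)%N -> plot k p A -> plot j p A.
Proof. by move=> jk [cp sp]; split=> // d Md i; exact: Ck_le (sp d Md i). Qed.

Lemma plot_sub (T : topologicalType) (m k : nat) (p : T * 'rV[R]_m -> M) A B :
  B `<=` A -> plot k p A -> plot k p B.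
Proof.
move=> BA [cp sp]; split=> [z /BA|d Md j]; first exact: cp.
apply: (@Ck_sub _ _ _ _ _ (A `&` p @^-1` chart_dom d)); last exact: sp.
by move=> z [/BA Az pz].
Qed.

(** One chart around each image point suffices, since the transition maps are smooth. *)
Lemma plot_local (T : topologicalType) (m k : nat) (p : T * 'rV[R]_m -> M) A : open A ->
  (forall z, A z -> {for z, continuous p}) ->
  (forall z, A z -> exists2 c, atlas M c & exists B, [/\ open B, B z, B `<=` A `&` p @^-1` chart_dom c &
     forall j, Ck k (fun z => c (p z) 0 j) B]) ->
  plot k p A.
Proof.
move=> oA cp loc; split=> // d Md j; apply: Ck_local => z [Az dz].
have [c Mc [B [oB Bz BA cB]]] := loc z Az.
have oB' : open (B `&` p @^-1` chart_dom d).
  by apply: open_preimage_on => //; [exact: chart_dom_open|move=> y /BA[Ay _]; exact: cp].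
exists (B `&` p @^-1` chart_dom d) => //.
have oD := @open_transition_dom R n M c d.
have CC : Ck k (fun z => d (chart_inv c (c (p z))) 0 j) (B `&` p @^-1` chart_dom d).
  apply: (@Ck_comp0 _ _ _ _ _ (fun y => d (chart_inv c y) 0 j) (fun z => c (p z)) _ (transition_dom c d)) => //.
  - move=> y [/BA[_ cy] dy]; split; first exact: chart_cod_in.
    by rewrite /= chart_mapK.
  - exact: transition_Ck.
  - by move=> l; apply: (@Ck_sub _ _ _ _ _ B) (cB l) => y [].
apply: Ck_ext CC => // y; rewrite inE => -[/BA[_ cy] _].
by rewrite chart_mapK.
Qed.

Lemma plot_ext (T : topologicalType) (m k : nat) (p q : T * 'rV[R]_m -> M) A : open A ->
  (forall z, A z -> p z = q z) -> plot k p A -> plot k q A.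
Proof.
move=> oA pq pp; have [cp sp] := pp.
have cq z : A z -> {for z, continuous q}.
  move=> Az; apply: near_eq_continuous (cp z Az).
  by apply: filterS (open_nbhs_nbhs (conj oA Az)) => y; exact: pq.
split=> // d Md j.
have oq : open (A `&` q @^-1` chart_dom d) by apply: open_preimage_on => //; exact: chart_dom_open.
apply: Ck_ext oq _ (_ : Ck k (fun z => d (p z) 0 j) _).
  by move=> y; rewrite inE => -[Ay _]; rewrite pq.
by apply: (@Ck_sub _ _ _ _ _ (A `&` p @^-1` chart_dom d)) (sp d Md j) => y [Ay /=]; rewrite -pq.
Qed.

Lemma plot_chart_inv (T : topologicalType) k c : atlas M c ->
  plot k (fun z : T * 'rV[R]_n => chart_inv c z.2) (cyl (chart_cod c)).
Proof.
move=> Mc; split=> [z cz|d Md j].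
  apply: (@continuous_comp _ _ _ snd (chart_inv c)); first exact: cvg_snd.
  exact: chart_inv_continuous.
exact: transition_Ck.
Qed.

Lemma plot_base (T : topologicalType) (m k : nat) (b : T -> M) (A : set (T * 'rV[R]_m)) :
  (forall z, A z -> {for z, continuous (b \o fst)}) -> plot k (fun z : T * 'rV[R]_m => b z.1) A.
Proof.
move=> cb; split=> // d Md j; apply: (@Ck_base _ _ _ k (fun t => d (b t) 0 j)) => z [Az dz].
apply: (@continuous_comp _ _ _ (b \o fst) (fun x => d x 0 j)); first exact: cb.
have := chart_map_continuous dz => /(@continuous_coord R M n d _) /(_ j).
exact.
Qed.

Lemma plot_comp (S T : topologicalType) (m q k : nat) (p : T * 'rV[R]_m -> M) A
    (a : S -> T) (F : S * 'rV[R]_q -> 'rV[R]_m) (B : set (S * 'rV[R]_q)) :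
  open A -> open B -> plot k p A -> (forall z, B z -> A (a z.1, F z)) ->
  (forall z, B z -> {for z, continuous (a \o fst)}) ->
  (forall j, Ck k (fun z => F z 0 j) B) -> plot k (fun z => p (a z.1, F z)) B.
Proof.
move=> oA oB [cp sp] BA ca cF.
have caF z : B z -> {for z, continuous (fun z => (a z.1, F z))}.
  move=> Bz; apply: continuous_pair; first exact: (ca z Bz).
  by apply/continuous_coord => j; exact: Ck_cont (cF j) Bz.
have cpF z : B z -> {for z, continuous (fun z => p (a z.1, F z))}.
  move=> Bz; apply: (@continuous_comp _ _ _ (fun z => (a z.1, F z)) p); first exact: caF.
  exact/cp/BA.
split=> // d Md j.
have oB' : open (B `&` (fun z => p (a z.1, F z)) @^-1` chart_dom d).
  by apply: open_preimage_on => //; exact: chart_dom_open.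
apply: (@Ck_comp R S T m q k (fun z => d (p z) 0 j) (A `&` p @^-1` chart_dom d) a F) => //.
- by apply: open_preimage_on => //; exact: chart_dom_open.
- by move=> z [Bz dz]; split=> //; exact: BA.
- by move=> z [Bz _]; exact: ca.
- by move=> l; apply: (@Ck_sub _ _ _ _ _ B) (cF l) => z [].
- exact: sp.
Qed.

Definition sfun (f : M -> R) : Prop := forall (T : topologicalType) c k, atlas M c ->
  Ck k (fun z : T * 'rV[R]_n => f (chart_inv c z.2)) (cyl (chart_cod c)).

Lemma sfun_plot (T : topologicalType) (m k : nat) (p : T * 'rV[R]_m -> M) A f :
  open A -> sfun f -> plot k p A -> Ck k (fun z => f (p z)) A.
Proof.
move=> oA sf pp; have [cp sp] := pp; apply: Ck_local => z Az.
have [c Mc cz] := @atlas_cover R n M (p z).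
have oB := plot_open oA (chart_dom_open c) pp.
exists (A `&` p @^-1` chart_dom c) => //.
have CC : Ck k (fun z => f (chart_inv c (c (p z)))) (A `&` p @^-1` chart_dom c).
  apply: (@Ck_comp0 _ _ _ _ _ (fun y => f (chart_inv c y)) (fun z => c (p z)) _ (chart_cod c)) => //.
  - exact: chart_cod_open.
  - by move=> y [_ cy]; exact: chart_cod_in.
  - exact: sf.
  - by move=> j; exact: sp.
by apply: Ck_ext CC => // y; rewrite inE => -[_ cy]; rewrite chart_mapK.
Qed.

End Plots.

Section LocalDom.
Context {R : realType} {m n : nat} {L : manifoldType R m} {M : manifoldType R n}.

Lemma open_local_dom (f : L -> M) (c : chart R m L) (d : chart R n M) : continuous f -> open (local_dom f c d).
Proof.
move=> cf; rewrite (_ : local_dom f c d = chart_cod c `&` (fun y => f (chart_inv c y)) @^-1` chart_dom d).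
  apply: open_preimage_on; [exact: chart_cod_open|exact: chart_dom_open|].
  move=> y cy; apply: (@continuous_comp _ _ _ (chart_inv c) f); last exact: cf.
  exact: chart_inv_continuous.
apply/seteqP; split=> x.
  by move=> [p [/= cp dp] <-]; split; [exists p | rewrite /= chart_mapK].
by move=> [[p cp <-]]; rewrite /= chart_mapK // => dp; exists p.
Qed.

Lemma local_domP (f : L -> M) (c : chart R m L) (d : chart R n M) y :
  chart_cod c y -> chart_dom d (f (chart_inv c y)) -> local_dom f c d y.
Proof. by move=> [p cp <-]; rewrite chart_mapK// => dp; exists p. Qed.

End LocalDom.

Section SmoothMaps.
Context {R : realType} {n : nat} {M : manifoldType R n}.

Lemma plot_smooth (T : topologicalType) (t : T) (f : M -> M) :
  (forall c k, atlas M c -> plot k (fun z : T * 'rV[R]_n => f (chart_inv c z.2)) (cyl (chart_cod c))) ->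
  smooth f.
Proof.
move=> pf; have cf : continuous f.
  move=> x; have [c Mc cx] := @atlas_cover R n M x.
  have [cp _] := pf c 0 Mc.
  have c1 : {for x, continuous (fun y => f (chart_inv c (c y)))}.
    apply: (@continuous_comp _ _ _ (fun y => (t, c y)) (fun z : T * 'rV[R]_n => f (chart_inv c z.2))).
      by apply: continuous_pair; [exact: cvg_cst|exact: chart_map_continuous].
    exact/cp/chart_cod_in.
  apply: near_eq_continuous c1.
  by apply: filterS (open_nbhs_nbhs (conj (chart_dom_open c) cx)) => y cy; rewrite chart_mapK.
split=> // c d Mc Md; have oD := @open_local_dom R n n M M f c d cf.
apply/(smooth_on_coordP _ oD) => j; apply: (Ck_smooth_on t oD) => k.
have [_ /(_ d Md j)] := pf c k Mc.
apply: Ck_sub => z [p [/= cp dp] E]; rewrite /cyl /= -E; split; first exact: chart_cod_in.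
by rewrite /= chart_mapK.
Qed.

Lemma smooth_plot (T : topologicalType) (m k : nat) (p : T * 'rV[R]_m -> M) A (f : M -> M) :
  open A -> smooth f -> plot k p A -> plot k (fun z => f (p z)) A.
Proof.
move=> oA [cf sf] pp; have [cp sp] := pp.
have cfp z : A z -> {for z, continuous (fun z => f (p z))}.
  by move=> Az; apply: (@continuous_comp _ _ _ p f); [exact: cp|exact: cf].
apply: plot_local => // z Az.
have [c Mc cz] := @atlas_cover R n M (p z).
have [d Md dz] := @atlas_cover R n M (f (p z)).
exists d => //; exists ((A `&` p @^-1` chart_dom c) `&` (fun z => f (p z)) @^-1` chart_dom d).
have o1 := plot_open oA (chart_dom_open c) pp.
have o2 : open ((A `&` p @^-1` chart_dom c) `&` (fun z => f (p z)) @^-1` chart_dom d).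
  by apply: open_preimage_on => //; [exact: chart_dom_open|move=> y [Ay _]; exact: cfp].
split=> //; first by move=> y [[Ay _] dy].
move=> j; have oD := @open_local_dom R n n M M f c d cf.
have /(smooth_on_coordP _ oD)/(_ j) sj := sf c d Mc Md.
have CC : Ck k (fun z => d (f (chart_inv c (c (p z)))) 0 j)
    ((A `&` p @^-1` chart_dom c) `&` (fun z => f (p z)) @^-1` chart_dom d).
  apply: (@Ck_comp0 _ _ _ _ _ (fun y => d (f (chart_inv c y)) 0 j) (fun z => c (p z)) _ (local_dom f c d)) => //.
  - by move=> y [[Ay cy] dy]; exists (p y).
  - exact: (smooth_on_Ck R k oD sj).
  - move=> l; apply: (@Ck_sub _ _ _ _ _ (A `&` p @^-1` chart_dom c)); last exact: sp.
    by move=> y [].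
by apply: Ck_ext CC => // y; rewrite inE => -[[_ cy] _]; rewrite chart_mapK.
Qed.

End SmoothMaps.

(** * The C^r topology and the evaluation of nearby maps *)

Section CrNear.
Context {R : realType} {r m n : nat} {L : manifoldType R m} {N : manifoldType R n}.

(** A closed ball around [x0] corresponds to a compact set in the chart domain, on which a basic
    neighbourhood controls the derivatives of the difference with [f1] uniformly; those of [f1]
    itself are continuous. *)
Lemma Cr_near (f1 : smoothMap L N) (e : chart R m L) (d : chart R n N) vs x0 (eps : R) :
  atlas L e -> atlas N d -> local_dom f1 e d x0 -> (size vs <= r)%N ->
  (forall v, v \in vs -> `|v| <= 1) -> 0 < eps ->
  \forall z \near ((f1 : CrMap r L N), x0),
    chart_dom d ((z.1 : smoothMap L N) (chart_inv e z.2)) /\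
    `|iter_derive vs (local_rep (z.1 : smoothMap L N) e d) z.2
      - iter_derive vs (local_rep f1 e d) x0| <= eps.
Proof.
move=> Le Nd x0D svs nvs eps0.
have [cf sf] := smooth_funP f1.
have oD := @open_local_dom R m n L N f1 e d cf.
have [r0 r00 r0D] := iffLR (near_ballP _ _) (open_nbhs_nbhs (conj oD x0D)).
pose C := closed_ball x0 (r0 / 2).
have r20 : 0 < r0 / 2 by rewrite divr_gt0.
have CE y : C y <-> `|y - x0| <= r0 / 2.
  by rewrite /C closed_ballE// /closed_ball_ /= distrC.
have CD : C `<=` local_dom f1 e d.
  by move=> y /CE yC; apply: r0D; apply: le_lt_trans yC _; lra.
have cC : compact C.
  apply: bounded_closed_compact; last exact: closed_ball_closed.
  exists (`|x0| + r0 / 2); split; first exact: num_real.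
  move=> b bB y /CE yC; rewrite -(subrK x0 y); apply: le_trans (ler_normD _ _) _.
  by apply: le_trans (ltW bB); rewrite addrC lerD2l.
pose K := chart_inv e @` C.
have dE y : local_dom f1 e d y -> chart_dom e (chart_inv e y) /\ e (chart_inv e y) = y /\
    chart_dom d (f1 (chart_inv e y)).
  by move=> [p [ep dp] <-]; rewrite chart_mapK.
have cK : compact K.
  apply: continuous_compact => //; apply: continuous_in_subspaceT => y; rewrite inE => /CD yD.
  by apply: chart_inv_continuous; have [h1 [<- _]] := dE y yD; exact: chart_cod_in.
have Ke : K `<=` chart_dom e by move=> _ [y /CD /dE[h _] <-].
have Kd : (f1 : smoothMap L N) @` K `<=` chart_dom d.
  by move=> _ [_ [y /CD /dE[_ [_ h]] <-] <-].
have e20 : 0 < eps / 2 by rewrite divr_gt0.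
have oB : open (Cr_ball (f1 : CrMap r L N) e d K (eps / 2)).
  rewrite /open/=; exists [set Cr_ball (f1 : CrMap r L N) e d K (eps / 2)]; last by rewrite bigcup_set1.
  by move=> _ ->; apply: finI_from1; exists f1, e, d, K, (eps / 2); split.
have f1B : Cr_ball (f1 : CrMap r L N) e d K (eps / 2) f1.
  by split=> // ws p _ _ _; rewrite subrr normr0.
have n1 : \forall f \near (f1 : CrMap r L N), Cr_ball (f1 : CrMap r L N) e d K (eps / 2) f.
  exact: (open_nbhs_nbhs (conj oB f1B)).
have n2 : \forall x \near x0, C x /\
    `|iter_derive vs (local_rep f1 e d) x - iter_derive vs (local_rep f1 e d) x0| <= eps / 2.
  have ci : {for x0, continuous (iter_derive vs (local_rep f1 e d))}.
    by apply: differentiable_continuous; exact: (sf e d Le Nd vs x0 x0D).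
  have nC : \forall x \near x0, C x.
    by apply/near_ballP; exists (r0 / 2) => // y yr; apply/CE/ltW.
  by apply: filterI => //; have /cvgrPdistC_le/(_ _ e20) := ci.
exists ([set f | Cr_ball (f1 : CrMap r L N) e d K (eps / 2) f],
  [set x | C x /\ `|iter_derive vs (local_rep f1 e d) x - iter_derive vs (local_rep f1 e d) x0| <= eps / 2]).
  by split.
move=> [f x] [/= [fK fB] [Cx hx]]; have [h1 [h2 h3]] := dE x (CD x Cx).
have Kx : K (chart_inv e x) by exists x.
split; first by apply: fK; exists (chart_inv e x).
have := fB vs (chart_inv e x) svs nvs Kx; rewrite h2 => /ltW hf.
rewrite -(subrKA (iter_derive vs (local_rep f1 e d) x)) [leRHS](splitr eps).
by apply: le_trans (ler_normD _ _) _; rewrite lerD// distrC.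
Qed.

End CrNear.

(** [psi vs] is a candidate for the partial derivative along the list [vs]; it is enough to check
    that each one differentiates the previous one. *)
Lemma Ck_iterated (R : realType) (T : topologicalType) (m k : nat)
    (psi : seq 'I_m -> T * 'rV[R]_m -> R) (A : set (T * 'rV[R]_m)) : open A ->
  (forall vs z, (size vs <= k)%N -> A z -> {for z, continuous (psi vs)}) ->
  (forall vs i z, (size vs < k)%N -> A z ->
    is_derive z.2 'e_i (fibre (psi vs) z.1) (psi (i :: vs) z)) ->
  Ck k (psi [::]) A.
Proof.
move=> oA cpsi dpsi.
suff H j vs : (size vs + j <= k)%N -> Ck j (psi vs) A by exact: H.
elim: j vs => [|j IH] vs svs; first by split=> // z; apply: cpsi; rewrite -[size vs]addn0.
split=> [z|i]; first by apply: cpsi; apply: leq_trans svs; rewrite leq_addr.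
have lt : (size vs < k)%N by apply: leq_trans svs; rewrite addnS ltnS leq_addr.
split; first by move=> z Az; have [] := dpsi vs i z lt Az.
apply: Ck_ext (IH (i :: vs) _) => //; last by rewrite /= addSn -addnS.
by move=> z; rewrite inE => Az; have [_ <-] := dpsi vs i z lt Az; rewrite pdE.
Qed.

Section Evaluation.
Context {R : realType} {k n : nat} {G : lieGroupType R k} {M : manifoldType R n}.
Notation P := (CrMap 2 (G * M)%type M).

Definition ev (rho : P) (g : G) (x : M) : M := (rho : smoothMap (G * M)%type M) (g, x).

Definition ev_dom (T : topologicalType) (r : T -> P) (c d : chart R n M) :
    set ((T * G) * 'rV[R]_n) :=
  [set z | chart_cod c z.2 /\ chart_dom d (ev (r z.1.1) z.1.2 (chart_inv c z.2))].

(* The evaluation [(t, g, x) |-> r t (g, x)] is of class C^j in the variable [x],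
   with derivatives jointly continuous. *)
Definition evCk (T : topologicalType) (r : T -> P) (j : nat) : Prop :=
  forall c d, atlas M c -> atlas M d -> open (ev_dom r c d) /\
    forall i, Ck j (fun z => d (ev (r z.1.1) z.1.2 (chart_inv c z.2)) 0 i) (ev_dom r c d).

Lemma is_derive_row_mx (p q : nat) (a : 'rV[R]_p) (x v : 'rV[R]_q) :
  is_derive x v (fun y => row_mx a y) (row_mx 0 v).
Proof.
apply/is_derive_rowP => j; rewrite -(splitK j); case: (fintype.split j) => l /=.
  by under eq_fun do rewrite row_mxEl; rewrite row_mxEl mxE; exact: is_derive_cst.
under eq_fun do rewrite row_mxEr; rewrite row_mxEr.
by move: l; apply/is_derive_rowP; exact: is_derive_id.
Qed.

Section LocalEvaluation.
Variables (a : chart R k G) (c d : chart R n M).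
Hypotheses (Ga : atlas G a) (Mc : atlas M c) (Md : atlas M d).
Let e := prod_chart a c.

Let Le : atlas (G * M)%type e. Proof. by exists a, c. Qed.

Let einv g y : chart_dom a g -> chart_inv e (row_mx (a g) y) = (g, chart_inv c y).
Proof. by move=> ag; rewrite /= row_mxKl row_mxKr chart_mapK. Qed.

Let eD (rho : P) g y : chart_dom a g -> chart_cod c y ->
  chart_dom d (ev rho g (chart_inv c y)) ->
  local_dom (rho : smoothMap _ _) e d (row_mx (a g) y).
Proof.
move=> ag cy dy; apply: local_domP; last by rewrite einv.
exists (g, chart_inv c y); last by rewrite /= chart_invK.
by split=> //=; exact: chart_inv_dom.
Qed.

Let cemb (z : (P * G) * 'rV[R]_n) : chart_dom a z.1.2 ->
  {for z, continuous (fun z : (P * G) * 'rV[R]_n => (z.1.1, row_mx (a z.1.2) z.2))}.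
Proof.
move=> az; have c12 : {for z, continuous (fun z : (P * G) * 'rV[R]_n => z.1.2)}.
  by apply: (@continuous_comp _ _ _ fst snd); [exact: cvg_fst|exact: cvg_snd].
apply: continuous_pair.
  by apply: (@continuous_comp _ _ _ fst fst); exact: cvg_fst.
apply: (@continuous_comp _ _ _ (fun z : (P * G) * 'rV[R]_n => (a z.1.2, z.2))
  (fun w : 'rV[R]_k * 'rV[R]_n => row_mx w.1 w.2)); last exact: continuous_row_mx.
apply: continuous_pair; last exact: cvg_snd.
by apply: (@continuous_comp _ _ _ (fun z : (P * G) * 'rV[R]_n => z.1.2) a) => //; exact: chart_map_continuous.
Qed.

Let near_chart (z : (P * G) * 'rV[R]_n) : chart_dom a z.1.2 ->
  \forall y \near z, chart_dom a y.1.2.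
Proof.
move=> az; have c12 : {for z, continuous (fun z : (P * G) * 'rV[R]_n => z.1.2)}.
  by apply: (@continuous_comp _ _ _ fst snd); [exact: cvg_fst|exact: cvg_snd].
by apply: c12; exact: (open_nbhs_nbhs (conj (chart_dom_open a) az)).
Qed.

Let near_ev (z : (P * G) * 'rV[R]_n) vs (eps : R) : chart_dom a z.1.2 ->
  ev_dom (@id P) c d z -> (size vs <= 2)%N -> (forall v, v \in vs -> `|v| <= 1) -> 0 < eps ->
  \forall y \near z, ev_dom (@id P) c d y /\
    `|iter_derive vs (local_rep (y.1.1 : smoothMap _ _) e d) (row_mx (a y.1.2) y.2)
     - iter_derive vs (local_rep (z.1.1 : smoothMap _ _) e d) (row_mx (a z.1.2) z.2)| <= eps.
Proof.
move=> az [cz dz] svs nvs eps0.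
have := Cr_near Le Md (eD az cz dz) svs nvs eps0.
move=> /(cemb az) h1; have h2 := near_chart az.
have h3 : \forall y \near z, chart_cod c y.2.
  have c2 : {for z, continuous (fun z : (P * G) * 'rV[R]_n => z.2)} by exact: cvg_snd.
  have oc : open (chart_cod c) := @chart_cod_open R n M c.
  by apply: c2; exact: (open_nbhs_nbhs (conj oc cz)).
have h4 : \forall y \near z, chart_dom d ((y.1.1 : smoothMap _ _) (chart_inv e (row_mx (a y.1.2) y.2))) /\
    `|iter_derive vs (local_rep (y.1.1 : smoothMap _ _) e d) (row_mx (a y.1.2) y.2)
     - iter_derive vs (local_rep (z.1.1 : smoothMap _ _) e d) (row_mx (a z.1.2) z.2)| <= eps by exact: h1.
apply: filterS3 h4 h2 h3 => y [h4 h5] h6 h7; split=> //; split=> //.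
by move: h4; rewrite einv.
Qed.

Lemma open_ev_dom_chart : open (ev_dom (@id P) c d `&` [set z | chart_dom a z.1.2]).
Proof.
rewrite openE => z [zE az]; have h1 := near_chart az.
have h2 := near_ev az zE (isT : (size [::] <= 2)%N) (fun v (h : v \in [::]) => ltac:(by [])) ltr01.
by apply: filterS2 h1 h2 => y h [h' _]; split.
Qed.

(** Partial derivatives in [x] are iterated derivatives of the local expression on [G * M] in the
    directions [row_mx 0 'e_i], which lie in the unit ball; those of order at most 2 are controlled
    by the C^2 topology. *)
Lemma ev_Ck_chart j : Ck 2 (fun z : (P * G) * 'rV[R]_n => d (ev z.1.1 z.1.2 (chart_inv c z.2)) 0 j)
  (ev_dom (@id P) c d `&` [set z | chart_dom a z.1.2]).
Proof.
have oA := open_ev_dom_chart.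
pose ws (vs : seq 'I_n) : seq 'rV[R]_(k + n) := [seq row_mx 0 'e_i | i <- vs].
pose psi vs (z : (P * G) * 'rV[R]_n) : R :=
  iter_derive (ws vs) (local_rep (z.1.1 : smoothMap _ _) e d) (row_mx (a z.1.2) z.2) 0 j.
have wsn vs v : v \in ws vs -> `|v| <= 1.
  move=> /mapP[i _ ->]; apply: normr_leP => // l.
  rewrite -(splitK l); case: (fintype.split l) => l' /=.
    by rewrite row_mxEl mxE normr0.
  by rewrite row_mxEr; apply: le_trans (normr_coord _ _) (normr_delta _).
have : Ck 2 (psi [::]) (ev_dom (@id P) c d `&` [set z | chart_dom a z.1.2]).
  apply: Ck_iterated => // [vs z svs [zE az]|vs i z svs [[cz dz] az]].
    apply/cvgrPdistC_le => eps eps0.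
    have sws : (size (ws vs) <= 2)%N by rewrite size_map.
    have := near_ev az zE sws (@wsn vs) eps0.
    apply: filterS => y [_ h]; apply: le_trans h.
    by have := normr_coord (iter_derive (ws vs) (local_rep (y.1.1 : smoothMap _ _) e d) (row_mx (a y.1.2) y.2)
     - iter_derive (ws vs) (local_rep (z.1.1 : smoothMap _ _) e d) (row_mx (a z.1.2) z.2)) j; rewrite !mxE.
  have [cf sf] := smooth_funP (z.1.1 : smoothMap _ _).
  have df := sf e d Le Md (ws vs) _ (eD az cz dz).
  have [h hE] := is_derive_row_mx (a z.1.2) z.2 'e_i.
  have := is_derive_chain h df; rewrite hE -deriveE// => /is_derive_rowP /(_ j).
  exact.
apply: Ck_ext => // z; rewrite inE => -[[cz dz] az].
by rewrite /psi /= /local_rep einv.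
Qed.

End LocalEvaluation.

Lemma evCk_id : evCk (@id P) 2.
Proof.
move=> c d Mc Md.
have pt (z : (P * G) * 'rV[R]_n) : exists2 a, atlas G a & chart_dom a z.1.2 by exact: atlas_cover.
split.
  rewrite openE => z zE; have [a Ga az] := pt z.
  have := open_nbhs_nbhs (conj (open_ev_dom_chart Ga Mc Md) (conj zE az)).
  by apply: filterS => y [].
move=> i; apply: Ck_local => z zE; have [a Ga az] := pt z.
by exists (ev_dom (@id P) c d `&` [set z | chart_dom a z.1.2]) => //; exact: ev_Ck_chart.
Qed.

(** A single action is smooth to every order, whereas [evCk_id] stops at 2. Constant families serve
    for the smoothness of the final diffeomorphism, the identity family for the neighbourhood of
    [rho0]. *)
Lemma evCk_cst (T : topologicalType) (rho : P) j : evCk (fun _ : T => rho) j.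
Proof.
move=> c d Mc Md; have [cf sf] := smooth_funP (rho : smoothMap _ _).
have cev (z : (T * G) * 'rV[R]_n) : chart_cod c z.2 ->
    {for z, continuous (fun z : (T * G) * 'rV[R]_n => ev rho z.1.2 (chart_inv c z.2))}.
  move=> cz; apply: (@continuous_comp _ _ _ (fun z : (T * G) * 'rV[R]_n => (z.1.2, chart_inv c z.2)) rho); last exact: cf.
  apply: continuous_pair.
    by apply: (@continuous_comp _ _ _ fst snd); [exact: cvg_fst|exact: cvg_snd].
  apply: (@continuous_comp _ _ _ snd (chart_inv c)); first exact: cvg_snd.
  exact: chart_inv_continuous.
have oE : open (ev_dom (fun _ : T => rho) c d).
  apply: (@open_preimage_on _ _ (cyl (chart_cod c)) (fun z => ev rho z.1.2 (chart_inv c z.2)) (chart_dom d)).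
  - by apply: open_cyl; exact: chart_cod_open.
  - exact: chart_dom_open.
  - by move=> z; exact: cev.
split=> // i; apply: Ck_local => z [cz dz]; have [a Ga az] := @atlas_cover R k G z.1.2.
pose e := prod_chart a c; have Le : atlas (G * M)%type e by exists a, c.
have c12 y : {for y, continuous (fun z : (T * G) * 'rV[R]_n => z.1.2)}.
  by apply: (@continuous_comp _ _ _ fst snd); [exact: cvg_fst|exact: cvg_snd].
pose B := ev_dom (fun _ : T => rho) c d `&` (fun z => z.1.2) @^-1` chart_dom a.
have oB : open B by apply: open_preimage_on => //; exact: chart_dom_open.
exists B => //.
have oD := @open_local_dom R _ n _ M rho e d cf.
have /(smooth_on_coordP _ oD)/(_ i) si := sf e d Le Md.
have CC : Ck j (fun z : (T * G) * 'rV[R]_n => local_rep (rho : smoothMap _ _) e d (row_mx (a z.1.2) z.2) 0 i) B.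
  apply: (@Ck_comp0 _ _ _ _ _ (fun y => local_rep (rho : smoothMap _ _) e d y 0 i)
      (fun z : (T * G) * 'rV[R]_n => row_mx (a z.1.2) z.2) B (local_dom rho e d)) => //.
  - move=> y [[cy dy] ay]; apply: local_domP; last by rewrite /= row_mxKl row_mxKr chart_mapK.
    exists (y.1.2, chart_inv c y.2); last by rewrite /= chart_invK.
    by split=> //=; exact: chart_inv_dom.
  - exact: (smooth_on_Ck R j oD si).
  move=> l; rewrite -(splitK l); case: (fintype.split l) => l' /=.
    under [X in Ck j X _]eq_fun do rewrite row_mxEl.
    apply: (@Ck_base _ _ _ j (fun t : T * G => a t.2 0 l')) => y [_ ay].
    apply: (@continuous_comp _ _ _ (fun z : (T * G) * 'rV[R]_n => z.1.2) (fun g => a g 0 l')) => //.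
    by have := chart_map_continuous ay => /(@continuous_coord R G k a _) /(_ l'); exact.
  by under [X in Ck j X _]eq_fun do rewrite row_mxEr; exact: Ck_coord.
apply: Ck_ext CC => // y; rewrite inE => -[[cy dy] ay].
by rewrite /local_rep /= row_mxKl row_mxKr chart_mapK.
Qed.

Lemma ev_plot (S T : topologicalType) (r : T -> P) (m j : nat) (a : S -> T) (g : S -> G)
    (p : S * 'rV[R]_m -> M) (A : set (S * 'rV[R]_m)) :
  evCk r j -> open A -> plot j p A ->
  (forall z, A z -> {for z, continuous (a \o fst)}) ->
  (forall z, A z -> {for z, continuous (g \o fst)}) ->
  plot j (fun z => ev (r (a z.1)) (g z.1) (p z)) A.
Proof.
move=> er oA pp ca cg; have [cp sp] := pp.
pose q z := ev (r (a z.1)) (g z.1) (p z).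
have loc z c d : A z -> atlas M c -> atlas M d -> chart_dom c (p z) -> chart_dom d (q z) ->
  exists B, [/\ open B, B z, B `<=` A, (forall y, B y -> chart_dom c (p y) /\ chart_dom d (q y)) &
     forall i, Ck j (fun z => d (q z) 0 i) B].
  move=> Az Mc Md cz dz; have [oE cE] := er c d Mc Md.
  pose A1 := A `&` p @^-1` chart_dom c.
  have oA1 : open A1 by exact: (plot_open oA (chart_dom_open c) pp).
  have ccp i : Ck j (fun z => c (p z) 0 i) A1 by exact: sp.
  pose F z := ((a z.1, g z.1), c (p z)).
  have cF y : A1 y -> {for y, continuous F}.
    move=> A1y; have [Ay _] := A1y; apply: continuous_pair.
      by apply: continuous_pair; [exact: (ca y Ay)|exact: (cg y Ay)].
    by apply/continuous_coord => i; exact: Ck_cont (ccp i) A1y.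
  pose B := A1 `&` F @^-1` ev_dom r c d.
  have oB : open B by exact: open_preimage_on.
  have BD y : A1 y -> chart_dom d (q y) -> B y.
    by move=> [Ay cy] dy; split=> //; split; [exact: chart_cod_in|rewrite /= chart_mapK].
  exists B; split=> //.
  - by apply: BD.
  - by move=> y [[]].
  - by move=> y [[Ay cy] [_ /=]]; rewrite chart_mapK.
  move=> i.
  have CC : Ck j (fun z => d (ev (r (a z.1)) (g z.1) (chart_inv c (c (p z)))) 0 i) B.
    apply: (@Ck_comp R S (T * G)%type n m j (fun z => d (ev (r z.1.1) z.1.2 (chart_inv c z.2)) 0 i)
       (ev_dom r c d) (fun s => (a s, g s)) (fun z => c (p z)) B) => //.
    - by move=> y [_].
    - move=> y [[Ay _] _]; apply: continuous_pair; [exact: (ca y Ay)|exact: (cg y Ay)].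
    - by move=> l; apply: (@Ck_sub _ _ _ _ _ A1) (ccp l) => y [].
  by apply: Ck_ext CC => // y; rewrite inE => -[[_ cy] _]; rewrite chart_mapK.
have cq z : A z -> {for z, continuous q}.
  move=> Az; have [c Mc cz] := @atlas_cover R n M (p z).
  have [d Md dz] := @atlas_cover R n M (q z).
  have [B [oB Bz BA Bd cB]] := loc z c d Az Mc Md cz dz.
  have c1 : {for z, continuous (fun z => chart_inv d (d (q z)))}.
    apply: (@continuous_comp _ _ _ (fun z => d (q z)) (chart_inv d)).
      by apply/continuous_coord => i; exact: Ck_cont (cB i) Bz.
    exact/chart_inv_continuous/chart_cod_in.
  apply: near_eq_continuous c1; apply: filterS (open_nbhs_nbhs (conj oB Bz)) => y By.
  by rewrite chart_mapK//; have [] := Bd y By.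
apply: plot_local => // z Az.
have [c Mc cz] := @atlas_cover R n M (p z); have [d Md dz] := @atlas_cover R n M (q z).
have [B [oB Bz BA Bd cB]] := loc z c d Az Mc Md cz dz.
by exists d => //; exists B; split=> // y By; split; [exact: BA|have [] := Bd y By].
Qed.

End Evaluation.

(** * Immersions by finitely many functions *)

Lemma near_open_preimage (X Y : topologicalType) (q : X -> Y) (B : set Y) (x : X) :
  {for x, continuous q} -> open B -> B (q x) -> \forall y \near x, B (q y).
Proof. by move=> cq oB Bx; apply: cq; exact: (open_nbhs_nbhs (conj oB Bx)). Qed.

Section ManifoldDerivatives.
Context {R : realType} {n : nat} {M : manifoldType R n}.

Definition mdiff (V : normedModType R) (q : V -> M) (x : V) : Prop :=
  {for x, continuous q} /\
  forall c, atlas M c -> chart_dom c (q x) -> differentiable (fun y => c (q y)) x.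

Lemma plot_mdiff (T : topologicalType) (m : nat) (p : T * 'rV[R]_m -> M) A z :
  open A -> plot 1 p A -> A z -> mdiff (fun x => p (z.1, x)) z.2.
Proof.
case: z => t x oA pp Az; have [cp sp] := pp; split=> /=.
  by apply: (@continuous_comp _ _ _ (fun x => (t, x)) p); [exact: continuous_section|exact: cp].
move=> c Mc cz; apply/differentiable_rowP => j.
have oB := plot_open oA (chart_dom_open c) pp.
by have [h _] := Ck1_diff oB (sp c Mc j) (conj Az cz : (A `&` p @^-1` chart_dom c) (t, x)).
Qed.

Lemma near_mdiff (V : normedModType R) (p q : V -> M) x :
  (\forall y \near x, p y = q y) -> mdiff p x -> mdiff q x.
Proof.
move=> pq [cp dp]; split; first exact: near_eq_continuous cp.
move=> c Mc cx; apply: (@near_eq_differentiable _ _ _ (fun y => c (p y))).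
  by apply: filterS pq => y ->.
by apply: dp => //; rewrite (nbhs_singleton pq).
Qed.

Lemma near_derive_chart (V : normedModType R) (p q : V -> M) (c : chart R n M) x u :
  (\forall y \near x, p y = q y) -> 'D_u (fun y => c (p y)) x = 'D_u (fun y => c (q y)) x.
Proof. by move=> pq; apply: near_eq_derive; apply: filterS pq => y ->. Qed.

Lemma mdiff_smooth (V : normedModType R) (f : M -> M) (q : V -> M) x : smooth f -> mdiff q x ->
  mdiff (fun y => f (q y)) x /\
  forall c d, atlas M c -> atlas M d -> chart_dom c (q x) -> chart_dom d (f (q x)) ->
  forall u, 'D_u (fun y => d (f (q y))) x = 'd (local_rep f c d) (c (q x)) ('D_u (fun y => c (q y)) x).
Proof.
move=> [cf sf] [cq dq].
have nE (c d : chart R n M) : chart_dom c (q x) -> \forall y \near x,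
    local_rep f c d (c (q y)) = d (f (q y)).
  move=> cx; have := near_open_preimage cq (chart_dom_open c) cx.
  by apply: filterS => y cy; rewrite /local_rep chart_mapK.
have dl c d : atlas M c -> atlas M d -> chart_dom c (q x) -> chart_dom d (f (q x)) ->
    differentiable (local_rep f c d) (c (q x)).
  by move=> Mc Md cx dx; apply: (sf c d Mc Md [::]); exists (q x).
split; first split.
- by apply: (@continuous_comp _ _ _ q f) => //; exact: cf.
- move=> d Md dx; have [c Mc cx] := @atlas_cover R n M (q x).
  have := (@near_eq_differentiable _ _ _ (fun y => local_rep f c d (c (q y))) (fun y => d (f (q y))) x (nE c d cx)); apply.
  exact: (@differentiable_comp _ _ _ _ (fun y => c (q y)) (local_rep f c d) x (dq c Mc cx) (dl c d Mc Md cx dx)).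
move=> c d Mc Md cx dx u; rewrite -(@near_eq_derive _ _ _ (fun y => local_rep f c d (c (q y))) _ x u (nE c d cx)).
have := is_derive_chain (diff_derivable (dq c Mc cx) : derivable _ x u) (dl c d Mc Md cx dx).
by case.
Qed.

Lemma smooth_id : smooth (id : M -> M).
Proof. by split=> [x|c d Mc Md]; [exact: cvg_id|exact: atlas_compatible]. Qed.

Lemma mdiff_comp (V W : normedModType R) (q : V -> M) (F : W -> V) x :
  mdiff q (F x) -> differentiable F x -> mdiff (fun y => q (F y)) x /\
  forall c, atlas M c -> chart_dom c (q (F x)) -> forall u,
  'D_u (fun y => c (q (F y))) x = 'D_('D_u F x) (fun y => c (q y)) (F x).
Proof.
move=> [cq dq] dF; split; first split.
- by apply: (@continuous_comp _ _ _ F q) => //; exact: differentiable_continuous.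
- move=> c Mc cx.
  exact: (@differentiable_comp _ _ _ _ F (fun y => c (q y)) x dF (dq c Mc cx)).
move=> c Mc cx u; have [_] := is_derive_chain (diff_derivable dF : derivable F x u) (dq c Mc cx).
by move=> ->; rewrite [RHS]deriveE//; exact: dq.
Qed.

Lemma sfun_mdiff (V : normedModType R) (f : M -> R) (q : V -> M) c x u :
  sfun f -> mdiff q x -> atlas M c -> chart_dom c (q x) ->
  is_derive x u (fun y => f (q y)) ('D_('D_u (fun y => c (q y)) x) (fun y => f (chart_inv c y)) (c (q x))).
Proof.
move=> sf [cq dq] Mc cx.
have oc : open (cyl (chart_cod c) : set (R * 'rV[R]_n)) by apply: open_cyl; exact: chart_cod_open.
have [df _] := Ck1_diff oc (sf R c 1%N Mc) (chart_cod_in cx : cyl (chart_cod c) (0, c (q x))).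
have [h1 h2] := is_derive_chain (diff_derivable (dq c Mc cx) : derivable _ x u) df.
have nE : \forall y \near x, ((fun y => f (chart_inv c y)) \o (fun y => c (q y))) y = f (q y).
  have := near_open_preimage cq (chart_dom_open c) cx.
  by apply: filterS => y cy; rewrite /= chart_mapK.
split; first exact: near_eq_derivable h1.
by rewrite -(@near_eq_derive _ _ _ ((fun y => f (chart_inv c y)) \o (fun y => c (q y))) _ x u nE) [RHS]deriveE.
Qed.

Lemma sfun_smooth (f : M -> R) (h : M -> M) : sfun f -> smooth h -> sfun (fun x => f (h x)).
Proof.
move=> sf sh T c k Mc; have oc : open (cyl (chart_cod c) : set (T * 'rV[R]_n)).
  by apply: open_cyl; exact: chart_cod_open.
by apply: sfun_plot => //; apply: smooth_plot => //; exact: plot_chart_inv.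
Qed.

Lemma sfun_continuous (f : M -> R) : sfun f -> continuous f.
Proof.
move=> sf x; have [c Mc cx] := @atlas_cover R n M x.
have c1 : {for x, continuous (fun y => f (chart_inv c (c y)))}.
  apply: (@continuous_comp _ _ _ (fun y => (0, c y)) (fun z : R * 'rV[R]_n => f (chart_inv c z.2))).
    by apply: continuous_pair; [exact: cvg_cst|exact: chart_map_continuous].
  exact: (Ck_cont (sf R c 0%N Mc) (chart_cod_in cx : cyl (chart_cod c) (0, c x))).
apply: near_eq_continuous c1.
by apply: filterS (open_nbhs_nbhs (conj (chart_dom_open c) cx)) => y cy; rewrite chart_mapK.
Qed.

End ManifoldDerivatives.

Section ImmersionFamily.
Context {R : realType} {n : nat} {M : manifoldType R n}.

(** The sum of squares vanishes exactly when [u] is killed by the differentials of all [f i] with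
    [i] in [l], so the condition says that the family is an immersion at [x]. *)
Definition immersive (I : Type) (f : I -> M -> R) (l : seq I) (x : M) :=
  exists c, [/\ atlas M c, chart_dom c x & forall u : 'rV[R]_n,
    \sum_(i <- l) ('D_u (fun y => f i (chart_inv c y)) (c x)) ^+ 2 = 0 -> u = 0].

(* The coordinates around [x], cut off near the boundary of a ball of the chart. *)
Lemma local_coordinates (x : M) : exists f : 'I_n -> M -> R, (forall j, sfun (f j)) /\
  \forall y \near x, immersive f (enum 'I_n) y.
Proof.
have [c Mc cx] := @atlas_cover R n M x.
have oc : open (chart_cod c) := @chart_cod_open R n M c.
have [r r0 rc] := iffLR (near_ballP _ _) (open_nbhs_nbhs (conj oc (chart_cod_in cx))).
pose r1 := r / 3; pose r2 := r / 2.
have r20 : 0 < r2 by rewrite divr_gt0.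
have r12 : r1 < r2 by rewrite /r1 /r2; lra.
pose g j (y : 'rV[R]_n) : R := bump (c x) r1 r2 y * y 0 j.
pose f j y : R := if y \in chart_dom c then g j (c y) else 0.
pose K := chart_inv c @` closed_ball (c x) r2.
have KE y : closed_ball (c x) r2 y <-> `|y - c x| <= r2.
  by rewrite closed_ballE// /closed_ball_ /= distrC.
have Kcod y : closed_ball (c x) r2 y -> chart_cod c y.
  by move=> /KE h; apply: rc; apply: le_lt_trans h _; rewrite /r2; lra.
(* [f j] vanishes off the compact set [K]. Its closedness, from the Hausdorff property, makes the
   extension by [0] smooth outside the chart. *)
have clK : closed K.
  apply: compact_closed; first exact: manifold_hausdorff.
  apply: continuous_compact.
    apply: continuous_in_subspaceT => y; rewrite inE => /Kcod.
    exact: chart_inv_continuous.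
  apply: bounded_closed_compact; last exact: closed_ball_closed.
  exists (`|c x| + r2); split; first exact: num_real.
  move=> b bB y /KE yC; rewrite -(subrK (c x) y); apply: le_trans (ler_normD _ _) _.
  by apply: le_trans (ltW bB); rewrite addrC lerD2l.
have f0 j y : ~ K y -> f j y = 0.
  move=> nK; rewrite /f; case: ifPn => // /set_mem cy.
  rewrite /g bump_eq0 ?mul0r// leNgt; apply/negP => /ltW h; apply: nK.
  by exists (c y); [exact/KE|rewrite chart_mapK].
exists f; split=> [j T d k Md|].
  pose A1 : set (T * 'rV[R]_n) := cyl (transition_dom d c).
  pose A2 : set (T * 'rV[R]_n) := cyl (chart_cod d) `&` (fun z => chart_inv d z.2) @^-1` (~` K).
  have od : open (cyl (chart_cod d) : set (T * 'rV[R]_n)) by apply: open_cyl; exact: chart_cod_open.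
  have oA1 : open A1 by apply: open_cyl; exact: open_transition_dom.
  have oA2 : open A2.
    apply: (plot_open od _ (plot_chart_inv T 0 Md)); exact: closed_openC.
  apply: Ck_local => z dz; have [Kz|nK] := pselect (K (chart_inv d z.2)).
    exists A1.
      by split=> //; have [y /Kcod hy E] := Kz; rewrite /= -E; exact: chart_inv_dom.
    have CC : Ck k (fun z : T * 'rV[R]_n => g j (c (chart_inv d z.2))) A1.
      apply: (@Ck_comp0 _ _ _ _ _ (g j) (fun z : T * 'rV[R]_n => c (chart_inv d z.2)) A1 setT) => //.
      - exact: openT.
      - by apply: CkM; [apply: open_cyl; exact: openT|apply: Ck_bump; apply: open_cyl; exact: openT|exact: Ck_coord].
      - by move=> l; exact: transition_Ck.
    apply: Ck_ext CC => // y; rewrite inE => -[dy cy].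
    by rewrite /f mem_set.
  exists A2 => //; apply: Ck_ext (Ck_cst k 0 A2) => // y; rewrite inE => -[_ nKy].
  by rewrite f0.
have n1 := near_open_preimage (chart_map_continuous cx) (ball_open (c x) r1) (ballxx (c x) (_ : 0 < r1)).
have /n1 {}n1 : 0 < r1 by rewrite divr_gt0.
apply: filterS2 n1 (open_nbhs_nbhs (conj (chart_dom_open c) cx)) => y.
rewrite -ball_normE /ball_ /= distrC => yr cy; exists c; split=> // u.
have fE j : \forall v \near c y, f j (chart_inv c v) = v 0 j.
  have h1 := open_nbhs_nbhs (conj oc (chart_cod_in cy)).
  have h2 : \forall v \near c y, `|v - c x| < r1.
    apply/near_ballP; exists (r1 - `|c y - c x|); first by rewrite subr_gt0.
    move=> v; rewrite ltrBrDr => h; apply: le_lt_trans h.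
    by rewrite -(subrKA (c y)) ler_normD.
  apply: filterS2 h1 h2 => v cv vr; rewrite /f mem_set; last exact: chart_inv_dom.
  by rewrite chart_invK// /g bump_eq1 ?mul1r//; exact: ltW.
have DE j : 'D_u (fun y => f j (chart_inv c y)) (c y) = u 0 j.
  rewrite (near_eq_derive _ (fE j)).
  by have [_] := iffLR (is_derive_rowP _ _ _ _) (is_derive_id (c y) u) j.
under eq_bigr do rewrite DE.
move=> /eqP; rewrite psumr_eq0 => [/allP h|j _]; last exact: sqr_ge0.
apply/rowP => j; have := h j (mem_enum _ _); rewrite mxE sqrf_eq0.
by move=> /eqP.
Qed.

Lemma immersive_family : compact [set: M] ->
  exists (I : choiceType) (f : I -> M -> R) (l : seq I), (forall i, sfun (f i)) /\
    forall x, immersive f l x.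
Proof.
move=> cM.
have [F hF] : exists F : M -> 'I_n -> M -> R, forall x, (forall j, sfun (F x j)) /\
    \forall y \near x, immersive (F x) (enum 'I_n) y.
  exists (fun x => sval (cid (local_coordinates x))) => x.
  exact: (svalP (cid (local_coordinates x))).
pose f (i : M * 'I_n) := F i.1 i.2.
exists (M * 'I_n)%type, f.
(* As in [uniform_translates], the filter of the lists containing a given list turns the finite
   subcover into one finite family; immersivity survives enlarging the list because the summands are
   squares. *)
pose FF : set_system (seq M) :=
  [set P : set (seq M) | exists s0 : seq M, forall s : seq M, {subset s0 <= s} -> P s].
have fF : Filter FF.
  split; first by exists [::].
    move=> P Q [s1 h1] [s2 h2]; exists (s1 ++ s2) => s sub; split.
      by apply: h1 => a as1; apply: sub; rewrite mem_cat as1.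
    by apply: h2 => a as2; apply: sub; rewrite mem_cat as2 orbT.
  by move=> P Q PQ [s0 h]; exists s0 => s /h; exact: PQ.
have cov x : [set: M] x -> \forall y \near x & s \near FF,
    immersive f [seq (p, j) | p <- s, j <- enum 'I_n] y.
  move=> _; exists ([set y | immersive (F x) (enum 'I_n) y], [set s : seq M | x \in s]).
    by split=> /=; [exact: (hF x).2|exists [:: x] => s; apply; rewrite mem_head].
  move=> [y s] [/= [c [Mc cy h]] xs]; exists c; split=> // u E; apply: h.
  move: E; rewrite big_allpairs (big_rem x)//= => /eqP.
  rewrite paddr_eq0; last 2 first.
  - by apply: sumr_ge0 => j _; exact: sqr_ge0.
  - by apply: sumr_ge0 => p _; apply: sumr_ge0 => j _; exact: sqr_ge0.
  by move=> /andP[/eqP E _].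
have [s0 h] := (iffLR (compact_near_coveringP _) cM) _ _ _ fF cov.
exists [seq (p, j) | p <- s0, j <- enum 'I_n]; split=> [i|x]; first exact: (hF i.1).1.
exact: (h s0 (fun _ => id) x I).
Qed.

End ImmersionFamily.

(** * The equivariant centre of mass *)

Section HaarPositive.
Context {R : realType} {k : nat} {G : lieGroupType R k}.
Hypothesis compactG : compact [set: G].

(** If [F 1%g] were positive, the sum of finitely many right translates of [F] would be bounded
    below by a positive constant, although each of them has mean [0]. *)
Lemma haar_eq0 (F : G -> R) : continuous F -> (forall g, 0 <= F g) -> haar F = 0 -> F 1%g = 0.
Proof.
move=> cF F0 hF; apply/eqP; rewrite eq_le F0 andbT leNgt; apply/negP => F1.
have F12 : 0 < F 1%g / 2 by rewrite divr_gt0.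
have [s hs] := uniform_translates compactG cF F12.
have cFa a : continuous (fun x => F (x * a)%g).
  move=> x; apply: (@continuous_comp _ _ _ (fun x => (x * a)%g) F); last exact: cF.
  by apply: (@continuous_mulg _ _ _ _ id (cst a)); [exact: cvg_id|exact: cvg_cst].
have : F 1%g / 2 <= haar (fun x => \sum_(a <- s) F (x * a)%g).
  apply: haar_ge => // [x|x]; first by apply: continuous_sum_seq => a; exact: cFa.
  have [a as_ /(_ 1%g)] := hs x 1%g; rewrite !mulg1 ler_norml => /andP[h _].
  rewrite (big_rem a)//=; have : 0 <= \sum_(b <- rem a s) F (x * b)%g by exact: sumr_ge0.
  by move: h; move: (F (x * a)%g) (F 1%g) (\sum_(_ <- _) _) => p q r; lra.
rewrite haar_sum// big1 ?leNgt ?F12// => a _.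
by rewrite haar_shift.
Qed.

End HaarPositive.

Lemma is_derive_prod_zero (R : realType) (V : normedModType R) (a b : V -> R) x v (da : R) :
  is_derive x v a da -> derivable b x v -> a x = 0 -> is_derive x v (fun y => a y * b y) (da * b x).
Proof.
move=> ha hb a0.
have E (D : R) : a x *: (D : R^o) + b x *: (da : R^o) = da * b x.
  by rewrite a0 scale0r add0r; exact: mulrC.
by have := is_deriveM ha (derivableP hb); rewrite E; apply.
Qed.

Lemma is_derive_sum_seq (R : realType) (V : normedModType R) (I : Type) (l : seq I) (a : I -> V -> R) x v
    (da : I -> R) : (forall i, is_derive x v (a i) (da i)) ->
  is_derive x v (fun y => \sum_(i <- l) a i y) (\sum_(i <- l) da i).
Proof.
move=> h; elim: l => [|i l IH].
  by rewrite big_nil; under eq_fun do rewrite big_nil; exact: is_derive_cst.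
have -> : (fun y => \sum_(j <- i :: l) a j y) = a i + (fun y => \sum_(j <- l) a j y).
  by apply/funext => y; rewrite big_cons.
by rewrite big_cons; exact: is_deriveD.
Qed.

Lemma open_cod (R : realType) (n : nat) (M : manifoldType R n) (T : topologicalType) (c : chart R n M) :
  open (cyl (chart_cod c) : set (T * 'rV[R]_n)).
Proof. by apply: open_cyl; exact: chart_cod_open. Qed.
Arguments open_cod {R n M} T c.

Section CriticalPoints.
Context {R : realType} {k n : nat} {G : lieGroupType R k} {M : manifoldType R n}.
Notation P := (CrMap 2 (G * M)%type M).
Hypothesis compactG : compact [set: G].
Variables (rho0 : P) (I : Type) (f : I -> M -> R) (l : seq I).
Hypotheses (sf : forall i, sfun (f i)) (immf : forall x, immersive f l x).
Hypothesis act0 : group_action (rho0 : smoothMap (G * M)%type M).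
Implicit Types (c d : chart R n M) (s : I -> G -> R).

Let ev1 x : ev rho0 1%g x = x. Proof. exact: act0.1. Qed.
Let evM g h x : ev rho0 g (ev rho0 h x) = ev rho0 (g * h)%g x. Proof. exact: act0.2. Qed.

Definition orbitf c i (z : G * 'rV[R]_n) : R := f i (ev rho0 z.1 (chart_inv c z.2)).

(* [y] is a critical point of [y |-> haar_g sum_i (f_i (rho0 (g, y)) - s_i g)^2 / 2]. *)
Definition residual c s (y : 'rV[R]_n) (j : 'I_n) (g : G) : R :=
  \sum_(i <- l) (orbitf c i (g, y) - s i g) * pd j (orbitf c i) (g, y).

(** Criticality in one chart; [crit_chart] extends it to all charts around [y]. *)
Definition crit s (y : M) := exists c, [/\ atlas M c, chart_dom c y &
  forall j, haar (residual c s (c y) j) = 0].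

Lemma orbitf_Ck c i j : atlas M c -> Ck j (orbitf c i) (cyl (chart_cod c)).
Proof.
move=> Mc; have oc := open_cod G c; apply: sfun_plot => //.
have := @ev_plot R k n G M G R (fun _ => rho0) n j (fun _ => 0) id _ _ (evCk_cst _ rho0 j) oc (plot_chart_inv G j Mc).
by apply => z _; [exact: cvg_cst|exact: cvg_fst].
Qed.

Lemma smooth_ev rho g : smooth (ev (rho : P) g : M -> M).
Proof.
apply: (@plot_smooth R n M R 0) => c j Mc.
have := @ev_plot R k n G M R R (fun _ => rho) n j id (fun _ => g) _ _ (evCk_cst _ rho j) (open_cod R c) (plot_chart_inv R j Mc).
by apply => z _; [exact: cvg_fst|exact: cvg_cst].
Qed.

Lemma continuous_ev rho x : continuous (fun g => ev (rho : P) g x).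
Proof.
move=> g; have [cr _] := smooth_funP (rho : smoothMap (G * M)%type M).
apply: (@continuous_comp _ _ _ (fun g : G => (g, x)) (rho : smoothMap (G * M)%type M)); last exact: cr.
by apply: continuous_pair; [exact: cvg_id|exact: cvg_cst].
Qed.

Let continuous_left c (y : 'rV[R]_n) (F : G * 'rV[R]_n -> R) j : Ck j F (cyl (chart_cod c)) -> chart_cod c y ->
  continuous (fun g => F (g, y)).
Proof.
move=> cF cy g; apply: (@continuous_comp _ _ _ (fun g : G => (g, y)) F); last exact: (Ck_cont cF).
by apply: continuous_pair; [exact: cvg_id|exact: cvg_cst].
Qed.

Lemma residual_continuous c s y j : atlas M c -> chart_cod c y -> (forall i, continuous (s i)) ->
  continuous (residual c s y j).
Proof.
move=> Mc cy cs g; apply: continuous_sum_seq => i.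
have c1 := @continuous_left c y _ _ (orbitf_Ck i 0 Mc) cy.
have [_ /(_ j)[_ cj]] := orbitf_Ck i 1 Mc; have c2 := @continuous_left c y (pd j (orbitf c i)) 0 cj cy.
apply: (@continuousM _ _ (fun g => orbitf c i (g, y) - s i g) (fun g => pd j (orbitf c i) (g, y))); last exact: c2.
by apply: (@continuousB _ _ _ (fun g => orbitf c i (g, y)) (s i)); [exact: c1|exact: cs].
Qed.

(** Chart-free form of criticality: the first variation vanishes along every differentiable map
    through [y], being a combination of the residues by the chain rule. *)
Lemma crit_along s (y : M) (V : normedModType R) (q : V -> M) x u : (forall i, continuous (s i)) ->
  crit s y -> mdiff q x -> q x = y ->
  haar (fun g => \sum_(i <- l) (f i (ev rho0 g y) - s i g) * 'D_u (fun z => f i (ev rho0 g (q z))) x) = 0.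
Proof.
move=> cs [c [Mc cy h]] dq qx; have cqx : chart_dom c (q x) by rewrite qx.
pose v := 'D_u (fun z => c (q z)) x.
have E g : \sum_(i <- l) (f i (ev rho0 g y) - s i g) * 'D_u (fun z => f i (ev rho0 g (q z))) x
    = \sum_j v 0 j * residual c s (c y) j g.
  rewrite /residual; under [RHS]eq_bigr do rewrite mulr_sumr.
  rewrite exchange_big /=; apply: eq_bigr => i _.
  have sg : sfun (fun x => f i (ev rho0 g x)) by apply: sfun_smooth => //; exact: smooth_ev.
  have [_ ->] := sfun_mdiff u sg dq Mc cqx.
  rewrite deriveE_partials; last first.
    by have [] := Ck1_diff (open_cod R c) (sg R c 1%N Mc) (chart_cod_in cqx : cyl (chart_cod c) (0, c (q x))).
  rewrite mulr_sumr; apply: eq_bigr => j _; rewrite -/v qx pdE /orbitf /= chart_mapK//.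
  by rewrite mulrCA.
under eq_fun do rewrite E.
have cr j := @residual_continuous c s (c y) j Mc (chart_cod_in cy) cs.
rewrite haar_sum// => [|j]; last exact: continuous_scale.
by rewrite big1// => j _; rewrite haarZ// h mulr0.
Qed.

Lemma mdiff_chart_inv c y : atlas M c -> chart_cod c y -> mdiff (chart_inv c) y.
Proof.
move=> Mc cy; exact: (@plot_mdiff R n M R n (fun z => chart_inv c z.2) _ (0, y) (open_cod R c)
  (plot_chart_inv R 1 Mc) cy).
Qed.

(** Moving [y] by [h] amounts to replacing [g] by [g h] in the integral, and the Haar mean is right
    invariant. *)
Lemma crit_act s h y : (forall i, continuous (s i)) -> crit s (ev rho0 h y) ->
  crit (fun i g => s i (g * h^-1)%g) y.
Proof.
move=> cs cy; have [d Md dy] := @atlas_cover R n M y; exists d; split=> // j.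
have dq := mdiff_chart_inv Md (chart_cod_in dy).
have [dq' _] := mdiff_smooth (smooth_ev rho0 h) dq.
have qE : ev rho0 h (chart_inv d (d y)) = ev rho0 h y by rewrite chart_mapK.
have := crit_along 'e_j cs cy dq' qE.
have cs' i : continuous (fun g => s i (g * h^-1)%g).
  move=> g; apply: (@continuous_comp _ _ _ (fun x => (x * h^-1)%g) (s i)); last exact: cs.
  by apply: (@continuous_mulg _ _ _ _ id (cst (h^-1)%g)); [exact: cvg_id|exact: cvg_cst].
rewrite -(haar_shift compactG h (@residual_continuous d _ _ j Md (chart_cod_in dy) cs')).
apply: etrans; congr haar; apply/funext => g; apply: eq_bigr => i _.
rewrite /orbitf /= chart_mapK// evM mulgK pdE; congr (_ * _).
apply: (congr1 (fun F : 'rV[R]_n -> R => 'D_('e_j) F (d y))).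
by apply/funext => z /=; rewrite /fibre /= evM.
Qed.

Lemma crit_chart s c y j : (forall i, continuous (s i)) -> crit s y -> atlas M c -> chart_dom c y ->
  haar (residual c s (c y) j) = 0.
Proof.
move=> cs cy Mc dy; have dq := mdiff_chart_inv Mc (chart_cod_in dy).
have := crit_along 'e_j cs cy dq (chart_mapK dy).
apply: etrans; congr haar; apply/funext => g; apply: eq_bigr => i _.
by rewrite /orbitf /= chart_mapK// pdE.
Qed.

(* The Hessian, at a point where all the residues vanish. *)
Definition gram c (y : 'rV[R]_n) : 'M[R]_n := \matrix_(a, b)
  haar (fun g => \sum_(i <- l) pd a (orbitf c i) (g, y) * pd b (orbitf c i) (g, y)).

(** A vector in the kernel makes the Haar mean of a sum of squares vanish, so by [haar_eq0] those
    squares vanish at the neutral element, where [rho0] acts trivially and the immersion property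
    applies. *)
Lemma gram_unit c y : atlas M c -> chart_cod c y -> gram c y \in unitmx.
Proof.
move=> Mc cy; rewrite -row_free_unit; apply: inj_row_free => u u0.
have cp a i : continuous (fun g => pd a (orbitf c i) (g, y)).
  by have [_ /(_ a)[_ ca]] := orbitf_Ck i 1 Mc; exact: (@continuous_left c y (pd a (orbitf c i)) 0 ca cy).
have cpp a b : continuous (fun g => \sum_(i <- l) pd a (orbitf c i) (g, y) * pd b (orbitf c i) (g, y)).
  by move=> g; apply: continuous_sum_seq => i; exact: (continuousM (cp a i g) (cp b i g)).
pose D i g := \sum_a u 0 a * pd a (orbitf c i) (g, y).
have DD g : \sum_(i <- l) D i g ^+ 2 = \sum_a \sum_b u 0 a * u 0 b *
    \sum_(i <- l) pd a (orbitf c i) (g, y) * pd b (orbitf c i) (g, y).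
  under [RHS]eq_bigr do under eq_bigr do rewrite mulr_sumr.
  under [RHS]eq_bigr do rewrite exchange_big /=.
  rewrite exchange_big /=; apply: eq_bigr => i _; rewrite expr2 /D mulr_suml.
  apply: eq_bigr => a _; rewrite mulr_sumr; apply: eq_bigr => b _.
  by move: (u 0 a) (u 0 b) (pd a _ _) (pd b _ _) => p q r t; ring.
have cDD a : continuous (fun g => \sum_b u 0 a * u 0 b *
    \sum_(i <- l) pd a (orbitf c i) (g, y) * pd b (orbitf c i) (g, y)).
  by move=> g; apply: continuous_sum_seq => b; apply: continuous_scale; exact: cpp.
have hDD : haar (fun g => \sum_(i <- l) D i g ^+ 2) = 0.
  under eq_fun do rewrite DD.
  rewrite haar_sum//.
  transitivity (\sum_a \sum_b u 0 a * gram c y a b * u 0 b).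
    apply: eq_bigr => a _; rewrite haar_sum//; last by move=> b; apply: continuous_scale; exact: cpp.
    by apply: eq_bigr => b _; rewrite haarZ// mxE mulrAC.
  rewrite exchange_big big1//= => b _; rewrite -mulr_suml.
  by have /rowP/(_ b) := u0; rewrite !mxE => ->; rewrite mul0r.
have D1 : \sum_(i <- l) D i 1%g ^+ 2 = 0.
  apply: (haar_eq0 compactG _ _ hDD).
    have -> : (fun g => \sum_(i <- l) D i g ^+ 2) = (fun g => \sum_a \sum_b u 0 a * u 0 b *
      \sum_(i <- l) pd a (orbitf c i) (g, y) * pd b (orbitf c i) (g, y)) by apply/funext.
    by move=> g; apply: continuous_sum_seq => a; exact: cDD.
  by move=> g; apply: sumr_ge0 => i _; exact: sqr_ge0.
have [c' [Mc' c'y imm]] := immf (chart_inv c y).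
have dq := mdiff_chart_inv Mc cy.
have [_ chain] := mdiff_smooth smooth_id dq.
pose v := 'D_u (fun z => c' (chart_inv c z)) y.
have v0 : v = 0.
  apply: imm; rewrite -[RHS]D1; apply: eq_bigr => i _; congr (_ ^+ 2).
  have [_ E] := sfun_mdiff u (sf i) dq Mc' c'y.
  rewrite -/v in E; rewrite -E deriveE_partials; last first.
    by have [] := Ck1_diff (open_cod R c) (@sf i R c 1%N Mc) (cy : cyl (chart_cod c) (0, y)).
  apply: eq_bigr => a _; rewrite pdE; congr (_ * _).
  apply: (congr1 (fun F : 'rV[R]_n -> R => 'D_('e_a) F y)).
  by apply/funext => z /=; rewrite /fibre /orbitf /= ev1.
have := chain c' c Mc' Mc c'y (chart_inv_dom cy) u.
rewrite -/v v0 linear0 => <-.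
have nE : \forall z \near y, c (chart_inv c z) = z.
  have oc : open (chart_cod c) := @chart_cod_open R n M c.
  by apply: filterS (open_nbhs_nbhs (conj oc cy)) => z; exact: chart_invK.
by rewrite (near_eq_derive _ nE); have [_ ->] := is_derive_id y u.
Qed.

End CriticalPoints.

(** * Solving an equation uniformly near the diagonal *)

Section SolutionsNearDiagonal.
Context {R : realType} {n : nat} {M : manifoldType R n} {P Z : topologicalType}.
Variables (p0 : P) (b : Z -> M) (C : P * Z -> M -> Prop) (good : P * Z -> M -> Prop).

(* [C q y] is an equation for [y], solved by [b s] at the parameter [(p0, s)]. *)
Definition solvable_at (s : Z) : Prop := exists U : set M,
  [/\ open U, U (b s),
    \forall q \near (p0, s), forall y y', U y -> U y' -> C q y -> C q y' -> y = y',
    forall N, nbhs (b s, b s) N -> \forall q \near (p0, s), exists2 y, N (b q.2, y) & C q y &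
    forall phi : P * Z -> M, (\forall q \near (p0, s), C q (phi q) /\ U (phi q)) ->
      \forall q \near (p0, s), {for q, continuous phi} /\ good q (phi q)].

Section Chart.
Variables (s0 : Z) (c : chart R n M) (H : (P * Z) * 'rV[R]_n -> 'rV[R]_n) (B : set ((P * Z) * 'rV[R]_n)).
Let q0 : P * Z := (p0, s0).
Hypotheses (cb : {for s0, continuous b}) (cs0 : chart_dom c (b s0)) (oB : open B)
  (cH : forall j, Ck 1 (fun z => H z 0 j) B) (Bc : forall z, B z -> chart_cod c z.2)
  (HC : forall q y, chart_dom c y -> B (q, c y) -> C q y <-> H (q, c y) = 0)
  (Hgood : forall q y, chart_dom c y -> B (q, c y) -> vjacobian H (q, c y) \in unitmx -> good q y)
  (B0 : B (q0, c (b s0))) (H0 : H (q0, c (b s0)) = 0)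
  (uJ : vjacobian H (q0, c (b s0)) \in unitmx).

(** The implicit function theorem in a chart around [b s0]. Invertibility of the Jacobian persists
    near [q0] by continuity of the determinant along the solution, which gives [good]. *)
Lemma solvable_atP : solvable_at s0.
Proof.
have [r [W [ysol [r0 oW Wq0 h]]]] := implicit_function oB cH B0 H0 uJ.
pose U := chart_dom c `&` (fun y => c y) @^-1` ball (c (b s0)) r.
have UE y : U y <-> chart_dom c y /\ `|c y - c (b s0)| < r.
  by rewrite /U /= -ball_normE /ball_ /= distrC.
have oU : open U.
  apply: open_preimage_on; [exact: chart_dom_open|exact: ball_open|].
  exact: chart_map_continuous.
have nW : \forall q \near q0, W q by exact: (open_nbhs_nbhs (conj oW Wq0)).
have solE q y : W q -> U y -> C q y -> y = chart_inv c (ysol q).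
  move=> Wq /UE[cy yr] Cy; have [_ _ hB hu _] := h q Wq.
  have /HC E := hB _ yr; rewrite -(hu _ yr (iffLR (E cy) Cy)); exact/esym/chart_mapK.
have yc q : W q -> chart_cod c (ysol q).
  by move=> Wq; have [hr _ hB _ _] := h q Wq; exact: (Bc (hB _ hr)).
have Usol q : W q -> U (chart_inv c (ysol q)).
  move=> Wq; have [hr _ _ _ _] := h q Wq; apply/UE.
  by rewrite chart_invK; [split=> //; exact/chart_inv_dom/yc|exact: yc].
have Csol q : W q -> C q (chart_inv c (ysol q)).
  move=> Wq; have [hr h0 hB _ _] := h q Wq; have Wc := yc q Wq.
  by apply/HC; rewrite ?chart_invK//; [exact: chart_inv_dom|exact: hB].
have csol q : W q -> {for q, continuous (fun q => chart_inv c (ysol q))}.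
  move=> Wq; have [_ _ _ _ cy] := h q Wq.
  by apply: (@continuous_comp _ _ _ ysol (chart_inv c)) => //; exact/chart_inv_continuous/yc.
have y0 : ysol q0 = c (b s0).
  have [_ _ _ hu _] := h q0 Wq0; apply/esym/hu => //.
  by rewrite subrr normr0.
exists U; split=> //.
- by apply/UE; rewrite subrr normr0.
- by apply: filterS nW => q Wq y y' Uy Uy' /(solE q y Wq Uy) -> /(solE q y' Wq Uy') ->.
- move=> N nN.
  have cc : {for q0, continuous (fun q : P * Z => (b q.2, chart_inv c (ysol q)))}.
    apply: continuous_pair; last exact: csol.
    by apply: (@continuous_comp _ _ _ snd b); [exact: cvg_snd|exact: cb].
  have n1 : \forall q \near q0, N (b q.2, chart_inv c (ysol q)).
    by apply: cc; rewrite /= y0 chart_mapK.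
  by apply: filterS2 nW n1 => q Wq Nq; exists (chart_inv c (ysol q)) => //; exact: Csol.
move=> phi nphi.
have phiE : \forall q \near q0, W q /\ phi q = chart_inv c (ysol q).
  by apply: filterS2 nW nphi => q Wq [Cq Uq]; split=> //; exact: solE.
pose J := vjacobian H; pose D q := \det (J (q, ysol q)).
have cD : {for q0, continuous D}.
  have CJ i j : Ck 0 (fun z => J z i j) B.
    have [_ /(_ i)[_ ci]] := cH j.
    by apply: (@Ck_ext _ _ _ 0 (pd i (fun z => H z 0 j))) ci => // z _; rewrite /J /vjacobian mxE.
  have Cd := Ck_det oB CJ.
  apply: (@continuous_comp _ _ _ (fun q => (q, ysol q)) (fun z => \det (J z))).
    by apply: continuous_pair; [exact: cvg_id|have [] := h q0 Wq0].
  by apply: (Ck_cont Cd); rewrite y0.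
have D0 : \forall q \near q0, D q != 0.
  have Dq0 : D q0 != 0 by rewrite /D y0 -unitfE -unitmxE.
  have D2 : 0 < `|D q0| by rewrite normr_gt0.
  have /cvgrPdist_lt/(_ _ D2) := cD; apply: filterS => q; apply: contraTneq => ->.
  by rewrite subr0 ltxx.
have phiN : \forall q \near q0, {for q, continuous phi}.
  apply: filterS2 (nbhs_interior phiE) nW => q nq Wq.
  apply: near_eq_continuous (csol q Wq).
  by move: nq; rewrite /interior /=; apply: filterS => p [].
apply: filterS3 phiN phiE D0 => q cq [Wq E] Dq; split=> //; rewrite E.
have [hr _ hB _ _] := h q Wq; have Wc := yc q Wq.
apply: Hgood; rewrite ?chart_invK//; [exact: chart_inv_dom|exact: hB|].
by rewrite unitmxE unitfE.
Qed.

End Chart.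

Section Compact.
Hypotheses (compactM : compact [set: M]) (cb : continuous b).

(** A neighbourhood of the diagonal measures, without a metric, how close a solution is to [b s]. *)
Definition diag_nbhs (N : set (M * M)) : Prop := forall x : M, nbhs (x, x) N.

(** Filter of the properties that hold for all small enough neighbourhoods of the diagonal:
    compactness can then choose [N] together with the neighbourhood of [p0]. *)
Let small : set_system (set (M * M)) := [set Q : set (set (M * M)) | exists2 N0 : set (M * M),
  diag_nbhs N0 & forall N, N `<=` N0 -> Q N].

Let small_filter : Filter small.
Proof.
split; first by exists setT => // x; exact: filterT.
  move=> Q1 Q2 [N1 d1 h1] [N2 d2 h2]; exists (N1 `&` N2) => [x|N NN]; first by apply: filterI.
  by split; [apply: h1|apply: h2] => z /NN[].
by move=> Q1 Q2 Q12 [N1 d1 h1]; exists N1 => // N /h1; exact: Q12.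
Qed.

Lemma unique_near_diagonal (K : set Z) : compact K -> (forall s, K s -> solvable_at s) ->
  exists2 N, diag_nbhs N & \forall p \near p0, forall s, K s -> forall y y',
    N (b s, y) -> N (b s, y') -> C (p, s) y -> C (p, s) y' -> y = y'.
Proof.
move=> cK solK.
have cov s : K s -> \forall s' \near s & i \near filter_prod (nbhs p0) small,
    forall y y', i.2 (b s', y) -> i.2 (b s', y') -> C (i.1, s') y -> C (i.1, s') y' -> y = y'.
  move=> Ks; have [U [oU Us huniq _ _]] := solK s Ks.
  have [V nV VU] : exists2 V, nbhs (b s) V & closure V `<=` U.
    have := @compact_regular M (b s) setT manifold_hausdorff compactM filterT U (open_nbhs_nbhs (conj oU Us)).
    by move=> [V nV VU]; exists V.
  (* The second point is constrained only when the first lies in [closure V]; elsewhere [N0] is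
     everything, so it is a neighbourhood of the whole diagonal. *)
  pose N0 : set (M * M) := [set z | closure V z.1 -> U z.2].
  have dN0 : diag_nbhs N0.
    move=> x; have [Vx|nVx] := pselect (closure V x).
      exists (setT, U); first by split; [exact: filterT|exact: open_nbhs_nbhs (conj oU (VU _ Vx))].
      by move=> [z1 z2] [_ /= Uz] _.
    exists (~` closure V, setT).
      split; last exact: filterT.
      by apply: open_nbhs_nbhs; split=> //; apply: closed_openC; exact: closed_closure.
    by move=> [z1 z2] [/= nz _] /nz.
  have [[A1 A2] /= [nA1 nA2] A12] := huniq.
  have nVs : \forall s' \near s, V (b s') by exact: (cb nV).
  exists (A2 `&` [set s' | V (b s')], [set i : P * set (M * M) | A1 i.1 /\ i.2 `<=` N0]).
    split=> /=; first exact: filterI.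
    by exists (A1, [set N | N `<=` N0]) => //; split=> //; exists N0.
  move=> [s' [p N]] [/= [As' Vs'] [Ap NN0]] y y' Ny Ny'.
  exact: (A12 (p, s') (conj Ap As') y y' (NN0 _ Ny (subset_closure Vs')) (NN0 _ Ny' (subset_closure Vs'))).
have hh : filter_prod (nbhs p0) small (fun i => K `<=` (fun s => forall y y',
    i.2 (b s, y) -> i.2 (b s, y') -> C (i.1, s) y -> C (i.1, s) y' -> y = y')).
  exact: ((iffLR (compact_near_coveringP _) cK) _ _ _ (filter_prod_filter _ _) cov).
have [[A1 QN] /= [nA1 [N0 dN0 hN0]] h] := hh; exists N0 => //; apply: filterS nA1 => p Ap s Ks.
exact: (h (p, N0) (conj Ap (hN0 N0 (@subset_refl _ _))) s Ks).
Qed.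

Lemma exists_near_diagonal (K : set Z) N : compact K -> (forall s, K s -> solvable_at s) -> diag_nbhs N ->
  \forall p \near p0, forall s, K s -> exists2 y, N (b s, y) & C (p, s) y.
Proof.
move=> cK solK dN.
apply: (iffLR (compact_near_coveringP _) cK) => s Ks.
have [U [oU Us _ hex _]] := solK s Ks.
have [[A1 A2] /= [nA1 nA2] A12] := hex N (dN _).
by exists (A2, A1) => // -[s' p] [/= As' Ap]; exact: (A12 (p, s') (conj Ap As')).
Qed.

(** [phi] is any selection of the unique solution. Near [s] there is a solution in [N1], inside both
    [N] and the local uniqueness set; by uniqueness it is [phi], to which the last clause of
    [solvable_at] applies. *)
Lemma continuous_near_diagonal (K K' : set Z) N (phi : P * Z -> M) : compact K' -> K' `<=` K° ->
  (forall s, K s -> solvable_at s) -> diag_nbhs N ->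
  (\forall p \near p0, forall s, K s -> [/\ N (b s, phi (p, s)), C (p, s) (phi (p, s)) &
     forall y, N (b s, y) -> C (p, s) y -> y = phi (p, s)]) ->
  \forall p \near p0, forall s, K' s -> {for (p, s), continuous phi} /\ good (p, s) (phi (p, s)).
Proof.
move=> cK' KK solK dN hphi.
apply: (iffLR (compact_near_coveringP _) cK') => s K's.
have Ks : K s by apply: nbhs_singleton; exact: KK.
have [U [oU Us _ hex hcont]] := solK s Ks.
pose N1 : set (M * M) := N `&` [set z | U z.2].
have nN1 : nbhs (b s, b s) N1.
  apply: filterI => //.
  by exists (setT, U); [split; [exact: filterT|exact: open_nbhs_nbhs (conj oU Us)]|move=> [z1 z2] []].
have n1 := hex N1 nN1.
have n2 : \forall q \near (p0, s), K q.2.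
  by exists (setT, K); [split; [exact: filterT|exact: KK]|move=> [z1 z2] []].
have n3 : \forall q \near (p0, s), forall s, K s -> [/\ N (b s, phi (q.1, s)), C (q.1, s) (phi (q.1, s)) &
     forall y, N (b s, y) -> C (q.1, s) y -> y = phi (q.1, s)].
  by exists ([set p | forall s, K s -> [/\ N (b s, phi (p, s)), C (p, s) (phi (p, s)) &
     forall y, N (b s, y) -> C (p, s) y -> y = phi (p, s)]], setT);
     [split; [exact: hphi|exact: filterT]|move=> [z1 z2] []].
have n4 : \forall q \near (p0, s), C q (phi q) /\ U (phi q).
  apply: filterS3 n1 n2 n3 => -[p s'] /= [y [Ny Uy] Cy] Ks' /(_ s' Ks')[_ Cphi uphi].
  by split=> //; rewrite -(uphi y Ny Cy).
have [[A1 A2] /= [nA1 nA2] A12] := hcont phi n4.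
by exists (A2, A1) => // -[s' p] [/= As' Ap]; exact: (A12 (p, s') (conj Ap As')).
Qed.

End Compact.
End SolutionsNearDiagonal.

Lemma derive_affine (R : realType) (V W U : normedModType R) (F : W -> U) (A : V -> W) (y v : V) (u : W) :
  (forall h : R, A (h *: v + y) = h *: u + A y) -> 'D_v (fun y => F (A y)) y = 'D_u F (A y).
Proof.
move=> hA; rewrite /derive.
suff -> : (fun h : R => h^-1 *: (((fun y => F (A y)) \o shift y) (h *: v) - F (A y))) =
  (fun h => h^-1 *: ((F \o shift (A y)) (h *: u) - F (A y))) by [].
by apply/funext => h /=; rewrite hA.
Qed.

Section Submatrices.
Context {R : realType} {p q : nat}.

Lemma is_derive_lsubmx (x v : 'rV[R]_(p + q)) : is_derive x v lsubmx (lsubmx v).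
Proof.
apply/is_derive_rowP => j; rewrite mxE; under eq_fun do rewrite mxE.
exact: (iffLR (is_derive_rowP _ _ _ _) (is_derive_id x v) _).
Qed.

Lemma is_derive_rsubmx (x v : 'rV[R]_(p + q)) : is_derive x v rsubmx (rsubmx v).
Proof.
apply/is_derive_rowP => j; rewrite mxE; under eq_fun do rewrite mxE.
exact: (iffLR (is_derive_rowP _ _ _ _) (is_derive_id x v) _).
Qed.

Lemma rsubmx_delta_r i : rsubmx ('e_(rshift p i) : 'rV[R]_(p + q)) = 'e_i.
Proof. by apply/rowP => j; rewrite !mxE eq_rshift. Qed.

Lemma rsubmx_delta_l i : rsubmx ('e_(lshift q i) : 'rV[R]_(p + q)) = 0.
Proof. by apply/rowP => j; rewrite !mxE eq_rlshift andbF. Qed.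

Lemma lsubmx_delta_l i : lsubmx ('e_(lshift q i) : 'rV[R]_(p + q)) = 'e_i.
Proof. by apply/rowP => j; rewrite !mxE eq_lshift. Qed.

Lemma lsubmx_delta_r i : lsubmx ('e_(rshift p i) : 'rV[R]_(p + q)) = 0.
Proof. by apply/rowP => j; rewrite !mxE eq_lrshift andbF. Qed.

Lemma Ck_row_mx (T : topologicalType) (m k : nat) (F : T * 'rV[R]_m -> 'rV[R]_p)
    (H : T * 'rV[R]_m -> 'rV[R]_q) A :
  (forall j, Ck k (fun z => F z 0 j) A) -> (forall j, Ck k (fun z => H z 0 j) A) ->
  forall j, Ck k (fun z => row_mx (F z) (H z) 0 j) A.
Proof.
move=> cF cH j; rewrite -(splitK j); case: (fintype.split j) => l /=.
  by under [X in Ck k X _]eq_fun do rewrite row_mxEl; exact: cF.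
by under [X in Ck k X _]eq_fun do rewrite row_mxEr; exact: cH.
Qed.

Lemma Ck_lsubmx (T : topologicalType) (m k : nat) (F : T * 'rV[R]_m -> 'rV[R]_(p + q)) A :
  (forall j, Ck k (fun z => F z 0 j) A) -> forall j, Ck k (fun z => lsubmx (F z) 0 j) A.
Proof. by move=> cF j; under [X in Ck k X _]eq_fun do rewrite mxE; exact: cF. Qed.

Lemma Ck_rsubmx (T : topologicalType) (m k : nat) (F : T * 'rV[R]_m -> 'rV[R]_(p + q)) A :
  (forall j, Ck k (fun z => F z 0 j) A) -> forall j, Ck k (fun z => rsubmx (F z) 0 j) A.
Proof. by move=> cF j; under [X in Ck k X _]eq_fun do rewrite mxE; exact: cF. Qed.

End Submatrices.

Lemma plot_inv_comp (R : realType) (n : nat) (M : manifoldType R n) (T : topologicalType) (m k : nat)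
    (c : chart R n M) (F : T * 'rV[R]_m -> 'rV[R]_n) A : atlas M c -> open A ->
  (forall z, A z -> chart_cod c (F z)) -> (forall j, Ck k (fun z => F z 0 j) A) ->
  plot k (fun z => chart_inv c (F z)) A.
Proof.
move=> Mc oA FA cF.
have := @plot_comp R n M T T n m k (fun z => chart_inv c z.2) (cyl (chart_cod c)) id F A.
apply => //.
- exact: open_cod.
- exact: plot_chart_inv.
- by move=> z _; exact: cvg_fst.
Qed.

Section CriticalEquation.
Context {R : realType} {k n : nat} {G : lieGroupType R k} {M : manifoldType R n}.
Notation P := (CrMap 2 (G * M)%type M).
Hypothesis compactG : compact [set: G].
Variables (rho0 : P) (I : Type) (f : I -> M -> R) (l : seq I).
Hypotheses (sf : forall i, sfun (f i)) (immf : forall x, immersive f l x).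
Hypothesis act0 : group_action (rho0 : smoothMap (G * M)%type M).
Implicit Types (c : chart R n M) (rho : P).

Definition target rho (t : R) (x : M) (i : I) (g : G) : R :=
  (1 - t) * f i (ev rho0 g x) + t * f i (ev rho g x).

Lemma target_continuous rho t x i : continuous (target rho t x i).
Proof.
have cfe r : continuous (fun g => f i (ev (r : P) g x)).
  move=> g; apply: (@continuous_comp _ _ _ (fun g => ev r g x) (f i)); first exact: continuous_ev.
  exact: sfun_continuous.
have c1 := @continuous_scale R k G (1 - t) _ (cfe rho0).
have c2 := @continuous_scale R k G t _ (cfe rho).
by move=> g; exact: (continuousD (c1 g) (c2 g)).
Qed.

Definition ptT (w : 'rV[R]_(1 + n + n)) : R := (lsubmx (lsubmx w)) 0 0.
Definition ptX (w : 'rV[R]_(1 + n + n)) : 'rV[R]_n := rsubmx (lsubmx w).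
Definition ptY (w : 'rV[R]_(1 + n + n)) : 'rV[R]_n := rsubmx w.

(* The unknown is the last block of coordinates, or the middle one when [sw]. *)
Definition pt (sw : bool) (t : R) (x u : 'rV[R]_n) : 'rV[R]_(1 + n + n) :=
  if sw then row_mx (row_mx (const_mx t) u) x else row_mx (row_mx (const_mx t) x) u.

Definition sel (sw : bool) (i : 'I_n) : 'I_(1 + n + n) :=
  if sw then lshift n (rshift 1 i) else rshift (1 + n) i.

Lemma ptTE sw t x u : ptT (pt sw t x u) = t.
Proof. by case: sw; rewrite /ptT /pt !row_mxKl mxE. Qed.
Lemma ptXE sw t x u : ptX (pt sw t x u) = if sw then u else x.
Proof. by case: sw; rewrite /ptX /pt !row_mxKl row_mxKr. Qed.
Lemma ptYE sw t x u : ptY (pt sw t x u) = if sw then x else u.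
Proof. by case: sw; rewrite /ptY /pt !row_mxKr. Qed.

Lemma pt_affine sw t x u i (h : R) : pt sw t x (h *: 'e_i + u) = h *: 'e_(sel sw i) + pt sw t x u.
Proof.
case: sw; rewrite /pt /sel.
  have -> : ('e_(lshift n (rshift 1 i)) : 'rV[R]_(1 + n + n)) = row_mx (row_mx 0 'e_i) 0.
    rewrite -[LHS]hsubmxK lsubmx_delta_l rsubmx_delta_l; congr row_mx.
    by rewrite -[LHS](@hsubmxK _ 1 1 n) lsubmx_delta_r rsubmx_delta_r.
  by rewrite !scale_row_mx !add_row_mx !scaler0 !add0r.
have -> : ('e_(rshift (1 + n) i) : 'rV[R]_(1 + n + n)) = row_mx 0 'e_i.
  by rewrite -[LHS]hsubmxK rsubmx_delta_r lsubmx_delta_r.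
by rewrite scale_row_mx add_row_mx scaler0 add0r.
Qed.

Lemma Ck_pt (T : topologicalType) (m j : nat) sw (t : T * 'rV[R]_m -> R) (x u : T * 'rV[R]_m -> 'rV[R]_n) A :
  Ck j t A -> (forall i, Ck j (fun z => x z 0 i) A) -> (forall i, Ck j (fun z => u z 0 i) A) ->
  forall i, Ck j (fun z => pt sw (t z) (x z) (u z) 0 i) A.
Proof.
move=> ct cx cu; have cc i : Ck j (fun z => (const_mx (t z) : 'rV[R]_1) 0 i) A.
  by under [X in Ck j X _]eq_fun do rewrite mxE.
by case: sw; apply: Ck_row_mx => //; apply: Ck_row_mx.
Qed.

Section Parametrized.
Context {T : topologicalType}.
Variables (r : T -> P) (m : nat).
Hypothesis er : evCk r m.

Definition critmap c (z : T * 'rV[R]_(1 + n + n)) : 'rV[R]_n := \row_j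
  haar (residual rho0 f l c (target (r z.1) (ptT z.2) (chart_inv c (ptX z.2))) (ptY z.2) j).

Definition crit_dom c : set (T * 'rV[R]_(1 + n + n)) :=
  [set z | chart_cod c (ptX z.2) /\ chart_cod c (ptY z.2)].

Lemma Ck_ptX (S : topologicalType) j i A : Ck j (fun z : S * 'rV[R]_(1 + n + n) => ptX z.2 0 i) A.
Proof. by apply: Ck_rsubmx; apply: Ck_lsubmx => a; exact: Ck_coord. Qed.

Lemma Ck_ptY (S : topologicalType) j i A : Ck j (fun z : S * 'rV[R]_(1 + n + n) => ptY z.2 0 i) A.
Proof. by apply: Ck_rsubmx => a; exact: Ck_coord. Qed.

Lemma open_crit_dom c : open (crit_dom c).
Proof.
have oc : open (chart_cod c) := @chart_cod_open R n M c.
apply: openI; apply: open_comp => // z _; apply/continuous_coord => i.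
  exact: (Ck_cont (@Ck_ptX T 0 i setT)).
exact: (Ck_cont (@Ck_ptY T 0 i setT)).
Qed.

Definition integrand c j (z : (T * G) * 'rV[R]_(1 + n + n)) : R :=
  residual rho0 f l c (target (r z.1.1) (ptT z.2) (chart_inv c (ptX z.2))) (ptY z.2) j z.1.2.

Lemma integrand_Ck c j : atlas M c -> Ck m (integrand c j) (with_group (crit_dom c)).
Proof.
move=> Mc; have oA := @open_with_group R k G T _ _ (@open_crit_dom c).
set A := with_group _ in oA *.
have pX : plot m (fun z : (T * G) * 'rV[R]_(1 + n + n) => chart_inv c (ptX z.2)) A.
  by apply: plot_inv_comp => // [z [cx _]|i] //; exact: Ck_ptX.
have pY : plot m (fun z : (T * G) * 'rV[R]_(1 + n + n) => chart_inv c (ptY z.2)) A.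
  by apply: plot_inv_comp => // [z [_ cy]|i] //; exact: Ck_ptY.
have c11 (z : (T * G) * 'rV[R]_(1 + n + n)) : {for z, continuous (fst \o fst)}.
  by apply: (@continuous_comp _ _ _ fst fst); exact: cvg_fst.
have c12 (z : (T * G) * 'rV[R]_(1 + n + n)) : {for z, continuous (snd \o fst)}.
  by apply: (@continuous_comp _ _ _ fst snd); [exact: cvg_fst|exact: cvg_snd].
have pe (S : topologicalType) (r' : S -> P) (a : T * G -> S) p : evCk r' m -> plot m p A ->
    (forall z : (T * G) * 'rV[R]_(1 + n + n), A z -> {for z, continuous (a \o fst)}) ->
    plot m (fun z => ev (r' (a z.1)) z.1.2 (p z)) A.
  by move=> er' pp ca; apply: (@ev_plot R k n G M _ _ r' _ m a snd p A) => // z _; exact: c12.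
have e0 p : plot m p A -> plot m (fun z => ev rho0 z.1.2 (p z)) A.
  move=> pp; apply: (pe R (fun=> rho0) (fun=> 0) p _ pp); first exact: evCk_cst.
  by move=> z _; exact: cvg_cst.
have e1 p : plot m p A -> plot m (fun z => ev (r z.1.1) z.1.2 (p z)) A.
  by move=> pp; apply: (pe T r fst p er pp) => z _; exact: c11.
have ct : Ck m (fun z : (T * G) * 'rV[R]_(1 + n + n) => ptT z.2) A.
  by apply: Ck_lsubmx; apply: Ck_lsubmx => a; exact: Ck_coord.
apply: Ck_sum => // i _; apply: CkM => //.
  apply: CkB => //; first by apply: sfun_plot => //; exact: e0.
  apply: CkD => //; apply: CkM => //.
  - by apply: CkB => //; exact: Ck_cst.
  - by apply: sfun_plot => //; exact: e0.
  - by apply: sfun_plot => //; exact: e1.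
have [_ /(_ j)[_ cj]] := orbitf_Ck rho0 sf i m.+1 Mc.
exact: (@Ck_comp R (T * G)%type G n (1 + n + n) m (pd j (orbitf rho0 f c i)) (cyl (chart_cod c)) snd
  (fun z => ptY z.2) A oA (open_cod G c) (fun z (Az : A z) => Az.2) (fun z _ => c12 z)
  (fun i' => Ck_ptY m i' A) cj).
Qed.

Lemma critmap_Ck c j : atlas M c -> Ck m (fun z => critmap c z 0 j) (crit_dom c).
Proof.
move=> Mc; have := Ck_haar_mean compactG (@open_crit_dom c) (integrand_Ck j Mc).
by apply: Ck_ext => [|z _]; [exact: open_crit_dom|rewrite mxE].
Qed.

Definition critjac sw c (z : T * 'rV[R]_(1 + n + n)) : 'M[R]_n :=
  \matrix_(i, j) pd (sel sw i) (fun z => critmap c z 0 j) z.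

(** At [rho0] the target is the orbit of [x] itself for every [t], so on the diagonal the first
    factor of each residue vanishes and only its derivative survives: the Jacobian is the Gram
    matrix, with opposite sign when [x] is the unknown. *)
Lemma critjac_unit sw c z : (0 < m)%N -> atlas M c -> r z.1 = rho0 -> ptX z.2 = ptY z.2 ->
  chart_cod c (ptY z.2) -> critjac sw c z \in unitmx.
Proof.
move=> m0 Mc rz XY cY.
have Az : crit_dom c z by split; rewrite ?XY.
have oA := @open_crit_dom c.
pose sg : R := if sw then -1 else 1.
have opd i : Ck 1 (orbitf rho0 f c i) (cyl (chart_cod c)) by exact: orbitf_Ck.
have opd2 i j : Ck 1 (pd j (orbitf rho0 f c i)) (cyl (chart_cod c)).
  by have [_ /(_ j)[_ h]] := orbitf_Ck rho0 sf i 2 Mc.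
have dF (F : G * 'rV[R]_n -> R) g : Ck 1 F (cyl (chart_cod c)) -> differentiable (fibre F g) (ptY z.2).
  by move=> cF; have [] := Ck1_diff (open_cod G c) cF (cY : cyl (chart_cod c) (g, ptY z.2)).
suff E : critjac sw c z = sg *: gram rho0 f l c (ptY z.2).
  rewrite E unitmxZ; first exact: gram_unit.
  by rewrite /sg; case: (sw); rewrite ?unitrN unitr1.
apply/matrixP => a j; rewrite !mxE.
have [_ dE] := haar_mean_derive compactG (sel sw a) oA (Ck_le m0 (integrand_Ck j Mc)) Az.
have -> : pd (sel sw a) (fun z => critmap c z 0 j) z = 'D_('e_(sel sw a)) (fibre (haar_mean (integrand c j)) z.1) z.2.
  rewrite pdE; apply: (congr1 (fun F : 'rV[R]_(1 + n + n) -> R => 'D_('e_(sel sw a)) F z.2)).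
  by apply/funext => w; rewrite /fibre mxE.
rewrite dE /haar_mean.
have cg : continuous (fun g => \sum_(i <- l) pd a (orbitf rho0 f c i) (g, ptY z.2) * pd j (orbitf rho0 f c i) (g, ptY z.2)).
  move=> g; apply: continuous_sum_seq => i.
  have cp b : {for g, continuous (fun g => pd b (orbitf rho0 f c i) (g, ptY z.2))}.
    apply: (@continuous_comp _ _ _ (fun g : G => (g, ptY z.2)) (pd b (orbitf rho0 f c i))); last exact: (Ck_cont (opd2 i b)).
    by apply: continuous_pair; [exact: cvg_id|exact: cvg_cst].
  exact: (continuousM (cp a) (cp j)).
rewrite -haarZ//; congr haar; apply/funext => g; rewrite pdE mulr_sumr.
have FE : fibre (integrand c j) ((z.1, g), z.2).1 = fun w => \sum_(i <- l)
    (fibre (orbitf rho0 f c i) g (ptY w) - fibre (orbitf rho0 f c i) g (ptX w)) *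
    fibre (pd j (orbitf rho0 f c i)) g (ptY w).
  apply/funext => w; apply: eq_bigr => i _; rewrite /target /= rz; congr (_ * _).
  by rewrite /fibre /orbitf /=; move: (f i _) (f i _) (ptT w) => p q s; ring.
rewrite FE /=.
have dY : is_derive z.2 'e_(sel sw a) ptY (if sw then 0 else 'e_a : 'rV[R]_n).
  have := is_derive_rsubmx z.2 'e_(sel sw a).
  by rewrite /sel; case: (sw); rewrite ?rsubmx_delta_l ?rsubmx_delta_r.
have dX : is_derive z.2 'e_(sel sw a) ptX (if sw then 'e_a : 'rV[R]_n else 0).
  apply/is_derive_rowP => j'; rewrite /ptX; under eq_fun do rewrite mxE.
  have <- : lsubmx ('e_(sel sw a) : 'rV[R]_(1 + n + n)) 0 (rshift 1 j') = (if sw then 'e_a : 'rV[R]_n else 0) 0 j'.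
    by rewrite /sel; case: (sw); rewrite ?lsubmx_delta_l ?lsubmx_delta_r !mxE// eq_rshift.
  exact: (iffLR (is_derive_rowP _ _ _ _) (is_derive_lsubmx _ _) _).
have linE (L : {linear 'rV[R]_n -> R^o}) : L (if sw then 0 else 'e_a) - L (if sw then 'e_a else 0) = sg * L 'e_a.
  rewrite /sg; case: (sw); rewrite linear0.
    by rewrite sub0r; exact: (esym (mulN1r (L 'e_a : R))).
  by rewrite subr0; exact: (esym (mul1r (L 'e_a : R))).
have ch (F : G * 'rV[R]_n -> R) (L : 'rV[R]_(1 + n + n) -> 'rV[R]_n) d : Ck 1 F (cyl (chart_cod c)) ->
    L z.2 = ptY z.2 -> is_derive z.2 'e_(sel sw a) L d ->
    is_derive z.2 'e_(sel sw a) (fun w => fibre F g (L w)) ('d (fibre F g) (ptY z.2) d).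
  move=> cF LE [dL <-]; rewrite -LE; apply: is_derive_chain => //.
  by rewrite LE; exact: dF.
have dd i : is_derive z.2 'e_(sel sw a) (fun w => fibre (orbitf rho0 f c i) g (ptY w) - fibre (orbitf rho0 f c i) g (ptX w))
    (sg * pd a (orbitf rho0 f c i) (g, ptY z.2)).
  have := is_deriveB (ch _ _ _ (opd i) erefl dY) (ch _ _ _ (opd i) XY dX).
  have -> : pd a (orbitf rho0 f c i) (g, ptY z.2) = 'd (fibre (orbitf rho0 f c i) g) (ptY z.2) 'e_a.
    by rewrite pdE deriveE//; exact: dF.
  by rewrite -linE.
have db i : derivable (fun w => fibre (pd j (orbitf rho0 f c i)) g (ptY w)) z.2 'e_(sel sw a).
  by have [] := ch _ _ _ (opd2 i j) erefl dY.
have d0 i : fibre (orbitf rho0 f c i) g (ptY z.2) - fibre (orbitf rho0 f c i) g (ptX z.2) = 0.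
  by rewrite XY subrr.
have dsum := is_derive_sum_seq l (fun i => is_derive_prod_zero (dd i) (db i) (d0 i)).
have [_ ->] := dsum; apply: eq_bigr => i _; exact: esym (mulrA _ _ _).
Qed.

End Parametrized.
End CriticalEquation.

Lemma vjacobianE (R : realType) (Q : topologicalType) (n : nat) (H : Q * 'rV[R]_n -> 'rV[R]_n) z i j :
  vjacobian H z i j = pd i (fun z => H z 0 j) z.
Proof. by rewrite mxE. Qed.

Lemma matrix_of_entries (R : Type) (m n : nat) (F : 'I_m -> 'I_n -> R) (A : 'M[R]_(m, n)) :
  (forall i j, F i j = A i j) -> \matrix_(i, j) F i j = A.
Proof. by move=> FA; apply/matrixP => i j; rewrite mxE. Qed.

Section CenterMap.
Context {R : realType} {k n : nat} {G : lieGroupType R k} {M : manifoldType R n}.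
Notation P := (CrMap 2 (G * M)%type M).
Hypotheses (compactG : compact [set: G]) (compactM : compact [set: M]).
Variables (rho0 : P) (I : Type) (f : I -> M -> R) (l : seq I).
Hypotheses (sf : forall i, sfun (f i)) (immf : forall x, immersive f l x).
Hypothesis act0 : group_action (rho0 : smoothMap (G * M)%type M).
Implicit Types (c : chart R n M) (rho : P) (N : set (M * M)).

Let tg := target rho0 f.
Let cmap (T : topologicalType) (r : T -> P) := critmap rho0 f l r.
Let cjac (T : topologicalType) (r : T -> P) := critjac rho0 f l r.

(* [sw] exchanges the roles of the point [x] and of its centre [y]. *)
Definition crel (sw : bool) (q : P * (R * M)) (y : M) : Prop :=
  crit rho0 f l (tg q.1 q.2.1 (if sw then y else q.2.2)) (if sw then q.2.2 else y).

(** Invertible Jacobian at the solution, recorded so that the regularity of a continuous solution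
    can be derived later for any family of parameters. *)
Definition regular (sw : bool) (q : P * (R * M)) (y : M) : Prop := exists c,
  [/\ atlas M c, chart_dom c q.2.2, chart_dom c y &
   cjac id sw c (q.1, pt sw q.2.1 (c q.2.2) (c y)) \in unitmx].

Let cjacE (T : topologicalType) (r : T -> P) sw c s w i j :
  cjac r sw c (s, w) i j = 'D_('e_(sel sw i)) (fun w => cmap r c (s, w) 0 j) w.
Proof. by rewrite /cjac mxE pdE. Qed.

Let cmap_affine (T : topologicalType) (r : T -> P) sw c s t x u i j :
  'D_('e_i) (fun u => cmap r c (s, pt sw t x u) 0 j) u = cjac r sw c (s, pt sw t x u) i j.
Proof.
rewrite cjacE.
exact: (@derive_affine R _ _ _ (fun w => cmap r c (s, w) 0 j) (pt sw t x) u 'e_i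
  'e_(sel sw i) (fun h => pt_affine sw _ _ _ i h)).
Qed.

Lemma crit_self s x : (forall i g, s i g = f i (ev rho0 g x)) -> crit rho0 f l s x.
Proof.
move=> sE; have [c Mc cx] := @atlas_cover R n M x; exists c; split=> // j.
rewrite (_ : residual _ _ _ _ _ _ _ = fun=> 0) ?haar_cst//; apply/funext => g.
by rewrite /residual big1// => i _; rewrite sE /orbitf /= chart_mapK// subrr mul0r.
Qed.

Lemma crelE (T : topologicalType) (r : T -> P) sw c s t x y : atlas M c -> chart_dom c x -> chart_dom c y ->
  crel sw (r s, (t, x)) y <-> cmap r c (s, pt sw t (c x) (c y)) = 0.
Proof.
move=> Mc cx cy; pose a := if sw then y else x; pose b := if sw then x else y.
have cb : chart_dom c b by rewrite /b; case: (sw).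
have E j : cmap r c (s, pt sw t (c x) (c y)) 0 j = haar (residual rho0 f l c (tg (r s) t a) (c b) j).
  rewrite /cmap mxE /= ptTE ptXE ptYE.
  have -> : chart_inv c (if sw then c y else c x) = a by rewrite /a; case: (sw); exact: chart_mapK.
  by have -> : (if sw then c x else c y) = c b by rewrite /b; case: (sw).
split=> [h|h].
  apply/rowP => j; rewrite E mxE; apply: crit_chart => //.
  by move=> i; exact: target_continuous.
by exists c; split=> // j; have /rowP/(_ j) := h; rewrite E mxE.
Qed.

Lemma Ck_critmap_pt (S T : topologicalType) (r : T -> P) (m d : nat) (a : S -> T) sw c
    (t : S * 'rV[R]_d -> R) (x u : S * 'rV[R]_d -> 'rV[R]_n) A : evCk r m -> atlas M c -> open A ->
  (forall z, A z -> {for z, continuous (a \o fst)}) ->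
  Ck m t A -> (forall j, Ck m (fun z => x z 0 j) A) -> (forall j, Ck m (fun z => u z 0 j) A) ->
  (forall z, A z -> chart_cod c (x z) /\ chart_cod c (u z)) ->
  forall j, Ck m (fun z => cmap r c (a z.1, pt sw (t z) (x z) (u z)) 0 j) A.
Proof.
move=> er Mc oA ca ct cx cu Axu j.
apply: (@Ck_comp R S T (1 + n + n) d m (fun z => cmap r c z 0 j) (crit_dom c) a
  (fun z => pt sw (t z) (x z) (u z)) A oA) => //.
- exact: open_crit_dom.
- move=> z /Axu[hx hu]; rewrite /crit_dom /= ptXE ptYE.
  by case: (sw).
- exact: Ck_pt.
- exact: critmap_Ck.
Qed.

(** At [rho0] every point is its own centre ([crit_self]), and the Jacobian there is invertible in
    either variable, so [solvable_atP] applies with [b = snd]. *)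
Lemma solvable_center sw s : solvable_at rho0 snd (crel sw) (regular sw) s.
Proof.
case: s => t0 x0; have [c Mc cx] := @atlas_cover R n M x0.
pose B : set ((P * (R * M)) * 'rV[R]_n) := [set z | chart_dom c z.1.2.2 /\ chart_cod c z.2].
pose H (z : (P * (R * M)) * 'rV[R]_n) := cmap id c (z.1.1, pt sw z.1.2.1 (c z.1.2.2) z.2).
have ev1 : evCk (@id P) 1.
  move=> d d' Md Md'; have [oE hE] := @evCk_id R k n G M d d' Md Md'.
  by split=> // i; exact: (@Ck_le _ _ _ 1 2 _ _ isT (hE i)).
have c22 (z : (P * (R * M)) * 'rV[R]_n) : {for z, continuous (fun z => z.1.2.2)}.
  apply: (@continuous_comp _ _ _ fst (fun q : P * (R * M) => q.2.2)); first exact: cvg_fst.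
  by apply: (@continuous_comp _ _ _ snd snd); exact: cvg_snd.
have oB : open B.
  apply: openI; last by apply: open_cyl; exact: chart_cod_open.
  by apply: (@open_comp _ _ (fun z : (P * (R * M)) * 'rV[R]_n => z.1.2.2)) => [z _|]; [exact: c22|exact: chart_dom_open].
have cH j : Ck 1 (fun z => H z 0 j) B.
  have := @Ck_critmap_pt (P * (R * M))%type P id 1 n (fun q : P * (R * M) => q.1) sw c
    (fun z => z.1.2.1) (fun z => c z.1.2.2) (fun z => z.2) B ev1 Mc oB.
  apply.
  - by move=> z _; apply: (@continuous_comp _ _ _ fst fst); exact: cvg_fst.
  - apply: (@Ck_base _ _ _ 1 (fun q : P * (R * M) => q.2.1)) => z _.
    apply: (@continuous_comp _ _ _ fst (fun q : P * (R * M) => q.2.1)); first exact: cvg_fst.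
    by apply: (@continuous_comp _ _ _ snd fst); [exact: cvg_snd|exact: cvg_fst].
  - move=> j'; apply: (@Ck_base _ _ _ 1 (fun q : P * (R * M) => c q.2.2 0 j')) => z [cz _].
    apply: (@continuous_comp _ _ _ (fun z => z.1.2.2) (fun y => c y 0 j')); first exact: c22.
    by have := chart_map_continuous cz => /(@continuous_coord R M n c _) /(_ j'); exact.
  - by move=> j'; exact: Ck_coord.
  - by move=> z [hx hu]; split=> //; exact: chart_cod_in.
have vE q u : vjacobian H (q, u) = cjac id sw c (q.1, pt sw q.2.1 (c q.2.2) u).
  apply/matrixP => i j.
  apply: (etrans (vjacobianE H (q, u) i j)).
  apply: (etrans (pdE i (fun z => H z 0 j) (q, u))).
  have := (@cmap_affine P id sw c q.1 q.2.1 (c q.2.2) u i j).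
  apply: etrans.
  apply: (congr1 (fun F : 'rV[R]_n -> R => 'D_('e_i) F u)).
  by [].
have xc := chart_cod_in cx.
apply: (@solvable_atP R n M P (R * M)%type rho0 snd (crel sw) (regular sw) (t0, x0) c H B) => //=.
- by move=> z; exact: cvg_snd.
- by move=> z [].
- move=> [rho [t x]] y cy [/= cx' _].
  exact: (@crelE P id sw c rho t x y Mc cx' cy).
- move=> q y cy [cx' _]; rewrite vE => hu; exists c; split=> //.
- apply/(@crelE P id sw c rho0 t0 x0 x0 Mc cx cx); apply: crit_self => i g /=.
  rewrite /tg /target /= if_same -mulrDl subrK mul1r.
  by [].
- rewrite vE; apply: (@critjac_unit R k n G M compactG rho0 I f l sf immf act0 P id 1) => //=.
  + by rewrite ptXE ptYE; case: (sw).
  + by rewrite ptYE; case: (sw).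
Qed.

(** The centre, read in a chart, is appended to the [d] vector coordinates as [n] unknowns, on the
    open set where the Jacobian is invertible; [implicit_Ck] then raises continuity to class [m]. *)
Lemma regular_plot (S : topologicalType) (r : S -> P) (m d : nat) sw (phi : P * (R * M) -> M)
    (t : S * 'rV[R]_d -> R) (q : S * 'rV[R]_d -> M) A : (0 < m)%N -> evCk r m -> open A ->
  Ck m t A -> plot m q A -> (forall z, A z -> {for z, continuous (r \o fst)}) ->
  (forall z, A z -> [/\ crel sw (r z.1, (t z, q z)) (phi (r z.1, (t z, q z))),
     {for (r z.1, (t z, q z)), continuous phi} &
     regular sw (r z.1, (t z, q z)) (phi (r z.1, (t z, q z)))]) ->
  plot m (fun z => phi (r z.1, (t z, q z))) A.
Proof.
move=> m0 er oA ct pq cr h; have [cq sq] := pq.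
pose p z := phi (r z.1, (t z, q z)).
have cp z : A z -> {for z, continuous p}.
  move=> Az; have [_ cphi _] := h z Az.
  apply: (@continuous_comp _ _ _ (fun z => (r z.1, (t z, q z))) phi) => //.
  apply: continuous_pair; first exact: (cr z Az).
  by apply: continuous_pair; [exact: Ck_cont ct Az|exact: cq].
apply: plot_local => // z0 Az0; have [_ _ [c [Mc cx cy uJ]]] := h z0 Az0.
exists c => //.
pose B1 := (A `&` q @^-1` chart_dom c).
have oB1 : open B1 by exact: plot_open oA (chart_dom_open c) pq.
pose B0 := B1 `&` p @^-1` chart_dom c.
have oB0 : open B0.
  by apply: open_preimage_on => //; [exact: chart_dom_open|move=> z [Az _]; exact: cp].
have ccq j : Ck m (fun z => c (q z) 0 j) B1 by exact: sq.
have ccp z : B0 z -> {for z, continuous (fun z => c (p z))}.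
  move=> [[Az _] cz]; apply: (@continuous_comp _ _ _ p c); first exact: cp.
  exact: chart_map_continuous.
pose D z := \det (cjac r sw c (z.1, pt sw (t z) (c (q z)) (c (p z)))).
have cD z : B0 z -> {for z, continuous D}.
  move=> B0z; have [[Az qz] pz] := B0z.
  have CJ i j : Ck 0 (fun z => cjac r sw c z i j) (crit_dom c).
    have [_ /(_ (sel sw i))[_ ci]] := Ck_le m0 (critmap_Ck compactG rho0 l sf er j Mc).
    apply: (@Ck_ext _ _ _ 0 (pd (sel sw i) (fun z => cmap r c z 0 j))) ci => //; first exact: open_crit_dom.
    by move=> y _; rewrite /cjac mxE.
  have Cd := Ck_det (@open_crit_dom _ _ _ _ c) CJ.
  apply: (@continuous_comp _ _ _ (fun z => (z.1, pt sw (t z) (c (q z)) (c (p z)))) (fun z => \det (cjac r sw c z))).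
    apply: continuous_pair; first exact: cvg_fst.
    have c1 : Ck 0 t B0 by apply: (@Ck_sub _ _ _ _ _ A) (Ck_le (leq0n m) ct) => y [[]].
    have c2 j : Ck 0 (fun z => c (q z) 0 j) B0 by apply: (@Ck_sub _ _ _ _ _ B1) (Ck_le (leq0n m) (ccq j)) => y [].
    have c3 j : Ck 0 (fun z => c (p z) 0 j) B0.
      by split=> // y B0y; move: j; apply/continuous_coord; exact: ccp.
    by apply/continuous_coord => j; exact: Ck_cont (Ck_pt sw c1 c2 c3 j) B0z.
  apply: (Ck_cont Cd); rewrite /crit_dom /= ptXE ptYE.
  by case: (sw); split; exact: chart_cod_in.
pose B := B0 `&` D @^-1` (~` [set 0]).
have oB : open B.
  apply: open_preimage_on => //; apply: closed_openC.
  exact/accessible_closed_set1/hausdorff_accessible/Rhausdorff.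
have BB1 : B `<=` B1 by move=> z [[]].
exists B; split=> //.
- split; first by split.
  have : D z0 != 0 by rewrite /D -unitfE -unitmxE.
  by move=> /eqP.
- by move=> z [[[Az _] cz] _].
move=> j.
pose A' : set (S * 'rV[R]_(d + n)) := [set z | B1 (z.1, lsubmx z.2) /\ chart_cod c (rsubmx z.2)].
have cl (z : S * 'rV[R]_(d + n)) : {for z, continuous (fun z : S * 'rV[R]_(d + n) => (z.1, lsubmx z.2))}.
  apply: continuous_pair; first exact: cvg_fst.
  apply: (@continuous_comp _ _ _ snd (lsubmx : 'rV[R]_(d + n) -> 'rV[R]_d)); first exact: cvg_snd.
  exact: continuous_lsubmx.
have oA' : open A'.
  apply: openI; first by apply: (@open_comp _ _ (fun z : S * 'rV[R]_(d + n) => (z.1, lsubmx z.2)) B1) => // z _; exact: cl.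
  apply: (@open_comp _ _ (fun z : S * 'rV[R]_(d + n) => rsubmx z.2)) => [z _|]; last exact: chart_cod_open.
  apply: (@continuous_comp _ _ _ snd (rsubmx : 'rV[R]_(d + n) -> 'rV[R]_n)); first exact: cvg_snd.
  exact: continuous_rsubmx.
pose H (z : S * 'rV[R]_(d + n)) := cmap r c (z.1, pt sw (t (z.1, lsubmx z.2)) (c (q (z.1, lsubmx z.2))) (rsubmx z.2)).
have pull (F : S * 'rV[R]_d -> R) : Ck m F B1 -> Ck m (fun z : S * 'rV[R]_(d + n) => F (z.1, lsubmx z.2)) A'.
  move=> cF; apply: (@Ck_comp R S S d (d + n) m F B1 id (fun z => lsubmx z.2) A') => //.
  - by move=> z [].
  - by move=> z _; exact: cvg_fst.
  - by apply: Ck_lsubmx => i; exact: Ck_coord.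
have hAB z : B z -> A' (z.1, row_mx z.2 (c (p z))).
  move=> [[B1z pz] _]; split; rewrite /= ?row_mxKl ?row_mxKr -?surjective_pairing//.
  exact: chart_cod_in.
have hH0 z : B z -> H (z.1, row_mx z.2 (c (p z))) = 0.
  move=> [[[Az qz] pz] _]; rewrite /H /= row_mxKl row_mxKr -surjective_pairing.
  by apply/(@crelE S r sw c z.1 (t z) (q z) (p z) Mc qz pz); have [] := h z Az.
have HE z u : H (z.1, row_mx z.2 u) = cmap r c (z.1, pt sw (t z) (c (q z)) u).
  by rewrite /H /= row_mxKl row_mxKr -surjective_pairing.
have row_affine (w : 'rV[R]_d) (u : 'rV[R]_n) i (e : R) : row_mx w (e *: 'e_i + u) = e *: 'e_(rshift d i) + row_mx w u.
  have -> : ('e_(rshift d i) : 'rV[R]_(d + n)) = row_mx 0 'e_i.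
    by rewrite -[LHS]hsubmxK rsubmx_delta_r lsubmx_delta_r.
  by rewrite scale_row_mx add_row_mx scaler0 add0r.
have JE z i i' : pd (rshift d i) (fun z => H z 0 i') (z.1, row_mx z.2 (c (p z))) =
    cjac r sw c (z.1, pt sw (t z) (c (q z)) (c (p z))) i i'.
  apply: (etrans (pdE (rshift d i) (fun z => H z 0 i') (z.1, row_mx z.2 (c (p z))))).
  have D1 := @derive_affine R _ _ _ (fun w => H (z.1, w) 0 i') (row_mx z.2) (c (p z)) 'e_i
    'e_(rshift d i) (row_affine z.2 (c (p z)) i).
  apply: (etrans (esym D1)).
  have D2 := @cmap_affine S r sw c z.1 (t z) (c (q z)) (c (p z)) i i'.
  apply: etrans D2.
  apply: (congr1 (fun F : 'rV[R]_n -> R => 'D_('e_i) F (c (p z)))).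
  by apply/funext => u; rewrite HE.
have huJ z : B z -> (\matrix_(i, i') pd (rshift d i) (fun z => H z 0 i') (z.1, row_mx z.2 (c (p z)))) \in unitmx.
  move=> [_ Dz]; have -> : \matrix_(i, i') pd (rshift d i) (fun z => H z 0 i') (z.1, row_mx z.2 (c (p z))) =
      cjac r sw c (z.1, pt sw (t z) (c (q z)) (c (p z))).
    by apply: matrix_of_entries => i i'; exact: JE.
  by rewrite unitmxE unitfE; apply/eqP => E; exact: Dz.
have hcy z : B z -> {for z, continuous (fun z => c (p z))} by move=> [B0z _]; exact: ccp.
have ct' := pull t (Ck_sub (fun z (h : B1 z) => h.1) ct).
have cq' i := pull (fun z => c (q z) 0 i) (ccq i).
have cr' i : Ck m (fun z : S * 'rV[R]_(d + n) => rsubmx z.2 0 i) A' by apply: Ck_rsubmx => a; exact: Ck_coord.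
have hcod z : A' z -> chart_cod c (c (q (z.1, lsubmx z.2))) /\ chart_cod c (rsubmx z.2).
  by move=> [[_ qz] cz]; split=> //; exact: chart_cod_in.
have hcf (z : S * 'rV[R]_(d + n)) : A' z -> {for z, continuous (id \o fst)} by move=> _; exact: cvg_fst.
have hcH := @Ck_critmap_pt S S r m (d + n) id sw c (fun z => t (z.1, lsubmx z.2))
  (fun z => c (q (z.1, lsubmx z.2))) (fun z => rsubmx z.2) A' er Mc oA' hcf ct' cq' cr' hcod.
exact: (@implicit_Ck R S d n H (fun z => c (p z)) B A' oB oA' hAB hH0 huJ hcy m hcH j).
Qed.

Lemma ev_continuous (z : P * (G * M)) : {for z, continuous (fun z : P * (G * M) => ev z.1 z.2.1 z.2.2)}.
Proof.
have c22 (w : (P * (G * M)) * 'rV[R]_1) : {for w, continuous (snd \o snd \o fst)}.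
  apply: (@continuous_comp _ _ _ fst (snd \o snd)); first exact: cvg_fst.
  by apply: (@continuous_comp _ _ _ snd snd); exact: cvg_snd.
have c21 (w : (P * (G * M)) * 'rV[R]_1) : {for w, continuous (fst \o snd \o fst)}.
  apply: (@continuous_comp _ _ _ fst (fst \o snd)); first exact: cvg_fst.
  by apply: (@continuous_comp _ _ _ snd fst); [exact: cvg_snd|exact: cvg_fst].
have pb := @plot_base R n M (P * (G * M))%type 1 2 (snd \o snd) setT (fun w _ => c22 w).
have [h _] := @ev_plot R k n G M _ P id 1 2 fst (fst \o snd) _ setT (@evCk_id _ _ _ _ _) openT pb
  (fun w _ => continuous_comp (@cvg_fst _ _ (nbhs w.1) (nbhs w.2) _) (@cvg_fst _ _ _ _ _)) (fun w _ => c21 w).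
apply: (@continuous_comp _ _ _ (fun z : P * (G * M) => (z, 0 : 'rV[R]_1)) (fun w : (P * (G * M)) * 'rV[R]_1 => ev w.1.1 w.1.2.1 w.1.2.2)).
  by apply: continuous_pair; [exact: cvg_id|exact: cvg_cst].
exact: (h (z, 0 : 'rV[R]_1) Logic.I).
Qed.

Definition flip (N : set (M * M)) (sw : bool) : set (M * M) :=
  [set z | N (if sw then (z.2, z.1) else z)].

Lemma diag_flip N sw : diag_nbhs N -> diag_nbhs (flip N sw).
Proof.
move=> dN x; case: sw; last exact: dN.
have cs : {for (x, x), continuous (fun z : M * M => (z.2, z.1))}.
  by apply: continuous_pair; [exact: cvg_snd|exact: cvg_fst].
exact: (cs _ (dN x)).
Qed.

(** The fallback [q.2.2] is taken only when there is no solution near the diagonal. Using the same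
    [N] for both values of [sw], through [flip], is what makes the two maps inverse to each
    other. *)
Definition center N sw (q : P * (R * M)) : M := xget q.2.2 [set y | flip N sw (q.2.2, y) /\ crel sw q y].

(** Existence and uniqueness hold on [-7, 7], regularity only on [-6, 6], because
    [continuous_near_diagonal] asks for a compact set in the interior of the first one. *)
Definition centered N (rho : P) := forall sw,
  (forall t, -7 <= t <= 7 -> forall x, [/\ flip N sw (x, center N sw (rho, (t, x))),
    crel sw (rho, (t, x)) (center N sw (rho, (t, x))) &
    forall y, flip N sw (x, y) -> crel sw (rho, (t, x)) y -> y = center N sw (rho, (t, x))]) /\
  (forall t, -6 <= t <= 6 -> forall x, {for (rho, (t, x)), continuous (center N sw)} /\
    regular sw (rho, (t, x)) (center N sw (rho, (t, x)))).

Lemma centered_near : exists2 N, diag_nbhs N & \forall rho \near rho0, centered N rho.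
Proof.
pose K : set (R * M) := `[-7, 7] `*` setT; pose K' : set (R * M) := `[-6, 6] `*` setT.
have cK : compact K by apply: compact_setX => //; exact: segment_compact.
have cK' : compact K' by apply: compact_setX => //; exact: segment_compact.
have KK : K' `<=` K°.
  move=> [t x] [/= + _]; rewrite in_itv /= => /andP[t1 t2].
  exists (`]-7, 7[%classic, setT); last first.
    by move=> [t' x'] [/= + _]; rewrite in_itv /= => /andP[/ltW h1 /ltW h2]; split=> //=; rewrite in_itv /= h1.
  split; last exact: filterT.
  apply: open_nbhs_nbhs; split; first exact: itv_open.
  by rewrite /= in_itv /=; apply/andP; split; lra.
have cs : continuous (snd : R * M -> M) by move=> z; exact: cvg_snd.
have sol sw s : K s -> solvable_at rho0 snd (crel sw) (regular sw) s by move=> _; exact: solvable_center.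
have [N1 d1 u1] := unique_near_diagonal compactM cs cK (sol false).
have [N2 d2 u2] := unique_near_diagonal compactM cs cK (sol true).
(* One neighbourhood of the diagonal on which the centre of a point is unique and, after exchange,
   so is the point with a given centre. *)
pose N := N1 `&` flip N2 true.
have dN : diag_nbhs N by move=> x; apply: filterI; [exact: d1|exact: (diag_flip true d2)].
have hu sw : \forall rho \near rho0, forall s, K s -> forall y y', flip N sw (s.2, y) -> flip N sw (s.2, y') ->
    crel sw (rho, s) y -> crel sw (rho, s) y' -> y = y'.
  case: sw.
    by apply: filterS u2 => rho h s Ks y y' [_ Ny] [_ Ny']; exact: h.
  by apply: filterS u1 => rho h s Ks y y' [Ny _] [Ny' _]; exact: h.
have hex sw := exists_near_diagonal cK (sol sw) (diag_flip sw dN).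
have hC sw : \forall rho \near rho0, forall s, K s -> [/\ flip N sw (s.2, center N sw (rho, s)),
    crel sw (rho, s) (center N sw (rho, s)) &
    forall y, flip N sw (s.2, y) -> crel sw (rho, s) y -> y = center N sw (rho, s)].
  apply: filterS2 (hu sw) (hex sw) => rho h1 h2 s Ks; have [y Ny Cy] := h2 s Ks.
  have [Nc Cc] : flip N sw (s.2, center N sw (rho, s)) /\ crel sw (rho, s) (center N sw (rho, s)).
    exact: (xgetPex s.2 (ex_intro _ y (conj Ny Cy :
      [set y | flip N sw (s.2, y) /\ crel sw (rho, s) y] y))).
  by split=> // y' Ny' Cy'; exact: (h1 s Ks).
have hR sw := continuous_near_diagonal cK' KK (sol sw) (diag_flip sw dN) (hC sw).
exists N => //.
have inK t x : -7 <= t <= 7 -> K (t, x) by move=> h; split; rewrite /= ?in_itv.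
have inK' t x : -6 <= t <= 6 -> K' (t, x) by move=> h; split; rewrite /= ?in_itv.
have h sw : \forall rho \near rho0,
    (forall s, K s -> [/\ flip N sw (s.2, center N sw (rho, s)), crel sw (rho, s) (center N sw (rho, s)) &
    forall y, flip N sw (s.2, y) -> crel sw (rho, s) y -> y = center N sw (rho, s)]) /\
    (forall s, K' s -> {for (rho, s), continuous (center N sw)} /\ regular sw (rho, s) (center N sw (rho, s))).
  by apply: filterI; [exact: hC|exact: hR].
apply: filterS2 (h true) (h false) => rho [a1 a2] [b1 b2] [].
  by split=> t ht x; [exact: (a1 _ (inK t x ht))|exact: (a2 _ (inK' t x ht))].
by split=> t ht x; [exact: (b1 _ (inK t x ht))|exact: (b2 _ (inK' t x ht))].
Qed.

Definition isotopy (phi psi : P * (R * M) -> M) (rho : P) : Prop :=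
  [/\ forall x, phi (rho, (0, x)) = x,
    forall h x, phi (rho, (1, ev rho h x)) = ev rho0 h (phi (rho, (1, x))),
    (forall x, psi (rho, (1, phi (rho, (1, x)))) = x) &
    (forall y, phi (rho, (1, psi (rho, (1, y)))) = y)].

(** The identities of [isotopy] all come from uniqueness of the solution near the diagonal. The last
    clause admits any family of actions, which gives continuity in the action as well as smoothness
    for a fixed one. *)
Lemma isotopy_near : exists phi psi (V : set P), [/\ nbhs rho0 V,
  forall t x, -7 <= t <= 7 -> phi (rho0, (t, x)) = x,
  forall rho, V rho -> group_action (rho : smoothMap (G * M)%type M) -> isotopy phi psi rho &
  forall (S : topologicalType) (r : S -> P) (m d : nat) (t : S * 'rV[R]_d -> R) (q : S * 'rV[R]_d -> M) A,
    (0 < m)%N -> evCk r m -> open A -> Ck m t A -> plot m q A ->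
    (forall z, A z -> {for z, continuous (r \o fst)}) ->
    (forall z, A z -> V (r z.1) /\ -6 <= t z <= 6) ->
    plot m (fun z => phi (r z.1, (t z, q z))) A /\ plot m (fun z => psi (r z.1, (t z, q z))) A].
Proof.
have [N dN hN] := centered_near.
pose phi := center N false; pose psi := center N true.
have i23 (t : R) : -6 <= t <= 6 -> -7 <= t <= 7.
  by move=> /andP[h1 h2]; apply/andP; split; lra.
have i1 : -6 <= (1 : R) <= 6 by apply/andP; split; lra.
have c0 : centered N rho0 := nbhs_singleton hN.
have phi0 t x : -7 <= t <= 7 -> phi (rho0, (t, x)) = x.
  move=> ht; have [h _] := c0 false; have [_ _ u] := h t ht x.
  apply/esym/u; first exact: nbhs_singleton (dN x).
  by apply: crit_self => i g; rewrite /tg /target /= -mulrDl subrK mul1r.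
(* To use uniqueness of the centre of [ev rho h x], the candidate [ev rho0 h (phi (rho, (1, x)))]
   must be close to that point. At [rho0] both coincide; compactness of [G * M] gives a
   neighbourhood. *)
have equi : \forall rho \near rho0, [set: G * M] `<=` (fun hx =>
    N (ev rho hx.1 hx.2, ev rho0 hx.1 (phi (rho, (1, hx.2))))).
  have cGM : compact [set: G * M] by rewrite -setXTT; exact: compact_setX.
  have := (iffLR (compact_near_coveringP _) cGM) P (nbhs rho0) (fun rho hx =>
    N (ev rho hx.1 hx.2, ev rho0 hx.1 (phi (rho, (1, hx.2))))) _.
  apply => -[h x] _.
  pose F (z : (G * M) * P) := (ev z.2 z.1.1 z.1.2, ev rho0 z.1.1 (phi (z.2, (1, z.1.2)))).
  have c12 (z : (G * M) * P) : {for z, continuous (fun z : (G * M) * P => z.1.2)}.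
    by apply: (@continuous_comp _ _ _ fst snd); [exact: cvg_fst|exact: cvg_snd].
  have c11 (z : (G * M) * P) : {for z, continuous (fun z : (G * M) * P => z.1.1)}.
    by apply: (@continuous_comp _ _ _ fst fst); exact: cvg_fst.
  have c2 (z : (G * M) * P) : {for z, continuous (fun z : (G * M) * P => z.2)} by exact: cvg_snd.
  have cphi : {for ((h, x), rho0), continuous (fun z : (G * M) * P => phi (z.2, (1, z.1.2)))}.
    apply: (@continuous_comp _ _ _ (fun z : (G * M) * P => (z.2, (1 : R, z.1.2))) phi).
      by apply: continuous_pair => //; apply: continuous_pair => //; exact: cvg_cst.
    by have [_ hc] := c0 false; have [] := hc 1 i1 x.
  have cF : {for ((h, x), rho0), continuous F}.
    apply: continuous_pair.
      apply: (@continuous_comp _ _ _ (fun z : (G * M) * P => (z.2, (z.1.1, z.1.2)))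
        (fun z : P * (G * M) => ev z.1 z.2.1 z.2.2)); last exact: ev_continuous.
      by apply: continuous_pair => //; exact: continuous_pair.
    apply: (@continuous_comp _ _ _ (fun z : (G * M) * P => (rho0, (z.1.1, phi (z.2, (1, z.1.2)))))
        (fun z : P * (G * M) => ev z.1 z.2.1 z.2.2)); last exact: ev_continuous.
    by apply: continuous_pair; [exact: cvg_cst|exact: continuous_pair].
  have nF : \forall z \near ((h, x), rho0), N (F z).
    by apply: cF; rewrite /F /= phi0; [exact: dN|exact: i23].
  by case: nF => -[A1 A2] /= [nA1 nA2] A12; exists (A1, A2) => // -[hx rho] [/= a1 a2]; exact: (A12 (hx, rho)).
exists phi, psi, [set rho | centered N rho /\ [set: G * M] `<=` (fun hx =>
    N (ev rho hx.1 hx.2, ev rho0 hx.1 (phi (rho, (1, hx.2)))))].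
split=> //; first exact: filterI.
  move=> rho [cr er] [act1 actM].
  have [hphi _] := cr false; have [hpsi _] := cr true.
  have i0 : -7 <= (0 : R) <= 7 by apply/andP; split; lra.
  have i1' := i23 _ i1.
  split=> [x|h x|x|y].
  - have [_ _ u] := hphi 0 i0 x; apply/esym/u; first exact: nbhs_singleton (dN x).
    by apply: crit_self => i g; rewrite /tg /target /= subr0 mul1r mul0r addr0.
  (* At time 1 the target is the orbit of [x] under [rho] alone, and shifting [g] by [h] turns it
     into the orbit of [ev rho h x]. *)
  - have [_ _ u] := hphi 1 i1' (ev rho h x); apply/esym/u; first exact: (er (h, x) Logic.I).
    have [_ Cx _] := hphi 1 i1' x.
    have ct i : continuous (tg rho 1 x i) by exact: target_continuous.
    have E : ev rho0 h^-1%g (ev rho0 h (phi (rho, (1, x)))) = phi (rho, (1, x)).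
      by rewrite /ev act0.2 mulVg act0.1.
    have := @crit_act R k n G M compactG rho0 I f l sf act0 (tg rho 1 x) h^-1%g (ev rho0 h (phi (rho, (1, x)))) ct.
    rewrite E => /(_ Cx); rewrite /crel /=.
    have -> // : (fun i g => tg rho 1 x i (g * h^-1^-1)%g) = tg rho 1 (ev rho h x).
    apply/funext => i; apply/funext => g; rewrite /tg /target subrr !mul0r invgK.
    by congr (_ + _ * f i _); rewrite /ev actM.
  - have [Nx Cx _] := hphi 1 i1' x.
    by have [_ _ u] := hpsi 1 i1' (phi (rho, (1, x))); apply/esym/u.
  - have [Ny Cy _] := hpsi 1 i1' y.
    by have [_ _ u] := hphi 1 i1' (psi (rho, (1, y))); apply/esym/u.
move=> S r m d t q A m0 er oA ct pq cr hA.
have hsw sw : plot m (fun z => center N sw (r z.1, (t z, q z))) A.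
  apply: (@regular_plot S r m d sw) => // z Az; have [[cz _] tz] := hA z Az.
  have [h1 h2] := cz sw; have [_ hC _] := h1 (t z) (i23 _ tz) (q z).
  by have [hc hr] := h2 (t z) tz (q z).
by split; exact: hsw.
Qed.

End CenterMap.

(** * Moser's argument *)

Section PullbackAlong.
Context {R : realType} {n : nat} {M : manifoldType R n}.
Variable w : twoForm M.
Implicit Types (c d : chart R n M).

Definition chart_at (x : M) : chart R n M := sval (cid2 (@atlas_cover R n M x)).

Lemma chart_at_atlas x : atlas M (chart_at x).
Proof. by rewrite /chart_at; case: cid2. Qed.

Lemma chart_at_dom x : chart_dom (chart_at x) x.
Proof. by rewrite /chart_at; case: cid2. Qed.

(** Pullback of [w] by [q] at [x], in a chosen chart; [pbwE] gives the same value in any chart. *)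
Definition pbw (V : normedModType R) (q : V -> M) (x u v : V) : R :=
  let c := chart_at (q x) in
  w c (c (q x)) ('D_u (fun y => c (q y)) x) ('D_v (fun y => c (q y)) x).

Lemma pbwE (V : normedModType R) (q : V -> M) x u v c : mdiff q x -> atlas M c -> chart_dom c (q x) ->
  pbw q x u v = w c (c (q x)) ('D_u (fun y => c (q y)) x) ('D_v (fun y => c (q y)) x).
Proof.
move=> dq Mc cx; have [_ ch] := mdiff_smooth smooth_id dq.
have Ma := chart_at_atlas (q x); have ax := chart_at_dom (q x).
rewrite /pbw (@form_compatible R n M w _ _ Ma Mc _ ax cx).
have E t := ch (chart_at (q x)) c Ma Mc ax cx t.
by rewrite -(E u) -(E v).
Qed.

Lemma pbw_ext (V : normedModType R) (p q : V -> M) x u v :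
  (\forall y \near x, p y = q y) -> pbw p x u v = pbw q x u v.
Proof.
move=> pq; have E := nbhs_singleton pq; rewrite /pbw E.
by rewrite (near_derive_chart _ u pq) (near_derive_chart _ v pq).
Qed.

Lemma pbw_comp (V W : normedModType R) (q : V -> M) (F : W -> V) x u v :
  mdiff q (F x) -> differentiable F x ->
  pbw (fun y => q (F y)) x u v = pbw q (F x) ('D_u F x) ('D_v F x).
Proof.
move=> dq dF; have [_ E] := mdiff_comp dq dF.
by rewrite /pbw !E//; first [exact: chart_at_atlas|exact: chart_at_dom].
Qed.

Lemma pbw_symplectic (V : normedModType R) (q : V -> M) (f : M -> M) x u v :
  smooth f -> is_pullback f (form_coef w) (form_coef w) -> mdiff q x ->
  pbw (fun y => f (q y)) x u v = pbw q x u v.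
Proof.
move=> sf pf dq; have [dfq ch] := mdiff_smooth sf dq.
have Ma := chart_at_atlas (q x); have ax := chart_at_dom (q x).
have Mb := chart_at_atlas (f (q x)); have bx := chart_at_dom (f (q x)).
rewrite /pbw (pf _ _ Ma Mb _ ax bx) (ch _ _ Ma Mb ax bx u) (ch _ _ Ma Mb ax bx v).
by [].
Qed.

Lemma chart_derive c y (u : 'rV[R]_n) : chart_cod c y -> 'D_u (fun z => c (chart_inv c z)) y = u.
Proof.
move=> cy; have nE : \forall z \near y, c (chart_inv c z) = z.
  have oc : open (chart_cod c) := @chart_cod_open R n M c.
  by apply: filterS (open_nbhs_nbhs (conj oc cy)) => z; exact: chart_invK.
by rewrite (near_eq_derive _ nE); have [_ ->] := is_derive_id y u.
Qed.

Lemma pbw_chart_inv c y u v : atlas M c -> chart_cod c y -> pbw (chart_inv c) y u v = w c y u v.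
Proof.
move=> Mc cy; rewrite (pbwE u v (mdiff_chart_inv Mc cy) Mc (chart_inv_dom cy)).
by rewrite chart_invK// !chart_derive.
Qed.

Lemma is_pullback_of (f : M -> M) : smooth f ->
  (forall c y u v, atlas M c -> chart_cod c y -> pbw (fun z => f (chart_inv c z)) y u v = w c y u v) ->
  is_pullback f (form_coef w) (form_coef w).
Proof.
move=> sf h c d Mc Md p cp dp u v; have cy := chart_cod_in cp.
have dq := mdiff_chart_inv Mc cy.
have [dfq ch] := mdiff_smooth sf dq.
have cq : chart_dom c (chart_inv c (c p)) by exact: chart_inv_dom.
have dq' : chart_dom d (f (chart_inv c (c p))) by rewrite chart_mapK.
have E (t : 'rV[R]_n) : 'D_t (fun z => d (f (chart_inv c z))) (c p) = 'd (local_rep f c d) (c p) t.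
  rewrite (ch c d Mc Md cq dq' t) (chart_derive t cy).
  exact: (congr1 (fun z => 'd (local_rep f c d) z t) (chart_invK cy)).
have fE : f (chart_inv c (c p)) = f p by rewrite chart_mapK.
rewrite -(h c (c p) u v Mc cy) (pbwE u v dfq Md dq') (E u) (E v).
by rewrite fE.
Qed.

Lemma derive_linear_dir (V W : normedModType R) (F : V -> W) x a u v : differentiable F x ->
  'D_(a *: u + v) F x = a *: 'D_u F x + 'D_v F x.
Proof. by move=> dF; rewrite !deriveE// linearP. Qed.

Lemma pbw_linearl (V : normedModType R) (q : V -> M) x v : mdiff q x -> scalar (fun u => pbw q x u v).
Proof.
move=> [_ dq] a u u'; have Ma := chart_at_atlas (q x); have ax := chart_at_dom (q x).
rewrite /pbw (derive_linear_dir _ _ _ (dq _ Ma ax)).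
exact: (@form_linearl R n M w _ Ma _ (chart_cod_in ax)).
Qed.

Lemma pbw_alternating (V : normedModType R) (q : V -> M) x u : pbw q x u u = 0.
Proof. exact: (@form_alternating R n M w _ (chart_at_atlas (q x)) _ (chart_cod_in (chart_at_dom (q x)))). Qed.

Lemma local_form_chart c : atlas M c -> local_form (chart_cod c) (w c).
Proof.
move=> Mc; have oc : open (chart_cod c) := @chart_cod_open R n M c; split.
- by move=> x cx v; exact: form_linearl.
- by move=> x cx u; exact: form_linearr.
- by move=> x cx u; exact: form_alternating.
- by move=> u v; exact: (smooth_on_Ck R 1 oc (@form_smooth R n M w _ Mc u v)).
Qed.

Lemma derive_row_coord (V : normedModType R) (m : nat) (F : V -> 'rV[R]_m) x u j : derivable F x u ->
  ('D_u F x) 0 j = 'D_u (fun y => F y 0 j) x.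
Proof.
by move=> dF; have [_ ->] := iffLR (is_derive_rowP F x u _) (derivableP dF) j.
Qed.

Lemma pbw_Ck (T : topologicalType) (m k : nat) (p : T * 'rV[R]_m -> M) A u v :
  open A -> plot k.+1 p A -> Ck k (fun z => pbw (fun x => p (z.1, x)) z.2 u v) A.
Proof.
move=> oA pp; have [cp sp] := pp; have pp1 : plot 1 p A by exact: plot_le pp.
apply: Ck_local => z0 Az0; have [c Mc cz0] := @atlas_cover R n M (p z0).
have oB := plot_open oA (chart_dom_open c) pp.
exists (A `&` p @^-1` chart_dom c) => //; set B := A `&` _ in oB *.
have oc : open (chart_cod c) := @chart_cod_open R n M c.
have la := local_form_chart Mc.
have cc j : Ck k.+1 (fun z => c (p z) 0 j) B by exact: sp.
pose Dc t j (z : T * 'rV[R]_m) := 'D_t (fibre (fun z => c (p z) 0 j) z.1) z.2.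
have cD t j : Ck k (Dc t j) B by exact: Ck_derive.
have CC : Ck k (fun z => \sum_i \sum_j Dc u i z * Dc v j z * w c (c (p z)) 'e_i 'e_j) B.
  apply: Ck_sum => // i _; apply: Ck_sum => // j _; apply: CkM => //; first exact: CkM.
  apply: (@Ck_comp0 R T m n k (fun x => w c x 'e_i 'e_j) (fun z => c (p z)) B (chart_cod c)) => //.
  - by move=> z [_ cz]; exact: chart_cod_in.
  - exact: (smooth_on_Ck R k oc (@form_smooth R n M w _ Mc _ _)).
  - by move=> l; exact: CkS (cc l).
apply: Ck_ext CC => // -[t x]; rewrite inE => -[Az cz].
have dq := plot_mdiff oA pp1 Az; have [_ dqc] := dq.
rewrite (pbwE u v dq Mc cz) (lf_expand la _ _ (chart_cod_in cz)) /=.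
apply: eq_bigr => i _; apply: eq_bigr => j _.
have dcp s : derivable (fun y => c (p (t, y))) x s by apply: diff_derivable; exact: dqc.
congr (_ * _ * _); apply: esym; exact: derive_row_coord.
Qed.

(** Near [x] a single chart reduces the claim to [pullback_closed]. *)
Lemma pbw_closed (m : nat) (q : 'rV[R]_m -> M) (U : set 'rV[R]_m) : closed_form w -> open U ->
  plot 2 (fun z : R * 'rV[R]_m => q z.2) (cyl U) -> local_closed U (fun x u v => pbw q x u v).
Proof.
move=> cw oU pq x Ux u v t; have [c Mc cx] := @atlas_cover R n M (q x).
have oc : open (chart_cod c) := @chart_cod_open R n M c.
have oA : open (cyl U : set (R * _)) by exact: open_cyl.
have pq1 : plot 1 (fun z : R * 'rV[R]_m => q z.2) (cyl U) by exact: plot_le pq.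
have dq y : U y -> mdiff q y by move=> Uy; exact: (plot_mdiff oA pq1 (Uy : cyl U (0, y))).
pose U' := U `&` q @^-1` chart_dom c.
have oU' : open U'.
  by apply: open_preimage_on => // [|y Uy]; [exact: chart_dom_open|exact: (dq y Uy).1].
have cq j : Ck 2 (fun z : R * 'rV[R]_m => c (q z.2) 0 j) (cyl U').
  have [_ /(_ c Mc j)] := pq; exact: Ck_sub.
have cla : local_closed (chart_cod c) (w c).
  by move=> y cy a b e; exact: (cw c Mc y cy a b e).
have := @pullback_closed R m n (chart_cod c) (w c) oc (local_form_chart Mc) cla (fun y => c (q y)) U' oU'
  (fun y Uy => chart_cod_in Uy.2) cq x (conj Ux cx) u v t.
have nE a b : \forall y \near x, pullback_form (w c) (fun y => c (q y)) y a b = pbw q y a b.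
  apply: filterS (open_nbhs_nbhs (conj oU' (conj Ux cx))) => y [Uy cy].
  by rewrite (pbwE a b (dq y Uy) Mc cy).
move=> E; rewrite -[RHS]E.
have D (e a b : 'rV[R]_m) : 'D_e (fun y => pbw q y a b) x =
    'D_e (fun y => pullback_form (w c) (fun y => c (q y)) y a b) x by apply/esym/near_eq_derive/nE.
exact: (congr2 +%R (congr2 +%R (D u v t) (D v t u)) (D t u v)).
Qed.

End PullbackAlong.

Lemma eq_haar (R : realType) (k : nat) (G : lieGroupType R k) (F F' : G -> R) : F =1 F' -> haar F = haar F'.
Proof. by move=> /funext ->. Qed.

Lemma haar_mean_dir (R : realType) (k : nat) (G : lieGroupType R k) (T : topologicalType) (m : nat)
    (f : (T * G) * 'rV[R]_m -> R) A z u : compact [set: G] -> open A -> Ck 1 f (with_group A) -> A z ->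
  'D_u (fibre (haar_mean f) z.1) z.2 = haar (fun g => 'D_u (fibre f (z.1, g)) z.2).
Proof.
move=> cG oA cf Az; have oA' := @open_with_group R k G T m A oA.
have [_ ->] := Ck1_derive u oA (Ck_haar_mean cG oA cf) Az.
have Az' (g : G) : with_group A ((z.1, g), z.2) by rewrite /with_group /= -surjective_pairing.
have -> : (fun g => 'D_u (fibre f (z.1, g)) z.2) = fun g => \sum_i u 0 i * pd i f ((z.1, g), z.2).
  by apply/funext => g; have [_ ->] := Ck1_derive u oA' cf (Az' g).
have cp i : continuous (fun g => pd i f ((z.1, g), z.2)).
  have [_ /(_ i)[_ ci]] := cf.
  exact: (@continuous_in_group R k G T m 0 (pd i f) A z ci Az).
rewrite haar_sum// => [|i]; last exact: continuous_scale.
apply: eq_bigr => i _; rewrite haarZ//; congr (_ * _).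
by rewrite pdE; have [_ ->] := haar_mean_derive cG i oA cf Az.
Qed.

Section HaarCombinations.
Context {R : realType} {k : nat} {G : lieGroupType R k}.
Hypothesis compactG : compact [set: G].
Implicit Types F : G -> R.

Lemma haar_lin (a : R) F1 F2 : continuous F1 -> continuous F2 ->
  haar (fun g => a * F1 g + F2 g) = a * haar F1 + haar F2.
Proof. by move=> c1 c2; rewrite haarD// ?haarZ//; exact: continuous_scale. Qed.

Lemma haar_add3 F1 F2 F3 : continuous F1 -> continuous F2 -> continuous F3 ->
  haar (fun g => F1 g + F2 g + F3 g) = haar F1 + haar F2 + haar F3.
Proof.
move=> c1 c2 c3; have c12 : continuous (fun g => F1 g + F2 g).
  by move=> g; exact: (continuousD (c1 g) (c2 g)).
by rewrite (haarD compactG c12 c3) haarD.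
Qed.

Lemma haarN F : continuous F -> haar (fun g => - F g) = - haar F.
Proof.
by move=> cF; rewrite -mulN1r -haarZ//; apply: eq_haar => g; rewrite mulN1r.
Qed.

End HaarCombinations.

(** * The averaged form on R * M *)

Section AveragedForm.
Context {R : realType} {k n : nat} {G : lieGroupType R k} {M : manifoldType R n}.
Notation P := (CrMap 2 (G * M)%type M).
Hypothesis compactG : compact [set: G].
Variables (w : twoForm M) (rho0 : P) (phi : P * (R * M) -> M) (V0 : set P).
Hypothesis sw : symplectic_form w.
Hypotheses (oV0 : open V0) (Vrho0 : V0 rho0).
Hypothesis phi0 : forall t x, -7 <= t <= 7 -> phi (rho0, (t, x)) = x.
Hypothesis phi_plot : forall (S : topologicalType) (r : S -> P) (m d : nat) (t : S * 'rV[R]_d -> R)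
    (q : S * 'rV[R]_d -> M) A,
    (0 < m)%N -> evCk r m -> open A -> Ck m t A -> plot m q A ->
    (forall z, A z -> {for z, continuous (r \o fst)}) ->
    (forall z, A z -> V0 (r z.1) /\ -6 <= t z <= 6) -> plot m (fun z => phi (r z.1, (t z, q z))) A.
Implicit Types (c d : chart R n M) (rho : P).

Lemma evCk_comp (S T : topologicalType) (r : T -> P) (a : S -> T) j : continuous a -> evCk r j -> evCk (r \o a) j.
Proof.
move=> ca er c d Mc Md; have [oE hE] := er c d Mc Md.
pose F (z : (S * G) * 'rV[R]_n) : (T * G) * 'rV[R]_n := ((a z.1.1, z.1.2), z.2).
have cag (z : (S * G) * 'rV[R]_n) : {for z, continuous (fun z : (S * G) * 'rV[R]_n => (a z.1.1, z.1.2))}.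
  apply: continuous_pair.
    apply: (@continuous_comp _ _ _ (fst \o fst) a); last exact: ca.
    by apply: (@continuous_comp _ _ _ fst fst); exact: cvg_fst.
  by apply: (@continuous_comp _ _ _ fst snd); [exact: cvg_fst|exact: cvg_snd].
have cF (z : (S * G) * 'rV[R]_n) : {for z, continuous F}.
  by apply: continuous_pair; [exact: cag|exact: cvg_snd].
have oE' : open (ev_dom (r \o a) c d) by apply: (@open_comp _ _ F (ev_dom r c d)) => // z _; exact: cF.
split=> // i.
exact: (@Ck_comp R (S * G)%type (T * G)%type n n j (fun z => d (ev (r z.1.1) z.1.2 (chart_inv c z.2)) 0 i)
  (ev_dom r c d) (fun s => (a s.1, s.2)) (fun z => z.2) (ev_dom (r \o a) c d) oE' oE
  (fun z Az => Az) (fun z _ => cag z) (fun i => Ck_coord _ _ _) (hE i)).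
Qed.

Definition moved rho (m : nat) (tau : 'rV[R]_m -> R) (q : 'rV[R]_m -> M) (g : G) (y : 'rV[R]_m) : M :=
  phi (rho, (tau y, ev rho g (q y))).

Lemma moved_plot (S : topologicalType) (r : S -> P) (m d : nat) (t : S * 'rV[R]_d -> R)
    (q : S * 'rV[R]_d -> M) A : (0 < m)%N -> evCk r m -> continuous r -> open A -> Ck m t A -> plot m q A ->
  (forall z, A z -> V0 (r z.1) /\ -6 <= t z <= 6) ->
  plot m (fun z : (S * G) * 'rV[R]_d =>
    moved (r z.1.1) (fun y => t (z.1.1, y)) (fun y => q (z.1.1, y)) z.1.2 z.2) (with_group A).
Proof.
move=> m0 er cr oA ct pq hA; have oA' := @open_with_group R k G S d A oA.
have c1 (z : (S * G) * 'rV[R]_d) : {for z, continuous (fst \o fst)}.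
  by apply: (@continuous_comp _ _ _ fst fst); exact: cvg_fst.
have c2 (z : (S * G) * 'rV[R]_d) : {for z, continuous (snd \o fst)}.
  by apply: (@continuous_comp _ _ _ fst snd); [exact: cvg_fst|exact: cvg_snd].
have cfst : continuous (fst : S * G -> S) by move=> z; exact: cvg_fst.
have ct' : Ck m (fun z : (S * G) * 'rV[R]_d => t (z.1.1, z.2)) (with_group A).
  exact: (@Ck_comp R (S * G)%type S d d m t A fst (fun z => z.2) (with_group A) oA' oA
    (fun z Az => Az) (fun z _ => c1 z) (fun i => Ck_coord _ _ _) ct).
have pq' : plot m (fun z : (S * G) * 'rV[R]_d => q (z.1.1, z.2)) (with_group A).
  exact: (@plot_comp R n M (S * G)%type S d d m q A fst (fun z => z.2) (with_group A) oA oA' pq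
    (fun z Az => Az) (fun z _ => c1 z) (fun i => Ck_coord _ _ _)).
have pe := @ev_plot R k n G M (S * G)%type S r d m fst snd _ _ er oA' pq' (fun z _ => c1 z) (fun z _ => c2 z).
have crf (z : (S * G) * 'rV[R]_d) : {for z, continuous ((r \o fst) \o fst)}.
  by apply: (@continuous_comp _ _ _ (fst \o fst) r); [exact: c1|exact: cr].
exact: (@phi_plot (S * G)%type (r \o fst) m d _ _ (with_group A) m0 (evCk_comp cfst er) oA' ct' pe
  (fun z _ => crf z) (fun z Az => hA _ Az)).
Qed.

(** The averaged form is represented by its pullbacks along the maps [(tau, q)]. Its chart
    expressions [OmC] and its restrictions to a fixed time are both of this kind, and [Om_comp]
    relates them. *)
Definition Om rho (m : nat) (tau : 'rV[R]_m -> R) (q : 'rV[R]_m -> M) x u v : R :=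
  haar (fun g => pbw w (moved rho tau q g) x u v).

Definition adm (m : nat) (U : set 'rV[R]_m) (tau : 'rV[R]_m -> R) (q : 'rV[R]_m -> M) : Prop :=
  [/\ open U, forall j, Ck j (fun z : R * 'rV[R]_m => tau z.2) (cyl U),
    forall j, plot j (fun z : R * 'rV[R]_m => q z.2) (cyl U) & forall x, U x -> -6 <= tau x <= 6].

Definition tc (z : 'rV[R]_(1 + n)) : R := (lsubmx z) 0 0.
Definition xc (z : 'rV[R]_(1 + n)) : 'rV[R]_n := rsubmx z.
Definition pdom c : set 'rV[R]_(1 + n) := [set z | `|tc z| < 6 /\ chart_cod c (xc z)].

Lemma Ck_tc (T : topologicalType) j A : Ck j (fun z : T * 'rV[R]_(1 + n) => tc z.2) A.
Proof. by apply: Ck_lsubmx => i; exact: Ck_coord. Qed.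

Lemma Ck_xc (T : topologicalType) j A i : Ck j (fun z : T * 'rV[R]_(1 + n) => xc z.2 0 i) A.
Proof. by apply: Ck_rsubmx => a; exact: Ck_coord. Qed.

Lemma continuous_tc : continuous tc.
Proof. by apply: (@Ck_continuous_snd R (1 + n) 0); exact: Ck_tc. Qed.

Lemma continuous_xc : continuous xc.
Proof. exact: continuous_rsubmx. Qed.

Lemma open_pdom c : open (pdom c).
Proof.
apply: openI.
  apply: (@open_comp _ _ (fun z => `|tc z|) [set a | a < 6]); last exact: open_lt.
  move=> z _; apply: (@continuous_comp _ _ _ tc (fun a : R => `|a|)); first exact: continuous_tc.
  exact: norm_continuous.
apply: (@open_comp _ _ xc); last exact: chart_cod_open.
by move=> z _; exact: continuous_xc.
Qed.

Lemma pdom_plot (T : topologicalType) j c : atlas M c ->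
  plot j (fun z : T * 'rV[R]_(1 + n) => chart_inv c (xc z.2)) (cyl (pdom c)).
Proof.
move=> Mc; apply: plot_inv_comp => //; last by move=> i; exact: Ck_xc.
  by apply: open_cyl; exact: open_pdom.
by move=> z [].
Qed.

Lemma adm_chart c : atlas M c -> adm (pdom c) tc (chart_inv c \o xc).
Proof.
move=> Mc; split=> [|j|j|z [+ _]]; first exact: open_pdom.
- exact: Ck_tc.
- exact: pdom_plot.
by rewrite ltr_norml => /andP[/ltW -> /ltW ->].
Qed.

Definition OmC rho c z u v : R := Om rho tc (chart_inv c \o xc) z u v.

Lemma OmC_Ck (S : topologicalType) (r : S -> P) (m : nat) c u v : atlas M c -> evCk r m.+1 -> continuous r ->
  Ck m (fun z : S * 'rV[R]_(1 + n) => OmC (r z.1) c z.2 u v) [set z | V0 (r z.1) /\ pdom c z.2].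
Proof.
move=> Mc er cr; set A := [set z | _].
have oA : open A.
  apply: openI; last by apply: open_cyl; exact: open_pdom.
  apply: (@open_comp _ _ (r \o fst) V0) => // z _.
  by apply: (@continuous_comp _ _ _ fst r); [exact: cvg_fst|exact: cr].
have pq : plot m.+1 (fun z : S * 'rV[R]_(1 + n) => chart_inv c (xc z.2)) A.
  by apply: (@plot_sub _ _ _ _ _ _ _ (cyl (pdom c))); [move=> z []|exact: pdom_plot].
have hA z : A z -> V0 (r z.1) /\ -6 <= tc z.2 <= 6.
  by move=> [Vz [tz _]]; split=> //; move: tz; rewrite ltr_norml => /andP[/ltW -> /ltW ->].
have pm := moved_plot (ltn0Sn m) er cr oA (@Ck_tc S m.+1 A) pq hA.
have oA' := @open_with_group R k G S (1 + n) A oA.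
exact: (Ck_haar_mean compactG oA (pbw_Ck w u v oA' pm)).
Qed.

Section FixedAction.
Variable rho : P.
Hypotheses (Vrho : V0 rho) (act : symplectic_action w (rho : smoothMap (G * M)%type M)).

Let actM g h x : ev rho g (ev rho h x) = ev rho (g * h)%g x. Proof. exact: act.1.2. Qed.

Section Adm.
Variables (m : nat) (U : set 'rV[R]_m) (tau : 'rV[R]_m -> R) (q : 'rV[R]_m -> M).
Hypothesis aU : adm U tau q.

Lemma adm_plot j : (0 < j)%N -> plot j (fun z : (R * G) * 'rV[R]_m => moved rho tau q z.1.2 z.2)
  (with_group (cyl U)).
Proof.
have [oU ct pq tU] := aU; move=> j0.
have cr : continuous (fun _ : R => rho) by move=> z; exact: cvg_cst.
have oc : open (cyl U : set (R * 'rV[R]_m)) by exact: open_cyl.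
exact: (@moved_plot R (fun=> rho) j m (fun z => tau z.2) (fun z => q z.2) (cyl U) j0 (evCk_cst _ rho j) cr
  oc (ct j) (pq j) (fun z Uz => conj Vrho (tU _ Uz))).
Qed.

Lemma adm_mdiff x g : U x -> mdiff (moved rho tau q g) x.
Proof.
have [oU _ _ _] := aU; move=> Ux.
have oA : open (with_group (cyl U) : set ((R * G) * 'rV[R]_m)) by apply: open_with_group; exact: open_cyl.
exact: (@plot_mdiff R n M (R * G)%type m _ _ ((0, g), x) oA (adm_plot (isT : (0 < 1)%N)) Ux).
Qed.

Lemma adm_Ck j u v : Ck j (fun z : (R * G) * 'rV[R]_m => pbw w (moved rho tau q z.1.2) z.2 u v)
  (with_group (cyl U)).
Proof.
have [oU _ _ _] := aU.
have oA : open (with_group (cyl U) : set ((R * G) * 'rV[R]_m)) by apply: open_with_group; exact: open_cyl.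
exact: (pbw_Ck w u v oA (adm_plot (ltn0Sn j))).
Qed.

Lemma adm_continuous x u v : U x -> continuous (fun g => pbw w (moved rho tau q g) x u v).
Proof.
by move=> Ux; exact: (@continuous_in_group R k G R m 0 _ (cyl U) (0, x) (adm_Ck 0 u v) Ux).
Qed.

(** Composing [q] with the action of [h] replaces [g] by [g h] in [moved], which the right-invariant
    mean ignores. *)
Lemma Om_act h x u v : U x -> Om rho tau (fun y => ev rho h (q y)) x u v = Om rho tau q x u v.
Proof.
move=> Ux; rewrite -[RHS](haar_shift compactG h (@adm_continuous x u v Ux)).
rewrite /Om; apply: eq_haar => g.
by have -> : moved rho tau (fun y => ev rho h (q y)) g = moved rho tau q (g * h)%g
  by apply/funext => y; rewrite /moved actM.
Qed.

Lemma Om_linearl x v : U x -> scalar (fun u => Om rho tau q x u v).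
Proof.
move=> Ux a u u'; rewrite /Om.
have E g := pbw_linearl w v (adm_mdiff g Ux) a u u'.
have c1 := @adm_continuous x u v Ux; have c2 := @adm_continuous x u' v Ux.
apply: (etrans _ (haar_lin compactG a c1 c2)).
by apply: eq_haar => g; exact: E.
Qed.

Lemma Om_alternating x u : Om rho tau q x u u = 0.
Proof. by rewrite /Om; under eq_fun do rewrite pbw_alternating; exact: haar_cst. Qed.

Lemma Om_Ck j u v : Ck j (fun z : R * 'rV[R]_m => Om rho tau q z.2 u v) (cyl U).
Proof.
have [oU _ _ _] := aU.
have oc : open (cyl U : set (R * 'rV[R]_m)) by exact: open_cyl.
exact: (Ck_haar_mean compactG oc (adm_Ck j u v)).
Qed.

(** Derivatives pass under the mean, and for each [g] the integrand is a pullback of the closed form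
    [w] ([pbw_closed]). *)
Lemma Om_closed : local_closed U (Om rho tau q).
Proof.
have [oU ct pq tU] := aU; move=> x Ux a b e.
have oc : open (cyl U : set (R * 'rV[R]_m)) by exact: open_cyl.
have D s u v : 'D_s (fun y => Om rho tau q y u v) x = haar (fun g => 'D_s (fun y => pbw w (moved rho tau q g) y u v) x).
  exact: (@haar_mean_dir R k G R m _ (cyl U) (0, x) s compactG oc (adm_Ck 1 u v) Ux).
have cD s u v : continuous (fun g => 'D_s (fun y => pbw w (moved rho tau q g) y u v) x).
  have oA : open (with_group (cyl U) : set ((R * G) * 'rV[R]_m)) by exact: open_with_group.
  exact: (@continuous_in_group R k G R m 0 _ (cyl U) (0, x) (Ck_derive s oA (adm_Ck 1 u v)) Ux).
apply: (etrans (congr2 +%R (congr2 +%R (D a b e) (D b e a)) (D e a b))).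
apply: (etrans (esym (haar_add3 compactG (cD a b e) (cD b e a) (cD e a b)))).
apply: (etrans _ (@haar_cst R k G compactG 0)); apply: eq_haar => g.
have pl : plot 2 (fun z : R * 'rV[R]_m => moved rho tau q g z.2) (cyl U).
  have cg (z : R * 'rV[R]_m) : {for z, continuous ((fun s : R => (s, g)) \o fst)}.
    by apply: continuous_pair; [exact: cvg_fst|exact: cvg_cst].
  have oA : open (with_group (cyl U) : set ((R * G) * 'rV[R]_m)) by exact: open_with_group.
  exact: (@plot_comp R n M R (R * G)%type m m 2 _ (with_group (cyl U)) (fun s => (s, g)) (fun z => z.2) (cyl U)
    oA oc (adm_plot (isT : (0 < 2)%N)) (fun z Uz => Uz) (fun z _ => cg z) (fun i => Ck_coord _ _ _)).
exact: (pbw_closed sw.1 oU pl Ux).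
Qed.

Lemma Om_local_form : local_form U (Om rho tau q).
Proof.
split=> [x Ux v|x Ux u a v v'|x Ux u|u v].
- exact: Om_linearl.
- have anti y z : Om rho tau q x y z = - Om rho tau q x z y.
    have al s := Om_linearl s Ux.
    have addl s t r : Om rho tau q x (s + t) r = Om rho tau q x s r + Om rho tau q x t r.
      by have := al r 1 s t; rewrite scale1r mul1r.
    have cE s r : continuous (fun g => pbw w (moved rho tau q g) x s r) by exact: adm_continuous.
    apply: (etrans _ (haarN compactG (cE z y))); apply: eq_haar => g.
    have lg t := pbw_linearl w t (adm_mdiff g Ux).
    have c1 : chart_cod (chart_at (moved rho tau q g x)) (chart_at (moved rho tau q g x) (moved rho tau q g x)).
      by apply: chart_cod_in; exact: chart_at_dom.
    exact: (lf_sym (local_form_chart w (chart_at_atlas _)) _ _ c1).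
  have alg (p p' s s' : R) : p = - p' -> s = - s' -> - (a * p' + s') = a * p + s.
    by move=> -> ->; rewrite mulrN opprD.
  exact: (etrans (anti u (a *: v + v')) (etrans (congr1 -%R (Om_linearl u Ux a v v'))
    (alg _ _ _ _ (anti u v) (anti u v')))).
- exact: Om_alternating.
- exact: Om_Ck.
Qed.

Lemma Om_comp (p : nat) (F : 'rV[R]_p -> 'rV[R]_m) x u v : U (F x) -> differentiable F x ->
  Om rho (fun y => tau (F y)) (fun y => q (F y)) x u v = Om rho tau q (F x) ('D_u F x) ('D_v F x).
Proof.
move=> UF dF; rewrite /Om; apply: eq_haar => g.
exact: (@pbw_comp R n M w _ _ (moved rho tau q g) F x u v (adm_mdiff g UF) dF).
Qed.

End Adm.

Lemma Om_ext (m : nat) (tau tau' : 'rV[R]_m -> R) (q q' : 'rV[R]_m -> M) x u v :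
  (\forall y \near x, tau y = tau' y /\ q y = q' y) -> Om rho tau q x u v = Om rho tau' q' x u v.
Proof.
move=> h; rewrite /Om; apply: eq_haar => g; apply: pbw_ext; apply: filterS h => y [e1 e2].
by rewrite /moved e1 e2.
Qed.

End FixedAction.
End AveragedForm.

Lemma scalar_lincomb (R : realType) (V : lmodType R) (p : nat) (f : V -> R) (c : 'I_p -> R) (F : 'I_p -> V) :
  scalar f -> f (\sum_i c i *: F i) = \sum_i c i * f (F i).
Proof.
move=> hf; have f0 : f 0 = 0.
  by have := hf (-1) 0 0; rewrite scaler0 addr0 mulN1r addNr.
elim/big_rec2: _ => // i y1 y2 _ E.
by rewrite hf E.
Qed.

(** * The kernel line of an alternating form in 1 + n variables *)

Section KernelLine.
Context {R : realType} {n : nat}.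
Variable B : 'rV[R]_(1 + n) -> 'rV[R]_(1 + n) -> R.
Hypotheses (Bl : forall v, scalar (fun u => B u v)) (Br : forall u, scalar (B u))
  (Ba : forall u, B u u = 0).

Definition spatial : 'M[R]_n := \matrix_(i, j) B 'e_(rshift 1 i) 'e_(rshift 1 j).
Definition mixed : 'rV[R]_n := \row_j B 'e_(lshift n ord0) 'e_(rshift 1 j).
Definition kernel_vector : 'rV[R]_n := - mixed *m invmx spatial.

Lemma row_mx_split (a : R) (xi : 'rV[R]_n) :
  row_mx (const_mx a) xi = a *: 'e_(lshift n ord0) + \sum_i xi 0 i *: 'e_(rshift 1 i).
Proof.
apply/rowP => j; rewrite -(splitK j); case: (fintype.split j) => i /=.
  rewrite row_mxEl ord1 !mxE summxE big1 ?addr0 => [|l _]; last by rewrite !mxE eq_lrshift andbF mulr0.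
  by rewrite !eqxx mulr1.
rewrite row_mxEr !mxE eq_rlshift andbF mulr0 add0r summxE (bigD1 i)//= big1 => [|l li].
  by rewrite !mxE !eqxx mulr1 addr0.
by rewrite !mxE eq_rshift eq_sym (negbTE li) andbF mulr0.
Qed.

Lemma scalarD (f : 'rV[R]_(1 + n) -> R) a u v : scalar f -> f (a *: u + v) = a * f u + f v.
Proof. by move=> ->. Qed.

Lemma kernel_equation xi j : B (row_mx (const_mx 1) xi) 'e_(rshift 1 j) = mixed 0 j + (xi *m spatial) 0 j.
Proof.
rewrite row_mx_split (scalarD _ _ _ (Bl _)) mul1r (scalar_lincomb _ _ (Bl _)) !mxE; congr (_ + _).
by apply: eq_bigr => i _; rewrite mxE.
Qed.

(** Testing against the space directions gives [n] linear equations with matrix [spatial], solved by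
    [kernel_vector]. The remaining equation, in the time direction, follows from [B y y = 0]. *)
Lemma kernel_vectorP xi : spatial \in unitmx ->
  (forall v, B (row_mx (const_mx 1) xi) v = 0) <-> xi = kernel_vector.
Proof.
move=> uS; split=> [h|->].
  rewrite /kernel_vector; have -> : mixed = - (xi *m spatial).
    by apply/rowP => j; have := kernel_equation xi j; rewrite h !mxE => /esym /eqP; rewrite addr_eq0 => /eqP.
  by rewrite opprK mulmxK.
set xi0 := kernel_vector; set y := row_mx _ xi0.
have h1 j : B y 'e_(rshift 1 j) = 0.
  by rewrite kernel_equation /xi0 /kernel_vector mulmxKV// [X in _ + X]mxE addrN.
have h2 : B y (\sum_i xi0 0 i *: 'e_(rshift 1 i)) = 0.
  by rewrite (scalar_lincomb _ _ (Br _)) big1// => i _; rewrite h1 mulr0.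
have h0 : B y 'e_(lshift n ord0) = 0.
  by have := Ba y; rewrite {2}/y row_mx_split (scalarD _ _ _ (Br _)) h2 mul1r addr0.
move=> v; have -> : v = row_mx (const_mx (v 0 (lshift n ord0))) (rsubmx v).
  rewrite -[LHS]hsubmxK; congr row_mx; apply/rowP => i.
  by rewrite !mxE ord1.
rewrite row_mx_split (scalarD _ _ _ (Br _)) h0 mulr0 add0r (scalar_lincomb _ _ (Br _)).
by rewrite big1// => i _; rewrite h1 mulr0.
Qed.

End KernelLine.

(** * The kernel field for actions near [rho0] *)

Section MoserField.
Context {R : realType} {k n : nat} {G : lieGroupType R k} {M : manifoldType R n}.
Notation P := (CrMap 2 (G * M)%type M).
Hypotheses (compactG : compact [set: G]) (compactM : compact [set: M]).
Variables (w : twoForm M) (rho0 : P) (phi : P * (R * M) -> M) (V0 : set P).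
Hypothesis sw : symplectic_form w.
Hypotheses (oV0 : open V0) (Vrho0 : V0 rho0).
Hypothesis act0 : symplectic_action w (rho0 : smoothMap (G * M)%type M).
Hypothesis phi0 : forall t x, -7 <= t <= 7 -> phi (rho0, (t, x)) = x.
Hypothesis phi_plot : forall (S : topologicalType) (r : S -> P) (m d : nat) (t : S * 'rV[R]_d -> R)
    (q : S * 'rV[R]_d -> M) A,
    (0 < m)%N -> evCk r m -> open A -> Ck m t A -> plot m q A ->
    (forall z, A z -> {for z, continuous (r \o fst)}) ->
    (forall z, A z -> V0 (r z.1) /\ -6 <= t z <= 6) -> plot m (fun z => phi (r z.1, (t z, q z))) A.
Implicit Types (c d : chart R n M) (rho : P).
Let OmC := OmC w phi.

(** Where [phi] is the identity, the integrand is the pullback of [w] by [ev rho g] after [q],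
    constant in [g] because [rho] is symplectic. This serves for [rho0] at all times and for [rho]
    at time 0. *)
Lemma Om_trivial rho (m : nat) U (tau : 'rV[R]_m -> R) (q : 'rV[R]_m -> M) x u v :
  symplectic_action w (rho : smoothMap (G * M)%type M) -> adm U tau q -> U x ->
  (forall y, U y -> forall z, phi (rho, (tau y, z)) = z) ->
  Om w phi rho tau q x u v = pbw w q x u v.
Proof.
move=> act [oU ct pq tU] Ux hU.
have oc : open (cyl U : set (R * 'rV[R]_m)) by exact: open_cyl.
have dq : mdiff q x := @plot_mdiff R n M R m _ _ (0, x) oc (pq 1%N) Ux.
apply: (etrans _ (@haar_cst R k G compactG _)); apply: eq_haar => g.
have nE : \forall y \near x, moved phi rho tau q g y = ev rho g (q y).
  by apply: filterS (open_nbhs_nbhs (conj oU Ux)) => y Uy; exact: hU.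
rewrite (pbw_ext w u v nE).
exact: (pbw_symplectic u v (@smooth_ev R k n G M rho g) (act.2 g) dq).
Qed.

Lemma pbw_xc c z u v : atlas M c -> pdom c z ->
  pbw w (chart_inv c \o xc (n := n)) z u v = w c (xc z) (xc u) (xc v).
Proof.
move=> Mc [_ cz]; have dq := mdiff_chart_inv Mc cz.
have D t := is_derive_rsubmx (p := 1) z t.
have dx : differentiable (xc (n := n) : 'rV[R]_(1 + n) -> 'rV[R]_n) z by exact: differentiable_rsubmx.
apply: (etrans (pbw_comp w u v dq dx)).
have E t : 'D_t (xc (n := n)) z = xc t by have [_ ->] := D t.
by rewrite (E u) (E v) pbw_chart_inv.
Qed.

Lemma OmC_rho0 c z u v : atlas M c -> pdom c z -> OmC rho0 c z u v = w c (xc z) (xc u) (xc v).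
Proof.
move=> Mc cz; rewrite -pbw_xc//; apply: (Om_trivial u v act0 (adm_chart Mc) cz) => y [ty _] x.
by apply: phi0; move: ty; rewrite ltr_norml => /andP[h1 h2]; apply/andP; split; lra.
Qed.

Definition Wm rho c z : 'M[R]_n := spatial (OmC rho c z).
Definition Xf rho c z : 'rV[R]_n := kernel_vector (OmC rho c z).

(** For [rho0] the form is the pullback of [w] by the projection to [M]: the space block is the
    nondegenerate matrix of [w], the mixed block vanishes, and the kernel is spanned by d/dt. *)
Lemma Wm_rho0 c z : atlas M c -> pdom c z -> Wm rho0 c z \in unitmx /\ Xf rho0 c z = 0.
Proof.
move=> Mc cz; have [_ ccz] := cz.
have la := local_form_chart w Mc.
have xr i : xc ('e_(rshift 1 i) : 'rV[R]_(1 + n)) = 'e_i by exact: rsubmx_delta_r.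
have xl i : xc ('e_(lshift n i) : 'rV[R]_(1 + n)) = 0 by exact: rsubmx_delta_l.
split; last first.
  rewrite /Xf /kernel_vector; have -> : mixed (OmC rho0 c z) = 0; last by rewrite oppr0 mul0mx.
  apply/rowP => j; rewrite !mxE OmC_rho0// xl.
  exact: (scalar0 (lf_linearl la ccz _)).
rewrite -row_free_unit; apply: inj_row_free => u uW.
apply: (sw.2 c Mc (xc z) ccz) => v.
rewrite [v]row_sum_e (scalar_sum _ _ (lf_linearr la ccz _)) big1// => j _.
rewrite [u]row_sum_e (scalar_sum _ _ (lf_linearl la ccz _)).
have /rowP/(_ j) := uW; rewrite !mxE => E; rewrite -[X in _ * X]/(\sum_i _).
rewrite (_ : \sum_i _ = 0) ?mulr0// -[RHS]E; apply: eq_bigr => i _.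
by rewrite mxE OmC_rho0// !xr.
Qed.

Section Regularity.
Context {S : topologicalType}.
Variables (r : S -> P) (m : nat) (c : chart R n M).
Hypotheses (Mc : atlas M c) (er : evCk r m.+1) (cr : continuous r).
Let A := [set z : S * 'rV[R]_(1 + n) | V0 (r z.1) /\ pdom c z.2].

Let oA : open A.
Proof.
apply: openI; last by apply: open_cyl; exact: open_pdom.
apply: (@open_comp _ _ (r \o fst) V0) => // z _.
by apply: (@continuous_comp _ _ _ fst r); [exact: cvg_fst|exact: cr].
Qed.

Let cO u v : Ck m (fun z => OmC (r z.1) c z.2 u v) A.
Proof. exact: (OmC_Ck compactG w oV0 phi_plot u v Mc er cr). Qed.

Let cW i j : Ck m (fun z => Wm (r z.1) c z.2 i j) A.
Proof. by apply: Ck_ext (cO 'e_(rshift 1 i) 'e_(rshift 1 j)) => // z _; rewrite /Wm mxE. Qed.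

Definition moser_dom := [set z : S * 'rV[R]_(1 + n) | [/\ V0 (r z.1), pdom c z.2 & Wm (r z.1) c z.2 \in unitmx]].

Lemma open_moser_dom : open moser_dom.
Proof.
have cd := Ck_det oA cW.
have -> : moser_dom = A `&` (fun z => \det (Wm (r z.1) c z.2)) @^-1` (~` [set 0]).
  apply/seteqP; split=> z; rewrite /moser_dom /A /= unitmxE unitfE.
    by move=> [h1 h2 /eqP h3].
  by move=> [[h1 h2] /eqP h3].
apply: open_preimage_on => //; last by move=> z; exact: Ck_cont cd.
by apply: closed_openC; exact/accessible_closed_set1/hausdorff_accessible/Rhausdorff.
Qed.

Lemma Xf_Ck j : Ck m (fun z => Xf (r z.1) c z.2 0 j) moser_dom.
Proof.
have oD := open_moser_dom.
have DA : moser_dom `<=` A by move=> z [].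
have cb i l : Ck m (fun z => (- mixed (OmC (r z.1) c z.2)) i l) moser_dom.
  rewrite (ord1 i); apply: Ck_ext (CkN oD (Ck_sub DA (cO 'e_(lshift n ord0) 'e_(rshift 1 l)))) => // z _.
  by rewrite !mxE.
have ci i l : Ck m (fun z => invmx (Wm (r z.1) c z.2) i l) moser_dom.
  by apply: Ck_invmx => // [i' l'|z []//]; exact: Ck_sub DA (cW i' l').
exact: (Ck_mulmx oD cb ci).
Qed.

End Regularity.

(** A chart ball that orbits cannot leave too soon: with space speed at most [r / 2], in a time of
    at most 2 a point at distance less than [r] from the centre stays within [2 * r], well inside
    the box of radius [3 * r]. *)
Record trapped (rho : P) (c : chart R n M) (x0 : M) (r : R) : Prop := Trapped {
  tr_atlas : atlas M c ;
  tr_dom : chart_dom c x0 ;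
  tr_gt0 : 0 < r ;
  tr_box : forall z, `|tc z| <= 5 -> `|xc z - c x0| <= 3 * r ->
    [/\ pdom c z, Wm rho c z \in unitmx & `|Xf rho c z| <= r / 2] }.

(** At [rho0] the kernel field is d/dt ([Wm_rho0]); joint continuity in the action, compactness of
    the box and then of [M] give a common neighbourhood. *)
Lemma trapped_near : \forall rho \near rho0, forall x, exists c x0 r,
  [/\ trapped rho c x0 r, chart_dom c x & `|c x - c x0| < r].
Proof.
suff : \forall rho \near rho0, [set: M] `<=` (fun x => exists c x0 r,
    [/\ trapped rho c x0 r, chart_dom c x & `|c x - c x0| < r]).
  by apply: filterS => rho h x; exact: h.
have := (iffLR (compact_near_coveringP _) compactM) P (nbhs rho0) (fun rho x => exists c x0 r,
    [/\ trapped rho c x0 r, chart_dom c x & `|c x - c x0| < r]) _.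
apply => x0 _.
have [c Mc cx0] := @atlas_cover R n M x0.
have oc : open (chart_cod c) := @chart_cod_open R n M c.
have [r4 r40 r4c] := iffLR (near_ballP _ _) (open_nbhs_nbhs (conj oc (chart_cod_in cx0))).
(* A quarter, so that the closed ball of radius [3 * r] lies in the open ball of radius [r4]. *)
pose r := r4 / 4; have r0 : 0 < r by rewrite divr_gt0.
pose K : set 'rV[R]_(1 + n) := [set z | `|tc z| <= 5 /\ `|xc z - c x0| <= 3 * r].
have Kp z : K z -> pdom c z.
  move=> [h1 h2]; split; first by apply: le_lt_trans h1 _; lra.
  by apply: r4c; apply: le_lt_trans h2 _; rewrite /r; lra.
have cK : compact K.
  apply: bounded_closed_compact.
    exists (`|c x0| + 3 * r + 5); split; first exact: num_real.
    move=> b bB z [h1 h2]; apply: le_trans (ltW bB).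
    have hx : `|xc z| <= `|c x0| + 3 * r.
      by rewrite -(subrK (c x0) (xc z)) addrC; apply: le_trans (ler_normD _ _) _; rewrite lerD2l.
    have e0 : 0 <= `|c x0| + 3 * r by apply: le_trans hx.
    apply: normr_leP => [|i]; first by rewrite addr_ge0.
    rewrite -(splitK i); case: (fintype.split i) => l /=.
      have -> : z 0 (lshift n l) = tc z by rewrite /tc mxE ord1.
      by apply: le_trans h1 _; rewrite lerDr.
    have -> : z 0 (rshift 1 l) = xc z 0 l by rewrite /xc mxE.
    by apply: le_trans (normr_coord _ _) _; apply: le_trans hx _; rewrite lerDl.
  apply: closedI.
    apply: (@closed_comp _ _ (fun z => `|tc z|) [set a | a <= 5]); last exact: closed_le.
    move=> z _; apply: (@continuous_comp _ _ _ (tc (n := n)) (fun a : R => `|a|)); first exact: continuous_tc.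
    exact: norm_continuous.
  apply: (@closed_comp _ _ (fun z => `|xc z - c x0|) [set a | a <= 3 * r]); last exact: closed_le.
  move=> z _; apply: (@continuous_comp _ _ _ (fun z => xc (n := n) z - c x0) (fun a : 'rV[R]_n => `|a|)).
    by apply: (@continuousB _ _ _ (xc (n := n)) (fun=> c x0)); [exact: continuous_xc|exact: cst_continuous].
  exact: norm_continuous.
have nK : \forall rho \near rho0, K `<=` (fun z => Wm rho c z \in unitmx /\ `|Xf rho c z| <= r / 2).
  have := (iffLR (compact_near_coveringP _) cK) P (nbhs rho0)
    (fun rho z => Wm rho c z \in unitmx /\ `|Xf rho c z| <= r / 2) _.
  apply => z Kz.
  have [uW X0] := Wm_rho0 Mc (Kp z Kz).
  have er : evCk (@id P) 2 by exact: evCk_id.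
  have cid : continuous (@id P) by move=> y; exact: cvg_id.
  have oD := open_moser_dom Mc er cid.
  have Dz : moser_dom (@id P) c (rho0, z) by split=> //; exact: Kp.
  have cX : {for (rho0, z), continuous (fun y : P * 'rV[R]_(1 + n) => Xf y.1 c y.2)}.
    by apply/continuous_coord => j; exact: Ck_cont (Xf_Ck Mc er cid j) Dz.
  have r20 : 0 < r / 2 by rewrite divr_gt0.
  have n1 : \forall y \near (rho0, z), moser_dom (@id P) c y /\ `|Xf y.1 c y.2| <= r / 2.
    apply: filterI; first exact: (open_nbhs_nbhs (conj oD Dz)).
    have /cvgrPdistC_le/(_ _ r20) := cX; rewrite /= X0.
    by apply: filterS => y; rewrite subr0.
  have [[A1 A2] [nA1 nA2] A12] := n1.
  exists (A2, A1); first exact: (conj nA2 nA1).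
  move=> [z' rho] [a2 a1].
  have [[_ _ h1] h2] := A12 (rho, z') (conj a1 a2).
  exact: (conj h1 h2).
have nx : \forall x \near x0, chart_dom c x /\ `|c x - c x0| < r.
  apply: filterI; first exact: (open_nbhs_nbhs (conj (chart_dom_open c) cx0)).
  have := near_open_preimage (chart_map_continuous cx0) (ball_open (c x0) r) (ballxx (c x0) r0).
  by apply: filterS => x; rewrite -ball_normE /ball_ /= distrC.
exists ([set x | chart_dom c x /\ `|c x - c x0| < r],
  [set rho | K `<=` (fun z => Wm rho c z \in unitmx /\ `|Xf rho c z| <= r / 2)]); first by split.
move=> [x rho] [/= [cx xr] hK]; exists c, x0, r; split=> //; split=> // z h1 h2.
by have [h3 h4] := hK z (conj h1 h2); split=> //; exact: Kp.
Qed.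

End MoserField.

Lemma is_derive_row_mx2 (R : realType) (V : normedModType R) (p q : nat) (a : V -> 'rV[R]_p) (b : V -> 'rV[R]_q)
    x v da db : is_derive x v a da -> is_derive x v b db ->
  is_derive x v (fun y => row_mx (a y) (b y)) (row_mx da db).
Proof.
move=> ha hb; apply/is_derive_rowP => j; rewrite -(splitK j); case: (fintype.split j) => l /=.
  under eq_fun do rewrite row_mxEl; rewrite row_mxEl.
  exact: (iffLR (is_derive_rowP _ _ _ _) ha l).
under eq_fun do rewrite row_mxEr; rewrite row_mxEr.
exact: (iffLR (is_derive_rowP _ _ _ _) hb l).
Qed.

Lemma differentiable_row_mx2 (R : realType) (V : normedModType R) (p q : nat) (a : V -> 'rV[R]_p) (b : V -> 'rV[R]_q)
    x : differentiable a x -> differentiable b x -> differentiable (fun y => row_mx (a y) (b y)) x.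
Proof.
move=> ha hb; apply/differentiable_rowP => j; rewrite -(splitK j); case: (fintype.split j) => l /=.
  under eq_fun do rewrite row_mxEl.
  exact: (iffLR (differentiable_rowP _ _) ha l).
under eq_fun do rewrite row_mxEr.
exact: (iffLR (differentiable_rowP _ _) hb l).
Qed.

(** * Integral curves of the kernel direction, across charts and under the action *)

Section Transfer.
Context {R : realType} {k n : nat} {G : lieGroupType R k} {M : manifoldType R n}.
Notation P := (CrMap 2 (G * M)%type M).
Hypotheses (compactG : compact [set: G]).
Variables (w : twoForm M) (rho : P) (phi : P * (R * M) -> M) (V0 : set P).
Hypothesis Vrho : V0 rho.
Hypothesis act : symplectic_action w (rho : smoothMap (G * M)%type M).
Hypothesis phi_plot : forall (S : topologicalType) (r : S -> P) (m d : nat) (t : S * 'rV[R]_d -> R)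
    (q : S * 'rV[R]_d -> M) A,
    (0 < m)%N -> evCk r m -> open A -> Ck m t A -> plot m q A ->
    (forall z, A z -> {for z, continuous (r \o fst)}) ->
    (forall z, A z -> V0 (r z.1) /\ -6 <= t z <= 6) -> plot m (fun z => phi (r z.1, (t z, q z))) A.
Implicit Types (c d : chart R n M).
Let OmC := OmC w phi rho.

Let ev1 x : ev rho 1%g x = x. Proof. exact: act.1.1. Qed.
Let evM g h x : ev rho g (ev rho h x) = ev rho (g * h)%g x. Proof. exact: act.1.2. Qed.
Let evV h x : ev rho h^-1%g (ev rho h x) = x. Proof. by rewrite evM mulVg ev1. Qed.
Let evK h x : ev rho h (ev rho h^-1%g x) = x. Proof. by rewrite evM mulgV ev1. Qed.
Let sev h : smooth (ev rho h : M -> M). Proof. exact: smooth_ev. Qed.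

Definition at_time (s : R) (x : 'rV[R]_n) : 'rV[R]_(1 + n) := row_mx (const_mx s) x.

Lemma tc_at s x : tc (at_time s x) = s.
Proof. by rewrite /tc /at_time row_mxKl mxE. Qed.

Lemma xc_at s x : xc (at_time s x) = x.
Proof. by rewrite /xc /at_time row_mxKr. Qed.

Lemma at_timeE z : z = at_time (tc z) (xc z).
Proof.
rewrite -[LHS]hsubmxK /at_time /xc; congr row_mx; apply/rowP => i.
by rewrite ord1 [RHS]mxE.
Qed.

Lemma diff_local_repK h c d (y : 'rV[R]_n) b : atlas M c -> atlas M d -> chart_cod d y ->
  chart_dom c (ev rho h^-1%g (chart_inv d y)) ->
  'd (local_rep (ev rho h) c d) (c (ev rho h^-1%g (chart_inv d y)))
    ('d (local_rep (ev rho h^-1%g) d c) y b) = b.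
Proof.
move=> Mc Md dy cy; have dq := mdiff_chart_inv Md dy; have dd := chart_inv_dom dy.
have [dq1 ch1] := mdiff_smooth (sev h^-1%g) dq.
have [dq2 ch2] := mdiff_smooth (sev h) dq1.
have dd2 : chart_dom d (ev rho h (ev rho h^-1%g (chart_inv d y))) by rewrite evK.
have E1 := ch1 d c Md Mc dd cy b; have E2 := ch2 c d Mc Md cy dd2 b.
rewrite (chart_derive b dy) (chart_invK dy) in E1; rewrite E1 in E2.
apply: (etrans (esym E2)); apply: etrans (chart_derive b dy).
by apply: (near_derive_chart d b); apply: filterE => z; rewrite evK.
Qed.

(** Invariance of the averaged form under [rho], in coordinates: [F] acts by [h] on the space
    variable and fixes time. With [h] neutral it is the change of charts. *)
Lemma OmC_transfer h c d z u v : atlas M c -> atlas M d -> pdom c z ->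
  chart_dom d (ev rho h (chart_inv c (xc z))) ->
  let L := local_rep (ev rho h) c d in
  OmC c z u v = OmC d (at_time (tc z) (L (xc z)))
    (row_mx (lsubmx u) ('d L (xc z) (xc u))) (row_mx (lsubmx v) ('d L (xc z) (xc v))).
Proof.
move=> Mc Md cz dz L; pose F (z : 'rV[R]_(1 + n)) : 'rV[R]_(1 + n) := row_mx (lsubmx z) (L (xc z)).
have Fz : F z = at_time (tc z) (L (xc z)).
  by rewrite /F /at_time; congr row_mx; apply/rowP => i; rewrite ord1 [RHS]mxE.
have [tz xz] := cz.
have dL : differentiable L (xc z).
  apply: ((sev h).2 c d Mc Md [::]); exact: local_domP.
have dx : differentiable (xc (n := n) : 'rV[R]_(1 + n) -> 'rV[R]_n) z by exact: differentiable_rsubmx.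
have dF : differentiable F z.
  apply: differentiable_row_mx2; first exact: differentiable_lsubmx.
  exact: (@differentiable_comp _ _ _ _ (xc (n := n)) L z dx dL).
have DF t : 'D_t F z = row_mx (lsubmx t) ('d L (xc z) (xc t)).
  have h1 := is_derive_chain (diff_derivable dx : derivable _ z t) dL.
  have [_ E] := is_derive_rsubmx (p := 1) z t.
  rewrite (E : 'D_t (xc (n := n)) z = xc t) in h1.
  by have [_ ->] := is_derive_row_mx2 (is_derive_lsubmx z t) h1.
have UF : pdom d (F z).
  rewrite Fz; split; first by rewrite tc_at.
  by rewrite xc_at; exact: chart_cod_in.
have := Om_comp w phi_plot Vrho (adm_chart Md) u v UF dF.
rewrite (DF u) (DF v) Fz => E; rewrite -[RHS]E.
rewrite -[LHS](Om_act compactG phi_plot Vrho act (adm_chart Mc) h u v cz).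
apply: (@Om_ext R k n G M w phi rho) => /=.
have n1 : \forall y \near z, pdom c y by apply: (open_nbhs_nbhs (conj _ cz)); exact: open_pdom.
have cq : {for z, continuous (fun y => ev rho h (chart_inv c (xc y)))}.
  apply: (@continuous_comp _ _ _ (fun y => chart_inv c (xc y)) (ev rho h)); last exact: (sev h).1.
  apply: (@continuous_comp _ _ _ (xc (n := n)) (chart_inv c)); first exact: continuous_xc.
  exact: chart_inv_continuous.
have n2 := near_open_preimage cq (chart_dom_open d) dz.
apply: filterS2 n1 n2 => y [_ cy] dy; split; first by rewrite /F /tc row_mxKl.
by rewrite /F /xc row_mxKr /L /local_rep chart_mapK.
Qed.

(** The velocity [(1, xi)] is asked to lie in the kernel of the form rather than to equal a field:
    the kernel is carried along by charts and by [rho], and it determines [xi] where [Wm] is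
    invertible. *)
Definition sol (gamma : R -> M) c (s : R) : Prop := exists2 xi : 'rV[R]_n,
  is_derive s (1 : R) (fun s => c (gamma s)) xi &
  forall b, OmC c (at_time s (c (gamma s))) (row_mx (const_mx 1) xi) b = 0.

Lemma sol_transfer h gamma c d s : `|s| < 6 -> {for s, continuous gamma} -> atlas M c -> atlas M d ->
  chart_dom c (gamma s) -> chart_dom d (ev rho h (gamma s)) -> sol gamma c s ->
  sol (fun s => ev rho h (gamma s)) d s.
Proof.
move=> s6 cg Mc Md cs ds [xi dxi hxi]; pose x := gamma s.
have dg : mdiff gamma s.
  have d1 : differentiable (fun s => c (gamma s)) s by apply/derivable1_diffP; have [] := dxi.
  have [h1 _] := mdiff_comp (mdiff_chart_inv Mc (chart_cod_in cs)) d1.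
  apply: near_mdiff h1; apply: filterS (near_open_preimage cg (chart_dom_open c) cs) => u cu.
  exact: chart_mapK.
have [dfg ch] := mdiff_smooth (sev h) dg.
pose L := local_rep (ev rho h) c d; pose L' := local_rep (ev rho h^-1%g) d c.
exists ('d L (c x) xi).
  have E := ch c d Mc Md cs ds (1 : R); have [_ E'] := dxi.
  split; first by apply: diff_derivable; exact: dfg.2.
  by rewrite E E'.
move=> b; have dx := chart_cod_in ds.
have Lx : L (c x) = d (ev rho h x) by rewrite /L /local_rep chart_mapK.
(* An arbitrary test vector [b] in the chart [d] is the image of [v], obtained with the differential
   of the inverse element of the group. *)
pose v : 'rV[R]_(1 + n) := row_mx (lsubmx b) ('d L' (d (ev rho h x)) (xc b)).
have pz : pdom c (at_time s (c x)) by split; rewrite ?tc_at// xc_at; exact: chart_cod_in.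
have dz : chart_dom d (ev rho h (chart_inv c (xc (at_time s (c x))))) by rewrite xc_at chart_mapK.
have := OmC_transfer (row_mx (const_mx 1) xi) v Mc Md pz dz.
rewrite /= hxi tc_at xc_at -/L Lx => E0; apply: (etrans _ (esym E0)).
have e : ev rho h^-1%g (chart_inv d (d (ev rho h x))) = x.
  by rewrite chart_mapK//; exact: evV.
have cx' : chart_dom c (ev rho h^-1%g (chart_inv d (d (ev rho h x)))) by rewrite e.
have E := diff_local_repK (xc b) Mc Md dx cx'.
have E' : 'd L (c x) ('d L' (d (ev rho h x)) (xc b)) = xc b.
  exact: (eq_ind _ (fun x0 => 'd L (c x0) ('d L' (d (ev rho h x)) (xc b)) = xc b) E _ e).
have xv : xc v = 'd L' (d (ev rho h x)) (xc b) by rewrite /xc /v row_mxKr.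
have Lb : row_mx (lsubmx v) ('d L (c x) (xc v)) = b.
  apply: (etrans _ (hsubmxK b)); apply: (congr2 (fun p q => row_mx p q)); first by rewrite /v row_mxKl.
  exact: (etrans (congr1 ('d L (c x)) xv) E').
have La : row_mx (lsubmx (row_mx (const_mx 1 : 'rV[R]_1) xi)) ('d L (c x) (xc (row_mx (const_mx 1) xi))) =
    row_mx (const_mx 1) ('d L (c x) xi).
  by apply: (congr2 (fun p q => row_mx p q)); rewrite ?row_mxKl// /xc row_mxKr.
exact: (esym (congr2 (OmC d (at_time s (d (ev rho h x)))) La Lb)).
Qed.

(** The open interval (-1/2, 3/2) contains [0, 1] and leaves room for derivatives at both ends. *)
Definition isocurve (gamma : R -> M) : Prop := forall s, `|s - 1 / 2| < 1 ->
  {for s, continuous gamma} /\ forall c, atlas M c -> chart_dom c (gamma s) -> sol gamma c s.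

Lemma time_bound (s : R) : `|s - 1 / 2| < 1 -> `|s| < 6.
Proof. by rewrite !ltr_norml => /andP[h1 h2]; apply/andP; split; lra. Qed.

(** Applying [sol_transfer] to the neutral element carries the condition from one chart to all. *)
Lemma isocurve_chart (gamma : R -> M) : (forall s : R, `|s - 1 / 2| < 1 -> {for s, continuous gamma} /\
    exists c, [/\ atlas M c, chart_dom c (gamma s) & sol gamma c s]) -> isocurve gamma.
Proof.
move=> h s hs; have [cg [c [Mc cs sc]]] := h s hs; split; first exact: cg.
move=> d Md ds.
have ds' : chart_dom d (ev rho 1%g (gamma s)) by rewrite ev1.
have := sol_transfer (time_bound hs) cg Mc Md cs ds' sc.
by have -> : (fun s => ev rho 1%g (gamma s)) = gamma by apply/funext => u; rewrite ev1.
Qed.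

Lemma isocurve_act h gamma : isocurve gamma -> isocurve (fun s => ev rho h (gamma s)).
Proof.
move=> ig s hs; have [cg sg] := ig s hs; split.
  by apply: (@continuous_comp _ _ _ gamma (ev rho h)) => //; exact: (sev h).1.
move=> d Md ds; have [c Mc cs] := @atlas_cover R n M (gamma s).
exact: (sol_transfer (time_bound hs) cg Mc Md cs ds (sg c Mc cs)).
Qed.

Lemma OmC_kernel c z xi : atlas M c -> pdom c z -> Wm w phi rho c z \in unitmx ->
  (forall b, OmC c z (row_mx (const_mx 1) xi) b = 0) <-> xi = Xf w phi rho c z.
Proof.
move=> Mc cz uW; have la := Om_local_form compactG w phi_plot Vrho (adm_chart Mc).
apply: (kernel_vectorP (B := OmC c z)) => //.
- exact: (lf_linearl la cz).
- exact: (lf_linearr la cz).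
- exact: (lf_alternating la cz).
Qed.

End Transfer.

Lemma norm_row1 (R : realType) (v : 'rV[R]_1) : `|v| = `|v 0 0|.
Proof.
apply/eqP; rewrite eq_le normr_coord andbT.
by apply: normr_leP => // i; rewrite ord1.
Qed.

Lemma drift (R : realType) (n : nat) (g dg : R -> 'rV[R]_n) (e s : R) : 0 <= e ->
  (forall u, is_derive u (1 : R) g (dg u)) -> (forall u, `|dg u| <= e) -> `|g s - g 0| <= e * `|s|.
Proof.
move=> e0 dgP dge; have := @growth_row R n g dg 1 0 e s ltr01 (lexx 0) e0.
rewrite mul0r mul0r add0r; apply=> // u _.
by rewrite mulr0 mul0r add0r.
Qed.

(** * The cut-off kernel field in one chart *)

Section ChartFlow.
Context {R : realType} {k n : nat} {G : lieGroupType R k} {M : manifoldType R n}.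
Notation P := (CrMap 2 (G * M)%type M).
Hypotheses (compactG : compact [set: G]).
Variables (w : twoForm M) (rho : P) (phi : P * (R * M) -> M) (V0 : set P).
Hypotheses (oV0 : open V0) (Vrho : V0 rho).
Hypothesis act : symplectic_action w (rho : smoothMap (G * M)%type M).
Hypothesis phi_plot : forall (S : topologicalType) (r : S -> P) (m d : nat) (t : S * 'rV[R]_d -> R)
    (q : S * 'rV[R]_d -> M) A,
    (0 < m)%N -> evCk r m -> open A -> Ck m t A -> plot m q A ->
    (forall z, A z -> {for z, continuous (r \o fst)}) ->
    (forall z, A z -> V0 (r z.1) /\ -6 <= t z <= 6) -> plot m (fun z => phi (r z.1, (t z, q z))) A.
Variables (c : chart R n M) (x0 : M) (r : R).
Hypothesis tr : trapped w phi rho c x0 r.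
Let X := Xf w phi rho c.
Let r0 : 0 < r := tr_gt0 tr.

(** Supported in the box of [trapped], where the kernel field is defined, and equal to [1] on a
    smaller box that contains the orbits of [flow_box]. *)
Definition cutoff (z : 'rV[R]_(1 + n)) : R :=
  bump 0 4 5 (lsubmx z) * bump (c x0) (5 / 2 * r) (3 * r) (xc z).

Definition moser_field (z : 'rV[R]_(1 + n)) : 'rV[R]_(1 + n) := cutoff z *: row_mx (const_mx 1) (X z).

Let norm_l (z : 'rV[R]_(1 + n)) : `|lsubmx z - 0| = `|tc z|.
Proof. by rewrite subr0 norm_row1. Qed.

Let lt_r : 5 / 2 * r < 3 * r. Proof. by move: r0 => h; lra. Qed.
Let r3 : 0 < 3 * r. Proof. by move: r0 => h; lra. Qed.
Let lt45 : (4 : R) < 5. Proof. by lra. Qed.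
Let gt05 : (0 : R) < 5. Proof. by []. Qed.

Lemma cutoff_eq1 z : `|tc z| <= 4 -> `|xc z - c x0| <= 5 / 2 * r -> cutoff z = 1.
Proof. by move=> h1 h2; rewrite /cutoff !bump_eq1 ?norm_l// mulr1. Qed.

Lemma cutoff_box z : cutoff z != 0 -> `|tc z| <= 5 /\ `|xc z - c x0| <= 3 * r.
Proof.
rewrite /cutoff mulf_eq0 negb_or => /andP[h1 h2]; split; rewrite leNgt; apply/negP => h.
  by case/eqP: h1; apply: bump_eq0; rewrite ?norm_l// ltW.
by case/eqP: h2; apply: bump_eq0 => //; exact: ltW.
Qed.

Lemma cutoff_ge0 z : 0 <= cutoff z. Proof. by rewrite mulr_ge0// bump_ge0. Qed.

Lemma cutoff_le1 z : cutoff z <= 1. Proof. by rewrite mulr_ile1 ?bump_ge0 ?bump_le1. Qed.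

Lemma moser_field_eq z : `|tc z| <= 4 -> `|xc z - c x0| <= 5 / 2 * r ->
  moser_field z = row_mx (const_mx 1) (X z).
Proof. by move=> h1 h2; rewrite /moser_field cutoff_eq1// scale1r. Qed.

Lemma moser_field_l z : `|lsubmx (moser_field z)| <= 1.
Proof.
rewrite /moser_field scale_row_mx row_mxKl normrZ norm_row1 mxE normr1 mulr1 ger0_norm ?cutoff_ge0//.
exact: cutoff_le1.
Qed.

Lemma moser_field_r z : `|xc (moser_field z)| <= r / 2.
Proof.
rewrite /xc /moser_field scale_row_mx row_mxKr normrZ ger0_norm ?cutoff_ge0//.
have r20 : 0 <= r / 2 by rewrite divr_ge0// ltW.
have [->|/cutoff_box[h1 h2]] := eqVneq (cutoff z) 0; first by rewrite mul0r.
have [_ _ h] := tr_box tr h1 h2.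
by apply: le_trans h; rewrite ler_piMl// cutoff_le1.
Qed.

Lemma tame_moser_field : tame moser_field.
Proof.
have Mc := tr_atlas tr; split=> [m j|]; last first.
  exists (5 + (`|c x0| + 3 * r)) => z zB; apply/eqP; rewrite scaler_eq0; apply/orP; left.
  apply/negP => /negP /cutoff_box[h1 h2]; move: zB; rewrite ltNge => /negP; apply.
  have hx : `|xc z| <= `|c x0| + 3 * r.
    by rewrite -(subrK (c x0) (xc z)) addrC; apply: le_trans (ler_normD _ _) _; rewrite lerD2l.
  have e0 : 0 <= `|c x0| + 3 * r by apply: le_trans hx.
  apply: normr_leP => [|i]; first by rewrite addr_ge0.
  rewrite -(splitK i); case: (fintype.split i) => l /=.
    have -> : z 0 (lshift n l) = tc z by rewrite /tc mxE ord1.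
    by apply: le_trans h1 _; rewrite lerDl.
  have -> : z 0 (rshift 1 l) = xc z 0 l by rewrite /xc mxE.
  by apply: le_trans (normr_coord _ _) _; apply: le_trans hx _; rewrite lerDr.
have er : evCk (fun _ : R => rho) m.+1 by exact: evCk_cst.
have cr : continuous (fun _ : R => rho) by move=> z; exact: cvg_cst.
pose B1 := moser_dom w phi V0 (fun _ : R => rho) c.
have oB1 : open B1 := open_moser_dom compactG oV0 phi_plot Mc er cr.
(* Off the box of [trapped] the cut-off vanishes, and this complement is open; around the box the
   field is a product of smooth functions. *)
pose B2 : set (R * 'rV[R]_(1 + n)) := [set z | 5 < `|tc z.2| \/ 3 * r < `|xc z.2 - c x0|].
apply: Ck_local => z _.
have [hz|hz] := pselect (`|tc z.2| <= 5 /\ `|xc z.2 - c x0| <= 3 * r).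
  exists B1; first by have [h1 h2 _] := tr_box tr hz.1 hz.2; split.
  have cl i : Ck m (fun z : R * 'rV[R]_(1 + n) => lsubmx z.2 0 i) B1.
    by apply: Ck_lsubmx => a; exact: Ck_coord.
  have cX i : Ck m (fun z : R * 'rV[R]_(1 + n) => X z.2 0 i) B1.
    exact: (Xf_Ck compactG w oV0 phi_plot Mc er cr i).
  have cb (p : nat) (a : 'rV[R]_p) s1 s2 (F : R * 'rV[R]_(1 + n) -> 'rV[R]_p) :
      (forall i, Ck m (fun z => F z 0 i) B1) -> Ck m (fun z => bump a s1 s2 (F z)) B1.
    move=> cF; apply: (@Ck_comp0 R R (1 + n) p m (bump a s1 s2) F B1 setT oB1 openT) => //.
    by apply: Ck_bump; apply: open_cyl; exact: openT.
  have cc : Ck m (fun z : R * 'rV[R]_(1 + n) => cutoff z.2) B1.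
    by apply: CkM => //; apply: cb => // i; exact: Ck_xc.
  have cR i : Ck m (fun z : R * 'rV[R]_(1 + n) => (row_mx (const_mx 1) (X z.2) : 'rV[R]_(1 + n)) 0 i) B1.
    apply: Ck_row_mx => // a.
    by under [Y in Ck m Y _]eq_fun do rewrite mxE; exact: Ck_cst.
  apply: Ck_ext (CkM oB1 cc (cR j)) => // y _.
  by rewrite /moser_field [RHS]mxE.
exists B2.
  by apply: contrapT => /not_orP[/negP h1 /negP h2]; apply: hz; rewrite leNgt h1 leNgt h2.
have oB2 : open B2.
  have ct : continuous (fun z : R * 'rV[R]_(1 + n) => `|tc z.2|).
    move=> y; apply: (@continuous_comp _ _ _ (fun z : R * 'rV[R]_(1 + n) => tc z.2) (fun a : R => `|a|)).
      by apply: (@continuous_comp _ _ _ snd (tc (n := n))); [exact: cvg_snd|exact: continuous_tc].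
    exact: norm_continuous.
  have cx : continuous (fun z : R * 'rV[R]_(1 + n) => `|xc z.2 - c x0|).
    move=> y; apply: (@continuous_comp _ _ _ (fun z : R * 'rV[R]_(1 + n) => xc z.2 - c x0) (fun a : 'rV[R]_n => `|a|)).
      apply: (@continuousB _ _ _ (fun z : R * 'rV[R]_(1 + n) => xc z.2) (fun=> c x0)); last exact: cst_continuous.
      by apply: (@continuous_comp _ _ _ snd (xc (n := n))); [exact: cvg_snd|exact: continuous_xc].
    exact: norm_continuous.
  apply: openU.
    by apply: (@open_comp _ _ (fun z : R * 'rV[R]_(1 + n) => `|tc z.2|) [set a : R | 5 < a] (fun z _ => ct z)); exact: open_gt.
  by apply: (@open_comp _ _ (fun z : R * 'rV[R]_(1 + n) => `|xc z.2 - c x0|) [set a : R | 3 * r < a] (fun z _ => cx z)); exact: open_gt.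
apply: Ck_ext (Ck_cst m 0 B2) => // y; rewrite inE => hy.
rewrite /moser_field (_ : cutoff y.2 = 0) ?scale0r ?mxE//.
apply/eqP/negP => /negP /cutoff_box[h1 h2]; move: hy.
by rewrite /B2 /= !ltNge h1 h2 => -[].
Qed.

Let tY := tame_moser_field.

Section Start.
Variables (t0 : R) (x : 'rV[R]_n).
Hypotheses (ht0 : 0 <= t0 <= 1) (hx : `|x - c x0| < r).
Let z s := flow moser_field s (at_time t0 x).
Let z0 : z 0 = at_time t0 x. Proof. by have [] := flowP (at_time t0 x) tY. Qed.
Let dz s : is_derive s (1 : R) z (moser_field (z s)).
Proof. by have [_ h] := flowP (at_time t0 x) tY; exact: h. Qed.

Let dl s : is_derive s (1 : R) (fun s => lsubmx (z s)) (lsubmx (moser_field (z s))).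
Proof.
apply/is_derive_rowP => j; rewrite mxE; under eq_fun do rewrite mxE.
exact: (iffLR (is_derive_rowP _ _ _ _) (dz s) _).
Qed.

Let dr s : is_derive s (1 : R) (fun s => xc (z s)) (xc (moser_field (z s))).
Proof.
apply/is_derive_rowP => j; rewrite mxE; under eq_fun do rewrite mxE.
exact: (iffLR (is_derive_rowP _ _ _ _) (dz s) _).
Qed.

(** Time speed at most 1 from a start in [0, 1], space speed at most [r / 2] from a start within
    [r], for a duration of at most 2. Hence the cut-off equals [1] along the orbit. *)
Lemma flow_box s : `|s| <= 2 -> `|tc (z s)| <= 3 /\ `|xc (z s) - c x0| < 2 * r.
Proof.
move=> s2; split.
  have := drift s (ler01 : 0 <= (1 : R)) dl (fun u => moser_field_l (z u)).
  have sub00 (a b : 'rV[R]_1) : (a - b) 0 0 = a 0 0 - b 0 0 by rewrite !mxE.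
  have l0 : (lsubmx (z 0)) 0 0 = t0 by rewrite z0; exact: tc_at.
  rewrite mul1r norm_row1 sub00 l0 => h.
  have E : `|tc (z s) - t0| <= `|s| by exact: h.
  rewrite -(subrK t0 (tc (z s))); apply: le_trans (ler_normD _ _) _.
  move: E s2 ht0; rewrite (_ : `|t0| = t0); last by rewrite ger0_norm//; case/andP: ht0.
  by move: (`|tc (z s) - t0|) (`|s|) => a b h1 h2 /andP[_ h3]; lra.
have r20 : 0 <= r / 2 by rewrite divr_ge0// ltW.
have := drift s r20 dr (fun u => moser_field_r (z u)).
rewrite z0 xc_at => h.
rewrite -(subrKA x); apply: le_lt_trans (ler_normD _ _) _.
have : r / 2 * `|s| <= r by rewrite -[leRHS]mulr1 -mulrA ler_pM2l// mulrC ler_pdivrMr// mul1r.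
by move: h hx; move: (`|xc (z s) - x|) (`|x - c x0|) (r / 2 * `|s|) => a b e; lra.
Qed.

Let box4 s : `|s| <= 2 -> `|tc (z s)| <= 4 /\ `|xc (z s) - c x0| <= 5 / 2 * r.
Proof. by move=> /flow_box[h1 h2]; split; move: h1 h2 r0; lra. Qed.

Lemma flow_time s : `|s| <= 2 -> tc (z s) = t0 + s.
Proof.
move=> s2.
have h u : `|u| <= `|s| -> is_derive u (1 : R) (fun s => tc (z s)) 1.
  move=> us; have [h1 h2] := box4 (le_trans us s2).
  have := iffLR (is_derive_rowP _ _ _ _) (dl u) 0.
  rewrite moser_field_eq// row_mxKl.
  by have -> : (const_mx 1 : 'rV[R]_1) 0 0 = 1 by rewrite mxE.
have h' u : `|u| <= `|s| -> is_derive u (1 : R) (fun s => tc (z s) - s) 0.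
  by move=> us; rewrite -(subrr (1 : R)); exact: is_deriveB (h u us) (is_derive_id u 1).
have [s0|s0] := leP 0 s.
  have E : tc (z s) - s = tc (z 0) - 0.
    apply: (@increment_eq0 R (fun s => tc (z s) - s) 0 s s0) => u /andP[u0 us]; apply: h'.
    by rewrite !ger0_norm.
  by move: E; rewrite z0 tc_at subr0 => /eqP; rewrite subr_eq => /eqP.
have E : tc (z 0) - 0 = tc (z s) - s.
  apply: (@increment_eq0 R (fun s => tc (z s) - s) s 0 (ltW s0)) => u /andP[us u0]; apply: h'.
  by rewrite !ler0_norm ?lerN2// ltW.
by move: E; rewrite z0 tc_at subr0 => /esym /eqP; rewrite subr_eq => /eqP.
Qed.

Lemma flow_pdom s : `|s| <= 2 -> pdom c (z s) /\ Wm w phi rho c (z s) \in unitmx.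
Proof.
move=> s2; have [h1 h2] := flow_box s2.
have [] := @tr_box _ _ _ _ _ _ _ _ _ _ _ tr (z s); last by [].
  by apply: le_trans h1 _; lra.
by move: h2 r0 => h2 h3; lra.
Qed.

Definition chart_curve (s : R) : M := chart_inv c (xc (z (s - t0))).

Lemma chart_curve_start : chart_cod c x -> chart_curve t0 = chart_inv c x.
Proof. by move=> _; rewrite /chart_curve subrr z0 xc_at. Qed.

Lemma chart_curve_isocurve : isocurve w rho phi chart_curve.
Proof.
have Mc := tr_atlas tr.
apply: (isocurve_chart compactG Vrho act phi_plot) => s hs.
(* [s] lies in (-1/2, 3/2) and [t0] in [0, 1], so they differ by less than 3/2. *)
have st : `|s - t0| <= 2.
  move: hs ht0; rewrite ltr_norml ler_norml => /andP[a1 a2] /andP[b1 b2].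
  by apply/andP; split; lra.
have [[p1 p2] uW] := flow_pdom st.
have cz : {for s, continuous (fun s => xc (z (s - t0)))}.
  apply: (@continuous_comp _ _ _ (fun s => s - t0) (fun s => xc (z s))).
    by apply: (@continuousB _ _ _ id (fun=> t0)); [exact: cvg_id|exact: cst_continuous].
  exact: (is_derive1_continuous (dr _)).
have cg : {for s, continuous chart_curve}.
  by apply: (@continuous_comp _ _ _ (fun s => xc (z (s - t0))) (chart_inv c)) => //; exact: chart_inv_continuous.
split; first exact: cg.
exists c; split; [exact: Mc|exact: chart_inv_dom|].
have cE : c (chart_curve s) = xc (z (s - t0)) by rewrite /chart_curve chart_invK.
have [b1 b2] := box4 st.
have YE : moser_field (z (s - t0)) = row_mx (const_mx 1) (X (z (s - t0))) by exact: moser_field_eq.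
have d1 : is_derive s (1 : R) (fun s => xc (z (s - t0))) (X (z (s - t0))).
  have := dr (s - t0); rewrite YE /xc row_mxKr; exact: is_derive_translate.
exists (X (z (s - t0))).
  have nE : \forall u \near s, xc (z (u - t0)) = c (chart_curve u).
    have oc : open (chart_cod c) := @chart_cod_open R n M c.
    have n1 : \forall u \near s, chart_cod c (xc (z (u - t0))) := near_open_preimage cz oc p2.
    by apply: filterS n1 => u cu; rewrite /chart_curve chart_invK.
  have [d2 d3] := d1; split; first exact: near_eq_derivable nE d2.
  by rewrite -(near_eq_derive _ nE).
have zE : z (s - t0) = at_time s (xc (z (s - t0))).
  by rewrite {1}(at_timeE (z (s - t0))) flow_time// addrC subrK.
rewrite cE -zE.
exact: (iffRL (OmC_kernel compactG Vrho phi_plot _ Mc (conj p1 p2) uW) erefl).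
Qed.

End Start.

End ChartFlow.

Lemma plot_patch (R : realType) (n : nat) (M : manifoldType R n) (T : topologicalType) (m k : nat)
    (p : T * 'rV[R]_m -> M) A :
  (forall z, A z -> exists B, [/\ B z, open B & plot k p B]) -> plot k p A.
Proof.
move=> h; split=> [z Az|d Md j].
  by have [B [Bz _ [cp _]]] := h z Az; exact: cp.
apply: Ck_local => z [Az dz]; have [B [Bz _ [_ sp]]] := h z Az.
by exists (B `&` p @^-1` chart_dom d); [split|exact: sp].
Qed.

(** * The flow of the kernel field on [M] *)

Section MoserFlow.
Context {R : realType} {k n : nat} {G : lieGroupType R k} {M : manifoldType R n}.
Notation P := (CrMap 2 (G * M)%type M).
Hypotheses (compactG : compact [set: G]).
Variables (w : twoForm M) (rho : P) (phi : P * (R * M) -> M) (V0 : set P).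
Hypotheses (oV0 : open V0) (Vrho : V0 rho).
Hypothesis act : symplectic_action w (rho : smoothMap (G * M)%type M).
Hypothesis phi_plot : forall (S : topologicalType) (r : S -> P) (m d : nat) (t : S * 'rV[R]_d -> R)
    (q : S * 'rV[R]_d -> M) A,
    (0 < m)%N -> evCk r m -> open A -> Ck m t A -> plot m q A ->
    (forall z, A z -> {for z, continuous (r \o fst)}) ->
    (forall z, A z -> V0 (r z.1) /\ -6 <= t z <= 6) -> plot m (fun z => phi (r z.1, (t z, q z))) A.
Hypothesis trap : forall x, exists c x0 r, [/\ trapped w phi rho c x0 r, chart_dom c x & `|c x - c x0| < r].
Let Y c x0 r := moser_field w rho phi c x0 r.
Implicit Types (gamma : R -> M) (s u : R).

(** The kernel equation determines the velocity ([OmC_kernel]), so inside the small ball an isocurve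
    is an integral curve of the tame field; uniqueness for flows then applies to isocurves. *)
Lemma curve_field gamma c x0 r u : trapped w phi rho c x0 r -> isocurve w rho phi gamma -> `|u - 1 / 2| < 1 ->
  chart_dom c (gamma u) -> `|c (gamma u) - c x0| < r ->
  is_derive u (1 : R) (fun u => at_time u (c (gamma u))) (Y c x0 r (at_time u (c (gamma u)))).
Proof.
move=> tr ig hu cu ur; have [_ /(_ c (tr_atlas tr) cu) [xi dxi hxi]] := ig u hu.
have r0 := tr_gt0 tr.
have u4 : `|u| <= 4.
  by move: hu; rewrite ltr_norml ler_norml => /andP[h1 h2]; apply/andP; split; lra.
have [pz uW _] : [/\ pdom c (at_time u (c (gamma u))), Wm w phi rho c (at_time u (c (gamma u))) \in unitmx
    & `|Xf w phi rho c (at_time u (c (gamma u)))| <= r / 2].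
  apply: (tr_box tr); rewrite ?tc_at ?xc_at; first by move: u4; lra.
  by move: ur; lra.
have -> : Y c x0 r (at_time u (c (gamma u))) = row_mx (const_mx 1) xi.
  rewrite (iffLR (OmC_kernel compactG Vrho phi_plot xi (tr_atlas tr) pz uW) hxi).
  apply: moser_field_eq => //; rewrite ?tc_at ?xc_at//.
  by move: ur r0; lra.
have dc : is_derive u (1 : R) (fun u : R => const_mx u : 'rV[R]_1) (const_mx 1).
  by apply/is_derive_rowP => j; rewrite mxE; under eq_fun do rewrite mxE; exact: is_derive_id.
exact: is_derive_row_mx2 dc dxi.
Qed.

Lemma isocurve_near gamma1 gamma2 s : isocurve w rho phi gamma1 -> isocurve w rho phi gamma2 ->
  `|s - 1 / 2| < 1 -> gamma1 s = gamma2 s -> \forall u \near s, gamma1 u = gamma2 u.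
Proof.
move=> i1 i2 hs E; have [c [x0 [r [tr cx xr]]]] := trap (gamma1 s).
pose Q u := [/\ `|u - 1 / 2| < 1, chart_dom c (gamma1 u) /\ `|c (gamma1 u) - c x0| < r &
  chart_dom c (gamma2 u) /\ `|c (gamma2 u) - c x0| < r].
have nI : \forall u \near s, `|u - 1 / 2| < 1.
  apply/near_ballP; exists (1 - `|s - 1 / 2|); first by rewrite subr_gt0.
  move=> u; rewrite ltrBrDr => h; apply: le_lt_trans h.
  by rewrite -(subrKA s) ler_normD.
have nc gamma : isocurve w rho phi gamma -> chart_dom c (gamma s) -> `|c (gamma s) - c x0| < r ->
    \forall u \near s, chart_dom c (gamma u) /\ `|c (gamma u) - c x0| < r.
  move=> ig cs sr; have [cg _] := ig s hs.
  have n1 := near_open_preimage cg (chart_dom_open c) cs.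
  have cc : {for s, continuous (fun u => c (gamma u))}.
    by apply: (@continuous_comp _ _ _ gamma c) => //; exact: chart_map_continuous.
  have sb : ball (c x0) r (c (gamma s)) by rewrite -ball_normE /ball_ /= distrC.
  have n2 := near_open_preimage cc (ball_open (c x0) r) sb.
  by apply: filterS2 n1 n2 => u h1; rewrite -ball_normE /ball_ /= distrC.
have n1 := nc gamma1 i1 cx xr.
have n2 : \forall u \near s, chart_dom c (gamma2 u) /\ `|c (gamma2 u) - c x0| < r.
  by apply: nc; rewrite // -E.
have nQ : \forall u \near s, Q u by apply: filterS3 nI n1 n2.
have [S S0 hS] := iffLR (near_ballP _ _) nQ.
have S20 : 0 <= S / 2 by rewrite divr_ge0// ltW.
have tY : tame (Y c x0 r) by exact: (tame_moser_field compactG oV0 Vrho phi_plot tr).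
have fl gamma : isocurve w rho phi gamma -> (forall u, `|u - s| < S -> chart_dom c (gamma u) /\ `|c (gamma u) - c x0| < r) ->
    forall v, `|v| <= S / 2 -> at_time (v + s) (c (gamma (v + s))) = flow (Y c x0 r) v (at_time s (c (gamma s))).
  move=> ig hg v vS.
  apply: (@flow_unique R (1 + n) (Y c x0 r) _ (fun v => at_time (v + s) (c (gamma (v + s)))) (S / 2)) => //.
    by rewrite add0r.
  move=> a aS; have aS' : `|a + s - s| < S by rewrite addrK; apply: le_lt_trans aS _; lra.
  have [h1 h2] := hg _ aS'; have [h3 _ _] := hS _ aS'.
  exact: (is_derive_translate (curve_field tr ig h3 h1 h2)).
apply/near_ballP; exists (S / 2) => [|u us]; first by rewrite divr_gt0.
have us' : `|u - s| <= S / 2 by exact: ltW.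
have f1 := fl gamma1 i1 (fun u h => let: And3 _ a _ := hS u h in a) _ us'.
have f2 := fl gamma2 i2 (fun u h => let: And3 _ _ a := hS u h in a) _ us'.
have uS : `|u - s| < S by apply: lt_le_trans us _; lra.
have [_ [c1 _] [c2 _]] := hS u uS.
rewrite -(chart_mapK c1) -(chart_mapK c2); congr (chart_inv c _).
have := f1; rewrite E -f2 subrK => /(congr1 (xc (n := n))).
by rewrite !xc_at.
Qed.

(** In a connected interval, the coincidence set is nonempty, open by [isocurve_near], and closed
    since [M] is Hausdorff. *)
Lemma isocurve_unique gamma1 gamma2 s : isocurve w rho phi gamma1 -> isocurve w rho phi gamma2 ->
  `|s - 1 / 2| < 1 -> gamma1 s = gamma2 s -> forall u, `|u - 1 / 2| < 1 -> gamma1 u = gamma2 u.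
Proof.
move=> i1 i2 hs E u hu.
pose I : set R := [set a | `|a - 1 / 2| < 1]; pose B := I `&` [set a | gamma1 a = gamma2 a].
have cI : connected I.
  apply/connected_intervalP => a b; rewrite /I /= !ltr_norml => /andP[a1 a2] /andP[b1 b2] z /andP[z1 z2].
  by rewrite /= ltr_norml; apply/andP; split; lra.
have BI : B = I; last by have : I u by []; rewrite -BI => -[].
apply: cI; first by exists s.
- exists B; last by rewrite /B setIA setIid.
  rewrite openE => a [Ia Ea].
  have nI : \forall b \near a, I b.
    apply/near_ballP; exists (1 - `|a - 1 / 2|); first by rewrite subr_gt0.
    move=> b; rewrite ltrBrDr => h; apply: le_lt_trans h.
    by rewrite -(subrKA a) ler_normD.
  have nE := isocurve_near i1 i2 Ia Ea.
  by apply: filterS2 nI nE => b h1 h2; split.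
exists (closure B); first exact: closed_closure.
apply/seteqP; split=> [a Ba|a [Ia Ba]]; first by split; [case: Ba|exact: subset_closure].
split=> //; apply: (@manifold_hausdorff R n M) => U1 U2 n1 n2.
have [c1 _] := i1 a Ia; have [c2 _] := i2 a Ia.
have m1 : \forall b \near a, U1 (gamma1 b) by exact: (c1 _ n1).
have m2 : \forall b \near a, U2 (gamma2 b) by exact: (c2 _ n2).
have [b [[_ Eb] [h1 h2]]] := Ba _ (filterI m1 m2).
by exists (gamma1 b); split=> //; rewrite Eb.
Qed.

(** Through every point there is an isocurve at any given time of [0, 1], and it is unique; so the
    fallback [x] is never taken for [a] and [b] in [0, 1]. *)
Definition transport (a b : R) (x : M) : M :=
  xget x [set y | exists gamma, [/\ isocurve w rho phi gamma, gamma a = x & gamma b = y]].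

Lemma transportE gamma a b : isocurve w rho phi gamma -> `|a - 1 / 2| < 1 -> `|b - 1 / 2| < 1 ->
  transport a b (gamma a) = gamma b.
Proof.
move=> ig ha hb.
have ex : [set y | exists gamma', [/\ isocurve w rho phi gamma', gamma' a = gamma a & gamma' b = y]] (gamma b).
  by exists gamma.
have [gamma' [ig' Ea Eb]] := xgetPex (gamma a) (ex_intro _ _ ex).
by rewrite -[LHS]Eb; apply: (isocurve_unique ig' ig ha Ea).
Qed.

Let unit_time (a : R) : 0 <= a <= 1 -> `|a - 1 / 2| < 1.
Proof. by move=> /andP[h1 h2]; rewrite ltr_norml; apply/andP; split; lra. Qed.

(** One trapped chart contains the whole arc between the times [a] and [b], so the transport is a
    single flow in that chart, without composing short times. *)
Lemma transport_chart c x0 r x a b : trapped w phi rho c x0 r -> chart_dom c x -> `|c x - c x0| < r ->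
  0 <= a <= 1 -> 0 <= b <= 1 ->
  transport a b x = chart_inv c (xc (flow (Y c x0 r) (b - a) (at_time a (c x)))).
Proof.
move=> tr cx xr ha hb.
have ic : isocurve w rho phi (chart_curve w rho phi c x0 r a (c x)).
  exact: (chart_curve_isocurve compactG oV0 Vrho act phi_plot tr ha xr).
apply: (etrans _ (transportE ic (unit_time ha) (unit_time hb))); congr transport.
rewrite (chart_curve_start compactG oV0 Vrho phi_plot tr) ?chart_mapK//.
exact: chart_cod_in.
Qed.

Lemma transport_exists a x : 0 <= a <= 1 -> exists2 gamma, isocurve w rho phi gamma & gamma a = x.
Proof.
move=> ha; have [c [x0 [r [tr cx xr]]]] := trap x.
exists (chart_curve w rho phi c x0 r a (c x)).
  exact: (chart_curve_isocurve compactG oV0 Vrho act phi_plot tr ha xr).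
rewrite (chart_curve_start compactG oV0 Vrho phi_plot tr) ?chart_mapK//.
exact: chart_cod_in.
Qed.

Lemma transportK a b : 0 <= a <= 1 -> 0 <= b <= 1 -> cancel (transport a b) (transport b a).
Proof.
move=> ha hb x; have [gamma ig <-] := transport_exists x ha.
by rewrite !transportE//; exact: unit_time.
Qed.

(** [rho] maps isocurves to isocurves, and these are determined by one value. *)
Lemma transport_act a b h x : 0 <= a <= 1 -> 0 <= b <= 1 ->
  transport a b (ev rho h x) = ev rho h (transport a b x).
Proof.
move=> ha hb; have [gamma ig <-] := transport_exists x ha.
have := transportE (isocurve_act compactG Vrho act phi_plot h ig) (unit_time ha) (unit_time hb).
by rewrite (transportE ig (unit_time ha) (unit_time hb)).
Qed.

Lemma transport_smooth a b : 0 <= a <= 1 -> 0 <= b <= 1 -> smooth (transport a b).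
Proof.
move=> ha hb; apply: (@plot_smooth R n M R 0) => d m Md; apply: plot_patch => z0 dz0.
have [c [x0 [r [tr cx xr]]]] := trap (chart_inv d z0.2); have Mc := tr_atlas tr.
have tY : tame (Y c x0 r) by exact: (tame_moser_field compactG oV0 Vrho phi_plot tr).
pose B0 : set (R * 'rV[R]_n) := cyl (transition_dom d c).
have oB0 : open B0 by apply: open_cyl; exact: open_transition_dom.
have ct j : Ck m (fun z : R * 'rV[R]_n => c (chart_inv d z.2) 0 j) B0 by exact: transition_Ck.
have cc z : B0 z -> {for z, continuous (fun z : R * 'rV[R]_n => c (chart_inv d z.2))}.
  by move=> Bz; apply/continuous_coord => j; exact: Ck_cont (ct j) Bz.
pose B := B0 `&` (fun z => c (chart_inv d z.2)) @^-1` ball (c x0) r.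
have oB : open B by apply: open_preimage_on => //; exact: ball_open.
have Br z : B z -> `|c (chart_inv d z.2) - c x0| < r.
  by move=> [_]; rewrite /= -ball_normE /ball_ /= distrC.
exists B; split=> //; first by split; [split|rewrite /= -ball_normE /ball_ /= distrC].
pose F (z : R * 'rV[R]_n) := flow (Y c x0 r) (b - a) (at_time a (c (chart_inv d z.2))).
have cF j : Ck m (fun z => F z 0 j) B.
  apply: (@Ck_comp0 R R n (1 + n) m (fun y => flow (Y c x0 r) (b - a) y 0 j)
    (fun z => at_time a (c (chart_inv d z.2))) B setT oB openT) => //.
    exact: flow_Ck.
  apply: Ck_row_mx => i; last by apply: (Ck_sub _ (ct i)) => z [].
  by under [X in Ck m X _]eq_fun do rewrite mxE; exact: Ck_cst.
have st : `|b - a| <= 2.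
  by move: ha hb => /andP[h1 h2] /andP[h3 h4]; rewrite ler_norml; apply/andP; split; lra.
have pF : plot m (fun z => chart_inv c (xc (F z))) B.
  apply: plot_inv_comp => // [z Bz|j]; last exact: Ck_rsubmx.
  by have [[_ h] _] := flow_pdom compactG oV0 Vrho phi_plot tr ha (Br z Bz) st.
apply: plot_ext pF => // z Bz; have [[_ cz] _] := Bz.
by rewrite (transport_chart tr cz (Br z Bz) ha hb).
Qed.

Section Form.
Hypotheses (sw : symplectic_form w) (phi_id : forall x, phi (rho, (0, x)) = x).
Variable rho0 : P.
Hypothesis act0 : symplectic_action w (rho0 : smoothMap (G * M)%type M).
Hypothesis phi_equi : forall h x, phi (rho, (1, ev rho h x)) = ev rho0 h (phi (rho, (1, x))).
Let phi1 x := phi (rho, (1, x)).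

Lemma phi_slice_smooth : smooth phi1.
Proof.
apply: (@plot_smooth R n M R 0) => d m Md; apply: (@plot_le _ _ _ _ _ m m.+1) => //.
have oc := open_cod R d.
have i1 : -6 <= (1 : R) <= 6 by apply/andP; split; lra.
have cr (z : R * 'rV[R]_n) : {for z, continuous ((fun _ : R => rho) \o fst)} by exact: cvg_cst.
exact: (@phi_plot R (fun=> rho) m.+1 n (fun=> 1) (fun z => chart_inv d z.2) _ (ltn0Sn m) (evCk_cst _ rho _) oc
  (Ck_cst _ _ _) (plot_chart_inv R m.+1 Md) (fun z _ => cr z) (fun z _ => conj Vrho i1)).
Qed.

(** At time 1 the intertwining [phi_equi] moves [g] outside [phi1], and [rho0] preserves [w], so the
    integrand does not depend on [g]. *)
Lemma Om_end (m : nat) (tau : 'rV[R]_m -> R) (q : 'rV[R]_m -> M) x (u v : 'rV[R]_m) : mdiff q x ->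
  (\forall y \near x, tau y = 1) -> Om w phi rho tau q x u v = pbw w (fun y => phi1 (q y)) x u v.
Proof.
move=> dq t1; have [dpq _] := mdiff_smooth phi_slice_smooth dq.
apply: (etrans _ (@haar_cst R k G compactG _)); apply: eq_haar => g.
have nE : \forall y \near x, moved phi rho tau q g y = ev rho0 g (phi1 (q y)).
  by apply: filterS t1 => y ty; rewrite /moved ty phi_equi.
rewrite (pbw_ext w u v nE).
exact: (pbw_symplectic u v (@smooth_ev R k n G M rho0 g) (act0.2 g) dpq).
Qed.

(** In a trapped chart the left-hand side is the averaged form pulled back along the time-1 flow of
    the slice at time 0 ([Om_end]); [flow_preserves_form] carries it back to that slice, where the
    form is [w] ([Om_trivial]). *)
Lemma transport_pullback x : exists c, [/\ atlas M c, chart_dom c x & forall u v : 'rV[R]_n,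
  pbw w (fun z => phi1 (transport 0 1 (chart_inv c z))) (c x) u v = w c (c x) u v].
Proof.
have [c [x0 [r [tr cx xr]]]] := trap x; have Mc := tr_atlas tr; have r0 := tr_gt0 tr.
exists c; split=> // u v; have ccx := chart_cod_in cx.
have tY : tame (Y c x0 r) by exact: (tame_moser_field compactG oV0 Vrho phi_plot tr).
have i0 : 0 <= (0 : R) <= 1 by apply/andP; split; lra.
have i1 : 0 <= (1 : R) <= 1 by apply/andP; split; lra.
have s1 : `|1 : R| <= 2 by rewrite normr1; lra.
have i6 : -6 <= (0 : R) <= 6 by apply/andP; split; lra.
have oc : open (chart_cod c) := @chart_cod_open R n M c.
pose F1 : 'rV[R]_(1 + n) -> 'rV[R]_(1 + n) := flow (Y c x0 r) 1.
pose Phi y := F1 (at_time 0 y); pose q y := chart_inv c (xc (Phi y)).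
have nr : \forall y \near c x, `|y - c x0| < r.
  apply/near_ballP; exists (r - `|c x - c x0|); first by rewrite subr_gt0.
  move=> y; rewrite ltrBrDr => h; apply: le_lt_trans h.
  by rewrite -(subrKA (c x)) ler_normD.
have nx : \forall y \near c x, chart_cod c y /\ `|y - c x0| < r.
  by apply: filterS2 (open_nbhs_nbhs (conj oc ccx)) nr => y h1 h2; split.
have nq : \forall y \near c x, phi1 (transport 0 1 (chart_inv c y)) = phi1 (q y).
  apply: filterS nx => y [cy yr]; congr phi1.
  rewrite (transport_chart tr (chart_inv_dom cy) _ i0 i1) chart_invK//.
  by rewrite subr0.
have nt : \forall y \near c x, tc (Phi y) = 1.
  apply: filterS nx => y [cy yr].
  by rewrite /Phi /F1 (flow_time compactG oV0 Vrho phi_plot tr i0 yr s1) add0r.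
have dat : differentiable (fun y : 'rV[R]_n => at_time 0 y) (c x).
  by apply: differentiable_row_mx2; [exact: differentiable_cst|].
have Dat t : 'D_t (fun y : 'rV[R]_n => at_time 0 y) (c x) = row_mx 0 t.
  by have [_ ->] := is_derive_row_mx (const_mx 0 : 'rV[R]_1) (c x) t.
have dF y : differentiable F1 y.
  apply/differentiable_rowP => j.
  by have [] := Ck1_diff openT (flow_Ck 1 1 j tY : Ck 1 (fun z : R * 'rV[R]_(1 + n) => F1 z.2 0 j) setT)
    (Logic.I : setT (0, y)).
have dPhi : differentiable Phi (c x).
  exact: (@differentiable_comp _ _ _ _ (fun y : 'rV[R]_n => at_time 0 y) F1 (c x) dat (dF _)).
have DPhi t : 'D_t Phi (c x) = 'D_(row_mx 0 t) F1 (at_time 0 (c x)).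
  have [_ E] := is_derive_chain (diff_derivable dat : derivable _ (c x) t) (dF (at_time 0 (c x))).
  apply: (etrans E); rewrite [RHS]deriveE//; exact: (congr1 _ (Dat t)).
have [pP _] := flow_pdom compactG oV0 Vrho phi_plot tr i0 xr s1.
have dxc : differentiable (xc (n := n) : 'rV[R]_(1 + n) -> 'rV[R]_n) (Phi (c x)) by exact: differentiable_rsubmx.
have dq : mdiff q (c x).
  have [h _] := mdiff_comp (mdiff_chart_inv Mc pP.2) dxc.
  by have [h' _] := @mdiff_comp R n M _ _ (fun y => chart_inv c (xc y)) Phi (c x) h dPhi.
apply: (etrans (pbw_ext w u v nq)).
apply: (etrans (esym (Om_end u v dq nt))).
apply: (etrans (Om_comp w phi_plot Vrho (adm_chart Mc) u v pP dPhi)).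
rewrite (DPhi u) (DPhi v).
(* An open box on which the cut-off is [1], so that the tame field lies in the kernel, and which
   contains the orbit from time 0 to time 1. *)
pose D : set 'rV[R]_(1 + n) := [set z | `|tc z| < 4 /\ `|xc z - c x0| < 5 / 2 * r].
have Dbox z : D z -> `|tc z| <= 5 /\ `|xc z - c x0| <= 3 * r.
  by move=> [h1 h2]; split; [move: h1|move: h2 r0]; lra.
have Dp z : D z -> pdom c z /\ Wm w phi rho c z \in unitmx.
  by move=> /Dbox[h1 h2]; have [] := tr_box tr h1 h2.
have oD : open D.
  apply: openI.
    apply: (@open_comp _ _ (fun z => `|tc z|) [set a | a < 4]); last exact: open_lt.
    move=> z _; apply: (@continuous_comp _ _ _ (tc (n := n)) (fun a : R => `|a|)); first exact: continuous_tc.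
    exact: norm_continuous.
  apply: (@open_comp _ _ (fun z => `|xc z - c x0|) [set a | a < 5 / 2 * r]); last exact: open_lt.
  move=> z _; apply: (@continuous_comp _ _ _ (fun z => xc (n := n) z - c x0) (fun a : 'rV[R]_n => `|a|)).
    by apply: (@continuousB _ _ _ (xc (n := n)) (fun=> c x0)); [exact: continuous_xc|exact: cst_continuous].
  exact: norm_continuous.
have la := Om_local_form compactG w phi_plot Vrho (adm_chart Mc).
have laD : local_form D (OmC w phi rho c).
  split=> [z /Dp[/(lf_linearl la) + _]|z /Dp[/(lf_linearr la) + _]|z /Dp[/(lf_alternating la) + _]|a b] //.
  by apply: (Ck_sub _ (lf_smooth la a b)) => z /Dp[].
have clD : local_closed D (OmC w phi rho c).
  by move=> z /Dp[pz _]; exact: (Om_closed compactG sw phi_plot Vrho (adm_chart Mc) pz).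
have kerD z : D z -> forall b, OmC w phi rho c z (Y c x0 r z) b = 0.
  move=> Dz; have [pz uW] := Dp z Dz; have [h1 h2] := Dz.
  rewrite /Y (moser_field_eq tr (ltW h1) (ltW h2)).
  exact: (iffRL (OmC_kernel compactG Vrho phi_plot _ Mc pz uW) erefl).
have orb s : 0 <= s <= 1 -> D (flow (Y c x0 r) s (at_time 0 (c x))).
  move=> /andP[s0 s1']; have s2 : `|s| <= 2 by rewrite ger0_norm//; apply: le_trans s1' _; lra.
  have [h1 h2] := flow_box compactG oV0 Vrho phi_plot tr i0 xr s2.
  by split; [apply: le_lt_trans h1 _|apply: lt_trans h2 _]; move: r0; lra.
apply: (etrans (flow_preserves_form oD laD clD tY kerD (row_mx 0 u) (row_mx 0 v) orb)).
have p0 : pdom c (at_time 0 (c x)) by split; rewrite ?tc_at ?normr0// xc_at.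
have := Om_comp w phi_plot Vrho (adm_chart Mc) u v p0 dat.
rewrite (Dat u) (Dat v) => E; apply: (etrans (esym E)).
(* The slice at time 0 is an admissible pair with constant time, on which [phi] is the identity. *)
have a0 : adm (chart_cod c) (fun _ : 'rV[R]_n => 0 : R) (chart_inv c).
  by split=> [|j|j|y _]; [exact: oc|exact: Ck_cst|exact: plot_chart_inv|exact: i6].
have nE : \forall y \near c x, tc (at_time 0 y : 'rV[R]_(1 + n)) = 0 :> R /\
    (chart_inv c \o xc (n := n)) (at_time 0 y) = chart_inv c y.
  by apply: filterE => y; split; [exact: tc_at|exact: (congr1 (chart_inv c) (xc_at 0 y))].
apply: (etrans (@Om_ext R k n G M w phi rho _ _ (fun=> 0) _ (chart_inv c) _ u v nE)).
apply: (etrans (Om_trivial compactG u v act a0 ccx (fun y _ z => phi_id z))).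
exact: pbw_chart_inv.
Qed.

(** One good chart at each point suffices: any other chart differs from it by a transition map,
    along which both sides are pulled back. *)
Lemma is_pullback_local (f : M -> M) : smooth f ->
  (forall x, exists c, [/\ atlas M c, chart_dom c x & forall u v : 'rV[R]_n,
    pbw w (fun z => f (chart_inv c z)) (c x) u v = w c (c x) u v]) ->
  is_pullback f (form_coef w) (form_coef w).
Proof.
move=> sf h; apply: is_pullback_of => // d y u v Md dy.
have [c [Mc cx hc]] := h (chart_inv d y).
have dq := mdiff_chart_inv Md dy; have ccx := chart_cod_in cx.
have dc := mdiff_chart_inv Mc ccx.
have [dfc _] := mdiff_smooth sf dc.
have dL : differentiable (fun z => c (chart_inv d z)) y by exact: dq.2.
have near_c : \forall z \near y, chart_dom c (chart_inv d z) by exact: (near_open_preimage dq.1 (chart_dom_open c) cx).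
have n1 : \forall z \near y, f (chart_inv d z) = f (chart_inv c (c (chart_inv d z))).
  by apply: filterS near_c => z cz; rewrite chart_mapK.
have n2 : \forall z \near y, chart_inv c (c (chart_inv d z)) = chart_inv d z.
  by apply: filterS near_c => z cz; rewrite chart_mapK.
apply: (etrans (pbw_ext w u v n1)).
apply: (etrans (pbw_comp w u v dfc dL)).
apply: (etrans (hc _ _)).
apply: (etrans (esym (pbw_chart_inv w _ _ Mc ccx))).
apply: (etrans (esym (pbw_comp w u v dc dL))).
apply: (etrans (pbw_ext w u v n2)).
exact: pbw_chart_inv.
Qed.

End Form.
End MoserFlow.

Lemma smooth_comp (R : realType) (n : nat) (M : manifoldType R n) (f h : M -> M) :
  smooth f -> smooth h -> smooth (fun x => f (h x)).
Proof.
move=> sf sh; apply: (@plot_smooth R n M R 0) => c k Mc; have oc := open_cod R c.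
by do 2?[apply: smooth_plot => //]; exact: plot_chart_inv.
Qed.

Theorem theorem2p5 (R : realType) (k n : nat)
    (G : lieGroupType R k) (M : manifoldType R n) (w : twoForm M)
    (compactG : compact [set: G]) (compactM : compact [set: M])
    (symplecticM : symplectic_form w)
    (rho0 : smoothMap (G * M)%type M) (action0 : symplectic_action w rho0) :
  exists2 V : set (CrMap 2 (G * M)%type M),
    nbhs (rho0 : CrMap 2 (G * M)%type M) V &
    forall rho1 : smoothMap (G * M)%type M,
      symplectic_action w rho1 -> V rho1 ->
      exists2 phi : M -> M, symplectomorphism w phi &
        forall (g : G) (x : M), rho0 (g, phi x) = phi (rho1 (g, x)).
Proof.
have [I [f [l [sf imm]]]] := immersive_family compactM.
have [phi [psi [V [nV phi0 iso plotV]]]] := isotopy_near compactG compactM sf imm action0.1.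
(* Joint regularity in the action is stated on open sets of actions, hence the interior of [V]. *)
have oV : open V° by exact: open_interior.
have Vr : V° (rho0 : CrMap 2 (G * M)%type M) by exact: nV.
have phi_plot (S : topologicalType) (r : S -> CrMap 2 (G * M)%type M) (m d : nat) (t : S * 'rV[R]_d -> R)
    (q : S * 'rV[R]_d -> M) A : (0 < m)%N -> evCk r m -> open A -> Ck m t A -> plot m q A ->
    (forall z, A z -> {for z, continuous (r \o fst)}) ->
    (forall z, A z -> V° (r z.1) /\ -6 <= t z <= 6) ->
    plot m (fun z => phi (r z.1, (t z, q z))) A /\ plot m (fun z => psi (r z.1, (t z, q z))) A.
  move=> m0 er oA ct pq cr h; apply: plotV => // z Az.
  by have [/interior_subset ? ?] := h z Az.
pose phiP S r m d t q A m0 er oA ct pq cr h := (@phi_plot S r m d t q A m0 er oA ct pq cr h).1.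
pose psiP S r m d t q A m0 er oA ct pq cr h := (@phi_plot S r m d t q A m0 er oA ct pq cr h).2.
have trap := trapped_near compactG compactM symplecticM oV Vr action0 phi0 phiP.
(* Two smallness conditions: [phi] and [psi] are regular and inverse to each other at time 1, and
   every point lies in a trapped ball of the kernel field. *)
pose W : set (CrMap 2 (G * M)%type M) := [set rho | V° rho /\ forall x, exists c x0 r,
  [/\ trapped w phi rho c x0 r, chart_dom c x & `|c x - c x0| < r]].
exists W; first by apply: filterI trap; exact: (open_nbhs_nbhs (conj oV Vr)).
move=> rho1 action1 [V1 trap1].
have [phi_id phi_equi psiK phiK] := iso _ (interior_subset V1) action1.1.
have i0 : 0 <= (0 : R) <= 1 by rewrite lexx ler01.
have i1 : 0 <= (1 : R) <= 1 by rewrite lexx ler01.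
pose chi a b := transport w rho1 phi a b.
pose phi1 x := phi (rho1 : CrMap 2 (G * M)%type M, (1, x)).
pose psi1 x := psi (rho1 : CrMap 2 (G * M)%type M, (1, x)).
have sphi : smooth phi1 by exact: (phi_slice_smooth V1 phiP).
have spsi : smooth psi1 by exact: (phi_slice_smooth V1 psiP).
have s01 : smooth (chi 0 1) by exact: (transport_smooth compactG oV V1 action1 phiP trap1 i0 i1).
have s10 : smooth (chi 1 0) by exact: (transport_smooth compactG oV V1 action1 phiP trap1 i1 i0).
have sPhi : smooth (fun x => phi1 (chi 0 1 x)) by exact: smooth_comp.
exists (fun x => phi1 (chi 0 1 x)); first split.
(* The inverse undoes the centre map by [psi1], then flows back from time 1 to time 0. *)
- split=> //; exists (fun y => chi 1 0 (psi1 y)); split; first exact: smooth_comp.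
    move=> x; rewrite /phi1 /psi1 psiK.
    exact: (transportK compactG oV V1 action1 phiP trap1 i0 i1).
  move=> y; rewrite /phi1 -[RHS]phiK; congr (phi (_, (_, _))).
  exact: (transportK compactG oV V1 action1 phiP trap1 i1 i0).
- apply: is_pullback_local => // x.
  exact: (transport_pullback compactG oV V1 action1 phiP trap1 symplecticM phi_id action0 phi_equi).
(* The flow commutes with [rho1], and [phi1] exchanges [rho1] for [rho0]. *)
move=> g x; apply: (etrans (esym (phi_equi g (chi 0 1 x)))).
exact: (congr1 phi1 (esym (transport_act compactG oV V1 action1 phiP trap1 g x i0 i1))).
Qed.
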